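(* Let $G$ be a non-discrete locally compact group, and let $\mu$ be the minimal cardinality of a neighborhood basis at the identity of $G$ (so $\mu$ is infinite). Then $|\operatorname{TIM}(\widehat G)| = 2^{2^\mu}$.
   Context: $\lambda$ is the left regular representation of $G$ on $L_2(G)$, and $VN(G) = \lambda[G]''$ is the group von Neumann algebra. $\mathcal P_1(\widehat G)$ is the set of normal states on $VN(G)$ ($\widehat G$ is only notation). $A(G)$, the Fourier algebra, is the linear span of $\mathcal P_1(\widehat G)$, the predual of $VN(G)$; it is identified with the algebra of functions $u_{f,g}(x) = \langle\lambda(x)f,g\rangle$, $f,g\in L_2(G)$, with pointwise multiplication and duality $\langle T,u_{f,g}\rangle = \langle Tf,g\rangle$. For $T\in VN(G)$ and $u,v\in A(G)$, $uT\in VN(G)$ is defined by $\langle uT,v\rangle = \langle T,uv\rangle$. A mean is a positive unital linear functional (state) on $VN(G)$; a mean $m$ is topologically invariant if $\langle m,uT\rangle = \langle m,T\rangle$ for all $u\in\mathcal P_1(\widehat G)$ and $T\in VN(G)$. $\operatorname{TIM}(\widehat G)$ is the set of topologically invariant means on $VN(G)$. *)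

(* Defs.v *)
From HB Require Import structures.
From mathcomp Require Import all_boot all_order all_algebra.
From mathcomp Require Import generic_quotient.
From mathcomp Require Import all_classical all_reals all_analysis.
From mathcomp Require Import measurable_realfun complex ring.

Set Implicit Arguments.
Unset Strict Implicit.
Unset Printing Implicit Defensive.
Import Order.TTheory GRing.Theory Num.Theory.
Import numFieldNormedType.Exports.

Local Open Scope classical_set_scope.
Local Open Scope ring_scope.
Local Open Scope complex_scope.
Local Open Scope card_scope.

Section L2_space.
Context d (T : measurableType d) (R : realType).
Variable mu : {measure set T -> \bar R}.

(* f is measurable with \int |f|^2 < +oo iff its real and imaginary parts are
   real L2 functions. *)
Definition L2_pred : {pred T -> R[i]} := fun f =>
  ((fun x => complex.Re (f x)) \in Lfun mu 2%:E) &&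
  ((fun x => complex.Im (f x)) \in Lfun mu 2%:E).

Lemma L2_pred_submod_closed : submod_closed L2_pred.
Proof.
have [L0 LD] := @Lfun_submod_closed _ T R mu 2%:E (lee1n 2).
have L1 a (f g : T -> R) : f \in Lfun mu 2%:E -> g \in Lfun mu 2%:E ->
  (fun x => a * f x + g x) \in Lfun mu 2%:E by exact: (LD a f g).
have L2 a b (f g h : T -> R) : f \in Lfun mu 2%:E -> g \in Lfun mu 2%:E ->
    h \in Lfun mu 2%:E -> (fun x => a * f x + (b * g x + h x)) \in Lfun mu 2%:E.
  by move=> fL gL hL; apply: (L1 a f (fun x => b * g x + h x)) => //; exact: L1.
split; first by apply/andP; split; exact: L0.
move=> [a b] f g /andP[f1 f2] /andP[g1 g2]; apply/andP; split.
- rewrite (_ : (fun _ => _) = (fun x => a * complex.Re (f x) +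
    (- b * complex.Im (f x) + complex.Re (g x)))); first exact: L2.
  apply/funext => x; rewrite !fctE; case: (f x) (g x) => [u v] [w z] /=.
  by rewrite addrA mulNr.
- rewrite (_ : (fun _ => _) = (fun x => a * complex.Im (f x) +
    (b * complex.Re (f x) + complex.Im (g x)))); first exact: L2.
  apply/funext => x; rewrite !fctE; case: (f x) (g x) => [u v] [w z] /=.
  by rewrite addrA.
Qed.

HB.instance Definition _ :=
  GRing.isSubmodClosed.Build _ _ L2_pred L2_pred_submod_closed.

Record L2fun := MkL2fun { L2fun_val :> T -> R[i] ; _ : L2fun_val \in L2_pred }.
HB.instance Definition _ := [isSub for L2fun_val].
HB.instance Definition _ := [Choice of L2fun by <:].
HB.instance Definition _ := [SubChoice_isSubLmodule of L2fun by <:].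

Definition L2_eq (f g : L2fun) := `[< (f : T -> R[i]) = g %[ae mu] >].

Lemma L2_eq_refl : reflexive L2_eq.
Proof. by move=> f; exact/asboolP/ae_eq_refl. Qed.

Lemma L2_eq_sym : symmetric L2_eq.
Proof. by move=> f g; apply/idP/idP => /asboolP h; exact/asboolP/ae_eq_sym. Qed.

Lemma L2_eq_trans : transitive L2_eq.
Proof.
by move=> f g h /asboolP gf /asboolP fh; apply/asboolP/(ae_eq_trans gf fh).
Qed.

Canonical L2_equiv := EquivRel L2_eq L2_eq_refl L2_eq_sym L2_eq_trans.

Local Open Scope quotient_scope.

Definition L2 : Type := {eq_quot L2_eq}.
HB.instance Definition _ := Choice.on L2.
HB.instance Definition _ := EqQuotient.on L2.

Lemma L2_piP (f g : L2fun) :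
  \pi_L2 f = \pi_L2 g <-> (f : T -> R[i]) = g %[ae mu].
Proof. by split=> [/eqmodP/asboolP//|fg]; apply/eqmodP/asboolP. Qed.

Lemma L2_repr_pi (f : L2fun) : (repr (\pi_L2 f) : T -> R[i]) = f %[ae mu].
Proof. by apply/L2_piP; rewrite reprK. Qed.

Lemma L2_ind (P : L2 -> Prop) : (forall f, P (\pi_L2 f)) -> forall u, P u.
Proof. by move=> Pf u; rewrite -[u]reprK. Qed.

Definition L2_add (u v : L2) : L2 := \pi_L2 (repr u + repr v).
Definition L2_opp (u : L2) : L2 := \pi_L2 (- repr u).
Definition L2_scale (a : R[i]) (u : L2) : L2 := \pi_L2 (a *: repr u).

Lemma L2_pi_add f g : L2_add (\pi_L2 f) (\pi_L2 g) = \pi_L2 (f + g).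
Proof.
apply/L2_piP; have := L2_repr_pi f; have := L2_repr_pi g.
by apply: filterS2 => x /= + + /[dup] xD => /(_ xD) gE /(_ xD) fE; rewrite !fctE fE gE.
Qed.

Lemma L2_pi_opp f : L2_opp (\pi_L2 f) = \pi_L2 (- f).
Proof.
apply/L2_piP; have := L2_repr_pi f.
by apply: filterS => x /= + /[dup] xD => /(_ xD) fE; rewrite !fctE fE.
Qed.

Lemma L2_pi_scale a f : L2_scale a (\pi_L2 f) = \pi_L2 (a *: f).
Proof.
apply/L2_piP; have := L2_repr_pi f.
by apply: filterS => x /= + /[dup] xD => /(_ xD) fE; rewrite !fctE fE.
Qed.

Lemma L2_addA : associative L2_add.
Proof.
move=> u v w; elim/L2_ind: u => f; elim/L2_ind: v => g; elim/L2_ind: w => h.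
by rewrite !L2_pi_add addrA.
Qed.

Lemma L2_addC : commutative L2_add.
Proof.
by move=> u v; elim/L2_ind: u => f; elim/L2_ind: v => g; rewrite !L2_pi_add addrC.
Qed.

Lemma L2_add0 : left_id (\pi_L2 0) L2_add.
Proof. by move=> u; elim/L2_ind: u => f; rewrite L2_pi_add add0r. Qed.

Lemma L2_addN : left_inverse (\pi_L2 0) L2_opp L2_add.
Proof. by move=> u; elim/L2_ind: u => f; rewrite L2_pi_opp L2_pi_add addNr. Qed.

HB.instance Definition _ :=
  GRing.isZmodule.Build L2 L2_addA L2_addC L2_add0 L2_addN.

Lemma L2_scaleA a b u : L2_scale a (L2_scale b u) = L2_scale (a * b) u.
Proof. by elim/L2_ind: u => f; rewrite !L2_pi_scale scalerA. Qed.

Lemma L2_scale1 : left_id 1 L2_scale.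
Proof. by move=> u; elim/L2_ind: u => f; rewrite L2_pi_scale scale1r. Qed.

Lemma L2_scaleDr : right_distributive L2_scale +%R.
Proof.
move=> a u v; elim/L2_ind: u => f; elim/L2_ind: v => g.
by rewrite [X in L2_scale a X]L2_pi_add !L2_pi_scale scalerDr -L2_pi_add.
Qed.

Lemma L2_scaleDl u : {morph L2_scale^~ u : a b / a + b}.
Proof.
elim/L2_ind: u => f a b.
by rewrite !L2_pi_scale scalerDl -L2_pi_add.
Qed.

HB.instance Definition _ := GRing.Zmodule_isLmodule.Build R[i] L2
  L2_scaleA L2_scale1 L2_scaleDr L2_scaleDl.

Definition cintegral (f : T -> R[i]) : R[i] :=
  (\int[mu]_x complex.Re (f x)) +i* (\int[mu]_x complex.Im (f x)).

Definition L2_dot (u v : L2) : R[i] :=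
  cintegral (fun x => repr u x * (repr v x)^*).

Definition L2_norm (u : L2) : R := Num.sqrt (complex.Re (L2_dot u u)).

End L2_space.

Section L2_norm_theory.
Context d (T : measurableType d) (R : realType).
Variable mu : {measure set T -> \bar R}.
Local Open Scope quotient_scope.
Implicit Types (f g : L2fun mu) (u v : L2 mu).

Let sqm (f : T -> R[i]) x := complex.Re (f x) ^+ 2 + complex.Im (f x) ^+ 2.

Let sqm_integrable f : mu.-integrable setT (EFin \o sqm f).
Proof.
case: f => f /= /andP[f1 f2].
have := integrableD measurableT (Lfun2_integrable_sqr f1)
  (Lfun2_integrable_sqr f2).
by apply: eq_integrable => // x _ /=.
Qed.

Let normsq u := complex.Re (L2_dot u u).

Let normsqE u : normsq u = \int[mu]_x sqm (repr u) x.
Proof.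
rewrite /normsq /L2_dot /cintegral /=; apply: eq_Rintegral => x _.
by rewrite /sqm; case: (repr u x) => a b /=; rewrite mulrN opprK !expr2.
Qed.

Let normsq_pi f : normsq (\pi_(L2 mu) f) = \int[mu]_x sqm f x.
Proof.
rewrite normsqE /Rintegral; congr fine; apply: ae_eq_integral => //.
- by have /integrableP[] := sqm_integrable (repr (\pi_(L2 mu) f)).
- by have /integrableP[] := sqm_integrable f.
by apply: filterS (L2_repr_pi f) => x /= + xD => /(_ xD) fE; rewrite /sqm fE.
Qed.

Let normsq_ge0 u : 0 <= normsq u.
Proof.
by rewrite normsqE; apply: Rintegral_ge0 => x _; rewrite addr_ge0 ?sqr_ge0.
Qed.

Let normsqD u v : normsq (u + v) <= 2 * (normsq u + normsq v).
Proof.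
elim/L2_ind: u => f; elim/L2_ind: v => g.
rewrite [X in normsq X]L2_pi_add !normsq_pi -RintegralD// -RintegralZl//.
- apply: le_Rintegral => //.
  + have := integrableZl measurableT 2 (integrableD measurableT
      (sqm_integrable f) (sqm_integrable g)).
    by apply: eq_integrable => // x _ /=.
  + move=> x _; have fgE : (f + g) x = f x + g x by [].
    rewrite /sqm fgE; case: (f x) (g x) => [a b] [c e] /=.
    have -> : 2 * (a ^+ 2 + b ^+ 2 + (c ^+ 2 + e ^+ 2)) =
      (a + c) ^+ 2 + (b + e) ^+ 2 + ((a - c) ^+ 2 + (b - e) ^+ 2) by ring.
    by rewrite lerDl addr_ge0 ?sqr_ge0.
- have := integrableD measurableT (sqm_integrable f) (sqm_integrable g).
  by apply: eq_integrable => // x _ /=.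
Qed.

Let normsqZ (a : R[i]) u :
  normsq (a *: u) = (complex.Re a ^+ 2 + complex.Im a ^+ 2) * normsq u.
Proof.
elim/L2_ind: u => f.
rewrite [X in normsq X]L2_pi_scale !normsq_pi -RintegralZl//.
apply: eq_Rintegral => x _; have fE : (a *: f) x = a * f x by [].
by rewrite /sqm fE; case: (f x) a {fE} => [b c] [e h] /=; ring.
Qed.

Lemma L2_norm_ge0 u : 0 <= L2_norm u.
Proof. exact: sqrtr_ge0. Qed.

Lemma L2_normD u v : L2_norm (u + v) ^+ 2 <= 2 * (L2_norm u ^+ 2 + L2_norm v ^+ 2).
Proof. by rewrite !sqr_sqrtr ?normsq_ge0//; exact: normsqD. Qed.

Lemma L2_normZ (a : R[i]) u : L2_norm (a *: u) ^+ 2 =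
  (complex.Re a ^+ 2 + complex.Im a ^+ 2) * L2_norm u ^+ 2.
Proof. by rewrite !sqr_sqrtr ?normsq_ge0//; exact: normsqZ. Qed.

Lemma L2_norm_pi f : L2_norm (\pi_(L2 mu) f) = Num.sqrt
  (\int[mu]_x (complex.Re (f x) ^+ 2 + complex.Im (f x) ^+ 2)).
Proof. by congr Num.sqrt; exact: normsq_pi. Qed.

End L2_norm_theory.

HB.mixin Record isTopologicalGroup G & Group G & Topological G := {
  mulg_continuous : continuous (fun xy : G * G => (xy.1 * xy.2)%g);
  invg_continuous : continuous (fun x : G => (x^-1)%g)
}.

#[short(type="topologicalGroupType")]
HB.structure Definition TopologicalGroup :=
  {G of Group G & Topological G & isTopologicalGroup G}.

Definition borel (G : topologicalGroupType) : Type := G.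

Section borel_group.
Variable G : topologicalGroupType.
HB.instance Definition _ := Choice.on (borel G).
HB.instance Definition _ := isPointed.Build (borel G) (1%g : G).
HB.instance Definition _ := Measurable.copy (borel G)
  (g_sigma_algebraType (@open G : set (set (borel G)))).
End borel_group.

(* A left Haar measure in the Radon sense: inner regularity is only required on
   open sets, since it can fail on Borel sets when G is not sigma-compact. *)
Record haarMeasure (R : realType) (G : topologicalGroupType) := HaarMeasure {
  haar :> {measure set (borel G) -> \bar R};
  haar_neq0 : haar setT != 0%E;
  haar_invariant : forall (x : G) (A : set (borel G)), measurable A ->
    haar [set (x * y)%g | y in A] = haar A;
  haar_compact : forall K : set G, compact K -> (haar K < +oo)%E;
  haar_outer : forall A : set (borel G), measurable A ->
    haar A = ereal_inf [set haar U | U in [set U : set G | open U /\ A `<=` U]];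
  haar_inner : forall U : set G, open U ->
    haar U = ereal_sup [set haar K | K in [set K : set G | compact K /\ K `<=` U]]
}.

Section left_regular_representation.
Context (R : realType) (G : topologicalGroupType) (h : haarMeasure R G).
Local Open Scope quotient_scope.

Definition ltrans (x : G) : borel G -> borel G := fun y => (x^-1 * y)%g : G.

Lemma measurable_ltrans x : measurable_fun setT (ltrans x).
Proof.
apply: (@measurability _ _ _ _ _ _ (@open G : set (set (borel G)))) => //.
move=> _ [A oA <-]; rewrite setTI; apply: sub_gen_smallest => /=.
have cx : continuous (fun y : G => x^-1 * y)%g.
  move=> y; apply: (@continuous_comp _ _ _ (fun y : G => (x^-1, y)%g)
    (fun xy : G * G => (xy.1 * xy.2)%g)).
    by apply: cvg_pair => //; exact: cvg_cst.
  exact: mulg_continuous.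
by move/continuousP : cx; exact.
Qed.

Lemma ltrans_preimage x (A : set (borel G)) :
  ltrans x @^-1` A = [set (x * y)%g | y in A].
Proof.
apply/seteqP; split => [y Ay|_ [y Ay <-]].
  by exists (ltrans x y) => //; rewrite /ltrans mulVKg.
by rewrite /= /ltrans mulKg.
Qed.

Lemma haar_ltrans x (A : set (borel G)) :
  measurable A -> h (ltrans x @^-1` A) = h A.
Proof. by move=> mA; rewrite ltrans_preimage haar_invariant. Qed.

Lemma ge0_integral_ltrans x (f : borel G -> \bar R) : measurable_fun setT f ->
  (forall y, (0 <= f y)%E) -> (\int[h]_y f (ltrans x y) = \int[h]_y f y)%E.
Proof.
move=> mf f0; have := ge0_integral_pushforward (measurable_ltrans x) h
  measurableT mf (fun y _ => f0 y).
rewrite preimage_setT => <-.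
by apply: eq_measure_integral => [|? A mA _]; [exact: measurable_ltrans|exact: haar_ltrans].
Qed.

Lemma Lfun_ltrans x (f : borel G -> R) :
  f \in Lfun h 2%:E -> (f \o ltrans x) \in Lfun h 2%:E.
Proof.
move=> /andP[]; rewrite inE/= => mf; rewrite inE/= => ff.
apply/andP; split; rewrite inE/=.
  by apply: measurableT_comp => //; exact: measurable_ltrans.
move: ff; rewrite /finite_norm unlock.
rewrite -(@ge0_integral_ltrans x (fun y => (`|(EFin \o f) y| `^ 2)%E))//.
  apply/measurable_EFinP.
  apply: (@measurableT_comp _ _ _ _ _ _ (fun t : R => t `^ 2)%R) => //.
  exact/measurableT_comp.
by move=> y; exact: poweR_ge0.
Qed.

Lemma L2_pred_ltrans x (f : L2fun h) : ((f : G -> R[i]) \o ltrans x) \in L2_pred h.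
Proof.
case: f => f /= /andP[f1 f2]; apply/andP; split.
  exact: (Lfun_ltrans x f1).
exact: (Lfun_ltrans x f2).
Qed.

Definition L2fun_ltrans x (f : L2fun h) : L2fun h := MkL2fun (L2_pred_ltrans x f).

(* (lreg x f) y = f (x^-1 y) *)
Definition lreg (x : G) (u : L2 h) : L2 h := \pi_(L2 h) (L2fun_ltrans x (repr u)).

Lemma lreg_pi x f : lreg x (\pi_(L2 h) f) = \pi_(L2 h) (L2fun_ltrans x f).
Proof.
apply/L2_piP; have [N [mN N0 sN]] := L2_repr_pi f.
exists (ltrans x @^-1` N); split.
- by rewrite -[X in measurable X]setTI; exact: measurable_ltrans.
- by rewrite haar_ltrans.
- by move=> y /= ney; apply: sN => /= fy; apply: ney => _; exact: fy.
Qed.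

Lemma lreg_linear x : linear (lreg x).
Proof.
move=> a u v; elim/L2_ind: u => f; elim/L2_ind: v => g.
rewrite [a *: _]L2_pi_scale [X in lreg x X]L2_pi_add !lreg_pi.
rewrite [a *: _]L2_pi_scale [RHS]L2_pi_add.
by congr (\pi_(L2 h) _); exact: val_inj.
Qed.

Lemma lreg_norm x u : L2_norm (lreg x u) = L2_norm u.
Proof.
elim/L2_ind: u => f; rewrite lreg_pi !L2_norm_pi; congr (Num.sqrt (fine _)).
apply: (@ge0_integral_ltrans x (fun y => (complex.Re (f y) ^+ 2 +
  complex.Im (f y) ^+ 2)%:E)).
  case: f => f /= /andP[/andP[+ _] /andP[+ _]].
  rewrite !inE/= => mf1 mf2; apply/measurable_EFinP.
  by apply: measurable_funD; exact: measurable_funX.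
by move=> y; rewrite lee_fin addr_ge0 ?sqr_ge0.
Qed.

End left_regular_representation.

Section operators.
Context d (T : measurableType d) (R : realType).
Variable mu : {measure set T -> \bar R}.
Implicit Types A B : L2 mu -> L2 mu.

Definition bounded_operator A :=
  linear A /\ exists c : R, forall u, L2_norm (A u) <= c * L2_norm u.

Definition commutant (S : set (L2 mu -> L2 mu)) : set (L2 mu -> L2 mu) :=
  [set A | bounded_operator A /\ forall B, S B -> A \o B = B \o A].

Lemma bounded_operator_comb (a : R[i]) A B :
  bounded_operator A -> bounded_operator B -> bounded_operator (a *: A + B).
Proof.
move=> [lA [c Ac]] [lB [e Be]]; split.
  move=> b u v; rewrite !fctE lA lB !scalerDr !scalerA (mulrC a b).
  by rewrite addrACA.
have a0 : 0 <= complex.Re a ^+ 2 + complex.Im a ^+ 2 by rewrite addr_ge0 ?sqr_ge0.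
set k := _ + _ in a0.
have k0 : 0 <= 2 * (k * c ^+ 2 + e ^+ 2).
  by apply: mulr_ge0 => //; apply: addr_ge0; [apply: mulr_ge0 => //|]; exact: sqr_ge0.
have sq w z : 0 <= w -> w <= z -> w ^+ 2 <= z ^+ 2 :> R.
  by move=> w0 wz; apply: lerXn2r => //; rewrite nnegrE// (le_trans w0).
exists (Num.sqrt (2 * (k * c ^+ 2 + e ^+ 2))) => u.
have r0 : 0 <= Num.sqrt (2 * (k * c ^+ 2 + e ^+ 2)) * L2_norm u.
  by apply: mulr_ge0; [exact: sqrtr_ge0|exact: L2_norm_ge0].
rewrite -(@ler_pXn2r _ 2%N) ?nnegrE//; last exact: L2_norm_ge0.
rewrite exprMn [X in X * _]sqr_sqrtr//.
have -> : (a *: A + B) u = a *: A u + B u by [].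
apply: (le_trans (L2_normD _ _)).
rewrite L2_normZ -/k -mulrA; apply: ler_wpM2l => //.
rewrite [leRHS]mulrDl -(mulrA k) -!exprMn; apply: lerD; first apply: ler_wpM2l => //.
  by apply: sq => //; exact: L2_norm_ge0.
by apply: sq => //; exact: L2_norm_ge0.
Qed.

Lemma bounded_operator0 : bounded_operator 0.
Proof.
split.
  move=> a u v; have E w : (0 : L2 mu -> L2 mu) w = 0 by [].
  by rewrite !E scaler0 addr0.
exists 0 => u; rewrite mul0r.
have : L2_norm ((0 : R[i]) *: u) ^+ 2 <= 0.
  by rewrite L2_normZ /= expr0n /= addr0 mul0r.
rewrite scale0r => n0; rewrite -(@ler_pXn2r _ 2%N) ?nnegrE//.
  by rewrite [leRHS]expr0n.
exact: L2_norm_ge0.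
Qed.

Lemma bounded_operator1 : bounded_operator idfun.
Proof. by split; [move=> a u v|exists 1 => u; rewrite mul1r]. Qed.

Lemma commutant_submod_closed (S : set (L2 mu -> L2 mu)) :
  (forall B, S B -> linear B) -> submod_closed (mem (commutant S)).
Proof.
move=> Sl; split.
  rewrite inE; split=> [|B SB]; first exact: bounded_operator0.
  apply/funext => u; have := Sl _ SB (-1) 0 0.
  by rewrite scaleN1r oppr0 addr0 scaleN1r addNr => /esym.
move=> a A B; rewrite !inE => -[bA cA] [bB cB]; split.
  exact: bounded_operator_comb.
move=> D SD; apply/funext => u.
have E w : (a *: A + B) w = a *: A w + B w by [].
rewrite /= !E (Sl _ SD).
by have /(congr1 (@^~ u)) /= -> := cA _ SD; have /(congr1 (@^~ u)) /= -> := cB _ SD.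
Qed.

Lemma commutant1 (S : set (L2 mu -> L2 mu)) : commutant S idfun.
Proof. by split => //; exact: bounded_operator1. Qed.

End operators.

Section group_von_Neumann_algebra.
Context (R : realType) (G : topologicalGroupType) (h : haarMeasure R G).

Definition VN_pred : {pred (L2 h -> L2 h)} :=
  mem (commutant (commutant (range (@lreg R G h)))).

Lemma VN_pred_submod_closed : submod_closed VN_pred.
Proof. by apply: commutant_submod_closed => B [[]]. Qed.

HB.instance Definition _ :=
  GRing.isSubmodClosed.Build _ _ VN_pred VN_pred_submod_closed.

Record VN := MkVN { VN_op :> L2 h -> L2 h ; _ : VN_op \in VN_pred }.
HB.instance Definition _ := [isSub for VN_op].
HB.instance Definition _ := [Choice of VN by <:].
HB.instance Definition _ := [SubChoice_isSubLmodule of VN by <:].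

Lemma lreg_VN x : lreg x \in VN_pred.
Proof.
rewrite inE; split; last by move=> B [_ cB]; rewrite cB//; exists x.
split; first exact: lreg_linear.
by exists 1 => u; rewrite mul1r lreg_norm.
Qed.

Definition VN_lreg (x : G) : VN := MkVN (lreg_VN x).

Lemma id_VN : idfun \in VN_pred.
Proof. by rewrite inE; exact: commutant1. Qed.

Definition VN_one : VN := MkVN id_VN.

Definition VN_ge0 (S : VN) := forall u, 0 <= L2_dot (S u) u.

Definition state (m : VN -> R[i]) :=
  [/\ scalar m, (forall S, VN_ge0 S -> 0 <= m S) & m VN_one = 1].

Definition directed (D : set VN) := D !=set0 /\
  forall S S', D S -> D S' -> exists2 U, D U & VN_ge0 (U - S) /\ VN_ge0 (U - S').

Definition VN_sup (D : set VN) (S : VN) :=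
  (forall S', D S' -> VN_ge0 (S - S')) /\
  forall U, (forall S', D S' -> VN_ge0 (U - S')) -> VN_ge0 (U - S).

(* For complex numbers z <= z' means that z' - z is a nonnegative real, so the
   conclusion says that m S is the least upper bound of the numbers m S'. *)
Definition normal (m : VN -> R[i]) := forall (D : set VN) (S : VN),
  (forall S', D S' -> VN_ge0 S') -> directed D -> VN_sup D S ->
  (forall S', D S' -> m S' <= m S) /\
  forall z, (forall S', D S' -> m S' <= z) -> m S <= z.

Definition P1 : set (VN -> R[i]) := [set m | state m /\ normal m].

(* The Fourier algebra, as a space of functionals on VN(G).  The function on G
   attached to u is x |-> u (lambda x): for u : T |-> <T f, g> this is
   u_{f,g} x = <lambda(x) f, g>, and the duality <T, u> is u T. *)
Definition fourier_algebra : set (VN -> R[i]) :=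
  [set u | exists (n : nat) (c : 'I_n -> R[i]) (w : 'I_n -> VN -> R[i]),
    (forall i, P1 (w i)) /\ u = \sum_(i < n) c i *: w i].

Definition fourier_fun (u : VN -> R[i]) (x : G) : R[i] := u (VN_lreg x).

(* The pointwise product u v belongs to A(G) and an element of A(G) is
   determined by its function on G, so xget picks the unique such element. *)
Definition fourier_mul (u v : VN -> R[i]) : VN -> R[i] :=
  xget 0 [set w | fourier_algebra w /\
    forall x, fourier_fun w x = fourier_fun u x * fourier_fun v x].

(* u T is the unique element with <u T, v> = <T, u v>, as VN(G) is the dual of
   A(G). *)
Definition fourier_act (u : VN -> R[i]) (S : VN) : VN :=
  xget 0 [set uS | forall v, fourier_algebra v -> v uS = fourier_mul u v S].

Definition TIM : set (VN -> R[i]) :=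
  [set m | state m /\ forall u S, P1 u -> m (fourier_act u S) = m S].

End group_von_Neumann_algebra.

Arguments P1 {R G} h.
Arguments fourier_algebra {R G} h.
Arguments TIM {R G} h.

Definition discrete_space (X : topologicalType) := @nbhs X X = principal_filter.

Definition nbhs_basis (X : topologicalType) (x : X) (B : set (set X)) :=
  (forall V, B V -> nbhs x V) /\ forall U, nbhs x U -> exists2 V, B V & V `<=` U.

(* The cardinality of M is the least cardinality of a neighborhood basis at x. *)
Definition is_character (X : topologicalType) (x : X) (M : Type) :=
  (exists2 B : set (set X), nbhs_basis x B & B #= [set: M]) /\
  forall B : set (set X), nbhs_basis x B -> [set: M] #<= B.

(* Main.v *)
(* A normal state u acts on VN(G) by T |-> uT.  Without a product measure, uT is built
   as follows.  For a map sigma : G -> G with finite range, send f in L_2(G) to the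
   formal sum of the lambda(y^-1) (x) 1_{sigma = y} f, where VN(G) carries the form
   (S, T) |-> u(T^* S); by the Schur product theorem the corresponding compressions of
   1 (x) T are bounded forms, and uT is their limit along an ultrafilter of maps sigma
   approaching the identity.  That uT lies in VN(G), and that u(lambda(x)) determines u,
   both rest on the density of the span of the translations for the seminorms
   T |-> m(T^* T), m normal: m is a sum of vector states, and the double commutant
   theorem applies on the l_2-sum of copies of L_2(G).  Hence TIM is the set of states m
   with m(uT) = m(T).

   Upper bound.  If u_0 is the vector state of the normalized indicator of a compact
   neighborhood K, then m(T) = m(u_0 T), and u_0 T depends only on the numbers <T d, d'>
   for d, d' in a family of cardinality mu that is total in L_2(K).

   Lower bound.  By transfinite recursion along a well-order of type mu, choose normalized
   indicators f_i of shrinking neighborhoods and averages c_i of four translations such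
   that the four translates of f_i are orthogonal, while c_i almost fixes f_j for j < i.
   Iterating T |-> c_i^* T c_i + 1_X(i) (1 - c_i^* c_i) along finite chains and taking a
   weak limit gives, for each set X of indices, an operator T with <T f_i, f_i> >= 2/3
   for i in X and <= 1/3 otherwise.  An independent family of 2^mu sets X of indices
   yields 2^(2^mu) ultrafilters along which the vector states of the f_i converge to
   distinct topologically invariant means. *)
Require Import Defs.
From HB Require Import structures.
From mathcomp Require Import all_boot all_order all_algebra.
From mathcomp Require Import all_classical all_reals all_analysis.
From mathcomp Require Import measurable_realfun complex generic_quotient ring lra.
From mathcomp Require wochoice.
Set Implicit Arguments.
Unset Strict Implicit.
Unset Printing Implicit Defensive.
Import Order.TTheory GRing.Theory Num.Theory.
Import numFieldNormedType.Exports.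

Local Open Scope classical_set_scope.
Local Open Scope ring_scope.
Local Open Scope card_scope.
Local Open Scope complex_scope.

(** Normality is what makes translations sufficient for testing identities: a functional that is
    only norm bounded need not be determined by its values there. Every map built as a limit along
    an ultrafilter must therefore be shown normal first. This is the obstacle in the construction of
    uT; it is overcome on compactly supported vectors, where a single fine partition approximates
    the limit uniformly on bounded sets of T.

    In the recursion each error is at most half of every earlier one, so it vanishes once there are
    infinitely many predecessors. A translation then has to fix fewer than mu vectors exactly. Such
    translations need not form a neighborhood of the identity, but minimality of mu makes their set
    infinite, and four distinct ones suffice. Four orthogonal translates of a unit vector average to
    squared norm 1/4; this is the main error in the values 0 and 1, and the recursion adds at most
    8/100, which stays below 1/3.

    In the upper bound the total family is indexed by positions in finite lists, not by points of G,
    since G may have more than mu points. *)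

Lemma quad_disc (R : realType) (a b c : R) : 0 <= a ->
  (forall t, 0 <= a * t ^+ 2 + 2 * b * t + c) -> b ^+ 2 <= a * c.
Proof.
move=> a0 ht; have [a_eq0|an0] := eqVneq a 0.
  suff -> : b = 0 by rewrite a_eq0 mul0r expr0n.
  apply/eqP/negPn/negP => bn0; have := ht (- (c + 1) / (2 * b)).
  have -> : a * (- (c + 1) / (2 * b)) ^+ 2 + 2 * b * (- (c + 1) / (2 * b)) + c = -1.
    by rewrite a_eq0; field.
  by rewrite oppr_ge0 ler10.
have a_gt0 : 0 < a by rewrite lt_def an0.
have := ht (- b / a).
have -> : a * (- b / a) ^+ 2 + 2 * b * (- b / a) + c = (a * c - b ^+ 2) / a by field.
by rewrite pmulr_lge0 ?invr_gt0// subr_ge0.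
Qed.

Lemma small_invn (R : realType) (e : R) : 0 < e -> exists N : nat, N.+1%:R^-1 < e.
Proof.
move=> e0; exists (Num.trunc e^-1); rewrite invf_plt ?posrE//.
exact: truncnS_gt.
Qed.

Lemma le_of_sqrt_eps (R : realType) (a b : R) :
  (forall n : nat, a <= b / n.+1%:R) -> 0 <= b -> a <= 0.
Proof.
move=> h b0; apply/ler_addgt0Pr => e e0; rewrite add0r.
have b10 : 0 < b + 1 by rewrite ltr_wpDl.
have [N hN] := small_invn (divr_gt0 e0 b10).
apply: le_trans (h N) _; rewrite ltr_pdivlMr// in hN.
apply/ltW/(le_lt_trans _ hN); rewrite mulrC ler_wpM2l ?invr_ge0//; lra.
Qed.

(** * Riesz representation *)

Section real_inner_product.
Context (R : realType) (H : zmodType) (sc : R -> H -> H) (dot : H -> H -> R).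
Hypothesis dotC : forall x y, dot x y = dot y x.
Hypothesis dotDl : forall x y z, dot (x + y) z = dot x z + dot y z.
Hypothesis dotZl : forall a x z, dot (sc a x) z = a * dot x z.
Hypothesis dot_ge0 : forall x, 0 <= dot x x.

Let dotDr z x y : dot z (x + y) = dot z x + dot z y.
Proof. by rewrite dotC dotDl !(dotC _ z). Qed.
Let dotZr z a x : dot z (sc a x) = a * dot z x.
Proof. by rewrite dotC dotZl !(dotC _ z). Qed.
Let dot0l z : dot 0 z = 0.
Proof. by apply: (addrI (dot 0 z)); rewrite addr0 -dotDl addr0. Qed.
Let dotNl x z : dot (- x) z = - dot x z.
Proof. by apply/eqP; rewrite -addr_eq0 -dotDl addNr dot0l. Qed.
Let dotNr x z : dot z (- x) = - dot z x.
Proof. by rewrite dotC dotNl !(dotC _ z). Qed.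

Lemma real_cauchy_schwarz x y : dot x y ^+ 2 <= dot x x * dot y y.
Proof.
rewrite mulrC; apply: quad_disc => // t; have := dot_ge0 (x + sc t y).
by rewrite dotDl !dotDr !dotZl !dotZr (dotC y x) => /le_trans; apply; lra.
Qed.

Hypothesis complete : forall u : nat -> H,
  (forall e : R, 0 < e -> exists N, forall n m, (N <= n)%N -> (N <= m)%N ->
     dot (u n - u m) (u n - u m) < e) ->
  exists y, forall e : R, 0 < e -> exists N, forall n, (N <= n)%N ->
     dot (u n - y) (u n - y) < e.

(* The formal sums V need not form a module: only their images in H and R are
   used. *)
Lemma riesz (V : Type) (add : V -> V -> V) (scV : R -> V -> V) (v0 : V)
    (p : V -> H) (l : V -> R) (C : R) :
  (forall v w, p (add v w) = p v + p w) -> (forall v w, l (add v w) = l v + l w) ->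
  (forall a v, p (scV a v) = sc a (p v)) -> (forall a v, l (scV a v) = a * l v) ->
  0 <= C -> (forall v, l v ^+ 2 <= C * dot (p v) (p v)) ->
  exists y, (forall v, l v = dot (p v) y) /\
    forall e : R, 0 < e -> exists v, dot (y - p v) (y - p v) < e.
Proof.
move=> pD lD pZ lZ C0 lC.
(* The representing vector minimizes this functional. Obtaining [y] as the limit of a minimizing
   sequence also places it in the closure of the image of [p], which later yields orthogonal
   projections and density. *)
pose J v := dot (p v) (p v) - 2 * l v.
have JC v : - C <= J v.
  have := dot_ge0 (p v); have := lC v; rewrite /J.
  move: (dot (p v) (p v)) (l v) => n k h n0.
  have [k0|k0] := leP k 0; first lra.
  have : (2 * k) ^+ 2 <= (n + C) ^+ 2.
    have := sqr_ge0 (n - C); rewrite !exprMn; nra.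
  rewrite ler_pXn2r// ?nnegrE; lra.
have JZ v w t : J (add v (scV t w)) =
    dot (p w) (p w) * t ^+ 2 + 2 * (dot (p v) (p w) - l w) * t + J v.
  rewrite /J pD pZ lD lZ dotDl !dotDr !dotZl !dotZr (dotC (p w)); ring.
pose S := range J.
have infS : has_inf S.
  by split; [exists (J v0), v0|exists (- C) => _ [v _ <-]].
pose d := inf S.
have dJ v : d <= J v by apply: ge_inf; [case: infS|exists v].
have /choice[v hv] (n : nat) : exists v, J v < d + n.+1%:R^-1.
  have n0 : 0 < n.+1%:R^-1 :> R by rewrite invr_gt0.
  have [_ [v _ <-] h] := inf_adherent n0 infS.
  by exists v.
pose u n := p (v n).
(* Parallelogram law, with [J] at the midpoint of [v n] and [v m] bounded below by [d]. *)
have uC n m : dot (u n - u m) (u n - u m) <= 2 * n.+1%:R^-1 + 2 * m.+1%:R^-1.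
  have := dJ (scV 2^-1 (add (v n) (v m))); have := hv n; have := hv m.
  rewrite /u /J !pZ !lZ pD lD !(dotZl, dotZr) !(dotDl, dotDr) !(dotNl, dotNr).
  rewrite (dotC (p (v m)) (p (v n))).
  move: n.+1%:R^-1 m.+1%:R^-1 => a b; lra.
have [|y hy] := complete (u := u).
  move=> e e0; have [N hN] := small_invn (divr_gt0 e0 (ltr0n R 5)).
  exists N => n m Nn Nm; apply: le_lt_trans (uC n m) _.
  have hn k : (N <= k)%N -> k.+1%:R^-1 < e / 5.
    move=> Nk; apply: le_lt_trans hN.
    by rewrite lef_pV2 ?posrE// ler_nat ltnS.
  have := hn _ Nn; have := hn _ Nm; move: (n.+1%:R^-1) (m.+1%:R^-1) => a b; lra.
exists y; split; last first.
  move=> e /hy[N /(_ N (leqnn N)) h]; exists (v N).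
  by rewrite -opprB dotNl dotNr opprK.
move=> w.
(* Moving [v n] in the direction [w] cannot bring [J] below [d]; the discriminant of this quadratic
   in [t] bounds the defect of [u n] as a representing vector. *)
have key n : (dot (u n) (p w) - l w) ^+ 2 <= dot (p w) (p w) * n.+1%:R^-1.
  apply: quad_disc => // t; have := dJ (add (v n) (scV t w)); rewrite JZ -/(u n).
  have := hv n; move: (n.+1%:R^-1) => a; lra.
apply/eqP; rewrite eq_sym -subr_eq0 -sqrf_eq0 eq_le sqr_ge0 andbT dotC.
apply/ler_addgt0Pr => e e0; rewrite add0r.
have D0 : 0 < 4 * (dot (p w) (p w) + 1) by rewrite mulr_gt0// ltr_wpDl.
have [N1 h1] := hy _ (divr_gt0 e0 D0).
have [N2 h2] := small_invn (divr_gt0 e0 D0).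
pose N := maxn N1 N2; have {}h1 := h1 N (leq_maxl _ _).
have {}h2 : N.+1%:R^-1 < e / (4 * (dot (p w) (p w) + 1)).
  by apply: le_lt_trans h2; rewrite lef_pV2 ?posrE// ler_nat ltnS leq_maxr.
have := key N; have := real_cauchy_schwarz (u N - y) (p w).
rewrite dotDl dotNl.
move: h1 h2; rewrite !ltr_pdivlMr//.
have := dot_ge0 (p w); have := dot_ge0 (u N - y).
have : 0 <= N.+1%:R^-1 :> R by rewrite invr_ge0.
move: (dot (p w) (p w)) (dot (u N - y) (u N - y)) (N.+1%:R^-1) (dot (u N) (p w)) (dot y (p w)) (l w) => P D I a b c I0 D0' P0 h1 h2 h3 h4.
have h5 : (b - c) ^+ 2 <= 2 * (a - b) ^+ 2 + 2 * (a - c) ^+ 2.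
  have := sqr_ge0 (a - b + (a - c)); rewrite !expr2; nra.
nra.
Qed.
End real_inner_product.

(** * The Hilbert space of square-integrable functions *)

Section complex_numbers.
Context (R : realType).
Implicit Types z w : R[i].

Lemma ReD z w : complex.Re (z + w) = complex.Re z + complex.Re w.
Proof. by case: z; case: w. Qed.
Lemma ImD z w : complex.Im (z + w) = complex.Im z + complex.Im w.
Proof. by case: z; case: w. Qed.
Lemma ReN z : complex.Re (- z) = - complex.Re z.
Proof. by case: z. Qed.
Lemma ImN z : complex.Im (- z) = - complex.Im z.
Proof. by case: z. Qed.
Lemma ReM z w : complex.Re (z * w) =
  complex.Re z * complex.Re w - complex.Im z * complex.Im w.
Proof. by case: z; case: w. Qed.
Lemma ImM z w : complex.Im (z * w) =
  complex.Re z * complex.Im w + complex.Im z * complex.Re w.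
Proof. by case: z; case: w. Qed.
Lemma ReJ z : complex.Re (conjc z) = complex.Re z.
Proof. by case: z. Qed.
Lemma ImJ z : complex.Im (conjc z) = - complex.Im z.
Proof. by case: z. Qed.
Lemma ReC (r : R) : complex.Re r%:C = r. Proof. by []. Qed.
Lemma ImC (r : R) : complex.Im r%:C = 0. Proof. by []. Qed.
Definition ReImE := (ReD, ImD, ReN, ImN, ReM, ImM, ReJ, ImJ, ReC, ImC).

Lemma eqcP z w : complex.Re z = complex.Re w -> complex.Im z = complex.Im w ->
  z = w.
Proof. by case: z => a b; case: w => c d /= -> ->. Qed.

Lemma conjcD z w : conjc (z + w) = conjc z + conjc w. Proof. exact: raddfD. Qed.
Lemma conjcM z w : conjc (z * w) = conjc z * conjc w. Proof. exact: rmorphM. Qed.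
Lemma conjcN z : conjc (- z) = - conjc z. Proof. exact: raddfN. Qed.

End complex_numbers.

Arguments L2_dot : simpl never.

Section L2_inner_product.
Context d (T : measurableType d) (R : realType).
Variable mu : {measure set T -> \bar R}.
Local Open Scope quotient_scope.
Implicit Types (f g : L2fun mu) (u v w : L2 mu).

Definition cintegrable (F : T -> R[i]) :=
  mu.-integrable setT (EFin \o (fun x => complex.Re (F x))) /\
  mu.-integrable setT (EFin \o (fun x => complex.Im (F x))).

Lemma cintegral_lin (a : R[i]) F G : cintegrable F -> cintegrable G ->
  cintegral mu (fun x => a * F x + G x) = a * cintegral mu F + cintegral mu G.
Proof.
move=> [F1 F2] [G1 G2]; case: a => a b; rewrite /cintegral; simpc; congr (_ +i* _).
- rewrite -RintegralZl// -[X in _ - X]RintegralZl// -RintegralB//; last 2 first.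
  + exact: (integrableZl measurableT a F1).
  + exact: (integrableZl measurableT b F2).
  rewrite -RintegralD//.
  + by apply: eq_Rintegral => x _; rewrite !ReImE.
  + have := integrableB measurableT
      (integrableZl measurableT a F1) (integrableZl measurableT b F2).
    by apply: eq_integrable.
- rewrite -RintegralZl// -[X in _ + X + _]RintegralZl// -RintegralD//; last 2 first.
  + exact: (integrableZl measurableT a F2).
  + exact: (integrableZl measurableT b F1).
  rewrite -RintegralD//.
  + by apply: eq_Rintegral => x _; rewrite !ReImE.
  + have := integrableD measurableT
      (integrableZl measurableT a F2) (integrableZl measurableT b F1).
    by apply: eq_integrable.
Qed.

Lemma L2fun_integrable_mul f g (p q : R[i] -> R) :
  p \in [:: @complex.Re R; @complex.Im R] -> q \in [:: @complex.Re R; @complex.Im R] ->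
  mu.-integrable setT (EFin \o (fun x => p (f x) * q (g x))).
Proof.
have h (f' : L2fun mu) (s : R[i] -> R) : s \in [:: @complex.Re R; @complex.Im R] ->
    (fun x => s (f' x)) \in Lfun mu 2%:E.
  case: f' => f' /= /andP[f1 f2]; rewrite !inE => /orP[] /eqP ->; [exact: f1|exact: f2].
move=> hp hq; apply/Lfun1_integrable.
exact: (Lfun2_mul_Lfun1 (h _ _ hp) (h _ _ hq)).
Qed.

Lemma L2fun_cintegrable f g : cintegrable (fun x => f x * conjc (g x)).
Proof.
have m1 : @complex.Re R \in [:: @complex.Re R; @complex.Im R] by rewrite !inE eqxx.
have m2 : @complex.Im R \in [:: @complex.Re R; @complex.Im R] by rewrite !inE eqxx orbT.
split.
- have := integrableD measurableT (L2fun_integrable_mul f g m1 m1)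
    (L2fun_integrable_mul f g m2 m2).
  apply: eq_integrable => // x _ /=.
  by rewrite !ReImE mulrN opprK.
- have := integrableB measurableT (L2fun_integrable_mul f g m2 m1)
    (L2fun_integrable_mul f g m1 m2).
  apply: eq_integrable => // x _ /=.
  by rewrite !ReImE mulrN addrC.
Qed.

Lemma cintegral_ae F G : cintegrable F -> cintegrable G ->
  F = G %[ae mu] -> cintegral mu F = cintegral mu G.
Proof.
move=> [/integrableP[F1 _] /integrableP[F2 _]] [/integrableP[G1 _] /integrableP[G2 _]] FG.
by rewrite /cintegral /Rintegral; congr (fine _ +i* fine _);
  apply: ae_eq_integral => //; apply: filterS FG => x /= + xT => /(_ xT) ->.
Qed.

Lemma L2_dot_pi f g :
  L2_dot (\pi_(L2 mu) f) (\pi_(L2 mu) g) = cintegral mu (fun x => f x * conjc (g x)).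
Proof.
apply: cintegral_ae; [exact: L2fun_cintegrable|exact: L2fun_cintegrable|].
have := L2_repr_pi f; have := L2_repr_pi g.
by apply: filterS2 => x /= + + xT => /(_ xT) -> /(_ xT) ->.
Qed.

Lemma L2_dot_linl a u v w : L2_dot (a *: u + v) w = a * L2_dot u w + L2_dot v w.
Proof.
elim/L2_ind: u => f; elim/L2_ind: v => g; elim/L2_ind: w => k.
rewrite [a *: _]L2_pi_scale [X in L2_dot X]L2_pi_add !L2_dot_pi.
rewrite -cintegral_lin; [|exact: L2fun_cintegrable..].
congr cintegral; apply/funext => x.
by rewrite (_ : (a *: f + g) x = a * f x + g x)// mulrDl mulrA.
Qed.

Lemma L2_dotC u v : L2_dot v u = conjc (L2_dot u v).
Proof.
elim/L2_ind: u => f; elim/L2_ind: v => g; rewrite !L2_dot_pi /cintegral /=.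
congr (_ +i* _).
  by apply: eq_Rintegral => x _; rewrite !ReImE; ring.
have [_ h] := L2fun_cintegrable f g.
rewrite -mulN1r -RintegralZl//.
by apply: eq_Rintegral => x _; rewrite !ReImE; ring.
Qed.

Lemma L2_dotDl u v w : L2_dot (u + v) w = L2_dot u w + L2_dot v w.
Proof. by rewrite -[u]scale1r L2_dot_linl mul1r scale1r. Qed.
Lemma L2_dot0l w : L2_dot 0 w = 0.
Proof. by apply: (addrI (L2_dot 0 w)); rewrite addr0 -L2_dotDl addr0. Qed.
Lemma L2_dotZl a u w : L2_dot (a *: u) w = a * L2_dot u w.
Proof. by rewrite -[a *: u]addr0 L2_dot_linl L2_dot0l addr0. Qed.
Lemma L2_dotNl u w : L2_dot (- u) w = - L2_dot u w.
Proof. by rewrite -scaleN1r L2_dotZl mulN1r. Qed.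
Lemma L2_dotDr w u v : L2_dot w (u + v) = L2_dot w u + L2_dot w v.
Proof. by rewrite L2_dotC L2_dotDl conjcD -!L2_dotC. Qed.
Lemma L2_dot0r w : L2_dot w 0 = 0.
Proof. by rewrite L2_dotC L2_dot0l conjc0. Qed.
Lemma L2_dotZr w a u : L2_dot w (a *: u) = conjc a * L2_dot w u.
Proof. by rewrite L2_dotC L2_dotZl conjcM -!L2_dotC. Qed.
Lemma L2_dotNr w u : L2_dot w (- u) = - L2_dot w u.
Proof. by rewrite L2_dotC L2_dotNl conjcN -!L2_dotC. Qed.
Lemma L2_dotBl u v w : L2_dot (u - v) w = L2_dot u w - L2_dot v w.
Proof. by rewrite L2_dotDl L2_dotNl. Qed.
Lemma L2_dotBr w u v : L2_dot w (u - v) = L2_dot w u - L2_dot w v.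
Proof. by rewrite L2_dotDr L2_dotNr. Qed.

Lemma L2_dotxx_pi f : L2_dot (\pi_(L2 mu) f) (\pi_(L2 mu) f) =
  (\int[mu]_x (complex.Re (f x) ^+ 2 + complex.Im (f x) ^+ 2))%:C.
Proof.
rewrite L2_dot_pi /cintegral; congr (_ +i* _).
  by apply: eq_Rintegral => x _; rewrite !ReImE; ring.
rewrite (_ : (fun x => _) = cst 0); last first.
  by apply/funext => x; rewrite !ReImE /=; ring.
by rewrite /Rintegral integral0.
Qed.

Lemma L2_dotxx u : L2_dot u u = (complex.Re (L2_dot u u))%:C.
Proof. by elim/L2_ind: u => f; rewrite L2_dotxx_pi. Qed.

Definition rdot u v : R := complex.Re (L2_dot u v).

Lemma rdotC u v : rdot u v = rdot v u.
Proof. by rewrite /rdot L2_dotC ReJ. Qed.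
Lemma rdotDl u v w : rdot (u + v) w = rdot u w + rdot v w.
Proof. by rewrite /rdot L2_dotDl ReD. Qed.
Lemma rdotZl (a : R) u w : rdot (a%:C *: u) w = a * rdot u w.
Proof. by rewrite /rdot L2_dotZl ReM ReC ImC mul0r subr0. Qed.
Lemma rdot_ge0 u : 0 <= rdot u u.
Proof.
elim/L2_ind: u => f; rewrite /rdot L2_dotxx_pi ReC.
by apply: Rintegral_ge0 => x _; rewrite addr_ge0 ?sqr_ge0.
Qed.

Lemma L2_dot_ge0 u : 0 <= L2_dot u u.
Proof. by rewrite L2_dotxx ler0c rdot_ge0. Qed.

Lemma L2_norm_sqr u : L2_norm u ^+ 2 = rdot u u.
Proof. by rewrite sqr_sqrtr ?rdot_ge0. Qed.

Lemma rdot_eq0 u : rdot u u = 0 -> u = 0.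
Proof.
elim/L2_ind: u => f; rewrite /rdot L2_dotxx_pi ReC => h.
suff : (f : T -> R[i]) = (0 : L2fun mu) %[ae mu] by move/L2_piP ->.
have m1 : @complex.Re R \in [:: @complex.Re R; @complex.Im R] by rewrite !inE eqxx.
have m2 : @complex.Im R \in [:: @complex.Re R; @complex.Im R] by rewrite !inE eqxx orbT.
have i1 := L2fun_integrable_mul f f m1 m1.
have i2 := L2fun_integrable_mul f f m2 m2.
have i3 : mu.-integrable setT (EFin \o (fun x => complex.Re (f x) ^+ 2 + complex.Im (f x) ^+ 2)).
  by have := integrableD measurableT i1 i2; apply: eq_integrable.
have : (\int[mu]_x (complex.Re (f x) ^+ 2 + complex.Im (f x) ^+ 2)%:E = 0)%E.
  have fi := integrable_fin_num measurableT i3.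
  by rewrite -(fineK fi) /=; congr EFin.
have [mi _] := integrableP _ _ _ i3.
rewrite (@eq_integral _ _ _ mu setT (fun x => abse ((EFin \o (fun x => complex.Re (f x) ^+ 2 +
    complex.Im (f x) ^+ 2)) x))); last first.
  by move=> x _ /=; rewrite ger0_norm// addr_ge0 ?sqr_ge0.
move/(ae_eq_integral_abs mu measurableT mi); apply: filterS => x /= + xT.
move=> /(_ xT)[] /eqP; rewrite paddr_eq0 ?sqr_ge0// !sqrf_eq0.
by case: (f x) => a b /= /andP[/eqP -> /eqP ->].
Qed.

Lemma rdotNl u v : rdot (- u) v = - rdot u v.
Proof. by rewrite /rdot L2_dotNl ReN. Qed.
Lemma rdotNr u v : rdot u (- v) = - rdot u v.
Proof. by rewrite /rdot L2_dotNr ReN. Qed.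
Lemma rdotDr w u v : rdot w (u + v) = rdot w u + rdot w v.
Proof. by rewrite /rdot L2_dotDr ReD. Qed.
Lemma rdotBl u v w : rdot (u - v) w = rdot u w - rdot v w.
Proof. by rewrite rdotDl rdotNl. Qed.
Lemma rdotBr w u v : rdot w (u - v) = rdot w u - rdot w v.
Proof. by rewrite rdotDr rdotNr. Qed.
Lemma rdotZr (a : R) u w : rdot w (a%:C *: u) = a * rdot w u.
Proof. by rewrite rdotC rdotZl rdotC. Qed.
Lemma rdot0l w : rdot 0 w = 0.
Proof. by rewrite /rdot L2_dot0l. Qed.
Lemma rdot0r w : rdot w 0 = 0.
Proof. by rewrite /rdot L2_dot0r. Qed.
Lemma rdotZZ (a : R[i]) u : rdot (a *: u) (a *: u) =
  (complex.Re a ^+ 2 + complex.Im a ^+ 2) * rdot u u.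
Proof. by rewrite -!L2_norm_sqr L2_normZ. Qed.
Lemma rdot_i u v : rdot ('i *: u) ('i *: v) = rdot u v.
Proof.
rewrite /rdot L2_dotZl L2_dotZr mulrA.
by rewrite (_ : 'i * conjc 'i = 1) ?mul1r//; simpc.
Qed.

Lemma L2_dotE u v : L2_dot u v = rdot u v +i* rdot u ('i *: v).
Proof.
by rewrite /rdot L2_dotZr; case: (L2_dot u v) => a b; apply/eqcP => //=; ring.
Qed.

Lemma rdot_ext u v : (forall w, rdot u w = rdot v w) -> u = v.
Proof.
move=> h; apply/eqP; rewrite -subr_eq0; apply/eqP/rdot_eq0.
by rewrite rdotBl !h subrr.
Qed.

Lemma L2_dot_ext u v : (forall w, L2_dot u w = L2_dot v w) -> u = v.
Proof. by move=> h; apply: rdot_ext => w; rewrite /rdot h. Qed.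

Lemma rdot_cs u v : rdot u v ^+ 2 <= rdot u u * rdot v v.
Proof.
exact: (real_cauchy_schwarz rdotC rdotDl rdotZl rdot_ge0).
Qed.

Lemma rdot_parallelogram u v :
  rdot (u + v) (u + v) + rdot (u - v) (u - v) = 2 * (rdot u u + rdot v v).
Proof.
by rewrite !(rdotDl, rdotDr, rdotNl, rdotNr) (rdotC v u); ring.
Qed.

Lemma rdotD_le u v : rdot (u + v) (u + v) <= 2 * (rdot u u + rdot v v).
Proof. by rewrite -rdot_parallelogram lerDl rdot_ge0. Qed.

End L2_inner_product.

Section L2_complete.
Context d (T : measurableType d) (R : realType).
Variable mu : {measure set T -> \bar R}.

Lemma Lfun2_intro (f : T -> R) : measurable_fun setT f ->
  (\int[mu]_x (f x ^+ 2)%:E < +oo)%E -> f \in Lfun mu 2%:E.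
Proof.
move=> mf fi; apply/andP; split; rewrite inE//=.
rewrite /finite_norm unlock; apply: poweR_lty => /=.
apply: le_lt_trans fi; rewrite le_eqVlt; apply/orP; left; apply/eqP.
apply: eq_integral => x _ /=.
by rewrite powR_mulrn// -normrX ger0_norm ?sqr_ge0.
Qed.

Lemma Lfun2_lty (f : T -> R) : f \in Lfun mu 2%:E ->
  (\int[mu]_x (f x ^+ 2)%:E < +oo)%E.
Proof.
move=> /Lfun2_integrable_sqr/integrableP[_]; apply: le_lt_trans.
rewrite le_eqVlt; apply/orP; left; apply/eqP; apply: eq_integral => x _ /=.
by rewrite ger0_norm// sqr_ge0.
Qed.

Lemma sum_half_le n : \sum_(0 <= k < n) (2^-1 : R) ^+ k <= 2.
Proof.
suff -> : \sum_(0 <= k < n) (2^-1 : R) ^+ k = 2 - 2 * 2^-1 ^+ n.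
  by rewrite lerBlDr lerDl mulr_ge0// exprn_ge0// invr_ge0.
elim: n => [|n IH]; first by rewrite big_geq// expr0; ring.
rewrite big_nat_recr//= IH exprS; move: (_ ^+ n) => a; lra.
Qed.

(** Riesz-Fischer: a fast subsequence converges almost everywhere, and Fatou's lemma carries the
    Cauchy estimate over to its limit. *)
Lemma Lfun2_complete (f : nat -> T -> R) : (forall n, f n \in Lfun mu 2%:E) ->
  (forall e : R, 0 < e -> exists N, forall n m, (N <= n)%N -> (N <= m)%N ->
    (\int[mu]_x ((f n x - f m x) ^+ 2)%:E <= e%:E)%E) ->
  exists2 g, g \in Lfun mu 2%:E & forall e : R, 0 < e ->
   exists N, forall n, (N <= n)%N ->
    (\int[mu]_x ((f n x - g x) ^+ 2)%:E <= e%:E)%E.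
Proof.
move=> fL fC.
have mf n : measurable_fun setT (f n).
  by have /andP[] := fL n; rewrite inE.
have e8 (k : nat) : 0 < (8^-1 : R) ^+ k by rewrite exprn_gt0// invr_gt0.
have /choice[N hN] : forall k : nat, exists N, forall n m, (N <= n)%N -> (N <= m)%N ->
    (\int[mu]_x ((f n x - f m x) ^+ 2)%:E <= ((8^-1 : R) ^+ k)%:E)%E.
  by move=> k; exact: fC.
(* The inner successor gives [k < nk k], which is needed when the Cauchy estimate is applied along
   the subsequence at the end of [key]. *)
pose nk k := (\sum_(j < k.+1) (N j).+1)%N.
have nkN k : (N k <= nk k)%N by rewrite /nk big_ord_recr /= (leq_trans (leqnSn _))// leq_addl.
have nkS k : (nk k <= nk k.+1)%N by rewrite {2}/nk big_ord_recr /= leq_addr.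
pose g k := f (nk k).
pose h k x := g k.+1 x - g k x.
have mh k : measurable_fun setT (h k) by apply: measurable_funB; exact: mf.
(* After the weight 4^k the rate 8^-k still leaves the summable 2^-k; where the weighted sum is
   finite, [h k x] decays like 2^-k. *)
pose w k x : R := 4 ^+ k * h k x ^+ 2.
have mw k : measurable_fun setT (EFin \o w k).
  apply/measurable_EFinP; apply: measurable_funM => //.
  exact: measurable_funX.
have w0 k x : 0 <= w k x by rewrite mulr_ge0 ?sqr_ge0// exprn_ge0.
have iw : (\int[mu]_x (\sum_(k <oo) (w k x)%:E) <= (2 : R)%:E)%E.
  rewrite integral_nneseries//; last by move=> n x _; rewrite lee_fin.
  apply: lime_le.
    by apply: is_cvg_nneseries => n _ _; apply: integral_ge0 => x _; rewrite lee_fin.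
  apply: nearW => n; apply: (@le_trans _ _ (\sum_(0 <= k < n) (2^-1 : R) ^+ k)%:E).
    rewrite -sumEFin; apply: lee_sum => k _; rewrite /w.
    under eq_integral do rewrite EFinM.
    rewrite ge0_integralZl//; last 2 first.
    + by apply/measurable_EFinP; exact: measurable_funX.
    + by move=> x _; rewrite lee_fin sqr_ge0.
    apply: (@le_trans _ _ ((4 ^+ k)%:E * ((8^-1 : R) ^+ k)%:E)%E).
      apply: lee_wpmul2l; first by rewrite lee_fin exprn_ge0.
      by apply: hN => //; exact: leq_trans (nkN k) (nkS k).
    rewrite -EFinM -exprMn lee_fin (_ : 4 / 8 = 2^-1 :> R)//; by field.
  by rewrite lee_fin; exact: sum_half_le.
have mW : measurable_fun setT (fun x => \sum_(k <oo) (w k x)%:E)%E.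
  apply: (@ge0_emeasurable_sum _ _ _ setT (fun k => EFin \o w k) xpredT) => // k x _ _.
  by rewrite lee_fin.
have W0 x : (0 <= \sum_(k <oo) (w k x)%:E)%E.
  by apply: nneseries_ge0 => k _ _; rewrite lee_fin.
have aeW : {ae mu, forall x, setT x -> (\sum_(k <oo) (w k x)%:E)%E \is a fin_num}.
  apply: integrable_ae => //; apply/integrableP; split => //.
  apply: (@le_lt_trans _ _ (2 : R)%:E); last exact: ltry.
  apply: le_trans iw; rewrite le_eqVlt; apply/orP; left; apply/eqP.
  by apply: eq_integral => x _; rewrite gee0_abs.
have gcvg x : (\sum_(k <oo) (w k x)%:E)%E \is a fin_num -> cvgn (g^~ x).
  move=> /fineK; set G := fine _ => GE.
  have G0 : 0 <= G by rewrite -lee_fin GE.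
  have hk k : `|h k x| <= (G + 1) * 2^-1 ^+ k.
    have wk : w k x <= G.
      rewrite -lee_fin GE; apply: le_trans (nneseries_lim_ge k.+1 _) => //.
        by rewrite big_mkord sumEFin lee_fin big_ord_recr/= lerDr sumr_ge0.
      by move=> i _ _; rewrite lee_fin.
    have p4 : 0 < (4 : R) ^+ k by rewrite exprn_gt0.
    rewrite -(@ler_pXn2r _ 2%N) ?nnegrE//; last first.
      by rewrite mulr_ge0 ?exprn_ge0 ?invr_ge0// addr_ge0.
    rewrite -normrX ger0_norm ?sqr_ge0// exprMn -exprM mulnC exprM.
    rewrite exprVn (_ : 2 ^+ 2 = 4 :> R); last by rewrite -natrX.
    rewrite exprVn ler_pdivlMr// mulrC; apply: le_trans wk _.
    by rewrite expr2; nra.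
  have : cvgn (series (telescope (g^~ x))).
    apply: normed_cvg; apply: (@series_le_cvg _ _ (fun k => (G + 1) * 2^-1 ^+ k)) => [k|k|k|].
    - exact: normr_ge0.
    - by rewrite mulr_ge0 ?exprn_ge0 ?invr_ge0// addr_ge0.
    - exact: hk.
    - by apply: is_cvg_geometric_series; rewrite ger0_norm ?invr_ge0// invf_lt1// ltr1n.
  rewrite telescopeK => hc.
  have -> : g^~ x = (fun n => (g n x - g 0%N x) + g 0%N x).
    by apply/funext => n; rewrite subrK.
  by apply: is_cvgD => //; exact: is_cvg_cst.
(* An upper limit is measurable whether or not the sequence converges at [x]; almost everywhere it
   is the limit. *)
pose g' x := fine (limn_esup (fun k => (g k x)%:E)).
have mg' : measurable_fun setT g'.
  apply: measurableT_comp => //.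
  by apply: measurable_fun_limn_esup => k; apply/measurable_EFinP; exact: mf.
have g'E x : cvgn (g^~ x) -> g^~ x @ \oo --> g' x.
  move=> gc; rewrite /g' (@is_cvg_limn_esupE _ (fun k => (g k x)%:E)).
    by rewrite EFin_lim.
  by apply/cvg_ex; exists (limn (g^~ x))%:E; apply: cvg_EFin => //; exact: nearW.
have key e : 0 < e -> exists N, forall n, (N <= n)%N ->
    (\int[mu]_x ((f n x - g' x) ^+ 2)%:E <= e%:E)%E.
  move=> e0; have [N0 hN0] := fC e e0; exists N0 => n nN0.
  pose F k x := ((f n x - g k x) ^+ 2)%:E.
  have mF k : measurable_fun setT (F k).
    apply/measurable_EFinP; apply: measurable_funX.
    by apply: measurable_funB; exact: mf.
  have F0 k x : setT x -> (0 <= F k x)%E by rewrite lee_fin sqr_ge0.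
  have := fatou mu measurableT mF F0.
  have -> : (\int[mu]_x limn_einf (F^~ x) = \int[mu]_x ((f n x - g' x) ^+ 2)%:E)%E.
    apply: ae_eq_integral => //.
    - rewrite (_ : (fun x => _) = (fun x => - limn_esup (fun k => - F k x)))%E.
        apply: measurableT_comp => //; apply: measurable_fun_limn_esup => k.
        exact: measurableT_comp.
      by apply/funext => x; rewrite (limn_esupN (F^~ x)) oppeK.
    - apply/measurable_EFinP; apply: measurable_funX.
      by apply: measurable_funB => //; exact: mf.
    apply: filterS aeW => x /= + xT => /(_ xT)/gcvg/g'E gg.
    have /cvg_limn_einf_sup[] // : F^~ x @ \oo --> ((f n x - g' x) ^+ 2)%:E.
    apply: cvg_EFin; first exact: nearW.
    apply: (@cvg_comp _ _ _ (fun k => f n x - g k x) (fun t => t ^+ 2) _ (nbhs (f n x - g' x))).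
      by apply: cvgB => //; exact: cvg_cst.
    exact: exprn_continuous.
  move=> /le_trans; apply; rewrite limn_einf_lim; apply: lime_le.
    exact: is_cvg_einfs.
  exists N0 => // k /= kN0; apply: (@le_trans _ _ (\int[mu]_x F k x)%E).
    by apply: ereal_inf_lbound; exists k => //=.
  apply: hN0 => //; apply: leq_trans kN0 _.
  by rewrite /nk (leq_trans (leqnSn k))// -[leqLHS](card_ord k.+1) -sum1_card leq_sum.
exists g' => //.
have [N1 hN1] := key 1 ltr01; have {}hN1 := hN1 N1 (leqnn _).
have dL : (fun x => f N1 x - g' x) \in Lfun mu 2%:E.
  apply: Lfun2_intro; first by apply: measurable_funB => //; exact: mf.
  by apply: le_lt_trans hN1 _; exact: ltry.
have [_ LD] := @Lfun_submod_closed _ T R mu 2%:E (lee1n 2).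
have -> : g' = (-1 : R) *: (fun x => f N1 x - g' x) + f N1.
  by apply/funext => x; rewrite !fctE scaleN1r; ring.
exact: LD.
Qed.
End L2_complete.

Section L2_vectors.
Context d (T : measurableType d) (R : realType).
Variable mu : {measure set T -> \bar R}.
Local Open Scope quotient_scope.
Implicit Types (f g : L2fun mu) (u v w : L2 mu) (A B : set T).

Lemma L2fun_Re f : (fun x => complex.Re (f x)) \in Lfun mu 2%:E.
Proof. by case: f => f /= /andP[]. Qed.
Lemma L2fun_Im f : (fun x => complex.Im (f x)) \in Lfun mu 2%:E.
Proof. by case: f => f /= /andP[]. Qed.
Lemma L2fun_measurable_Re f : measurable_fun setT (fun x => complex.Re (f x)).
Proof. by have /andP[] := L2fun_Re f; rewrite inE. Qed.
Lemma L2fun_measurable_Im f : measurable_fun setT (fun x => complex.Im (f x)).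
Proof. by have /andP[] := L2fun_Im f; rewrite inE. Qed.

Lemma rdot_piE f : ((rdot (\pi_(L2 mu) f) (\pi_(L2 mu) f))%:E =
  \int[mu]_x (complex.Re (f x) ^+ 2 + complex.Im (f x) ^+ 2)%:E)%E.
Proof.
rewrite /rdot L2_dotxx_pi ReC /Rintegral fineK//.
apply: integrable_fin_num => //.
have := integrableD measurableT (Lfun2_integrable_sqr (L2fun_Re f))
  (Lfun2_integrable_sqr (L2fun_Im f)).
by apply: eq_integrable.
Qed.

Lemma L2_piB f g : \pi_(L2 mu) f - \pi_(L2 mu) g = \pi_(L2 mu) (f - g).
Proof. by rewrite [- _]L2_pi_opp [LHS]L2_pi_add. Qed.

Lemma L2_complete (u : nat -> L2 mu) :
  (forall e : R, 0 < e -> exists N, forall n m, (N <= n)%N -> (N <= m)%N ->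
     rdot (u n - u m) (u n - u m) < e) ->
  exists y, forall e : R, 0 < e -> exists N, forall n, (N <= n)%N ->
     rdot (u n - y) (u n - y) < e.
Proof.
move=> uC; pose f n := repr (u n).
have uE n : u n = \pi_(L2 mu) (f n) by rewrite /f reprK.
have mR n m : measurable_fun setT (fun x => ((complex.Re (f n x) - complex.Re (f m x)) ^+ 2)%:E).
  apply/measurable_EFinP; apply: measurable_funX; apply: measurable_funB;
    exact: L2fun_measurable_Re.
have mI n m : measurable_fun setT (fun x => ((complex.Im (f n x) - complex.Im (f m x)) ^+ 2)%:E).
  apply/measurable_EFinP; apply: measurable_funX; apply: measurable_funB;
    exact: L2fun_measurable_Im.
have CRI n m : ((rdot (u n - u m) (u n - u m))%:E =
    \int[mu]_x ((complex.Re (f n x) - complex.Re (f m x)) ^+ 2 +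
                (complex.Im (f n x) - complex.Im (f m x)) ^+ 2)%:E)%E.
  rewrite !uE L2_piB rdot_piE; apply: eq_integral => x _.
  by rewrite (_ : (f n - f m) x = f n x - f m x)// !ReImE.
have mRI n m : measurable_fun setT (fun x => ((complex.Re (f n x) - complex.Re (f m x)) ^+ 2 +
    (complex.Im (f n x) - complex.Im (f m x)) ^+ 2)%:E).
  under eq_fun do rewrite EFinD; exact: emeasurable_funD.
have [|gR gRL hR] := @Lfun2_complete _ T R mu (fun n x => complex.Re (f n x))
    (fun n => L2fun_Re (f n)).
  move=> e /uC[N hN]; exists N => n m Nn Nm.
  have := hN n m Nn Nm; rewrite -lte_fin CRI => /ltW; apply: le_trans.
  apply: ge0_le_integral => // x _; first by rewrite lee_fin sqr_ge0.
  by rewrite lee_fin lerDl sqr_ge0.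
have [|gI gIL hI] := @Lfun2_complete _ T R mu (fun n x => complex.Im (f n x))
    (fun n => L2fun_Im (f n)).
  move=> e /uC[N hN]; exists N => n m Nn Nm.
  have := hN n m Nn Nm; rewrite -lte_fin CRI => /ltW; apply: le_trans.
  apply: ge0_le_integral => // x _; first by rewrite lee_fin sqr_ge0.
  by rewrite lee_fin lerDr sqr_ge0.
have gL : (fun x => gR x +i* gI x) \in L2_pred mu by apply/andP.
exists (\pi_(L2 mu) (MkL2fun gL)) => e e0.
have e3 : 0 < e / 3 by rewrite divr_gt0.
have [N1 h1] := hR _ e3; have [N2 h2] := hI _ e3; exists (maxn N1 N2) => n.
rewrite geq_max => /andP[/h1 {}h1 /h2 {}h2].
rewrite uE L2_piB -lte_fin rdot_piE.
apply: (@le_lt_trans _ _ (e / 3 + e / 3)%:E); last by rewrite lte_fin; lra.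
have mgR : measurable_fun setT gR by have /andP[] := gRL; rewrite inE.
have mgI : measurable_fun setT gI by have /andP[] := gIL; rewrite inE.
apply: (@le_trans _ _ (\int[mu]_x ((complex.Re (f n x) - gR x) ^+ 2)%:E +
  \int[mu]_x ((complex.Im (f n x) - gI x) ^+ 2)%:E)%E); last by rewrite EFinD leeD.
rewrite -ge0_integralD//.
- rewrite le_eqVlt; apply/orP; left; apply/eqP; apply: eq_integral => x _.
  by rewrite (_ : (f n - MkL2fun gL) x = f n x - (gR x +i* gI x))// !ReImE.
- by move=> x _; rewrite lee_fin sqr_ge0.
- apply/measurable_EFinP; apply: measurable_funX; apply: measurable_funB => //.
  exact: L2fun_measurable_Re.
- by move=> x _; rewrite lee_fin sqr_ge0.
- apply/measurable_EFinP; apply: measurable_funX; apply: measurable_funB => //.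
  exact: L2fun_measurable_Im.
Qed.

Definition restr_fun B f x : R[i] := if x \in B then f x else 0.

Lemma restr_L2_pred B f : measurable B -> restr_fun B f \in L2_pred mu.
Proof.
move=> mB; have key (p : R[i] -> R) : p 0 = 0 -> (fun x => p (f x)) \in Lfun mu 2%:E ->
    (fun x => p (restr_fun B f x)) \in Lfun mu 2%:E.
  move=> p0 pL; have mp : measurable_fun setT (fun x => p (f x)).
    by have /andP[] := pL; rewrite inE.
  have -> : (fun x => p (restr_fun B f x)) = (fun x => p (f x) * \1_B x).
    apply/funext => x; rewrite /restr_fun indicE; case: ifP => _.
      by rewrite mulr1.
    by rewrite mulr0 p0.
  have mp' : measurable_fun setT (fun x => p (f x) * \1_B x : R).
    by apply: measurable_funM => //; exact: measurable_indic.
  apply: Lfun2_intro => //; apply: le_lt_trans (Lfun2_lty pL).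
  apply: ge0_le_integral => //.
  - by move=> x _; rewrite lee_fin sqr_ge0.
  - by apply/measurable_EFinP; exact: measurable_funX.
  - by apply/measurable_EFinP; exact: measurable_funX.
  - move=> x _; rewrite lee_fin indicE; case: (x \in B); rewrite ?mulr1// mulr0.
    by rewrite expr0n /= sqr_ge0.
by apply/andP; split; apply: key => //; [exact: L2fun_Re|exact: L2fun_Im].
Qed.

(** The value 0 for a non-measurable [B] keeps linearity and self-adjointness free of hypotheses on
    [B]. *)
Definition restr B u : L2 mu :=
  if pselect (measurable B) is left mB
  then \pi_(L2 mu) (MkL2fun (restr_L2_pred (repr u) mB)) else 0.

Lemma restr_pi B (mB : measurable B) f :
  restr B (\pi_(L2 mu) f) = \pi_(L2 mu) (MkL2fun (restr_L2_pred f mB)).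
Proof.
rewrite /restr; case: pselect => // mB'; apply/L2_piP.
apply: filterS (L2_repr_pi f) => x /= + xT => /(_ xT) fE.
by rewrite /restr_fun fE.
Qed.

Lemma restr_linear B : linear (restr B).
Proof.
have [mB|nB] := pselect (measurable B); last first.
  by rewrite /restr; case: pselect => // _ a u v; rewrite scaler0 addr0.
move=> a u v; elim/L2_ind: u => f; elim/L2_ind: v => g.
rewrite [a *: _]L2_pi_scale [X in restr _ X]L2_pi_add !(restr_pi mB).
rewrite [a *: _]L2_pi_scale [RHS]L2_pi_add.
congr (\pi_(L2 mu) _); apply: val_inj; apply/funext => x.
transitivity (a * restr_fun B f x + restr_fun B g x); last by [].
rewrite /= /restr_fun; case: ifP => // xB.
by rewrite mulr0 addr0.
Qed.

Lemma restr_dot B u v : L2_dot (restr B u) v = L2_dot u (restr B v).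
Proof.
have [mB|nB] := pselect (measurable B); last first.
  by rewrite /restr; case: pselect => // _; rewrite L2_dot0l L2_dot0r.
elim/L2_ind: u => f; elim/L2_ind: v => g; rewrite !(restr_pi mB) !L2_dot_pi.
congr cintegral; apply/funext => x /=; rewrite /restr_fun.
by case: ifP => // _; rewrite mul0r conjc0 mulr0.
Qed.

Lemma restrI A B u : measurable A -> measurable B ->
  restr A (restr B u) = restr (A `&` B) u.
Proof.
move=> mA mB; have mAB := measurableI _ _ mA mB; elim/L2_ind: u => f.
rewrite (restr_pi mB) (restr_pi mA) (restr_pi mAB).
congr (\pi_(L2 mu) _); apply: val_inj; apply/funext => x /=.
by rewrite /restr_fun in_setI; case: (x \in A).
Qed.

Lemma restrT u : restr setT u = u.
Proof.
elim/L2_ind: u => f; rewrite (restr_pi measurableT).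
by congr (\pi_(L2 mu) _); apply: val_inj; apply/funext => x /=; rewrite /restr_fun in_setT.
Qed.

Lemma restr0 u : restr set0 u = 0.
Proof.
elim/L2_ind: u => f; rewrite (restr_pi measurable0).
congr (\pi_(L2 mu) _); apply: val_inj; apply/funext => x /=.
by rewrite /restr_fun in_set0.
Qed.

Lemma restrU A B u : measurable A -> measurable B -> A `&` B = set0 ->
  restr (A `|` B) u = restr A u + restr B u.
Proof.
move=> mA mB AB; have mAB := measurableU _ _ mA mB; elim/L2_ind: u => f.
rewrite (restr_pi mA) (restr_pi mB) (restr_pi mAB) [RHS]L2_pi_add.
congr (\pi_(L2 mu) _); apply: val_inj; apply/funext => x.
transitivity (restr_fun A f x + restr_fun B f x); last by [].
rewrite /= /restr_fun in_setU.
have : ~~ ((x \in A) && (x \in B)) by rewrite -in_setI AB in_set0.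
by case: (x \in A); case: (x \in B) => //=; rewrite ?addr0 ?add0r.
Qed.

Definition chi_fun B (x : T) : R[i] := (\1_B x)%:C.

Lemma chi_L2_pred B : measurable B -> (mu B < +oo)%E -> chi_fun B \in L2_pred mu.
Proof.
move=> mB fB; apply/andP; split.
  apply: (Lfun2_intro (f := \1_B : T -> R)); first exact: measurable_indic.
  rewrite (@eq_integral _ _ _ mu setT (EFin \o \1_B)); last first.
    by move=> x _; rewrite /= indicE; case: (_ \in _); rewrite ?expr1n ?expr0n.
  by rewrite integral_indic// setIT.
rewrite (_ : (fun _ => _) = cst 0); last by [].
have [h _] := @Lfun_submod_closed _ T R mu 2%:E (lee1n 2); exact: h.
Qed.

Definition chi B : L2 mu :=
  if pselect (measurable B /\ (mu B < +oo)%E) is left h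
  then \pi_(L2 mu) (MkL2fun (chi_L2_pred h.1 h.2)) else 0.

Lemma chiE B (h : measurable B /\ (mu B < +oo)%E) :
  chi B = \pi_(L2 mu) (MkL2fun (chi_L2_pred h.1 h.2)).
Proof.
by rewrite /chi; case: pselect => // h'; congr (\pi_(L2 mu) _); exact: val_inj.
Qed.

Lemma restr_chi A B : measurable A -> measurable B -> (mu B < +oo)%E ->
  restr A (chi B) = chi (A `&` B).
Proof.
move=> mA mB fB.
have h : measurable (A `&` B) /\ (mu (A `&` B) < +oo)%E.
  split; first exact: measurableI.
  by apply: le_lt_trans fB; apply: le_measure; rewrite ?inE//; exact: measurableI.
rewrite (chiE (conj mB fB)) (chiE h) (restr_pi mA).
congr (\pi_(L2 mu) _); apply: val_inj; apply/funext => x /=.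
rewrite /restr_fun /chi_fun !indicE in_setI.
by case: (x \in A).
Qed.

Lemma chi_dot A B : measurable A -> measurable B -> (mu A < +oo)%E ->
  (mu B < +oo)%E -> L2_dot (chi A) (chi B) = (fine (mu (A `&` B)))%:C.
Proof.
move=> mA mB fA fB; rewrite (chiE (conj mA fA)) (chiE (conj mB fB)) L2_dot_pi.
rewrite /cintegral; congr (_ +i* _).
  rewrite -(setIT (A `&` B)) -[in RHS](@integral_indic _ _ _ mu setT measurableT)//; last first.
    exact: measurableI.
  congr fine; apply: eq_integral => x _.
  by rewrite /= /chi_fun indicI; congr EFin; rewrite ?ReImE /=; ring.
rewrite (_ : (fun x => _) = cst 0); last first.
  by apply/funext => x; rewrite /chi_fun ?ReImE /=; ring.
by rewrite /Rintegral integral0.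
Qed.

(** By Chebyshev's inequality the level set has finite measure, so it may itself serve as the test
    set [B]. *)
Lemma Lfun2_ae0 (g : T -> R) : g \in Lfun mu 2%:E ->
  (forall B, measurable B -> (mu B < +oo)%E -> \int[mu]_x (g x * \1_B x) = 0) ->
  forall e : R, 0 < e -> mu [set x | e <= g x] = 0%E.
Proof.
move=> gL gB e e0; have mg : measurable_fun setT g by have /andP[] := gL; rewrite inE.
set B := [set x | e <= g x].
have mB : measurable B.
  rewrite (_ : B = setT `&` g @^-1` `[e, +oo[); last first.
    by rewrite setTI; apply/seteqP; split => x /=; rewrite /B /= in_itv/= andbT.
  exact: mg.
have mB1 : measurable_fun setT (\1_B : T -> R) by exact: measurable_indic.
have fB : (mu B < +oo)%E.
  have e20 : 0 < e ^+ 2 by rewrite exprn_gt0.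
  have : ((e ^+ 2)%:E * mu B < +oo)%E.
    rewrite -(setIT B) -integral_indic// -ge0_integralZl//; last 2 first.
    - exact/measurable_EFinP.
    - by rewrite lee_fin ltW.
    apply: le_lt_trans (Lfun2_lty gL); apply: ge0_le_integral => //.
    - by move=> x _; rewrite -EFinM lee_fin mulr_ge0// ltW.
    - by apply/measurable_EFinP; exact: measurable_funM.
    - by apply/measurable_EFinP; exact: measurable_funX.
    - move=> x _; rewrite -EFinM lee_fin indicE; have [] := boolP (x \in B); rewrite ?mulr0 ?sqr_ge0//.
      rewrite inE /B /= mulr1 => ex.
      by rewrite ler_pXn2r// ?nnegrE ?ltW//; exact: lt_le_trans ex.
  by have [//|] := ltP (mu B) +oo%E; rewrite leye_eq => /eqP ->; rewrite gt0_muley ?lte_fin.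
have gint : mu.-integrable setT (EFin \o (fun x => g x * \1_B x)).
  apply/Lfun1_integrable; apply: Lfun2_mul_Lfun1 => //.
  by have /andP[] := chi_L2_pred mB fB.
have iint : mu.-integrable setT (EFin \o \1_B).
  have cL : (\1_B : T -> R) \in Lfun mu 2%:E by have /andP[] := chi_L2_pred mB fB.
  have /Lfun1_integrable := Lfun2_mul_Lfun1 cL cL.
  by apply: eq_integrable => // x _; rewrite /= indicE; case: (_ \in _); rewrite ?mulr1 ?mulr0.
have : e * fine (mu B) <= 0.
  rewrite -(gB B mB fB).
  have -> : fine (mu B) = \int[mu]_x \1_B x.
    by rewrite /Rintegral integral_indic// setIT.
  rewrite -RintegralZl//; apply: le_Rintegral => //.
    have := integrableZl measurableT e iint.
    by apply: eq_integrable => // x _ /=; rewrite EFinM.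
  move=> x _; by rewrite indicE; have [] := boolP (x \in B); rewrite ?mulr0// inE /B /= !mulr1.
rewrite pmulr_rle0// => h; apply/eqP; rewrite eq_le measure_ge0 andbT.
by rewrite -(@fineK _ (mu B)) ?lee_fin// ge0_fin_numE.
Qed.

Lemma Lfun2_ae_eq0 (g : T -> R) : g \in Lfun mu 2%:E ->
  (forall B, measurable B -> (mu B < +oo)%E -> \int[mu]_x (g x * \1_B x) = 0) ->
  \forall x \ae mu, g x = 0.
Proof.
move=> gL gB; have [_ LD] := @Lfun_submod_closed _ T R mu 2%:E (lee1n 2).
have [L0 _] := @Lfun_submod_closed _ T R mu 2%:E (lee1n 2).
pose g1 x := - g x.
have g1L : g1 \in Lfun mu 2%:E.
  rewrite (_ : g1 = (-1 : R) *: g + 0); first exact: LD.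
  by apply/funext => x; rewrite !fctE addr0 scaleN1r.
have g1B B : measurable B -> (mu B < +oo)%E -> \int[mu]_x (g1 x * \1_B x) = 0.
  move=> mB fB; have gint : mu.-integrable setT (EFin \o (fun x => g x * \1_B x)).
    apply/Lfun1_integrable; apply: Lfun2_mul_Lfun1 => //.
    by have /andP[] := chi_L2_pred mB fB.
  rewrite -[RHS](mulr0 (-1)) -(gB B mB fB) -RintegralZl//.
  by apply: eq_Rintegral => x _; rewrite /g1; ring.
apply: (@negligibleS _ _ _ _ (\bigcup_n ([set x | n.+1%:R^-1 <= g x] `|` [set x | n.+1%:R^-1 <= g1 x]))).
  move=> x /= /eqP gx.
  have [n hn] : exists n : nat, n.+1%:R^-1 < `|g x| by apply: small_invn; rewrite normr_gt0.
  exists n => //=; move: hn; rewrite /g1; case: (ger0P (g x)) => _ /ltW; [by left|by right].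
have mge (k : T -> R) (e : R) : k \in Lfun mu 2%:E -> measurable [set x | e <= k x].
  move=> kL; have mk : measurable_fun setT k by have /andP[] := kL; rewrite inE.
  rewrite (_ : [set x | _] = setT `&` k @^-1` `[e, +oo[); last first.
    by rewrite setTI; apply/seteqP; split => x /=; rewrite in_itv/= andbT.
  exact: mk.
have n0 n : 0 < n.+1%:R^-1 :> R by rewrite invr_gt0.
apply: negligible_bigcup => n; apply: negligibleU; apply/negligibleP; try exact: mge.
- exact: Lfun2_ae0.
- exact: (Lfun2_ae0 g1L g1B).
Qed.

Lemma chi_total u : (forall B, measurable B -> (mu B < +oo)%E ->
  L2_dot u (chi B) = 0) -> u = 0.
Proof.
elim/L2_ind: u => f fB; apply/L2_piP.
have key B : measurable B -> (mu B < +oo)%E ->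
   \int[mu]_x (complex.Re (f x) * \1_B x) = 0 /\ \int[mu]_x (complex.Im (f x) * \1_B x) = 0.
  move=> mB fiB; have := fB B mB fiB; rewrite (chiE (conj mB fiB)) L2_dot_pi.
  by case=> h1 h2; split; [rewrite -[RHS]h1|rewrite -[RHS]h2]; apply: eq_Rintegral => x _;
    rewrite /= /chi_fun; case: (f x) => a b /=; ring.
have h1 := Lfun2_ae_eq0 (L2fun_Re f) (fun B mB fiB => (key B mB fiB).1).
have h2 := Lfun2_ae_eq0 (L2fun_Im f) (fun B mB fiB => (key B mB fiB).2).
by apply: filterS2 h1 h2 => x /= r0 i0 _; apply/eqcP.
Qed.

End L2_vectors.

(** * Ultrafilter limits of bounded forms *)

Section ultrafilter_limits.
Context (R : realType) (I : Type) (F : set_system I) (FU : UltraFilter F).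

Lemma ultra_fmap (U : Type) (f : I -> U) : UltraFilter (f @ F).
Proof.
have FF := @ultra_proper _ _ FU.
split; first exact: fmap_proper_filter.
move=> G GF sfFG; rewrite predeqE => A; split; last exact: sfFG.
move=> GA; have [//|FnA] := in_ultra_setVsetC (f @^-1` A) FU.
have GnA : G (~` A) by exact: sfFG.
by have /filter_ex [? []] : G (A `&` ~` A) by exact: filterI.
Qed.

Lemma ultra_cvg (f : I -> R) (C : R) : F [set i | `|f i| <= C] -> cvg (f @ F).
Proof.
have FF := @ultra_proper _ _ FU; move=> fC; have GU : UltraFilter (f @ F) by exact: ultra_fmap.
have fC' : (f @ F) `[- C, C]%classic.
  by apply: (@filterS _ F _ _ _ _ fC) => i /=; rewrite in_itv /= ler_norml.
have [p [_ pc]] := segment_compact (@ultra_proper _ _ GU) fC'.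
by apply/cvg_ex; exists p; move: pc; rewrite ultra_cvg_clusterE.
Qed.

Lemma filter_le (f g : I -> R) a b : f @ F --> a -> g @ F --> b ->
  F [set i | f i <= g i] -> a <= b.
Proof.
move=> fa gb fg; have FF := @ultra_proper _ _ FU.
rewrite -subr_le0; apply: (cvgr_to_le (cvgB fa gb)).
by apply: filterS fg => i /=; rewrite fctE /= subr_le0.
Qed.

End ultrafilter_limits.

Section operators.
Context d (T : measurableType d) (R : realType).
Variable mu : {measure set T -> \bar R}.
Implicit Types (u v w : L2 mu) (A B : L2 mu -> L2 mu).

(** [C] bounds the square of the operator norm, which avoids square roots. *)
Definition op_le (C : R) A := forall u, rdot (A u) (A u) <= C * rdot u u.

Lemma bounded_operatorP A : bounded_operator A <->
  linear A /\ exists2 C, 0 <= C & op_le C A.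
Proof.
split=> -[lA]; last first.
  move=> [C C0 hC]; split=> //; exists (Num.sqrt C) => u.
  rewrite /L2_norm -sqrtrM// ler_wsqrtr//; exact: hC.
move=> [c hc]; split => //; exists (c ^+ 2); first exact: sqr_ge0.
move=> u; rewrite -!L2_norm_sqr -exprMn; apply: lerXn2r; rewrite ?nnegrE.
- exact: L2_norm_ge0.
- exact: le_trans (L2_norm_ge0 _) (hc u).
- exact: hc.
Qed.

Lemma bop_linear A : bounded_operator A -> linear A.
Proof. by case. Qed.

Section linear_maps.
Variable A : L2 mu -> L2 mu.
Hypothesis lA : linear A.
Lemma lin_opD u v : A (u + v) = A u + A v.
Proof. by have := lA 1 u v; rewrite !scale1r. Qed.
Lemma lin_op0 : A 0 = 0.
Proof. by apply: (addrI (A 0)); rewrite addr0 -lin_opD addr0. Qed.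
Lemma lin_opZ a u : A (a *: u) = a *: A u.
Proof. by have := lA a u 0; rewrite lin_op0 !addr0. Qed.
Lemma lin_opN u : A (- u) = - A u.
Proof. by rewrite -scaleN1r lin_opZ scaleN1r. Qed.
Lemma lin_opB u v : A (u - v) = A u - A v.
Proof. by rewrite lin_opD lin_opN. Qed.
End linear_maps.

(** A bounded sesquilinear form. As in [op_le], the constant belongs to the square; only the real
    part is bounded because the operator is built from the real part alone. *)
Record good_form (C : R) (b : L2 mu -> L2 mu -> R[i]) := GoodForm {
  gf_linl : forall a u v w, b (a *: u + v) w = a * b u w + b v w;
  gf_linr : forall a u v w, b u (a *: v + w) = conjc a * b u v + b u w;
  gf_bound : forall u v, complex.Re (b u v) ^+ 2 <= C * (rdot u u * rdot v v) }.

Lemma L2_riesz (l : L2 mu -> R) (C : R) : (forall u v, l (u + v) = l u + l v) ->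
  (forall (a : R) u, l (a%:C *: u) = a * l u) -> 0 <= C ->
  (forall u, l u ^+ 2 <= C * rdot u u) -> exists y, forall v, l v = rdot v y.
Proof.
move=> lD lZ C0 lC.
have [||||y [hy _]] := riesz (@rdotC _ T R mu) (@rdotDl _ T R mu) (@rdotZl _ T R mu)
  (@rdot_ge0 _ T R mu) (@L2_complete _ T R mu) (add := +%R)
  (scV := fun a v => a%:C *: v) 0 (p := id) (l := l) _ _ _ _ C0 lC => //.
by exists y.
Qed.

(** Riesz representation in the second variable gives a real-linear operator, and invariance under
    multiplying both arguments by ['i] makes it complex linear. Real-valued forms are used so that
    limits of real numbers along an ultrafilter apply directly. *)
Lemma form_operator_real (C : R) (b : L2 mu -> L2 mu -> R) : 0 <= C ->
  (forall u v w, b (u + v) w = b u w + b v w) ->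
  (forall u v w, b u (v + w) = b u v + b u w) ->
  (forall (a : R) u v, b (a%:C *: u) v = a * b u v) ->
  (forall (a : R) u v, b u (a%:C *: v) = a * b u v) ->
  (forall u v, b ('i *: u) ('i *: v) = b u v) ->
  (forall u v, b u v ^+ 2 <= C * (rdot u u * rdot v v)) ->
  exists A, [/\ linear A, op_le C A & forall u v, rdot (A u) v = b u v].
Proof.
move=> C0 bDl bDr bZl bZr bi bC.
have /choice[A hA] u : exists y, forall v, rdot y v = b u v.
  have [||||y hy] := @L2_riesz (b u) (C * rdot u u) => //.
  - by rewrite mulr_ge0 ?rdot_ge0.
  - by move=> v; rewrite -mulrA.
  by exists y => v; rewrite hy rdotC.
exists A; split=> //; last first.
  move=> u; have := bC u (A u); rewrite -hA.
  have [->|n0] := eqVneq (rdot (A u) (A u)) 0; first by rewrite mulr_ge0 ?rdot_ge0.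
  by rewrite mulrA expr2 ler_pM2r// lt_def n0 rdot_ge0.
have AD u v : A (u + v) = A u + A v.
  by apply: rdot_ext => w; rewrite rdotDl !hA bDl.
have AZ (a : R) u : A (a%:C *: u) = a%:C *: A u.
  by apply: rdot_ext => w; rewrite rdotZl !hA bZl.
have Ai u : A ('i *: u) = 'i *: A u.
  apply: rdot_ext => w; rewrite hA.
  have -> : w = 'i *: ((- 'i) *: w).
    by rewrite scalerA mulrN -expr2 sqr_i opprK scale1r.
  by rewrite bi rdot_i hA.
move=> a u v; rewrite AD; congr (_ + _).
by rewrite [a]complexE !scalerDl AD AZ -!scalerA Ai AZ.
Qed.

Lemma gf_Zl C b a u v : good_form C b -> b (a *: u) v = a * b u v.
Proof.
case=> bl _ _; have b0l w : b 0 w = 0.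
  by have := bl (-1) 0 0 w; rewrite scaler0 addr0 mulN1r addNr.
by have := bl a u 0 v; rewrite !addr0 b0l addr0.
Qed.

Lemma gf_Zr C b a u v : good_form C b -> b u (a *: v) = conjc a * b u v.
Proof.
case=> _ br _; have b0r w : b w 0 = 0.
  by have := br (-1) w 0 0; rewrite scaler0 addr0 rmorphN1 mulN1r addNr.
by have := br a u v 0; rewrite !addr0 b0r addr0.
Qed.

Lemma form_operator (C : R) b : 0 <= C -> good_form C b ->
  exists A, [/\ linear A, op_le C A & forall u v, L2_dot (A u) v = b u v].
Proof.
move=> C0 gb; have [bl br bC] := gb.
have bZl a u v := gf_Zl a u v gb; have bZr a u v := gf_Zr a u v gb.
have [|||||||A [lA cA hA]] := @form_operator_real C (fun u v => complex.Re (b u v)) => //.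
- by move=> u v w; have := bl 1 u v w; rewrite scale1r mul1r => ->; rewrite ReD.
- by move=> u v w; have := br 1 u v w; rewrite scale1r conjc1 mul1r => ->; rewrite ReD.
- by move=> a u v; rewrite bZl ReM ReC ImC mul0r subr0.
- by move=> a u v; rewrite bZr conjc_real ReM ReC ImC mul0r subr0.
- by move=> u v; rewrite bZl bZr mulrA (_ : 'i * conjc 'i = 1) ?mul1r//; simpc.
exists A; split => // u v; rewrite L2_dotE !hA bZr.
by case: (b u v) => x y; apply/eqcP => //=; ring.
Qed.

(** Weak compactness of balls of operators: the values of uniformly bounded forms converge along an
    ultrafilter, and the limit is again a bounded form. *)
Lemma ultra_form (C : R) (I : Type) (F : set_system I) (FU : UltraFilter F)
    (b : I -> L2 mu -> L2 mu -> R[i]) : 0 <= C ->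
  F [set i | good_form C (b i)] ->
  exists A, [/\ linear A, op_le C A &
    forall u v, (fun i => complex.Re (b i u v)) @ F --> rdot (A u) v].
Proof.
move=> C0 gb.
have FF := @ultra_proper _ _ FU.
pose b' u v := lim ((fun i => complex.Re (b i u v)) @ F).
have bcvg u v : (fun i => complex.Re (b i u v)) @ F --> b' u v.
  apply: (@ultra_cvg _ _ _ FU _ (C * (rdot u u * rdot v v) + 1)).
  apply: filterS gb => i /= [_ _ /(_ u v)].
  move: (complex.Re _) => x; have : 0 <= C * (rdot u u * rdot v v).
    by rewrite !mulr_ge0 ?rdot_ge0.
  move: (C * _) => k k0 xk; rewrite ler_norml; apply/andP; split; nra.
have bE u v (f : I -> R) (l : R) : f @ F --> l -> F [set i | complex.Re (b i u v) = f i] ->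
    b' u v = l.
  move=> fl fb; apply: cvg_lim => //; apply: cvg_trans fl.
  by apply: near_eq_cvg; apply: filterS fb => i /= ->.
have [|||||||A [lA cA hA]] := @form_operator_real C b' => //.
- move=> u v w; apply: bE (cvgD (bcvg u w) (bcvg v w)) _.
  apply: filterS gb => i /= [bl _ _].
  by have := bl 1 u v w; rewrite scale1r mul1r => ->; rewrite ReD.
- move=> u v w; apply: bE (cvgD (bcvg u v) (bcvg u w)) _.
  apply: filterS gb => i /= [_ br _].
  by have := br 1 u v w; rewrite scale1r conjc1 mul1r => ->; rewrite ReD.
- move=> a u v; apply: bE (cvgM (cvg_cst a) (bcvg u v)) _.
  by apply: filterS gb => i /= /gf_Zl ->; rewrite ReM ReC ImC mul0r subr0.
- move=> a u v; apply: bE (cvgM (cvg_cst a) (bcvg u v)) _.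
  by apply: filterS gb => i /= /gf_Zr ->; rewrite conjc_real ReM ReC ImC mul0r subr0.
- move=> u v; apply: bE (bcvg u v) _.
  apply: filterS gb => i /= h; rewrite (gf_Zl _ _ _ h) (gf_Zr _ _ _ h).
  by rewrite mulrA (_ : 'i * conjc 'i = 1) ?mul1r//; simpc.
- move=> u v; apply: (@cvgr_to_le _ F _ _ (fun i => complex.Re (b i u v) ^+ 2)).
    rewrite expr2; under eq_cvg do rewrite expr2; exact: (cvgM (bcvg u v) (bcvg u v)).
  by apply: filterS gb => i /= [_ _ /(_ u v)].
by exists A; split => // u v; rewrite hA.
Qed.

End operators.

(** * Positive semidefinite sesquilinear forms *)

Section psd_forms.
Context (R : realType) (V : lmodType R[i]).

Definition sqmod (z : R[i]) : R := complex.Re z ^+ 2 + complex.Im z ^+ 2.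

Lemma sqmod_ge0 z : 0 <= sqmod z.
Proof. by rewrite addr_ge0 ?sqr_ge0. Qed.

Lemma mulcJ (z : R[i]) : z * conjc z = (sqmod z)%:C.
Proof. by rewrite /sqmod; case: z => a b; apply/eqcP => /=; ring. Qed.

Lemma mulJc (z : R[i]) : conjc z * z = (sqmod z)%:C.
Proof. by rewrite mulrC mulcJ. Qed.

Lemma sqmod_eq0 z : sqmod z = 0 -> z = 0.
Proof.
move/eqP; rewrite paddr_eq0 ?sqr_ge0// !sqrf_eq0.
by case: z => a b /= /andP[/eqP -> /eqP ->].
Qed.

Record psd (B : V -> V -> R[i]) : Prop := Psd {
  psd_linl : forall a u v w, B (a *: u + v) w = a * B u w + B v w;
  psd_linr : forall a u v w, B u (a *: v + w) = conjc a * B u v + B u w;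
  psd_ge0 : forall u, 0 <= B u u }.

Variable B : V -> V -> R[i].
Hypothesis pB : psd B.

Lemma psd_Dl u v w : B (u + v) w = B u w + B v w.
Proof. by have := psd_linl pB 1 u v w; rewrite scale1r mul1r. Qed.
Lemma psd_0l w : B 0 w = 0.
Proof. by apply: (addrI (B 0 w)); rewrite addr0 -psd_Dl addr0. Qed.
Lemma psd_Zl a u w : B (a *: u) w = a * B u w.
Proof. by have := psd_linl pB a u 0 w; rewrite !addr0 psd_0l addr0. Qed.
Lemma psd_Nl u w : B (- u) w = - B u w.
Proof. by rewrite -scaleN1r psd_Zl mulN1r. Qed.
Lemma psd_Dr u v w : B w (u + v) = B w u + B w v.
Proof. by have := psd_linr pB 1 w u v; rewrite scale1r conjc1 mul1r. Qed.
Lemma psd_0r w : B w 0 = 0.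
Proof. by apply: (addrI (B w 0)); rewrite addr0 -psd_Dr addr0. Qed.
Lemma psd_Zr a u w : B w (a *: u) = conjc a * B w u.
Proof. by have := psd_linr pB a w u 0; rewrite !addr0 psd_0r addr0. Qed.
Lemma psd_Nr u w : B w (- u) = - B w u.
Proof. by rewrite -scaleN1r psd_Zr rmorphN1 mulN1r. Qed.

Lemma psd_re_ge0 u : 0 <= complex.Re (B u u).
Proof. by have := psd_ge0 pB u; rewrite lecE => /andP[]. Qed.

Lemma psd_real u : B u u = (complex.Re (B u u))%:C.
Proof.
by have := psd_ge0 pB u; rewrite lecE => /andP[/eqP h _]; apply/eqcP.
Qed.

(** Polarization: the form is real at [u + v] and at ['i *: u + v], and the two imaginary parts give
    the two equations. *)
Lemma psd_herm u v : B v u = conjc (B u v).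
Proof.
have h w : complex.Im (B w w) = 0 by rewrite psd_real.
have := h (u + v); have := h ('i *: u + v).
rewrite !(psd_Dl, psd_Dr, psd_Zl, psd_Zr) !ImD.
rewrite mulrA (_ : 'i * conjc 'i = 1); last by simpc.
rewrite mul1r !h !add0r !addr0.
case: (B u v) => a b; case: (B v u) => c e /= h1 h2.
by apply/eqcP => /=; lra.
Qed.

(** The real inequality is applied after rotating [u] by the conjugate of [B u v], which makes the
    mixed value real. *)
Lemma psd_cs u v : sqmod (B u v) <= complex.Re (B u u) * complex.Re (B v v).
Proof.
have rcs x y : complex.Re (B x y) ^+ 2 <= complex.Re (B x x) * complex.Re (B y y).
  apply: (@real_cauchy_schwarz R V (fun a => *:%R a%:C) (fun x y => complex.Re (B x y))).
  - by move=> s t; rewrite psd_herm ReJ.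
  - by move=> s t r; rewrite psd_Dl ReD.
  - by move=> a s t; rewrite psd_Zl ReM ReC ImC mul0r subr0.
  - exact: psd_re_ge0.
set z := B u v; have [->|z0] := eqVneq (sqmod z) 0.
  by rewrite mulr_ge0 ?psd_re_ge0.
have := rcs (conjc z *: u) v.
rewrite !(psd_Zl, psd_Zr) -/z mulJc conjcK ReC mulrA mulJc.
rewrite ReM ReC ImC mul0r subr0 -mulrA expr2 ler_pM2l//.
by rewrite lt_def z0 sqmod_ge0.
Qed.

Lemma psd_null u v : B u u = 0 -> B u v = 0.
Proof.
move=> h; apply: sqmod_eq0; apply/eqP; rewrite eq_le sqmod_ge0 andbT.
by apply: le_trans (psd_cs u v) _; rewrite h mul0r.
Qed.

End psd_forms.

(** * Algebra and order of the group von Neumann algebra *)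

Section group_operators.
Context (R : realType) (G : topologicalGroupType) (h : haarMeasure R G).
Local Open Scope quotient_scope.
Implicit Types (u v w : L2 h) (x y : G).

Lemma bounded_lreg x : bounded_operator (@lreg R G h x).
Proof.
by split; [exact: lreg_linear|exists 1 => u; rewrite mul1r lreg_norm].
Qed.

Lemma lregM x y u : lreg x (lreg y u) = lreg (x * y)%g u.
Proof.
elim/L2_ind: u => f; rewrite !lreg_pi; congr (\pi_(L2 h) _).
by apply: val_inj; apply/funext => z /=; rewrite /ltrans /= invgM mulgA.
Qed.

Lemma lreg1 u : lreg 1%g u = u.
Proof.
elim/L2_ind: u => f; rewrite !lreg_pi; congr (\pi_(L2 h) _).
by apply: val_inj; apply/funext => z /=; rewrite /ltrans /= invg1 mul1g.
Qed.

Lemma lregVK x u : lreg x (lreg x^-1%g u) = u.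
Proof. by rewrite lregM mulgV lreg1. Qed.

Lemma lreg_rdot x u v : rdot (lreg x u) (lreg x v) = rdot u v.
Proof.
have hn w : rdot (lreg x w) (lreg x w) = rdot w w by rewrite -!L2_norm_sqr lreg_norm.
have := hn (u + v); rewrite (lin_opD (@lreg_linear R G h x)).
by rewrite !(rdotDl, rdotDr) !hn (rdotC v u) (rdotC (lreg x v) (lreg x u)); lra.
Qed.

Lemma lreg_dot x u v : L2_dot (lreg x u) (lreg x v) = L2_dot u v.
Proof.
by rewrite !L2_dotE lreg_rdot -(lin_opZ (@lreg_linear R G h x)) lreg_rdot.
Qed.

Lemma lreg_adj x u v : L2_dot (lreg x u) v = L2_dot u (lreg x^-1%g v).
Proof. by rewrite -[in RHS](lreg_dot x) lregVK. Qed.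

Definition lset x (B : set G) : set (borel G) := [set (x * y)%g | y in B].

Lemma mem_lset x B y : (y \in lset x B) = ((x^-1 * y)%g \in B).
Proof.
apply/idP/idP; rewrite !inE; first by move=> [z Bz <-]; rewrite mulKg.
by move=> Bz; exists (x^-1 * y)%g => //; rewrite mulVKg.
Qed.

Lemma measurable_lset x B : measurable (B : set (borel G)) -> measurable (lset x B).
Proof.
move=> mB; rewrite /lset -ltrans_preimage -[X in measurable X]setTI.
exact: measurable_ltrans.
Qed.

Lemma lreg_restr x B u : measurable (B : set (borel G)) ->
  lreg x (restr B u) = restr (lset x B) (lreg x u).
Proof.
move=> mB; elim/L2_ind: u => f.
rewrite (restr_pi mB) !lreg_pi (restr_pi (measurable_lset x mB)).
congr (\pi_(L2 h) _); apply: val_inj; apply/funext => y /=.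
by rewrite /restr_fun mem_lset.
Qed.

Lemma haar_lset x B : measurable (B : set (borel G)) -> h (lset x B) = h B.
Proof. exact: haar_invariant. Qed.

Lemma lreg_chi x B : measurable (B : set (borel G)) -> (h B < +oo)%E ->
  lreg x (chi h B) = chi h (lset x B).
Proof.
move=> mB fB.
have hx : measurable (lset x B) /\ (h (lset x B) < +oo)%E.
  by split; [exact: measurable_lset|rewrite haar_lset].
rewrite (chiE (conj mB fB)) lreg_pi (chiE hx).
congr (\pi_(L2 h) _); apply: val_inj; apply/funext => y /=.
by rewrite /chi_fun !indicE mem_lset.
Qed.

Lemma adjoint_exists (A : L2 h -> L2 h) : bounded_operator A ->
  exists2 B, bounded_operator B & forall u v, L2_dot (A u) v = L2_dot u (B v).
Proof.
move=> /bounded_operatorP[lA [C C0 hC]].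
have [||B [lB cB hB]] := @form_operator _ _ _ h C (fun v u => L2_dot v (A u)) => //.
  split.
  - by move=> a u v w; rewrite L2_dot_linl.
  - by move=> a u v w; rewrite lA L2_dotDr L2_dotZr.
  - move=> u v; apply: le_trans (rdot_cs _ _) _.
    rewrite mulrCA; apply: ler_wpM2l; [exact: rdot_ge0|exact: hC].
exists B; first by apply/bounded_operatorP; split => //; exists C.
by move=> u v; rewrite L2_dotC -hB -L2_dotC.
Qed.

Definition com : set (L2 h -> L2 h) := commutant (range (@lreg R G h)).

Lemma com_lreg A x u : com A -> A (lreg x u) = lreg x (A u).
Proof.
by move=> [_ /(_ (lreg x))] /(_ (ex_intro2 _ _ x I erefl)) /(congr1 (@^~ u)).
Qed.

Lemma com_adj A B : com A -> bounded_operator B ->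
  (forall u v, L2_dot (A u) v = L2_dot u (B v)) -> com B.
Proof.
move=> cA bB AB; split => // _ [x _ <-]; apply/funext => u /=.
apply: L2_dot_ext => v; rewrite [LHS]L2_dotC [RHS]L2_dotC; congr conjc.
rewrite -AB -[in RHS](lregVK x v) lreg_dot -AB.
by rewrite -[in LHS](lregVK x v) (com_lreg _ _ cA) lreg_dot.
Qed.

Implicit Types S T : VN h.

Lemma VNP S : commutant com S.
Proof. by case: S => A /=; rewrite inE. Qed.

Lemma VN_bounded S : bounded_operator S.
Proof. by have [] := VNP S. Qed.

Lemma VN_linear S : linear S.
Proof. by have [] := VN_bounded S. Qed.

Lemma VN_com S A u : com A -> S (A u) = A (S u).
Proof. by have [_ hS] := VNP S => /hS /(congr1 (@^~ u)). Qed.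

Definition VN_mk (A : L2 h -> L2 h) (cA : commutant com A) : VN h :=
  MkVN (mem_set cA).

Lemma VN_ext S T : (forall u, S u = T u) -> S = T.
Proof. by move=> ST; apply: val_inj; apply/funext. Qed.

Lemma VN_addE S T u : (S + T : VN h) u = S u + T u. Proof. by []. Qed.
Lemma VN_scaleE a S u : (a *: S : VN h) u = a *: S u. Proof. by []. Qed.
Lemma VN_oppE S u : (- S : VN h) u = - S u. Proof. by []. Qed.
Lemma VN_zeroE u : (0 : VN h) u = 0. Proof. by []. Qed.
Lemma VN_oneE u : (VN_one h) u = u. Proof. by []. Qed.
Lemma VN_lregE x u : VN_lreg h x u = lreg x u. Proof. by []. Qed.

Lemma bounded_comp A B : bounded_operator A -> bounded_operator B ->
  bounded_operator (A \o B : L2 h -> L2 h).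
Proof.
move=> /bounded_operatorP[lA [C C0 hC]] /bounded_operatorP[lB [D D0 hD]].
apply/bounded_operatorP; split; first by move=> a u v /=; rewrite lB lA.
exists (C * D) => [|u]; first exact: mulr_ge0.
by apply: le_trans (hC _) _; rewrite -mulrA ler_wpM2l.
Qed.

Lemma VN_mul_subproof S T : commutant com (S \o T).
Proof.
split; first exact: (bounded_comp (VN_bounded S) (VN_bounded T)).
by move=> A cA; apply/funext => u /=; rewrite (VN_com T u cA) (VN_com S _ cA).
Qed.

Definition VN_mul S T : VN h := VN_mk (VN_mul_subproof S T).
Lemma VN_mulE S T u : VN_mul S T u = S (T u). Proof. by []. Qed.

Lemma VN_adj_exists S : exists T : VN h, forall u v, L2_dot (S u) v = L2_dot u (T v).
Proof.
have [B bB hB] := adjoint_exists (VN_bounded S).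
suff cB : commutant com B by exists (VN_mk cB).
split => // A cA; have [A' bA' AA'] := adjoint_exists (proj1 cA).
have cA' := com_adj cA bA' AA'.
apply/funext => u /=; apply: L2_dot_ext => v.
rewrite [LHS]L2_dotC [RHS]L2_dotC; congr conjc.
have A'A s t : L2_dot (A' s) t = L2_dot s (A t).
  by rewrite L2_dotC -AA' -L2_dotC.
by rewrite -hB -A'A -(VN_com S v cA') hB A'A.
Qed.

Definition VN_adj S : VN h := xget 0 [set T : VN h | forall u v, L2_dot (S u) v = L2_dot u (T v)].

Lemma VN_adjP S u v : L2_dot (S u) v = L2_dot u (VN_adj S v).
Proof. by rewrite /VN_adj; case: xgetP => [T ->//|hn]; have [T /hn] := VN_adj_exists S. Qed.

Lemma VN_adjP' S u v : L2_dot (VN_adj S u) v = L2_dot u (S v).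
Proof. by rewrite L2_dotC -VN_adjP -L2_dotC. Qed.

Lemma VN_adj_unique S T : (forall u v, L2_dot (S u) v = L2_dot u (T v)) -> VN_adj S = T.
Proof.
move=> ST; apply: VN_ext => u; apply: L2_dot_ext => v.
by rewrite VN_adjP' [RHS]L2_dotC -ST -L2_dotC.
Qed.

Lemma VN_adjD S T : VN_adj (S + T) = VN_adj S + VN_adj T.
Proof.
by apply: VN_adj_unique => u v; rewrite !VN_addE L2_dotDl L2_dotDr !VN_adjP.
Qed.

Lemma VN_adjZ a S : VN_adj (a *: S) = conjc a *: VN_adj S.
Proof.
by apply: VN_adj_unique => u v; rewrite !VN_scaleE L2_dotZl L2_dotZr conjcK VN_adjP.
Qed.

Lemma VN_adjM S T : VN_adj (VN_mul S T) = VN_mul (VN_adj T) (VN_adj S).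
Proof. by apply: VN_adj_unique => u v; rewrite !VN_mulE !VN_adjP. Qed.

Lemma VN_adj1 : VN_adj (VN_one h) = VN_one h.
Proof. by apply: VN_adj_unique. Qed.

Lemma VN_adj_lreg x : VN_adj (VN_lreg h x) = VN_lreg h x^-1%g.
Proof. by apply: VN_adj_unique => u v; rewrite !VN_lregE lreg_adj. Qed.

Lemma VN_mul_lreg x y : VN_mul (VN_lreg h x) (VN_lreg h y) = VN_lreg h (x * y)%g.
Proof. by apply: VN_ext => u; rewrite VN_mulE !VN_lregE lregM. Qed.

Lemma VN_lreg_one : VN_lreg h 1%g = VN_one h.
Proof. by apply: VN_ext => u; rewrite VN_lregE lreg1. Qed.

Lemma VN_mul1l S : VN_mul (VN_one h) S = S. Proof. exact: VN_ext. Qed.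
Lemma VN_mulA S T U : VN_mul S (VN_mul T U) = VN_mul (VN_mul S T) U.
Proof. exact: VN_ext. Qed.
Lemma VN_mulDl S T U : VN_mul (S + T) U = VN_mul S U + VN_mul T U.
Proof. exact: VN_ext. Qed.
Lemma VN_mulDr S T U : VN_mul U (S + T) = VN_mul U S + VN_mul U T.
Proof. by apply: VN_ext => u; rewrite VN_mulE !VN_addE (lin_opD (VN_linear U)). Qed.
Lemma VN_mulZl a S U : VN_mul (a *: S) U = a *: VN_mul S U.
Proof. exact: VN_ext. Qed.
Lemma VN_mulZr a S U : VN_mul U (a *: S) = a *: VN_mul U S.
Proof. by apply: VN_ext => u; rewrite VN_mulE !VN_scaleE (lin_opZ (VN_linear U)). Qed.

End group_operators.

Section operator_order.
Context (R : realType) (G : topologicalGroupType) (h : haarMeasure R G).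
Implicit Types (u v w : L2 h) (x y : G) (S T U : VN h).

(* An inductive rather than a definition, so that conversion never unfolds it. *)
Variant VN_le S T : Prop := VNLe of VN_ge0 (T - S).

Lemma VN_leE S T : VN_le S T <-> VN_ge0 (T - S).
Proof. by split=> [[]|]. Qed.

Lemma ge0_psd S : VN_ge0 S <-> psd (fun u v => L2_dot (S u) v).
Proof.
split=> [S0|[_ _ S0] u]; last exact: S0.
split=> // [a u v w|a u v w]; first by rewrite VN_linear L2_dot_linl.
by rewrite L2_dotDr L2_dotZr.
Qed.

Lemma ge0_rdot S : VN_ge0 S <->
  forall u, 0 <= rdot (S u) u /\ rdot (S u) ('i *: u) = 0.
Proof.
split=> S0 u; last by have [r0 i0] := S0 u; rewrite L2_dotE i0 ler0c.
by have := S0 u; rewrite L2_dotE lecE => /andP[/eqP].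
Qed.

Lemma VN_ge0_re S u : VN_ge0 S -> 0 <= rdot (S u) u.
Proof. by move=> /ge0_rdot/(_ u)[]. Qed.

Lemma ge0_cs S u v : VN_ge0 S ->
  rdot (S u) v ^+ 2 <= rdot (S u) u * rdot (S v) v.
Proof.
move=> /ge0_psd pS; apply: le_trans (psd_cs pS u v).
by rewrite /sqmod -/(rdot _ _) lerDl sqr_ge0.
Qed.

Lemma VN_ge0_adj S : VN_ge0 S -> VN_adj S = S.
Proof.
move=> /ge0_psd pS; apply: VN_adj_unique => u v.
by rewrite [RHS]L2_dotC; exact: (psd_herm pS v u).
Qed.

Lemma VN_ge0_eq0 S : VN_ge0 S -> (forall u, rdot (S u) u <= 0) -> S = 0.
Proof.
move=> S0 hS; have /ge0_psd pS := S0; apply: VN_ext => u; apply: L2_dot_ext => v.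
rewrite L2_dot0l; apply: (psd_null pS); rewrite (psd_real pS); apply/eqcP => //=.
by apply/eqP; rewrite eq_le hS VN_ge0_re.
Qed.

Lemma VN_ge0D S T : VN_ge0 S -> VN_ge0 T -> VN_ge0 (S + T).
Proof. by move=> S0 T0 u; rewrite VN_addE L2_dotDl addr_ge0. Qed.

Lemma VN_ge0Z (c : R) S : 0 <= c -> VN_ge0 S -> VN_ge0 (c%:C *: S).
Proof. by move=> c0 S0 u; rewrite VN_scaleE L2_dotZl mulr_ge0// ler0c. Qed.

Lemma VN_ge0_0 : VN_ge0 (0 : VN h).
Proof. by move=> u; rewrite VN_zeroE L2_dot0l. Qed.

Lemma VN_ge0_1 : VN_ge0 (VN_one h).
Proof. by move=> u; rewrite VN_oneE L2_dot_ge0. Qed.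

Lemma VN_ge0_sq S : VN_ge0 (VN_mul (VN_adj S) S).
Proof. by move=> u; rewrite VN_mulE VN_adjP' L2_dot_ge0. Qed.

Lemma VN_ge0_conj S T : VN_ge0 T -> VN_ge0 (VN_mul (VN_adj S) (VN_mul T S)).
Proof. by move=> T0 u; rewrite !VN_mulE VN_adjP'; exact: T0. Qed.

Lemma VN_le_refl S : VN_le S S.
Proof. by apply/VN_leE; rewrite subrr; exact: VN_ge0_0. Qed.

Lemma VN_le_trans T S U : VN_le S T -> VN_le T U -> VN_le S U.
Proof.
by move=> /VN_leE ST /VN_leE TU; apply/VN_leE; rewrite -(subrK T U) -addrA; exact: VN_ge0D.
Qed.

Lemma VN_le_anti S T : VN_le S T -> VN_le T S -> S = T.
Proof.
move=> /VN_leE ST /VN_leE TS; apply/eqP; rewrite -subr_eq0; apply/eqP; apply: (VN_ge0_eq0 TS) => u.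
have := VN_ge0_re u ST; rewrite -opprB VN_oppE rdotNl; lra.
Qed.

Lemma VN_ge0_le S T : VN_ge0 S -> VN_le S T -> VN_ge0 T.
Proof. by move=> S0 /VN_leE ST; rewrite -(subrK S T); exact: VN_ge0D. Qed.

Lemma VN_le_re S T u : VN_le S T -> rdot (S u) u <= rdot (T u) u.
Proof. by move=> /VN_leE/(VN_ge0_re u); rewrite VN_addE VN_oppE rdotBl subr_ge0. Qed.

Lemma VN_op_le S : exists2 C : R, 0 <= C & op_le C S.
Proof. by have /bounded_operatorP[_] := VN_bounded S. Qed.

Lemma op_le_rdot (C : R) (A : L2 h -> L2 h) u v : op_le C A ->
  rdot (A u) v ^+ 2 <= C * (rdot u u * rdot v v).
Proof.
move=> hA; apply: le_trans (rdot_cs _ _) _; rewrite mulrA.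
by rewrite ler_wpM2r ?rdot_ge0.
Qed.

Lemma op_le_form (C : R) S u : 0 <= C -> op_le (C ^+ 2) S -> rdot (S u) u <= C * rdot u u.
Proof.
move=> C0 hS; have := op_le_rdot u u hS; have := rdot_ge0 u.
move: (rdot u u) (rdot (S u) u) => a b a0 hb.
have [b0|/ltW b0] := lerP b 0; first by apply: le_trans b0 _; exact: mulr_ge0.
have Ca : 0 <= C * a by exact: mulr_ge0.
rewrite -(@ler_pXn2r _ 2%N) ?nnegrE// exprMn.
by rewrite (expr2 a).
Qed.

(** A crude way to turn the constant into a perfect square, the form in which [op_le_form] takes
    it. *)
Lemma op_le_sqrt (C : R) (A : L2 h -> L2 h) : 0 <= C -> op_le C A -> op_le ((C + 1) ^+ 2) A.
Proof.
move=> C0 hA u; apply: le_trans (hA u) _; rewrite ler_wpM2r ?rdot_ge0//.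
by rewrite expr2; nra.
Qed.

Lemma VN_le_scal S : VN_ge0 S -> exists2 c : R, 0 < c & VN_le S (c%:C *: VN_one h).
Proof.
move=> S0; have [C C0 /(op_le_sqrt C0) hS] := VN_op_le S.
have C1 : 0 < C + 1 by rewrite ltr_wpDl.
exists (C + 1) => //; apply/VN_leE/ge0_rdot => u.
rewrite VN_addE VN_oppE VN_scaleE VN_oneE !rdotBl; split.
  by rewrite subr_ge0 rdotZl op_le_form// ltW.
have /ge0_rdot/(_ u)[_ ->] := S0.
by rewrite rdotZl subr0 /rdot L2_dotZr ReM (L2_dotxx u) /= ; ring.
Qed.

(** Cauchy-Schwarz for the form of [S], at the vectors [u] and [S u]. *)
Lemma VN_le_op (c : R) S : 0 <= c -> VN_ge0 S -> VN_le S (c%:C *: VN_one h) ->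
  op_le (c ^+ 2) S.
Proof.
move=> c0 S0 Sc u.
have Su w : rdot (S w) w <= c * rdot w w.
  by have := VN_le_re w Sc; rewrite VN_scaleE VN_oneE rdotZl.
have := ge0_cs u (S u) S0; have := Su u; have := Su (S u).
have := VN_ge0_re u S0; have := VN_ge0_re (S u) S0; have := rdot_ge0 u; have := rdot_ge0 (S u).
move: (rdot (S u) (S u)) (rdot u u) (rdot (S u) u) (rdot (S (S u)) (S u)) => a b e f.
move=> a0 b0 f0 e0 h1 h2 h3.
have [->|n0] := eqVneq a 0; first by rewrite mulr_ge0 ?sqr_ge0.
have a1 : 0 < a by rewrite lt_def n0.
rewrite -(ler_pM2r a1) -expr2; apply: le_trans h3 _.
by apply: le_trans (ler_pM e0 f0 h2 h1) _; rewrite expr2; nra.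
Qed.

Lemma VN_sq_le S : VN_ge0 S -> VN_le S (VN_one h) -> VN_le (VN_mul S S) S.
Proof.
move=> S0 S1; have S1' : VN_le S ((1 : R)%:C *: VN_one h) by rewrite scale1r.
have hS := VN_le_op ler01 S0 S1'; have /ge0_psd pS := S0.
apply/VN_leE/ge0_rdot => u; rewrite VN_addE VN_oppE VN_mulE !rdotBl.
have SS w : L2_dot (S (S u)) w = L2_dot (S u) (S w).
  by have := VN_adjP S (S u) w; rewrite (VN_ge0_adj S0).
rewrite /rdot SS SS -!/(rdot _ _); split.
  rewrite subr_ge0; have := ge0_cs u (S u) S0.
  have := VN_le_re (S u) S1; rewrite VN_oneE.
  have := VN_ge0_re u S0; have := VN_ge0_re (S u) S0; have := rdot_ge0 (S u).
  move: (rdot (S u) (S u)) (rdot (S u) u) (rdot (S (S u)) (S u)) => a b e.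
  move=> a0 e0 b0 h1 h2.
  have [->//|n0] := eqVneq a 0.
  have a1 : 0 < a by rewrite lt_def n0.
  rewrite -(ler_pM2r a1) -expr2; apply: le_trans h2 _.
  by rewrite ler_wpM2l.
have /ge0_rdot/(_ u)[_ ->] := S0.
by rewrite /rdot (lin_opZ (VN_linear S)) L2_dotZr ReM (L2_dotxx (S u)) /=; ring.
Qed.

(** Weak limits stay in the bicommutant: an operator of the commutant is moved to the other argument
    through its adjoint before the limit is taken. *)
Lemma VN_wlim (C : R) (I : Type) (F : set_system I) (FU : UltraFilter F)
    (T : I -> VN h) : 0 <= C -> F [set i | op_le C (T i)] ->
  exists2 A : VN h, op_le C A &
    forall u v, (fun i => rdot (T i u) v) @ F --> rdot (A u) v.
Proof.
move=> C0 hT; have FF := @ultra_proper _ _ FU.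
have [|A [lA cA hA]] := @ultra_form _ _ _ h C _ F FU (fun i u v => L2_dot (T i u) v) C0.
  apply: filterS hT => i /= hi; split => [a u v w|a u v w|u v].
  - by rewrite VN_linear L2_dot_linl.
  - by rewrite L2_dotDr L2_dotZr.
  - exact: op_le_rdot.
have cA' : commutant (@com R G h) A.
  split; first by apply/bounded_operatorP; split => //; exists C.
  move=> B cB; have [B' _ BB'] := adjoint_exists (proj1 cB).
  apply/funext => u /=; apply: rdot_ext => v.
  have -> : rdot (B (A u)) v = rdot (A u) (B' v) by rewrite /rdot BB'.
  have h1 := hA (B u) v; have h2 := hA u (B' v).
  apply: (@cvg_unique _ (@Rhausdorff R) _ _ _ _ h1).
  apply: cvg_trans h2; apply: near_eq_cvg; apply: nearW => i.
  by rewrite (VN_com _ _ cB) /rdot BB'.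
by exists (VN_mk cA').
Qed.

Lemma VN_sup_unique (D : set (VN h)) S S' : VN_sup D S -> VN_sup D S' -> S = S'.
Proof. by move=> [h1 h2] [h3 h4]; apply: VN_le_anti; apply/VN_leE; [exact: (h2 _ h3)|exact: (h4 _ h1)]. Qed.

(** The supremum is a weak limit along an ultrafilter refining the tails of [D]. Its quadratic form
    is therefore the pointwise supremum, and this is what makes vector functionals normal. *)
Lemma VN_dsup (D : set (VN h)) T : (forall S, D S -> VN_ge0 S) -> directed D ->
  (forall S, D S -> VN_le S T) ->
  exists2 S, VN_sup D S & forall u (z : R),
    (forall S', D S' -> rdot (S' u) u <= z) -> rdot (S u) u <= z.
Proof.
move=> D0 [[S0 DS0] Ddir] DT.
pose F0 : set_system (VN h) := filter_from D (fun S => [set S' | D S' /\ VN_le S S']).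
have FF0 : ProperFilter F0.
  apply: filter_from_proper; last by move=> S DS; exists S; split => //; exact: VN_le_refl.
  apply: filter_from_filter; first by exists S0.
  move=> S S' DS DS'; have [U DU [/VN_leE SU /VN_leE S'U]] := Ddir _ _ DS DS'.
  exists U => // V [DV UV].
  by split; split => //; [exact: VN_le_trans SU UV|exact: VN_le_trans S'U UV].
have [F [FU F0F]] := ultraFilterLemma FF0; have FF := @ultra_proper _ _ FU.
have FD : F D by apply: F0F; exists S0 => // S [].
have T0 : VN_ge0 T := VN_ge0_le (D0 _ DS0) (DT _ DS0).
have [c c0 Tc] := VN_le_scal T0.
have [|A _ hA] := @VN_wlim (c ^+ 2) _ F FU id (sqr_ge0 _).
  apply: filterS FD => S DS.
  exact: (VN_le_op (ltW c0) (D0 _ DS) (VN_le_trans (DT _ DS) Tc)).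
have Alim u (z : R) : F [set S | z <= rdot (S u) u] -> z <= rdot (A u) u.
  move=> hz; have := @filter_le _ _ _ FU _ _ _ _ (@cvg_cst _ z _ F _) (hA u u); exact.
have Alim' u (z : R) : F [set S | rdot (S u) u <= z] -> rdot (A u) u <= z.
  move=> hz; have := @filter_le _ _ _ FU _ _ _ _ (hA u u) (@cvg_cst _ z _ F _); exact.
have Aim u : rdot (A u) ('i *: u) = 0.
  apply: (@cvg_unique _ (@Rhausdorff R) _ _ _ _ (hA u ('i *: u))).
  apply: cvg_near_cst; apply: filterS FD => S /D0/ge0_rdot/(_ u)[_].
  by move=> ->.
have ub u (z : R) : (forall S', D S' -> rdot (S' u) u <= z) -> rdot (A u) u <= z.
  by move=> hz; apply: Alim'; apply: filterS FD => S /hz.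
exists A => //; split.
  move=> S DS; apply/ge0_rdot => u; rewrite VN_addE VN_oppE !rdotBl Aim.
  have /ge0_rdot/(_ u)[_ ->] := D0 _ DS; rewrite subr0; split => //.
  rewrite subr_ge0; apply: Alim; apply: F0F; exists S => // S' [DS' SS'].
  exact: VN_le_re.
move=> U hU; apply/ge0_rdot => u; rewrite VN_addE VN_oppE !rdotBl Aim.
have U0 : VN_ge0 U.
  by apply: (VN_ge0_le (D0 _ DS0)); apply/VN_leE; exact: hU.
have /ge0_rdot/(_ u)[_ ->] := U0; rewrite subr0; split => //.
by rewrite subr_ge0; apply: ub => S /hU/VN_leE; exact: VN_le_re.
Qed.

Lemma VN_sup_vec (D : set (VN h)) S u (z : R) : (forall S', D S' -> VN_ge0 S') ->
  directed D -> VN_sup D S -> (forall S', D S' -> rdot (S' u) u <= z) ->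
  rdot (S u) u <= z.
Proof.
move=> D0 dD sS; have DS S' : D S' -> VN_le S' S by move=> /(proj1 sS)/VN_leE.
have [T sT hT] := VN_dsup D0 dD DS.
by rewrite (VN_sup_unique sS sT); exact: hT.
Qed.

Lemma VN_sup_ge0 (D : set (VN h)) S : (forall S', D S' -> VN_ge0 S') ->
  directed D -> VN_sup D S -> VN_ge0 S.
Proof.
move=> D0 [[S0 DS0] _] [hS _].
by apply: (VN_ge0_le (D0 _ DS0)); apply/VN_leE; exact: hS.
Qed.

End operator_order.

(** * Normal functionals are sums of vector functionals *)

Section positive_functionals.
Context (R : realType) (G : topologicalGroupType) (h : haarMeasure R G).
Implicit Types (u v w : L2 h) (x y : G) (S T U : VN h) (m : VN h -> R[i]).
Implicit Types (D : set (VN h)).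

Lemma rdot_iself u : rdot u ('i *: u) = 0.
Proof.
rewrite /rdot L2_dotZr; have := L2_dotxx u; case: (L2_dot u u) => a b /= -[->].
by rewrite mulr0 subr0 mul0r.
Qed.

(** In the limit [v] tends to [y] and the hypothesis reads |y|^4 <= K |y|^2. It bounds the norm of
    [S eta] when only inner products with nearby vectors can be estimated. *)
Lemma rdot_closure_bound (E : set (L2 h)) (K : R) (y : L2 h) : 0 <= K ->
  (forall v, E v -> rdot v y ^+ 2 <= K * rdot v v) ->
  (forall e : R, 0 < e -> exists2 v, E v & rdot (y - v) (y - v) < e) ->
  rdot y y <= K.
Proof.
move=> K0 hE clo; apply/ler_addgt0Pr => e e0.
have [v Ev] := clo e e0; have := hE v Ev.
have : rdot (y - v) (y - v) = rdot y y - 2 * rdot v y + rdot v v.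
  by rewrite !(rdotBl, rdotBr) (rdotC y v); ring.
have := rdot_ge0 (y - v); have := rdot_ge0 v; have := rdot_ge0 y.
move: (rdot (y - v) (y - v)) (rdot y y) (rdot v v) (rdot v y) => d n p k.
move=> n0 p0 d0 dE hk de; rewrite leNgt; apply/negP => lt.
have h1 : k = (p + n - d) / 2 by lra.
have h2 : p * (n - d) <= k ^+ 2 by rewrite h1; have := sqr_ge0 (p - (n - d)); nra.
have p1 : p = 0.
  apply/eqP; rewrite eq_le p0 andbT leNgt; apply/negP => pp.
  have := le_trans h2 hk; rewrite (mulrC K) ler_pM2l//; lra.
move: hk; rewrite p1 mulr0 h1 p1 add0r; nra.
Qed.

Record posf m : Prop := Posf {
  posf_lin : forall a S T, m (a *: S + T) = a * m S + m T;
  posf_ge0 : forall S, VN_ge0 S -> 0 <= m S }.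

(** Normality tested on real upper bounds of real parts, without normalization; [P1P] relates it to
    [P1]. This version passes well to sums, differences and limits. *)
Definition onormal m := forall D S, (forall S', D S' -> VN_ge0 S') ->
  directed D -> VN_sup D S -> forall z : R,
  (forall S', D S' -> complex.Re (m S') <= z) -> complex.Re (m S) <= z.

Definition pnormal m := posf m /\ onormal m.

Section posf_theory.
Variable m : VN h -> R[i].
Hypothesis pm : posf m.

Lemma pmD S T : m (S + T) = m S + m T.
Proof. by have := posf_lin pm 1 S T; rewrite scale1r mul1r. Qed.
Lemma pm0 : m 0 = 0.
Proof. by apply: (addrI (m 0)); rewrite addr0 -pmD addr0. Qed.
Lemma pmZ a S : m (a *: S) = a * m S.
Proof. by have := posf_lin pm a S 0; rewrite !addr0 pm0 addr0. Qed.
Lemma pmN S : m (- S) = - m S.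
Proof. by rewrite -scaleN1r pmZ mulN1r. Qed.
Lemma pmB S T : m (S - T) = m S - m T.
Proof. by rewrite pmD pmN. Qed.

Lemma pm_re S : VN_ge0 S -> 0 <= complex.Re (m S).
Proof. by move=> /(posf_ge0 pm); rewrite lecE => /andP[]. Qed.
Lemma pm_im S : VN_ge0 S -> complex.Im (m S) = 0.
Proof. by move=> /(posf_ge0 pm); rewrite lecE => /andP[/eqP]. Qed.
Lemma pm_le S T : VN_le S T -> complex.Re (m S) <= complex.Re (m T).
Proof. by move=> /VN_leE /pm_re; rewrite pmB ReD ReN subr_ge0. Qed.

Lemma pm_psd : psd (fun S T => m (VN_mul (VN_adj T) S)).
Proof.
split=> [a S T U|a U S T|S].
- by rewrite VN_mulDr VN_mulZr pmD pmZ.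
- by rewrite VN_adjD VN_adjZ VN_mulDl VN_mulZl pmD pmZ.
- by apply: (posf_ge0 pm); exact: VN_ge0_sq.
Qed.

Lemma pm_cs2 S T : sqmod (m (VN_mul (VN_adj T) S)) <=
  complex.Re (m (VN_mul (VN_adj S) S)) * complex.Re (m (VN_mul (VN_adj T) T)).
Proof. exact: (psd_cs pm_psd S T). Qed.

Lemma pm_cs S : sqmod (m S) <=
  complex.Re (m (VN_one h)) * complex.Re (m (VN_mul (VN_adj S) S)).
Proof.
by have := pm_cs2 S (VN_one h); rewrite VN_adj1 !VN_mul1l mulrC.
Qed.

Lemma pm_bound (C : R) S : op_le C S ->
  complex.Re (m (VN_mul (VN_adj S) S)) <= C * complex.Re (m (VN_one h)).
Proof.
move=> hS; have : VN_le (VN_mul (VN_adj S) S) (C%:C *: VN_one h).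
  apply/VN_leE/ge0_rdot => u.
  rewrite VN_addE VN_oppE VN_mulE VN_scaleE VN_oneE !rdotBl.
  have E w : rdot (VN_adj S (S u)) w = rdot (S u) (S w) by rewrite /rdot VN_adjP'.
  rewrite !E rdotZl; split; first by rewrite subr_ge0 hS.
  by rewrite rdotZl (lin_opZ (VN_linear S)) !rdot_iself mulr0 subr0.
by move=> /pm_le; rewrite pmZ ReM ReC ImC mul0r subr0.
Qed.

Lemma pm1_ge0 : 0 <= complex.Re (m (VN_one h)).
Proof. exact: (pm_re (@VN_ge0_1 R G h)). Qed.

Lemma pm_op_bound (C : R) S : op_le C S ->
  sqmod (m S) <= C * complex.Re (m (VN_one h)) ^+ 2.
Proof.
move=> /pm_bound hS; apply: le_trans (pm_cs S) _.
by rewrite expr2 mulrCA ler_wpM2l// pm1_ge0.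
Qed.

Lemma pm_zero : complex.Re (m (VN_one h)) = 0 -> forall S, m S = 0.
Proof.
move=> h1 S; apply: sqmod_eq0; apply/eqP; rewrite eq_le sqmod_ge0 andbT.
by apply: le_trans (pm_cs S) _; rewrite h1 mul0r.
Qed.

End posf_theory.

Definition vecf u : VN h -> R[i] := fun S => L2_dot (S u) u.

Lemma pnormal_vecf u : pnormal (vecf u).
Proof.
split; first split=> [a S T|S S0]; rewrite /vecf ?VN_addE ?VN_scaleE ?L2_dot_linl//.
move=> D S D0 dD sS z hz; exact: VN_sup_vec sS hz.
Qed.

Lemma pnormal0 : pnormal (fun=> 0).
Proof.
split; first by split=> [a S T|S _]; rewrite ?mulr0 ?addr0.
by move=> D S _ [[S0 DS0] _] _ z /(_ _ DS0).
Qed.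

Lemma pnormalD m1 m2 : pnormal m1 -> pnormal m2 -> pnormal (fun S => m1 S + m2 S).
Proof.
move=> [p1 n1] [p2 n2]; split.
  split=> [a S T|S S0]; first by rewrite (posf_lin p1) (posf_lin p2); ring.
  by rewrite addr_ge0// posf_ge0.
move=> D S D0 dD sS z hz; rewrite ReD -lerBrDr.
apply: (n1 D S D0 dD sS) => S1 DS1; rewrite lerBrDl -lerBrDr.
apply: (n2 D S D0 dD sS) => S2 DS2; rewrite lerBrDl.
(* Directedness gives one element above both [S1] and [S2], so the two suprema can be taken
   independently. *)
have [U DU [S1U S2U]] := dD.2 _ _ DS1 DS2.
have := hz _ DU; rewrite ReD; apply: le_trans; apply: lerD; apply: pm_le => //; exact/VN_leE.
Qed.

Lemma pnormalB m1 m2 : pnormal m1 -> pnormal m2 -> posf (fun S => m1 S - m2 S) ->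
  pnormal (fun S => m1 S - m2 S).
Proof.
move=> [p1 n1] [p2 n2] p; split => // D S D0 dD sS z hz.
rewrite ReD ReN lerBlDr; apply: (n1 D S D0 dD sS) => S' DS'.
have := hz _ DS'; rewrite ReD ReN lerBlDr => /le_trans; apply.
by rewrite lerD2l; apply: (pm_le p2); apply/VN_leE; exact: sS.1.
Qed.

Lemma VN_zorn (P : VN h -> Prop) S0 T : P S0 ->
  (forall S, P S -> VN_ge0 S /\ VN_le S T) ->
  (forall D S, (forall S', D S' -> P S') -> directed D -> VN_sup D S -> P S) ->
  exists2 S, P S & forall S', P S' -> VN_le S S' -> S' = S.
Proof.
move=> PS0 Pb Psup.
pose X := {S : VN h | P S}.
have [||||[S PS] hS] := @Zorn X (fun a b => `[< VN_le (sval a) (sval b) >]).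
- by move=> a; apply/asboolP; exact: VN_le_refl.
- by move=> a b c /asboolP ab /asboolP bc; apply/asboolP; exact: VN_le_trans ab bc.
- move=> [a Pa] [b Pb'] /= /asboolP ab /asboolP ba; have E := VN_le_anti ab ba.
  by move: Pa Pb' ab ba; rewrite E => Pa Pb' _ _; congr exist; exact: Prop_irrelevance.
- move=> A totA; have [[a0 Aa0]|A0] := pselect (exists a, A a); last first.
    by exists (exist _ S0 PS0) => s As; exfalso; apply: A0; exists s.
  pose D := [set sval a | a in A].
  have DP S : D S -> P S by move=> [[a Pa] _ <-].
  have D0 S : D S -> VN_ge0 S by move=> /DP/Pb[].
  have DT S : D S -> VN_le S T by move=> /DP/Pb[].
  have dD : directed D.
    split; first by exists (sval a0), a0.
    move=> _ _ [a Aa <-] [b Ab <-]; have [/asboolP ab|/asboolP ba] := totA _ _ Aa Ab.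
      exists (sval b); first by exists b.
      by split; apply/VN_leE => //; exact: VN_le_refl.
    exists (sval a); first by exists a.
    by split; apply/VN_leE => //; exact: VN_le_refl.
  have [S sS _] := VN_dsup D0 dD DT.
  exists (exist _ S (Psup D S DP dD sS)) => a Aa /=.
  by apply/asboolP/VN_leE; apply: sS.1; exists a.
exists S => // S' PS' SS'.
by have /(congr1 sval) := hS (exist _ S' PS') (introT (asboolP _) SS').
Qed.

Lemma ge0_neq0_vec S : VN_ge0 S -> S != 0 -> exists u, 0 < rdot (S u) u.
Proof.
move=> S0; apply: contra_neqP => hS; apply: (VN_ge0_eq0 S0) => u.
by rewrite leNgt; apply/negP => hu; apply: hS; exists u.
Qed.

Lemma VN_sup_le D S T : VN_sup D S -> (forall S', D S' -> VN_le S' T) -> VN_le S T.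
Proof.
by move=> [_ hS] hT; apply/VN_leE; apply: hS => S' DS'; apply/VN_leE; exact: hT.
Qed.

Lemma VN_conj_le_sq (r S : VN h) (c : R) : VN_ge0 r -> 0 < c ->
  VN_le S (c%:C *: VN_one h) ->
  VN_le (c^-1%:C *: VN_mul r (VN_mul S r)) (VN_mul r r).
Proof.
move=> r0 c0 /VN_leE Sc; have adjr := VN_ge0_adj r0; apply/VN_leE.
have -> : VN_mul r r - c^-1%:C *: VN_mul r (VN_mul S r) =
    c^-1%:C *: VN_mul (VN_adj r) (VN_mul (c%:C *: VN_one h - S) r).
  rewrite adjr; apply: VN_ext => u.
  rewrite !(VN_addE, VN_oppE, VN_scaleE, VN_mulE, VN_oneE).
  rewrite (lin_opB (VN_linear r)) (lin_opZ (VN_linear r)) scalerBr scalerA.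
  by rewrite -rmorphM /= mulVf ?gt_eqF// scale1r.
by apply: VN_ge0Z; [rewrite invr_ge0 ltW|exact: VN_ge0_conj].
Qed.

(** Comparison of [m] with a vector functional by exhaustion. Positive contractions found by Zorn's
    lemma replace the support projections of the usual argument, so no spectral theory is involved;
    normality enters only to keep the constraints under suprema. *)
Lemma pnormal_dominated m : pnormal m -> complex.Re (m (VN_one h)) != 0 ->
  exists (r : VN h) (xi : L2 h), [/\ VN_ge0 r, complex.Re (m r) != 0 &
   forall S, VN_ge0 S ->
     complex.Re (m (VN_mul r (VN_mul S r))) <= rdot (S (r xi)) (r xi)].
Proof.
move=> [pm nm] m1.
(* [z] is a maximal positive contraction on which [m] vanishes, and [q = 1 - z] takes the part of
   the support of [m]. *)
have [z [[z0 z1] mz] zmax] : exists2 z, (VN_ge0 z /\ VN_le z (VN_one h)) /\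
    complex.Re (m z) <= 0 & forall S',
    (VN_ge0 S' /\ VN_le S' (VN_one h)) /\ complex.Re (m S') <= 0 ->
    VN_le z S' -> S' = z.
  apply: (@VN_zorn (fun z => (VN_ge0 z /\ VN_le z (VN_one h)) /\
    complex.Re (m z) <= 0) 0 (VN_one h)).
  - split; last by rewrite (pm0 pm).
    by split; [exact: VN_ge0_0|apply/VN_leE; rewrite subr0; exact: VN_ge0_1].
  - by move=> S [].
  - move=> D S DP dD sS.
    have D0 S' : D S' -> VN_ge0 S' by move=> /DP[[]].
    split; first split.
    + exact: VN_sup_ge0 D0 dD sS.
    + by apply: (VN_sup_le sS) => S' /DP[[]].
    + by apply: (nm D S D0 dD sS) => S' /DP[].
pose q := VN_one h - z.
have q0 : VN_ge0 q by apply/VN_leE.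
have [xi0 hxi0] : exists u, 0 < rdot (q u) u.
  apply: ge0_neq0_vec => //; apply: contraNneq m1 => /eqP.
  rewrite subr_eq0 => /eqP ->; apply/eqP/le_anti.
  by rewrite mz /= pm_re.
pose k := (complex.Re (m q) + 1) / rdot (q xi0) xi0.
have mq0 : 0 <= complex.Re (m q) by exact: pm_re.
have k0 : 0 <= k by rewrite divr_ge0// ?addr_ge0// ltW.
pose xi := (Num.sqrt k)%:C *: xi0.
have hxi : complex.Re (m q) < rdot (q xi) xi.
  rewrite /xi (lin_opZ (VN_linear q)) rdotZl rdotZr mulrA -expr2 sqr_sqrtr//.
  by rewrite /k divfK ?gt_eqF// ltrDl.
(* [T0] is maximal below [q] where [m] still dominates the vector functional of [xi]. Below
   [r = q - T0] the reverse domination holds. The scaling of [xi] excludes [T0 = q], hence [r != 0],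
   and maximality of [z] then excludes that [m] vanishes at [r]. *)
have [T0 [[T00 T0q] hT0] T0max] : exists2 T, (VN_ge0 T /\ VN_le T q) /\
    rdot (T xi) xi <= complex.Re (m T) & forall S',
    (VN_ge0 S' /\ VN_le S' q) /\ rdot (S' xi) xi <= complex.Re (m S') ->
    VN_le T S' -> S' = T.
  apply: (@VN_zorn (fun T => (VN_ge0 T /\ VN_le T q) /\
    rdot (T xi) xi <= complex.Re (m T)) 0 q).
  - split; last by rewrite (pm0 pm) VN_zeroE rdot0l.
    by split; [exact: VN_ge0_0|apply/VN_leE; rewrite subr0].
  - by move=> S [].
  - move=> D S DP dD sS.
    have D0 S' : D S' -> VN_ge0 S' by move=> /DP[[]].
    split; first split.
    + exact: VN_sup_ge0 D0 dD sS.
    + by apply: (VN_sup_le sS) => S' /DP[[]].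
    + apply: (VN_sup_vec D0 dD sS) => S' DS'; apply: le_trans (DP _ DS').2 _.
      by apply: pm_le => //; apply/VN_leE; exact: sS.1.
pose r := q - T0.
have r0 : VN_ge0 r by apply/VN_leE.
have rq : VN_le r q by apply/VN_leE; rewrite /r opprB addrC subrK.
have q1 : VN_le q (VN_one h) by apply/VN_leE; rewrite /q opprB addrC subrK.
have r1 := VN_le_trans rq q1.
have rn0 : r != 0.
  rewrite subr_eq0; apply: contraTneq hxi => ->; by rewrite -leNgt.
have mr0 : complex.Re (m r) != 0.
  apply: contraNneq rn0 => mr.
  suff E : z + r = z by apply/eqP; apply: (addrI z); rewrite addr0.
  apply: zmax; last by apply/VN_leE; rewrite addrC addKr.
  split; last by rewrite (pmD pm) ReD mr addr0.
  split; first exact: VN_ge0D.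
  apply/VN_leE; rewrite opprD addrA -/q; exact/VN_leE.
have dom S : VN_ge0 S -> VN_le S r -> complex.Re (m S) <= rdot (S xi) xi.
  move=> S0 Sr; rewrite leNgt; apply/negP => lt.
  have E : T0 + S = T0.
    apply: T0max; last by apply/VN_leE; rewrite addrC addKr.
    split; last by rewrite VN_addE rdotDl (pmD pm) ReD lerD// ltW.
    split; first exact: VN_ge0D.
    by apply/VN_leE; rewrite opprD addrA; exact/VN_leE.
  have S00 : S = 0 by apply: (addrI T0); rewrite addr0.
  by move: lt; rewrite S00 (pm0 pm) VN_zeroE rdot0l ltxx.
exists r, xi; split => // S S0.
have [c c0 Sc] := VN_le_scal S0.
have rr := VN_sq_le r0 r1.
have adjr := VN_ge0_adj r0.
pose Q := VN_mul r (VN_mul S r).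
have Q0 : VN_ge0 Q by rewrite /Q -[X in VN_mul X _]adjr; exact: VN_ge0_conj.
have ci0 : 0 <= c^-1 by rewrite invr_ge0 ltW.
have Qr : VN_le (c^-1%:C *: Q) r.
  exact: VN_le_trans (VN_conj_le_sq r0 c0 Sc) rr.
have := dom _ (VN_ge0Z ci0 Q0) Qr.
rewrite (pmZ pm) ReM ReC ImC mul0r subr0 VN_scaleE rdotZl.
rewrite ler_pM2l ?invr_gt0// /Q !VN_mulE => /le_trans; apply.
by rewrite /rdot -{1}adjr VN_adjP'.
Qed.

(* Zorn's lemma first yields a positive r on which m is dominated by a vector functional,
   and Riesz representation of S |-> m (S r) then gives eta. *)
Lemma pnormal_vec_below m : pnormal m -> complex.Re (m (VN_one h)) != 0 ->
  exists2 eta : L2 h, 0 < rdot eta eta &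
    forall S, rdot (S eta) (S eta) <= complex.Re (m (VN_mul (VN_adj S) S)).
Proof.
move=> nm m1; have pm := nm.1.
have [r [xi [r0 mr hr]]] := pnormal_dominated nm m1.
have adjr := VN_ge0_adj r0.
pose l S := complex.Re (m (VN_mul S r)).
have lb S : sqmod (m (VN_mul S r)) <= complex.Re (m (VN_one h)) * rdot (S (r xi)) (S (r xi)).
  apply: le_trans (pm_cs pm _) _; rewrite ler_wpM2l ?pm1_ge0//.
  rewrite VN_adjM adjr -VN_mulA (VN_mulA (VN_adj S)).
  apply: le_trans (hr _ (VN_ge0_sq S)) _.
  by rewrite VN_mulE /rdot VN_adjP'.
have [|||||eta [heta clo]] := riesz (@rdotC _ _ R h) (@rdotDl _ _ R h) (@rdotZl _ _ R h)
  (@rdot_ge0 _ _ R h) (@L2_complete _ _ R h) (add := +%R)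
  (scV := fun a (S : VN h) => a%:C *: S) 0 (p := fun S : VN h => S (r xi)) (l := l)
  _ _ _ _ (pm1_ge0 pm) => //.
- by move=> S T; rewrite /l VN_mulDl (pmD pm) ReD.
- by move=> a S; rewrite /l VN_mulZl (pmZ pm) ReM ReC ImC mul0r subr0.
- by move=> S; apply: le_trans (lb S); rewrite lerDl sqr_ge0.
exists eta.
  rewrite lt_def rdot_ge0 andbT; apply: contraNneq mr => /rdot_eq0 e0.
  by have := heta (VN_one h); rewrite e0 rdot0r /l VN_mul1l => ->.
move=> S; set K := complex.Re (m _).
have K0 : 0 <= K by apply: (pm_re pm); exact: VN_ge0_sq.
have key T : rdot (T (r xi)) (S eta) ^+ 2 <= K * rdot (T (r xi)) (T (r xi)).
  have -> : rdot (T (r xi)) (S eta) = l (VN_mul (VN_adj S) T).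
    by rewrite heta VN_mulE /rdot VN_adjP'.
  rewrite /l -VN_mulA.
  apply: (@le_trans _ _ (sqmod (m (VN_mul (VN_adj S) (VN_mul T r))))).
    by rewrite lerDl sqr_ge0.
  apply: le_trans (pm_cs2 pm (VN_mul T r) S) _; rewrite -/K mulrC ler_wpM2l//.
  rewrite VN_adjM adjr -VN_mulA (VN_mulA (VN_adj T)).
  by have := hr _ (VN_ge0_sq T); rewrite VN_mulE /rdot VN_adjP'.
have [C C0 hC] := VN_op_le S.
(* [eta] is a limit of vectors [T (r xi)], so [S eta] is a limit of vectors of the same kind, and on
   these [key] applies. *)
apply: (@rdot_closure_bound (range (fun T : VN h => T (r xi)))) => //.
  by move=> _ [T _ <-]; exact: key.
move=> e e0; have C1 : 0 < C + 1 by rewrite ltr_wpDl.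
have [T hT] := clo _ (divr_gt0 e0 C1).
exists (S (T (r xi))); first by exists (VN_mul S T).
rewrite -(lin_opB (VN_linear S)); apply: le_lt_trans (hC _) _.
move: hT; rewrite ltr_pdivlMr//; apply: le_lt_trans.
by rewrite mulrC ler_wpM2l ?rdot_ge0// lerDl.
Qed.

End positive_functionals.

(** * Positivity from positivity on squares *)

Section square_roots.
Context (R : realType) (G : topologicalGroupType) (h : haarMeasure R G).
Implicit Types (u v w : L2 h) (S T U : VN h) (m : VN h -> R[i]).

Lemma op_le_add (c e : R) S T : 0 <= c -> 0 <= e -> op_le (c ^+ 2) S -> op_le (e ^+ 2) T ->
  op_le ((c + e) ^+ 2) (S + T : VN h).
Proof.
move=> c0 e0 hS hT u; rewrite VN_addE !(rdotDl, rdotDr) (rdotC (T u)).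
have := rdot_cs (S u) (T u); have := hS u; have := hT u.
have := rdot_ge0 u; have := rdot_ge0 (S u); have := rdot_ge0 (T u).
move: (rdot (T u) (T u)) (rdot (S u) (S u)) (rdot u u) (rdot (S u) (T u)).
move=> t s n k t0 s0 n0 h1 h2 h3.
have h4 : k <= c * e * n.
  have [k0|/ltW k0] := lerP k 0; first by rewrite (le_trans k0)// !mulr_ge0.
  rewrite -(@ler_pXn2r _ 2%N) ?nnegrE ?mulr_ge0//; apply: le_trans h3 _.
  apply: le_trans (ler_pM s0 t0 h2 h1) _.
  by rewrite (_ : c ^+ 2 * n * (e ^+ 2 * n) = (c * e * n) ^+ 2)//; ring.
rewrite (_ : (c + e) ^+ 2 * n = c ^+ 2 * n + 2 * (c * e * n) + e ^+ 2 * n); [lra|ring].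
Qed.

Lemma op_le_mul (c e : R) S T : op_le (c ^+ 2) S -> op_le (e ^+ 2) T ->
  op_le ((c * e) ^+ 2) (VN_mul S T).
Proof.
move=> hS hT u; rewrite VN_mulE; apply: le_trans (hS _) _.
by rewrite exprMn -(mulrA (c ^+ 2)) ler_wpM2l ?sqr_ge0.
Qed.

Lemma op_le_scale (c e : R) S : op_le (c ^+ 2) S -> op_le ((e * c) ^+ 2) (e%:C *: S).
Proof.
move=> hS u; rewrite VN_scaleE rdotZl rdotZr mulrA -expr2 exprMn -(mulrA (e ^+ 2)).
by rewrite ler_wpM2l ?sqr_ge0.
Qed.

(** The classical iteration y -> (a + y^2)/2 towards 1 - sqrt (1 - a). *)
Fixpoint sqrt_iter (a : VN h) n : VN h :=
  if n is n'.+1 then (2^-1)%:C *: (a + VN_mul (sqrt_iter a n') (sqrt_iter a n')) else 0.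

(** The same iteration for the scalar 1. It majorizes the norms of the iterates and of their
    increments whenever [a] is a contraction. *)
Fixpoint sqrt_scal n : R :=
  if n is n'.+1 then 2^-1 * (1 + sqrt_scal n' * sqrt_scal n') else 0.

(** The defect t = 1 - s obeys t -> t (1 - t/2), hence decays like 2/n. *)
Lemma sqrt_scal_bound n : 0 <= sqrt_scal n <= 1 /\ 1 - sqrt_scal n <= 2 / n.+2%:R.
Proof.
elim: n => [|n [/andP[s0 s1] IH]] /=; first by rewrite lexx ler01 subr0 divff.
move: (sqrt_scal n) s0 s1 IH => s s0 s1 IH.
split; first by apply/andP; split; nra.
have n3 : 0 < n.+3%:R :> R by []. have n2 : 0 < n.+2%:R :> R by [].
have -> : 1 - 2^-1 * (1 + s * s) = (1 - s) * (1 - (1 - s) / 2) by field.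
move: IH; rewrite ler_pdivlMr// ler_pdivlMr//.
have : n.+3%:R = n.+2%:R + 1 :> R by rewrite natr1.
have : 2 <= n.+2%:R :> R by rewrite ler_nat.
move: (n.+3%:R) (n.+2%:R) n2 => p q q0 q2 -> hq.
have [q1|q1] := lerP ((1 - s) * q) 1; nra.
Qed.

Lemma sqrt_scal_small n : 0 <= sqrt_scal n.+1 - sqrt_scal n <= 2 / n.+1%:R.
Proof.
have [/andP[s0 s1] hs] := sqrt_scal_bound n.
have E : sqrt_scal n.+1 - sqrt_scal n = (1 - sqrt_scal n) * (1 - sqrt_scal n) / 2.
  by rewrite /=; field.
rewrite E; apply/andP; split; first by rewrite divr_ge0// mulr_ge0// subr_ge0.
apply: (@le_trans _ _ (1 - sqrt_scal n)); first by move: (sqrt_scal n) s0 s1 => s; nra.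
apply: le_trans hs _; rewrite ler_wpM2l// lef_pV2 ?posrE//.
by rewrite ler_nat.
Qed.

Lemma sqrt_step (a y z : VN h) :
  (2^-1)%:C *: (a + VN_mul y y) - (2^-1)%:C *: (a + VN_mul z z) =
  (2^-1)%:C *: (VN_mul y (y - z) + VN_mul (y - z) z).
Proof.
rewrite -(scaleN1r z) -scalerBr; congr (_ *: _).
rewrite VN_mulDl VN_mulDr VN_mulZl VN_mulZr !scaleN1r.
by rewrite opprD addrACA subrr add0r addrA subrK.
Qed.

Lemma sqrt_iter_bound (a : VN h) n : op_le (1 ^+ 2) a ->
  op_le (sqrt_scal n ^+ 2) (sqrt_iter a n) /\
  op_le ((sqrt_scal n.+1 - sqrt_scal n) ^+ 2) (sqrt_iter a n.+1 - sqrt_iter a n).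
Proof.
move=> ha.
have s0 k : 0 <= sqrt_scal k by have [/andP[]] := sqrt_scal_bound k.
have half (X : VN h) (c : R) : op_le (c ^+ 2) X -> op_le ((2^-1 * c) ^+ 2) ((2^-1)%:C *: X : VN h).
  exact: op_le_scale.
have b k : op_le (sqrt_scal k ^+ 2) (sqrt_iter a k).
  elim: k => [|k IH]; first by move=> u; rewrite VN_zeroE rdot0l expr0n /= mul0r.
  by apply: half; apply: op_le_add => //; [exact: mulr_ge0|exact: op_le_mul].
split; first exact: b.
elim: n => [|n IH].
  have -> : sqrt_iter a 1 - sqrt_iter a 0 = (2^-1)%:C *: a.
    apply: VN_ext => u; rewrite VN_addE VN_oppE !VN_scaleE VN_addE VN_mulE !VN_zeroE.
    by rewrite oppr0 !addr0.
  have -> : sqrt_scal 1 - sqrt_scal 0 = 2^-1 * 1 by rewrite /= mulr0 addr0 subr0.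
  exact: half.
have -> : sqrt_iter a n.+2 - sqrt_iter a n.+1 = (2^-1)%:C *:
    (VN_mul (sqrt_iter a n.+1) (sqrt_iter a n.+1 - sqrt_iter a n) +
     VN_mul (sqrt_iter a n.+1 - sqrt_iter a n) (sqrt_iter a n)).
  exact: sqrt_step.
have -> : sqrt_scal n.+2 - sqrt_scal n.+1 = 2^-1 *
   (sqrt_scal n.+1 * (sqrt_scal n.+1 - sqrt_scal n) +
    (sqrt_scal n.+1 - sqrt_scal n) * sqrt_scal n).
  rewrite (_ : sqrt_scal n.+2 = 2^-1 * (1 + sqrt_scal n.+1 * sqrt_scal n.+1))//.
  by rewrite [in X in _ - X = _]/=; ring.
have d0 : 0 <= sqrt_scal n.+1 - sqrt_scal n by have /andP[] := sqrt_scal_small n.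
by apply: half; apply: op_le_add; [exact: mulr_ge0|exact: mulr_ge0|
  apply: op_le_mul|apply: op_le_mul].
Qed.

Lemma sqrt_iter_adj (a : VN h) n : VN_adj a = a -> VN_adj (sqrt_iter a n) = sqrt_iter a n.
Proof.
move=> ha; elim: n => [|n IH] /=.
  by apply: VN_adj_unique => u v; rewrite !VN_zeroE L2_dot0l L2_dot0r.
by rewrite VN_adjZ VN_adjD VN_adjM IH ha conjc_real.
Qed.

(** This exhibits 1 - a as a square up to twice an increment of the iteration. Only the increments
    have to tend to 0, so no limit of the iterates is formed. *)
Lemma sqrt_iter_sq (a : VN h) n : VN_adj a = a ->
  VN_mul (VN_adj (VN_one h - sqrt_iter a n)) (VN_one h - sqrt_iter a n) =
  VN_one h - a + (2 : R)%:C *: (sqrt_iter a n.+1 - sqrt_iter a n).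
Proof.
move=> ha.
have -> : VN_one h - sqrt_iter a n = VN_one h + (-1) *: sqrt_iter a n by rewrite scaleN1r.
rewrite VN_adjD VN_adjZ VN_adj1 sqrt_iter_adj// rmorphN1.
apply: VN_ext => u.
rewrite [sqrt_iter a n.+1]/=; move: (sqrt_iter a n) => y.
rewrite !(VN_mulE, VN_addE, VN_oppE, VN_scaleE, VN_oneE) !scaleN1r.
rewrite (lin_opB (VN_linear y)) scalerBr scalerA -rmorphM /= divff// scale1r.
have two v : (2 : R)%:C *: v = v + v :> L2 h.
  by rewrite (_ : (2 : R)%:C = 1 + 1) ?scalerDl ?scale1r// -rmorphD.
by rewrite two opprB addrACA -opprD !addrA subrK.
Qed.

(** A positive operator is, after scaling, a norm limit of squares by [sqrt_iter_sq], and [m] is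
    norm bounded. Differences of functionals are compared on squares only, and this lemma upgrades
    the comparison to all positive operators. *)
Lemma posf_sq m (K : R) : (forall a S T, m (a *: S + T) = a * m S + m T) ->
  (forall S, 0 <= m (VN_mul (VN_adj S) S)) ->
  (forall (C : R) S, op_le C S -> sqmod (m S) <= C * K) -> posf m.
Proof.
move=> mlin msq mb; split => // S S0.
have mD S1 S2 : m (S1 + S2) = m S1 + m S2 by have := mlin 1 S1 S2; rewrite scale1r mul1r.
have m0 : m 0 = 0 by apply: (addrI (m 0)); rewrite addr0 -mD addr0.
have mZ b S1 : m (b *: S1) = b * m S1 by have := mlin b S1 0; rewrite !addr0 m0 addr0.
have K0 : 0 <= K.
  have h1 : op_le 1 (VN_one h) by move=> u; rewrite mul1r.
  by have := mb _ _ h1; rewrite mul1r; apply: le_trans; exact: sqmod_ge0.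
have [c c0 Sc] := VN_le_scal S0.
have ci0 : 0 <= c^-1 by rewrite invr_ge0 ltW.
pose S1 := c^-1%:C *: S.
have S10 : VN_ge0 S1 by exact: VN_ge0Z.
pose a := VN_one h - S1.
have a0 : VN_ge0 a.
  rewrite /a (_ : _ - _ = c^-1%:C *: (c%:C *: VN_one h - S)).
    by apply: VN_ge0Z => //; exact/VN_leE.
  by rewrite scalerBr scalerA -rmorphM /= mulVf ?gt_eqF// scale1r.
have a1 : VN_le a ((1 : R)%:C *: VN_one h).
  by apply/VN_leE; rewrite scale1r /a opprB addrC subrK.
have ha := VN_le_op ler01 a0 a1.
have adja := VN_ge0_adj a0.
have mS n : m S1 = m (VN_mul (VN_adj (VN_one h - sqrt_iter a n)) (VN_one h - sqrt_iter a n))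
   + (- 2 : R)%:C * m (sqrt_iter a n.+1 - sqrt_iter a n).
  rewrite sqrt_iter_sq// mD (mZ (2 : R)%:C) (_ : VN_one h - a = S1); last first.
    by rewrite /a opprB addrC subrK.
  by rewrite rmorphN /=; ring.
have small n : sqmod (m (sqrt_iter a n.+1 - sqrt_iter a n)) <= 4 * K / n.+1%:R.
  have [_ /mb] := sqrt_iter_bound n ha.
  have /andP[d0 d1] := sqrt_scal_small n => /le_trans; apply.
  rewrite [leRHS]mulrAC; apply: ler_wpM2r => //.
  have d2 : 2 / n.+1%:R <= 2 :> R by rewrite ler_pdivrMr// ler_peMr// ler1n.
  have n0 : 0 <= n.+1%:R^-1 :> R by rewrite invr_ge0.
  move: n0 d2 d1 d0; move: (n.+1%:R^-1) (sqrt_scal n.+1 - sqrt_scal n) => q dd q0 d2 d1 d0; nra.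
suff : 0 <= m S1.
  rewrite mZ => h1; have -> : m S = c%:C * (c^-1%:C * m S).
    by rewrite mulrA -rmorphM /= divff ?gt_eqF// mul1r.
  by rewrite mulr_ge0// ler0c ltW.
(* [m S1] differs from a nonnegative number by twice the small value, whose squared modulus is at
   most 4K/(n+1); the factor 2 is squared, whence 16. *)
have bnd n : complex.Im (m S1) ^+ 2 <= 16 * K / n.+1%:R /\
   (Num.min (complex.Re (m S1)) 0) ^+ 2 <= 16 * K / n.+1%:R.
  have := small n; rewrite /sqmod (mS n).
  have := msq (VN_one h - sqrt_iter a n).
  rewrite !ReImE; move: (complex.Re (m (sqrt_iter a n.+1 - sqrt_iter a n)))
    (complex.Im (m (sqrt_iter a n.+1 - sqrt_iter a n))) => r s.
  rewrite lecE => /andP[/eqP -> p0].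
  rewrite (_ : 16 * K / n.+1%:R = 4 * (4 * K / n.+1%:R)); last by field.
  move: (complex.Re (m _)) p0 (4 * K / n.+1%:R) => p p0 k.
  move=> hk; split; first nra.
  rewrite minEle; case: ifP => hp; last by nra.
  move: hp; rewrite mul0r subr0 => hp.
  have h1 : p * (4 * r - p) >= 0 by apply: mulr_ge0 => //; lra.
  nra.
have K16 : 0 <= 16 * K by rewrite mulr_ge0.
have i0 : complex.Im (m S1) = 0.
  apply/eqP; rewrite -sqrf_eq0 eq_le sqr_ge0 andbT.
  by apply: (@le_of_sqrt_eps _ _ (16 * K)) => // n; have [] := bnd n.
have r0 : Num.min (complex.Re (m S1)) 0 = 0.
  apply/eqP; rewrite -sqrf_eq0 eq_le sqr_ge0 andbT.
  by apply: (@le_of_sqrt_eps _ _ (16 * K)) => // n; have [] := bnd n.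
by rewrite lecE i0 eqxx /= -r0 ge_min lexx.
Qed.
End square_roots.

(** * Decomposition of a normal functional into vector functionals *)

Section normal_series.
Context (R : realType) (G : topologicalGroupType) (h : haarMeasure R G).
Implicit Types (u v w : L2 h) (S T U : VN h) (m : VN h -> R[i]) (z : nat -> L2 h).

Lemma dominated_series_cvg (a b : nat -> R) (K : R) : (forall k, `|a k| <= b k) ->
  (forall n, series b n <= K) -> cvgn (series a).
Proof.
move=> ab bK; apply: normed_cvg.
have b0 k : 0 <= b k by apply: le_trans (ab k).
apply: (@series_le_cvg _ _ b) => [k|k|k|//].
- exact: normr_ge0.
- exact: b0.
- exact: ab.
apply: nondecreasing_is_cvgn; first exact: nondecreasing_series.
by exists K => _ [n _ <-].
Qed.

Definition sq_summable z := exists K : R, forall n, series (fun k => rdot (z k) (z k)) n <= K.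

Definition sumf z : VN h -> R[i] := fun S =>
  limn (series (fun k => rdot (S (z k)) (z k))) +i*
  limn (series (fun k => rdot (S (z k)) ('i *: z k))).

Lemma rdot_le_half (c : R) S u v : 0 <= c -> op_le c S ->
  `|rdot (S u) v| <= (c + 1) * (rdot u u + rdot v v).
Proof.
move=> c0 hS; have := op_le_rdot u v hS; have := rdot_ge0 u; have := rdot_ge0 v.
move: (rdot u u) (rdot v v) (rdot (S u) v) => a b k b0 a0 hk.
have h0 : 0 <= (c + 1) * (a + b) by rewrite mulr_ge0// ?addr_ge0.
rewrite -(@ler_pXn2r _ 2%N) ?nnegrE// -normrX ger0_norm ?sqr_ge0//.
apply: le_trans hk _; have h1 : a * b <= (a + b) ^+ 2 by nra.
apply: (@le_trans _ _ ((c + 1) ^+ 2 * (a * b))).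
  by apply: ler_wpM2r; [exact: mulr_ge0|nra].
by rewrite exprMn ler_wpM2l ?sqr_ge0.
Qed.

Section summable_family.
Variable z : nat -> L2 h.
Hypothesis sz : sq_summable z.

Lemma sumf_cvg S (w : nat -> L2 h) : (forall k, rdot (w k) (w k) = rdot (z k) (z k)) ->
  cvgn (series (fun k => rdot (S (z k)) (w k))).
Proof.
move=> wz; have [c c0 hc] := VN_op_le S; have [K hK] := sz.
apply: (@dominated_series_cvg _ (fun k => (c + 1) * (rdot (z k) (z k) + rdot (w k) (w k)))
  ((c + 1) * (K + K))).
  by move=> k; exact: rdot_le_half.
move=> n; rewrite seriesEnat /= -mulr_sumr ler_wpM2l ?addr_ge0//.
rewrite big_split /=; apply: lerD; first exact: hK.
by under eq_bigr do rewrite wz; exact: hK.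
Qed.

Lemma sumf_cvg_re S : cvgn (series (fun k => rdot (S (z k)) (z k))).
Proof. exact: sumf_cvg. Qed.
Lemma sumf_cvg_im S : cvgn (series (fun k => rdot (S (z k)) ('i *: z k))).
Proof. by apply: sumf_cvg => k; exact: rdot_i. Qed.

Lemma sumf_lin a S T : sumf z (a *: S + T) = a * sumf z S + sumf z T.
Proof.
have cS1 := @sumf_cvg_re S; have cS2 := @sumf_cvg_im S.
have cT1 := @sumf_cvg_re T; have cT2 := @sumf_cvg_im T.
rewrite /sumf; case: a => a b; simpc.
have E3 (f g k l : nat -> R) (c e : R) : cvgn (series g) -> cvgn (series k) ->
    cvgn (series l) -> (forall n, f n = c * g n + e * k n + l n) ->
    limn (series f) = c * limn (series g) + e * limn (series k) + limn (series l).
  move=> cg ck cl fE; apply: cvg_lim => //.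
  rewrite (_ : series f = (fun n => c * series g n + e * series k n + series l n)).
    by apply: cvgD => //; apply: cvgD; apply: cvgM => //; exact: cvg_cst.
  apply/funext => n; rewrite !seriesEnat /= !mulr_sumr -!big_split /=.
  by apply: eq_bigr => i _; exact: fE.
have Ere k : rdot (((a +i* b) *: S + T : VN h) (z k)) (z k) =
    a * rdot (S (z k)) (z k) + (- b) * rdot (S (z k)) ('i *: z k) + rdot (T (z k)) (z k).
  rewrite VN_addE VN_scaleE rdotDl {1}/rdot L2_dotZl L2_dotE ReM /=; ring.
have Eim k : rdot (((a +i* b) *: S + T : VN h) (z k)) ('i *: z k) =
    a * rdot (S (z k)) ('i *: z k) + b * rdot (S (z k)) (z k) + rdot (T (z k)) ('i *: z k).
  rewrite VN_addE VN_scaleE rdotDl {1}/rdot L2_dotZl L2_dotZr L2_dotE !ReM !ImM /=; ring.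
rewrite (E3 _ _ _ _ _ _ cS1 cS2 cT1 Ere) (E3 _ _ _ _ _ _ cS2 cS1 cT2 Eim).
by congr (_ +i* _); ring.
Qed.

Lemma sumf_term_ge0 S k : VN_ge0 S -> 0 <= rdot (S (z k)) (z k).
Proof. exact: VN_ge0_re. Qed.

Lemma sumf_partial_le S n : VN_ge0 S ->
  series (fun k => rdot (S (z k)) (z k)) n <= complex.Re (sumf z S).
Proof.
move=> S0; apply: nondecreasing_cvgn_le; last exact: sumf_cvg_re.
by apply: nondecreasing_series => k _ _; exact: sumf_term_ge0.
Qed.

Lemma posf_sumf : posf (sumf z).
Proof.
split=> [|S S0]; first exact: sumf_lin.
rewrite lecE; apply/andP; split.
  apply/eqP => /=; rewrite (_ : series _ = fun=> 0) ?lim_cst//.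
  apply/funext => n; rewrite seriesEnat /= big1// => k _.
  by have /ge0_rdot/(_ (z k))[] := S0.
apply: le_trans (sumf_partial_le 0%N S0).
by rewrite seriesEnat /= big_geq.
Qed.

Lemma pnormal_partial n : pnormal (fun S => \sum_(0 <= k < n) vecf (z k) S).
Proof.
elim: n => [|n IH].
  rewrite (_ : (fun S => _) = (fun=> 0)); first exact: pnormal0.
  by apply/funext => S; rewrite big_geq.
rewrite (_ : (fun S => _) = (fun S => \sum_(0 <= k < n) vecf (z k) S + vecf (z n) S)).
  by apply: pnormalD => //; exact: pnormal_vecf.
by apply/funext => S; rewrite big_nat_recr.
Qed.

Lemma partial_re n S : complex.Re (\sum_(0 <= k < n) vecf (z k) S) =
  series (fun k => rdot (S (z k)) (z k)) n.
Proof.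
rewrite seriesEnat /=; elim: n => [|n IH]; first by rewrite !big_geq.
by rewrite !big_nat_recr//= ReD IH.
Qed.

Lemma pnormal_sumf : pnormal (sumf z).
Proof.
split; first exact: posf_sumf.
move=> D S D0 dD sS t ht.
apply: limr_le; first exact: sumf_cvg_re.
apply: nearW => n; rewrite -partial_re.
apply: ((pnormal_partial n).2 D S D0 dD sS) => S' DS'; rewrite partial_re.
by apply: le_trans (sumf_partial_le n (D0 _ DS')) _; exact: ht.
Qed.

End summable_family.

Definition below m u := forall S, rdot (S u) (S u) <= complex.Re (m (VN_mul (VN_adj S) S)).

Lemma below1 m u : below m u -> rdot u u <= complex.Re (m (VN_one h)).
Proof. by move=> /(_ (VN_one h)); rewrite VN_adj1 VN_mul1l. Qed.

Lemma vecf_sq u S : complex.Re (vecf u (VN_mul (VN_adj S) S)) = rdot (S u) (S u).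
Proof. by rewrite /vecf VN_mulE VN_adjP'. Qed.

Lemma sqmodB (a b : R[i]) : sqmod (a - b) <= 2 * (sqmod a + sqmod b).
Proof.
rewrite /sqmod !ReD !ImD !ReN !ImN.
move: (complex.Re a) (complex.Im a) (complex.Re b) (complex.Im b) => x y s t.
by have := sqr_ge0 (x + s); have := sqr_ge0 (y + t); nra.
Qed.

Lemma posfB m1 m2 : posf m1 -> posf m2 ->
  (forall S, complex.Re (m2 (VN_mul (VN_adj S) S)) <= complex.Re (m1 (VN_mul (VN_adj S) S))) ->
  posf (fun S => m1 S - m2 S).
Proof.
move=> p1 p2 m21.
apply: (@posf_sq _ _ _ _ (2 * (complex.Re (m1 (VN_one h)) ^+ 2 + complex.Re (m2 (VN_one h)) ^+ 2))).
- by move=> a S T; rewrite (posf_lin p1) (posf_lin p2); ring.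
- move=> S; rewrite lecE ReD ImD ReN ImN.
  rewrite (pm_im p1 (VN_ge0_sq S)) (pm_im p2 (VN_ge0_sq S)) subr0 eqxx /=.
  by rewrite subr_ge0.
- move=> C S hS; apply: le_trans (sqmodB _ _) _; rewrite mulrCA ler_wpM2l// mulrDr.
  by apply: lerD; exact: pm_op_bound.
Qed.

Lemma pnormalB_below m u : pnormal m -> below m u -> pnormal (fun S => m S - vecf u S).
Proof.
move=> nm bm; apply: pnormalB => //; first exact: pnormal_vecf.
apply: posfB => [||S]; [exact: nm.1|exact: (pnormal_vecf u).1|].
by rewrite vecf_sq; exact: bm.
Qed.

(** A maximal [u] might not exist; one whose squared norm is at least half of the supremum is enough
    for a greedy choice. *)
Lemma below_big m : pnormal m ->
  exists2 u, below m u & forall v, below m v -> rdot v v <= 2 * rdot u u.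
Proof.
move=> nm; pose A := [set rdot u u | u in below m].
have b0 : below m 0.
  by move=> S; rewrite (lin_op0 (VN_linear S)) rdot0l; apply: (pm_re nm.1); exact: VN_ge0_sq.
have sA : has_sup A.
  split; first by exists (rdot (0 : L2 h) 0), 0.
  by exists (complex.Re (m (VN_one h))) => _ [u bu <-]; exact: below1.
have ubA v : below m v -> rdot v v <= sup A by move=> bv; apply: sup_upper_bound => //; exists v.
have [s0|s0] := lerP (sup A) 0.
  by exists 0 => // v /ubA hv; rewrite rdot0l mulr0 (le_trans hv).
have [_ [u bu <-] hu] := sup_adherent (divr_gt0 s0 (ltr0n R 2)) sA.
exists u => // v /ubA hv; lra.
Qed.

Definition big_below m : L2 h := xget 0 [set u | below m u /\
  forall v, below m v -> rdot v v <= 2 * rdot u u].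

Lemma big_belowP m : pnormal m -> below m (big_below m) /\
  forall v, below m v -> rdot v v <= 2 * rdot (big_below m) (big_below m).
Proof.
move=> /below_big[u bu hu]; rewrite /big_below.
by case: xgetP => [v -> //|/(_ u)]; case.
Qed.

(** Greedy subtraction of vector functionals. If a remainder survived, [pnormal_vec_below] would
    give a nonzero [eta] below it, hence below every intermediate remainder; each chosen vector
    would then have squared norm at least half that of [eta], against summability. *)
Theorem pnormal_series m : pnormal m ->
  exists2 z, sq_summable z & forall S, m S = sumf z S.
Proof.
move=> nm; pose mm := fix mm n : VN h -> R[i] :=
  if n is n'.+1 then (fun S => mm n' S - vecf (big_below (mm n')) S) else m.
pose z n := big_below (mm n).
have nmm n : pnormal (mm n).
  elim: n => [//|n IH]; apply: pnormalB_below => //; exact: (big_belowP IH).1.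
have mmE n S : mm n S = m S - \sum_(0 <= k < n) vecf (z k) S.
  elim: n => [|n IH]; first by rewrite big_geq// subr0.
  by rewrite big_nat_recr//= opprD addrA -IH.
have sz : sq_summable z.
  exists (complex.Re (m (VN_one h))) => n.
  have := pm_re (nmm n).1 (@VN_ge0_1 _ _ h).
  by rewrite mmE ReD ReN partial_re subr_ge0.
have psz := posf_sumf sz.
have pd : posf (fun S => m S - sumf z S).
  apply: posfB => [||S]; [exact: nm.1|exact: psz|].
  apply: limr_le; first exact: sumf_cvg_re.
  apply: nearW => n; rewrite -partial_re -subr_ge0 -ReN -ReD -mmE.
  by apply: (pm_re (nmm n).1); exact: VN_ge0_sq.
have nd : pnormal (fun S => m S - sumf z S).
  by apply: pnormalB => //; exact: pnormal_sumf.
have d1 : complex.Re (m (VN_one h) - sumf z (VN_one h)) = 0.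
  apply/eqP/negPn/negP => dn0.
  have [eta eta0 heta] := pnormal_vec_below nd dn0.
  have bn n : below (mm n) eta.
    move=> S; apply: le_trans (heta S) _.
    rewrite mmE !ReD !ReN lerD2l lerN2 partial_re; apply: sumf_partial_le => //.
    exact: VN_ge0_sq.
  have [K hK] := sz.
  have hn n : n%:R * (rdot eta eta / 2) <= K.
    apply: le_trans (hK n); rewrite seriesEnat /= mulr_natl.
    rewrite -[X in _ *+ X](subn0 n) -sumr_const_nat; apply: ler_sum => k _.
    rewrite ler_pdivrMr// mulrC; exact: (big_belowP (nmm k)).2.
  have := hn (Num.trunc (K / (rdot eta eta / 2))).+1.
  have e2 : 0 < rdot eta eta / 2 by rewrite divr_gt0.
  rewrite leNgt => /negP; apply; rewrite -ltr_pdivrMr//; exact: truncnS_gt.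
exists z => // S; apply/eqP; rewrite -subr_eq0; apply/eqP.
exact: (pm_zero pd d1).
Qed.

End normal_series.

(** * Density of the span of the translations *)

Section l2_sequences.
Context (R : realType) (G : topologicalGroupType) (h : haarMeasure R G).
Implicit Types (u v w : L2 h) (z : nat -> L2 h).

Definition l2_pred : {pred (nat -> L2 h)} := mem [set z | @sq_summable R G h z].

Lemma l2_pred_submod_closed : submod_closed l2_pred.
Proof.
split.
  rewrite inE; exists 0 => n; rewrite seriesEnat /= big1// => k _.
  by rewrite (_ : (0 : nat -> L2 h) k = 0)// rdot0l.
move=> a y z; rewrite !inE => -[K hK] [L hL].
exists (2 * (sqmod a * K + L)) => n; rewrite seriesEnat /=.
apply: (@le_trans _ _ (\sum_(0 <= k < n) 2 * (sqmod a * rdot (y k) (y k) + rdot (z k) (z k)))).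
  apply: ler_sum => k _; rewrite (_ : (a *: y + z) k = a *: y k + z k)//.
  by apply: le_trans (rdotD_le _ _) _; rewrite rdotZZ.
rewrite -mulr_sumr big_split /= -mulr_sumr ler_wpM2l// lerD//; last exact: hL.
by rewrite ler_wpM2l ?sqmod_ge0//; exact: hK.
Qed.

HB.instance Definition _ :=
  GRing.isSubmodClosed.Build _ _ l2_pred l2_pred_submod_closed.

(** The Hilbert sum of countably many copies of [L2 h]. With operators acting diagonally, a whole
    series [sumf z] becomes the functional of the single vector [z], to which the double commutant
    argument applies. *)
Record l2 := MkL2seq { l2_val :> nat -> L2 h ; _ : l2_val \in l2_pred }.
HB.instance Definition _ := [isSub for l2_val].
HB.instance Definition _ := [Choice of l2 by <:].
HB.instance Definition _ := [SubChoice_isSubLmodule of l2 by <:].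

Implicit Types x y : l2.

Lemma l2P x : sq_summable x.
Proof. by case: x => x /=; rewrite inE. Qed.
Definition l2_mk z (sz : sq_summable z) : l2 := MkL2seq (mem_set sz).
Lemma l2_addE x y k : (x + y) k = x k + y k. Proof. by []. Qed.
Lemma l2_subE x y k : (x - y) k = x k - y k. Proof. by []. Qed.
Lemma l2_scaleE a x k : (a *: x) k = a *: x k. Proof. by []. Qed.
Lemma l2_ext x y : (forall k, x k = y k) -> x = y.
Proof. by move=> xy; apply: val_inj; apply/funext. Qed.

Definition ldot x y : R := limn (series (fun k => rdot (x k) (y k))).

Lemma rdot_le_add u v : `|rdot u v| <= rdot u u + rdot v v.
Proof.
have h1 : op_le 1 (VN_one h) by move=> w; rewrite VN_oneE mul1r.
have := rdot_cs u v; have := rdot_ge0 u; have := rdot_ge0 v.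
move: (rdot u u) (rdot v v) (rdot u v) => a b k b0 a0 hk.
rewrite -(@ler_pXn2r _ 2%N) ?nnegrE ?addr_ge0// -normrX ger0_norm ?sqr_ge0//.
nra.
Qed.

Lemma ldot_cvg x y : cvgn (series (fun k => rdot (x k) (y k))).
Proof.
have [K hK] := l2P x; have [L hL] := l2P y.
apply: (@dominated_series_cvg _ _ (fun k => rdot (x k) (x k) + rdot (y k) (y k)) (K + L)).
  by move=> k; exact: rdot_le_add.
move=> n; rewrite seriesEnat /= big_split /=.
by apply: lerD; [exact: hK|exact: hL].
Qed.

Lemma ldotC x y : ldot x y = ldot y x.
Proof. by rewrite /ldot; under eq_fun do rewrite rdotC. Qed.

Lemma ldotDl x y (z : l2) : ldot (x + y) z = ldot x z + ldot y z.
Proof.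
rewrite /ldot; apply: cvg_lim => //.
rewrite (_ : series _ = (series (fun k => rdot (x k) (z k)) +
  series (fun k => rdot (y k) (z k)))%R); first by apply: cvgD; exact: ldot_cvg.
apply/funext => n; rewrite fctE /= !seriesEnat /= -big_split /=.
by apply: eq_bigr => k _; exact: rdotDl.
Qed.

Lemma ldotZl (a : R) x y : ldot (a%:C *: x) y = a * ldot x y.
Proof.
rewrite /ldot; apply: cvg_lim => //.
rewrite (_ : series _ = (fun n => a * series (fun k => rdot (x k) (y k)) n)).
  by apply: cvgM; [exact: cvg_cst|exact: ldot_cvg].
apply/funext => n; rewrite !seriesEnat /= mulr_sumr.
by apply: eq_bigr => k _; exact: rdotZl.
Qed.

Lemma ldot_partial x n : series (fun k => rdot (x k) (x k)) n <= ldot x x.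
Proof.
apply: nondecreasing_cvgn_le; last exact: ldot_cvg.
by apply: nondecreasing_series => k _ _; exact: rdot_ge0.
Qed.

Lemma ldot_le x (K : R) : (forall n, series (fun k => rdot (x k) (x k)) n <= K) ->
  ldot x x <= K.
Proof.
by move=> hK; apply: limr_le; [exact: ldot_cvg|apply: nearW => n; exact: hK].
Qed.

Lemma ldot_ge0 x : 0 <= ldot x x.
Proof. by apply: le_trans (ldot_partial x 0); rewrite seriesEnat /= big_geq. Qed.

Lemma ldot_coord x k : rdot (x k) (x k) <= ldot x x.
Proof.
apply: le_trans (ldot_partial x k.+1); rewrite seriesEnat /= big_nat_recr//=.
by rewrite lerDr sumr_ge0// => i _; exact: rdot_ge0.
Qed.

Lemma ldot_eq0 x : ldot x x = 0 -> x = 0.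
Proof.
move=> x0; apply: l2_ext => k; apply: rdot_eq0; apply/eqP.
by rewrite eq_le rdot_ge0 andbT -x0 ldot_coord.
Qed.

Lemma l2_complete (u : nat -> l2) :
  (forall e : R, 0 < e -> exists N, forall n m, (N <= n)%N -> (N <= m)%N ->
     ldot (u n - u m) (u n - u m) < e) ->
  exists y, forall e : R, 0 < e -> exists N, forall n, (N <= n)%N ->
     ldot (u n - y) (u n - y) < e.
Proof.
move=> uC.
have /choice[y hy] k : exists y : L2 h, forall e : R, 0 < e -> exists N, forall n, (N <= n)%N ->
     rdot (u n k - y) (u n k - y) < e.
  apply: L2_complete => e /uC[N hN]; exists N => n m Nn Nm.
  by apply: le_lt_trans (hN n m Nn Nm); rewrite -l2_subE; exact: ldot_coord.
have key (e : R) : 0 < e -> exists N, forall n p, (N <= n)%N ->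
    \sum_(0 <= k < p) rdot (u n k - y k) (u n k - y k) <= e.
  move=> e0; have e4 : 0 < e / 4 by rewrite divr_gt0.
  have [N hN] := uC _ e4; exists N => n p Nn.
  have [m Nm hm] : exists2 m, (N <= m)%N & forall k, (k < p)%N ->
      rdot (u m k - y k) (u m k - y k) <= e / 4 / p.+1%:R.
    have ep : 0 < e / 4 / p.+1%:R by rewrite divr_gt0.
    have /choice[M hM] k := hy k _ ep.
    exists (N + \sum_(k < p) M k)%N; first exact: leq_addr.
    move=> k kp; apply/ltW/hM; apply: leq_trans (leq_addl _ _).
    by rewrite (bigD1 (Ordinal kp)) //= leq_addr.
  apply: (@le_trans _ _ (\sum_(0 <= k < p) 2 * (rdot (u n k - u m k) (u n k - u m k) +
      rdot (u m k - y k) (u m k - y k)))).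
    apply: ler_sum => k _; rewrite -[u n k - y k](subrKA (u m k)).
    exact: rdotD_le.
  rewrite -mulr_sumr big_split /=.
  have h1 : \sum_(0 <= k < p) rdot (u n k - u m k) (u n k - u m k) <= e / 4.
    apply: le_trans (ltW (hN n m Nn Nm)); apply: le_trans (ldot_partial _ p).
    by rewrite seriesEnat.
  have h2 : \sum_(0 <= k < p) rdot (u m k - y k) (u m k - y k) <= e / 4.
    apply: (@le_trans _ _ (\sum_(0 <= k < p) e / 4 / p.+1%:R)).
      by apply: ler_sum_nat => k /andP[_ kp]; exact: hm.
    rewrite sumr_const_nat subn0 -[leLHS]mulr_natr (mulrAC (e / 4)) ler_pdivrMr//.
    by rewrite ler_wpM2l ?(ltW e4)// ler_nat.
  lra.
have [N0 hN0] := key 1 ltr01.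
have sy : sq_summable y.
  have [K hK] := l2P (u N0); exists (2 * (1 + K)) => p; rewrite seriesEnat /=.
  apply: (@le_trans _ _ (\sum_(0 <= k < p) 2 * (rdot (u N0 k - y k) (u N0 k - y k) +
      rdot (u N0 k) (u N0 k)))).
    apply: ler_sum => k _; have := rdotD_le (y k - u N0 k) (u N0 k).
    by rewrite subrK -opprB rdotNl rdotNr opprK.
  rewrite -mulr_sumr big_split /= ler_wpM2l// lerD//; first exact: hN0.
  by have := hK p; rewrite seriesEnat.
exists (l2_mk sy) => e e0; have e2 : 0 < e / 2 by rewrite divr_gt0.
have [N hN] := key _ e2; exists N => n Nn.
apply: (@le_lt_trans _ _ (e / 2)); last lra.
apply: ldot_le => p; rewrite seriesEnat /=; exact: hN.
Qed.

End l2_sequences.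

Section translation_span.
Context (R : realType) (G : topologicalGroupType) (h : haarMeasure R G).
Implicit Types (u v w : L2 h) (S T : VN h) (x y : l2 h) (s : seq (R[i] * G)).

Lemma ldotNl x y : ldot (- x) y = - ldot x y.
Proof. by apply/eqP; rewrite -addr_eq0 -ldotDl addNr /ldot; apply/eqP; rewrite
  (_ : series _ = fun=> 0) ?lim_cst//; apply/funext => n;
  rewrite seriesEnat /= big1// => k _; exact: rdot0l. Qed.
Lemma ldotBl x y (z : l2 h) : ldot (x - y) z = ldot x z - ldot y z.
Proof. by rewrite ldotDl ldotNl. Qed.
Lemma ldotBr x y (z : l2 h) : ldot z (x - y) = ldot z x - ldot z y.
Proof. by rewrite ldotC ldotBl !(ldotC _ z). Qed.
Lemma ldotDr x y (z : l2 h) : ldot z (x + y) = ldot z x + ldot z y.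
Proof. by rewrite ldotC ldotDl !(ldotC _ z). Qed.
Lemma ldotZr (a : R) x y : ldot x (a%:C *: y) = a * ldot x y.
Proof. by rewrite ldotC ldotZl ldotC. Qed.
Lemma ldot_i x y : ldot ('i *: x) ('i *: y) = ldot x y.
Proof.
rewrite /ldot; congr (limn (series _)); apply/funext => k.
by rewrite !l2_scaleE rdot_i.
Qed.
Lemma ldot_cs x y : ldot x y ^+ 2 <= ldot x x * ldot y y.
Proof. exact: (real_cauchy_schwarz (@ldotC _ _ h) (@ldotDl _ _ h) (@ldotZl _ _ h) (@ldot_ge0 _ _ h)). Qed.
Lemma ldotD_le x y : ldot (x + y) (x + y) <= 2 * (ldot x x + ldot y y).
Proof.
have := ldot_ge0 (x - y); rewrite !(ldotBl, ldotBr, ldotDl, ldotDr) (ldotC y x); lra.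
Qed.

Lemma l2_subACA x y (a b : l2 h) : x + y - (a + b) = (x - a) + (y - b).
Proof. by rewrite opprD addrACA. Qed.

Lemma ldiag_subproof T x : sq_summable (fun k => T (x k)).
Proof.
have [c c0 hc] := VN_op_le T; have [K hK] := l2P x.
exists (c * K) => n; apply: (@le_trans _ _ (c * series (fun k => rdot (x k) (x k)) n)).
  by rewrite !seriesEnat /= mulr_sumr; apply: ler_sum => k _; exact: hc.
by apply: ler_wpM2l.
Qed.
Definition ldiag T x : l2 h := l2_mk (ldiag_subproof T x).

Lemma ldiagE T x k : ldiag T x k = T (x k). Proof. by []. Qed.

Lemma ldiagD T x y : ldiag T (x + y) = ldiag T x + ldiag T y.
Proof. by apply: l2_ext => k; rewrite l2_addE !ldiagE l2_addE (lin_opD (VN_linear T)). Qed.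
Lemma ldiagB T x y : ldiag T (x - y) = ldiag T x - ldiag T y.
Proof. by apply: l2_ext => k; rewrite l2_subE !ldiagE l2_subE (lin_opB (VN_linear T)). Qed.

Lemma ldiag_bound (c : R) T x : 0 <= c -> op_le c T ->
  ldot (ldiag T x) (ldiag T x) <= c * ldot x x.
Proof.
move=> c0 hc; apply: ldot_le => n.
apply: (@le_trans _ _ (c * series (fun k => rdot (x k) (x k)) n)).
  by rewrite !seriesEnat /= mulr_sumr; apply: ler_sum => k _; exact: hc.
by apply: ler_wpM2l => //; exact: ldot_partial.
Qed.

Lemma ldiag_lreg g x y : ldot (ldiag (VN_lreg h g) x) y =
  ldot x (ldiag (VN_lreg h g^-1%g) y).
Proof.
rewrite /ldot; congr (limn (series _)); apply/funext => k.
by rewrite !ldiagE !VN_lregE /rdot lreg_adj.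
Qed.

Definition lspan s : VN h := \sum_(p <- s) p.1 *: VN_lreg h p.2.

Lemma lspan_cat s t : lspan (s ++ t) = lspan s + lspan t.
Proof. by rewrite /lspan big_cat. Qed.

Lemma lspan_scale a s : lspan [seq (a * p.1, p.2) | p <- s] = a *: lspan s.
Proof.
by rewrite /lspan big_map scaler_sumr; apply: eq_bigr => p _; rewrite scalerA.
Qed.

Lemma lspan_mull g s : lspan [seq (p.1, g * p.2)%g | p <- s] = VN_mul (VN_lreg h g) (lspan s).
Proof.
elim: s => [|p s IH].
  by rewrite /lspan !big_nil; apply: VN_ext => u; rewrite VN_mulE !VN_zeroE (lin_op0 (VN_linear _)).
rewrite /= /lspan !big_cons VN_mulDr VN_mulZr VN_mul_lreg; congr (_ + _); exact: IH.
Qed.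

Section double_commutant.
Variable z : l2 h.

Let p s := ldiag (lspan s) z.

Let pD s t : p (s ++ t) = p s + p t.
Proof. by apply: l2_ext => k; rewrite l2_addE !ldiagE lspan_cat VN_addE. Qed.

Let pZ a s : p [seq (a * q.1, q.2) | q <- s] = a *: p s.
Proof. by apply: l2_ext => k; rewrite l2_scaleE !ldiagE lspan_scale VN_scaleE. Qed.

Let pM g s : p [seq (q.1, g * q.2)%g | q <- s] = ldiag (VN_lreg h g) (p s).
Proof. by apply: l2_ext => k; rewrite !ldiagE lspan_mull VN_mulE. Qed.

Let clos (y : l2 h) := forall e : R, 0 < e -> exists s, ldot (y - p s) (y - p s) < e.
Let orth (y : l2 h) := forall s, ldot (p s) y = 0.

Let closD x y : clos x -> clos y -> clos (x + y).
Proof.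
move=> cx cy e e0; have e4 : 0 < e / 4 by rewrite divr_gt0.
have [s hs] := cx _ e4; have [t ht] := cy _ e4; exists (s ++ t).
rewrite (pD s t) (l2_subACA x y (p s) (p t)); apply: le_lt_trans (ldotD_le _ _) _; lra.
Qed.

Let closZ a x : clos x -> clos (a *: x).
Proof.
move=> cx e e0; have a0 : 0 < sqmod a + 1 by rewrite ltr_wpDl ?sqmod_ge0.
have [s hs] := cx _ (divr_gt0 e0 a0); exists [seq (a * q.1, q.2) | q <- s].
rewrite pZ -scalerBr; apply: (@le_lt_trans _ _ (sqmod a * ldot (x - p s) (x - p s))).
  apply: ldot_le => n; apply: (@le_trans _ _ (sqmod a * series (fun k => rdot ((x - p s) k) ((x - p s) k)) n)).
    rewrite !seriesEnat /= mulr_sumr; apply: ler_sum => k _.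
    by rewrite rdotZZ.
  by apply: ler_wpM2l; [exact: sqmod_ge0|exact: ldot_partial].
move: hs; rewrite ltr_pdivlMr//; apply: le_lt_trans.
by rewrite mulrC ler_wpM2l ?ldot_ge0// lerDl.
Qed.

Let closM g x : clos x -> clos (ldiag (VN_lreg h g) x).
Proof.
move=> cx e /cx[s hs]; exists [seq (q.1, g * q.2)%g | q <- s].
rewrite pM -ldiagB; apply: le_lt_trans hs; rewrite -[leRHS]mul1r.
by apply: ldiag_bound => // u; rewrite VN_lregE lreg_rdot mul1r.
Qed.

Let orth_clos x y : orth y -> clos x -> ldot x y = 0.
Proof.
move=> oy cx; apply/eqP; rewrite -sqrf_eq0 eq_le sqr_ge0 andbT.
apply/ler_addgt0Pr => e e0; rewrite add0r.
have y0 : 0 < ldot y y + 1 by rewrite ltr_wpDl ?ldot_ge0.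
have [s hs] := cx _ (divr_gt0 e0 y0).
have -> : ldot x y = ldot (x - p s) y by rewrite ldotBl oy subr0.
apply: le_trans (ldot_cs _ _) _; move: hs; rewrite ltr_pdivlMr// => /ltW; apply: le_trans.
by rewrite ler_wpM2l ?ldot_ge0// lerDl.
Qed.

Lemma span_proj_exists (y : l2 h) : exists q : l2 h, clos q /\ orth (y - q).
Proof.
have [s t|s t|a s|a s|s|q [hq cq]] := riesz (@ldotC _ _ h) (@ldotDl _ _ h) (@ldotZl _ _ h)
  (@ldot_ge0 _ _ h) (@l2_complete _ _ h) (add := cat)
  (scV := fun (a : R) s => [seq (a%:C * q.1, q.2) | q <- s]) [::] (p := p)
  (l := fun s => ldot (p s) y) _ _ _ _ (ldot_ge0 y).
- exact: pD.
- by rewrite pD ldotDl.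
- exact: pZ.
- by rewrite pZ ldotZl.
- by rewrite mulrC; exact: ldot_cs.
by exists q; split => // s; rewrite ldotBr hq subrr.
Qed.

Variable P : l2 h -> l2 h.
Hypothesis PP : forall y, clos (P y) /\ orth (y - P y).

Let P_unique y q : clos q -> orth (y - q) -> P y = q.
Proof.
move=> cq oq; have [cP oP] := PP y.
apply/eqP; rewrite -subr_eq0; apply/eqP/ldot_eq0.
have od : orth (P y - q).
  move=> s; have /eqP := oq s; have /eqP := oP s.
  by rewrite (ldotBr y) (ldotBr y) !subr_eq0 => /eqP E1 /eqP E2; rewrite ldotBr -E1 -E2 subrr.
by rewrite ldotBl (orth_clos od cP) (orth_clos od cq) subrr.
Qed.

Let P_add x y : P (x + y) = P x + P y.
Proof.
have [cx ox] := PP x; have [cy oy] := PP y.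
apply: P_unique; first exact: closD.
move=> s; rewrite (l2_subACA x y (P x) (P y)) (ldotDr (x - P x)).
exact: etrans (congr2 +%R (ox s) (oy s)) (addr0 _).
Qed.

Let orth_scale a y : orth y -> orth (a *: y).
Proof.
move=> oy; have oi : orth ('i *: y).
  move=> s; rewrite -[p s]opprK ldotNl.
  have -> : - p s = 'i *: p [seq ('i * q.1, q.2) | q <- s].
    by rewrite pZ scalerA -expr2 sqr_i scaleN1r.
  by rewrite ldot_i oy oppr0.
move=> s; rewrite [a]complexE scalerDl mulrC -scalerA ldotDr !ldotZr oy oi.
by rewrite !mulr0 addr0.
Qed.

Let P_scale a y : P (a *: y) = a *: P y.
Proof.
have [cy oy] := PP y; apply: P_unique; first exact: closZ.
by rewrite -scalerBr; exact: orth_scale.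
Qed.

Let P_lreg g y : P (ldiag (VN_lreg h g) y) = ldiag (VN_lreg h g) (P y).
Proof.
have [cy oy] := PP y; apply: P_unique; first exact: closM.
by move=> s; rewrite -ldiagB ldotC ldiag_lreg ldotC -pM; exact: oy.
Qed.

Let P_bound y : ldot (P y) (P y) <= ldot y y.
Proof.
have [cy oy] := PP y; have h1 := orth_clos oy cy.
have := ldot_ge0 (y - P y); move/eqP: h1; rewrite (ldotBr y) subr_eq0 => /eqP E.
by rewrite (ldotBl y) !(ldotBr y) (ldotC y (P y)) E subrr subr0 subr_ge0.
Qed.

Definition lcoord_fun (m : nat) (u : L2 h) k : L2 h := if k == m then u else 0.

Lemma lcoord_sum (m : nat) u n : series (fun k => rdot (lcoord_fun m u k) (lcoord_fun m u k)) n <=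
  rdot u u.
Proof.
have E k : rdot (lcoord_fun m u k) (lcoord_fun m u k) = if k == m then rdot u u else 0.
  by rewrite /lcoord_fun; case: eqP => // _; rewrite rdot0l.
have -> : series (fun k => rdot (lcoord_fun m u k) (lcoord_fun m u k)) n =
    if (m < n)%N then rdot u u else 0.
  rewrite seriesEnat /=; elim: n => [|n IH]; first by rewrite big_geq.
  rewrite big_nat_recr//= IH E ltnS (leq_eqVlt m) (eq_sym m).
  by case: eqP => [->|_] /=; rewrite ?ltnn ?add0r ?addr0.
by case: ifP => // _; exact: rdot_ge0.
Qed.

Lemma lcoord_summable m u : sq_summable (lcoord_fun m u).
Proof. by exists (rdot u u) => n; exact: lcoord_sum. Qed.

Definition lcoord m u : l2 h := l2_mk (lcoord_summable m u).

Lemma lcoordE m u k : lcoord m u k = if k == m then u else 0. Proof. by []. Qed.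

(** The matrix entries of the projection [P]. They lie in [com] because [P] commutes with the
    diagonal translations. *)
Let A n m u := P (lcoord m u) n.

Let A_com n m : com (A n m).
Proof.
split; last first.
  move=> _ [g _ <-]; apply/funext => u; rewrite /A /=.
  rewrite -[RHS](ldiagE (VN_lreg h g)) -P_lreg; congr (P _ n); apply: l2_ext => k.
  by rewrite ldiagE !lcoordE; case: eqP => // _; rewrite (lin_op0 (VN_linear _)).
apply/bounded_operatorP; split.
  move=> a u v; rewrite /A.
  have -> : lcoord m (a *: u + v) = a *: lcoord m u + lcoord m v.
    apply: l2_ext => k; rewrite l2_addE l2_scaleE !lcoordE.
    by case: eqP => // _; rewrite scaler0 addr0.
  by rewrite P_add P_scale.
exists 1 => // u; rewrite mul1r /A; apply: le_trans (ldot_coord _ _) _.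
apply: le_trans (P_bound _) _; apply: ldot_le => k; exact: lcoord_sum.
Qed.

Definition ltrunc y N : l2 h := \sum_(0 <= m < N) lcoord m (y m).

Lemma ltruncE y N k : ltrunc y N k = if (k < N)%N then y k else 0.
Proof.
elim: N => [|N IH]; first by rewrite /ltrunc big_geq.
have -> : ltrunc y N.+1 = ltrunc y N + lcoord N (y N) by rewrite /ltrunc big_nat_recr.
rewrite l2_addE IH lcoordE ltnS (leq_eqVlt k).
by case: eqP => [->|_] /=; rewrite ?ltnn ?add0r ?addr0.
Qed.

Lemma ltrunc_approx y (e : R) : 0 < e ->
  exists N, ldot (y - ltrunc y N) (y - ltrunc y N) < e.
Proof.
move=> e0; have yc := @ldot_cvg _ _ h y y.
have e2 : 0 < e / 2 by rewrite divr_gt0.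
have lt : ldot y y - e / 2 < ldot y y by rewrite ltrBlDr ltrDl.
have [N _ hN] := cvgr_gt _ yc _ lt.
have {}hN := hN _ (leqnn N); exists N.
apply: (@le_lt_trans _ _ (e / 2)); last lra.
apply: ldot_le => n.
suff : series (fun k => rdot ((y - ltrunc y N) k) ((y - ltrunc y N) k)) n +
    series (fun k => rdot (y k) (y k)) N <= ldot y y.
  move: (series _ n) (series _ N) (ldot y y) hN => a b c; lra.
have rE k : (y - ltrunc y N) k = if (k < N)%N then 0 else y k.
  by rewrite l2_subE ltruncE; case: ifP; rewrite ?subrr ?subr0.
move: (y - ltrunc y N) rE => r rE.
pose M := maxn n N; apply: le_trans (ldot_partial y M).
apply: (@le_trans _ _ (series (fun k => rdot (r k) (r k)) M +
    series (fun k => rdot (y k) (y k)) N)).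
  rewrite lerD2r; apply: nondecreasing_series (leq_maxl _ _) => k _ _.
  exact: rdot_ge0.
rewrite !seriesEnat /= (@big_cat_nat _ _ _ N)//= ?leq_maxr// big1_seq ?add0r; last first.
  by move=> k; rewrite mem_index_iota => /andP[_ /andP[_ kN]]; rewrite rE kN rdot0l.
rewrite addrC [leRHS](@big_cat_nat _ _ _ N)//= ?leq_maxr// lerD2l.
rewrite le_eqVlt; apply/orP; left; apply/eqP; apply: eq_big_nat => k /andP[Nk _].
by rewrite rE ltnNge Nk.
Qed.

(** The double commutant theorem with amplification. An operator of the bicommutant commutes with
    every matrix entry of [P], so its diagonal copy commutes with [P]; since [P z = z], the image of
    [z] stays in the closed span of its translates. *)
Lemma commutant_closure T : clos (ldiag T z).
Proof.
have hA n m u : T (A n m u) = A n m (T u) by exact: VN_com (A_com n m).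
have hcoord m u : P (ldiag T (lcoord m u)) = ldiag T (P (lcoord m u)).
  apply: l2_ext => n; rewrite ldiagE hA; congr (P _ n); apply: l2_ext => k.
  by rewrite ldiagE !lcoordE; case: eqP => // _; rewrite (lin_op0 (VN_linear _)).
have P0 : P 0 = 0 by have := P_scale 0 0; rewrite !scale0r.
have hT0 : ldiag T 0 = 0 by apply: l2_ext => k; rewrite ldiagE (lin_op0 (VN_linear _)).
(* The matrix entries control finitely supported sequences only; the general case follows by
   truncation, as both sides are bounded in [y]. *)
have htrunc y N : P (ldiag T (ltrunc y N)) = ldiag T (P (ltrunc y N)).
  elim: N => [|N IH]; first by rewrite /ltrunc big_geq// P0 hT0 P0.
  have -> : ltrunc y N.+1 = ltrunc y N + lcoord N (y N) by rewrite /ltrunc big_nat_recr.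
  by rewrite ldiagD !P_add ldiagD IH hcoord.
have [c c0 hc] := VN_op_le T.
have PTC y : P (ldiag T y) = ldiag T (P y).
  apply/eqP; rewrite -subr_eq0; apply/eqP/ldot_eq0/eqP.
  rewrite eq_le ldot_ge0 andbT; apply/ler_addgt0Pr => e e0; rewrite add0r.
  have c1 : 0 < 4 * (c + 1) by rewrite mulr_gt0// ltr_wpDl.
  have [N hN] := ltrunc_approx y (divr_gt0 e0 c1).
  have yE : y - ltrunc y N + ltrunc y N = y by rewrite subrK.
  have := htrunc y N; move: hN yE; move: (y - ltrunc y N) => r; move: (ltrunc y N) => t hr <- ht.
  have -> : P (ldiag T (r + t)) - ldiag T (P (r + t)) = P (ldiag T r) + - ldiag T (P r).
    by rewrite ldiagD !P_add ldiagD ht l2_subACA subrr addr0.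
  apply: le_trans (ldotD_le _ _) _; rewrite ldotNl (ldotC _ (- _)) ldotNl opprK.
  have h1 := le_trans (P_bound (ldiag T r)) (ldiag_bound r c0 hc).
  have h2 := le_trans (ldiag_bound (P r) c0 hc) (ler_wpM2l c0 (P_bound r)).
  apply: le_trans (ler_wpM2l _ (lerD h1 h2)) _ => //.
  move: hr; rewrite ltr_pdivlMr//; have := ldot_ge0 r.
  move: (ldot r r) => k k0 hk; nra.
have Pz : P z = z.
  apply: P_unique; last by move=> s; rewrite subrr ldotC -[0](scale0r 0) ldotZl mul0r.
  (* [z] belongs to the span as its own translate by 1. *)
  move=> e e0; exists [:: (1, 1%g)]; rewrite (_ : z - _ = 0).
    by rewrite -[0](scale0r 0) ldotZl mul0r.
  apply: l2_ext => k; rewrite l2_subE ldiagE /lspan big_seq1 scale1r VN_lregE lreg1.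
  by rewrite subrr.
by have [] := PP (ldiag T z); rewrite PTC Pz.
Qed.

End double_commutant.

Theorem normal_span_dense m T (e : R) : pnormal m -> 0 < e ->
  exists s, complex.Re (m (VN_mul (VN_adj (T - lspan s)) (T - lspan s))) < e.
Proof.
move=> nm e0; have [z sz mz] := pnormal_series nm.
have /choice[P PP] := span_proj_exists (l2_mk sz).
have [s hs] := commutant_closure PP T e0; exists s.
rewrite mz; apply: le_lt_trans hs; rewrite le_eqVlt; apply/orP; left; apply/eqP.
transitivity (limn (series (fun k =>
  rdot (VN_mul (VN_adj (T - lspan s)) (T - lspan s) (z k)) (z k)))); first by [].
by congr (limn (series _)); apply/funext => k; rewrite VN_mulE {1}/rdot VN_adjP'.
Qed.

(** Domination by [m] makes [w] continuous for the seminorm in which the span of the translations is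
    dense. All later identities between normal functionals are obtained from their values on
    translations in this way. *)
Theorem normal_unique m (w : VN h -> R[i]) (C : R) : pnormal m ->
  (forall a S T, w (a *: S + T) = a * w S + w T) -> 0 <= C ->
  (forall S, sqmod (w S) <= C * complex.Re (m (VN_mul (VN_adj S) S))) ->
  (forall x : G, w (VN_lreg h x) = 0) -> forall T, w T = 0.
Proof.
move=> nm wl C0 wC wx T.
have wD S1 S2 : w (S1 + S2) = w S1 + w S2 by have := wl 1 S1 S2; rewrite scale1r mul1r.
have w0 : w 0 = 0 by apply: (addrI (w 0)); rewrite addr0 -wD addr0.
have wZ b S1 : w (b *: S1) = b * w S1 by have := wl b S1 0; rewrite !addr0 w0 addr0.
have ws s : w (lspan s) = 0.
  rewrite /lspan (big_morph w wD w0) big1// => p _.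
  by rewrite wZ wx mulr0.
apply: sqmod_eq0; apply/eqP; rewrite eq_le sqmod_ge0 andbT.
apply/ler_addgt0Pr => e e0; rewrite add0r.
have C1 : 0 < C + 1 by rewrite ltr_wpDl.
have [s hs] := normal_span_dense T nm (divr_gt0 e0 C1).
have -> : w T = w (T - lspan s) by rewrite -scaleN1r wD wZ ws mulr0 addr0.
apply: le_trans (wC _) _; move: hs; rewrite ltr_pdivlMr//.
have := pm_re nm.1 (VN_ge0_sq (T - lspan s)).
move: (complex.Re _) => k k0 hk; nra.
Qed.

End translation_span.

(** * Schur products *)

Section schur_product.
Context (R : realType) (V W : lmodType R[i]).
Variables (B1 : V -> V -> R[i]) (B2 : W -> W -> R[i]).
Implicit Types (s t : seq (V * W)).

Lemma psd_suml (U : lmodType R[i]) (B : U -> U -> R[i]) (pB : psd B)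
    (I : Type) (r : seq I) (a : I -> U) v :
  B (\sum_(i <- r) a i) v = \sum_(i <- r) B (a i) v.
Proof.
by apply: (big_morph (fun u => B u v)) => [u w|]; rewrite ?(psd_0l pB)// (psd_Dl pB).
Qed.

Lemma psd_sumr (U : lmodType R[i]) (B : U -> U -> R[i]) (pB : psd B)
    (I : Type) (r : seq I) (a : I -> U) v :
  B v (\sum_(i <- r) a i) = \sum_(i <- r) B v (a i).
Proof.
by apply: (big_morph (fun u => B v u)) => [u w|]; rewrite ?(psd_0r pB)// (psd_Dr pB).
Qed.

(* The form on the algebraic tensor product, evaluated on formal sums of
   elementary tensors. *)
Definition fsum_form s t : R[i] :=
  \sum_(p <- s) \sum_(q <- t) B1 p.1 q.1 * B2 p.2 q.2.

Hypotheses (pB1 : psd B1) (pB2 : psd B2).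

(* Gaussian elimination on the Gram matrix of the second components. *)
Lemma schur_psd s : 0 <= fsum_form s s.
Proof.
have [n] := ubnP (size s); elim: n s => // n IH [|p0 t] /=.
  by move=> _; rewrite /fsum_form big_nil.
rewrite ltnS => st; pose y0 := p0.2; pose c := B2 y0 y0.
have [c0|cn0] := eqVneq c 0.
  have h1 y : B2 y0 y = 0 by exact: psd_null.
  have h2 y : B2 y y0 = 0 by rewrite (psd_herm pB2 y0) h1 conjc0.
  rewrite /fsum_form big_cons big1 ?add0r; last first.
    by move=> q _; rewrite h1 mulr0.
  rewrite (eq_bigr (fun p => \sum_(q <- t) B1 p.1 q.1 * B2 p.2 q.2)); first exact: IH.
  by move=> p _; rewrite big_cons h2 mulr0 add0r.
have cr : conjc c = c by rewrite /c (psd_real pB2) conjc_real.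
(* [ph] removes the [y0] component of the second factor, which kills the head. The difference of the
   two Gram matrices has rank one and contributes [B1 z z / c]. *)
pose ph (p : V * W) := (p.1, p.2 - (B2 p.2 y0 / c) *: y0).
have E p q : B2 p.2 q.2 = B2 (ph p).2 (ph q).2 + B2 p.2 y0 * B2 y0 q.2 / c.
  rewrite /ph /= !(psd_Dl pB2, psd_Dr pB2, psd_Nl pB2, psd_Nr pB2, psd_Zl pB2, psd_Zr pB2).
  rewrite -/c conjcM (_ : conjc c^-1 = c^-1); last by rewrite conjc_inv cr.
  rewrite -(psd_herm pB2 q.2 y0).
  by move: (B2 p.2 y0) (B2 y0 q.2) (B2 p.2 q.2) => a b e; field.
pose z := \sum_(p <- p0 :: t) B2 p.2 y0 *: p.1.
have -> : fsum_form (p0 :: t) (p0 :: t) =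
    fsum_form [seq ph p | p <- t] [seq ph p | p <- t] + B1 z z / c.
  have -> : B1 z z / c = \sum_(p <- p0 :: t) \sum_(q <- p0 :: t)
      B1 p.1 q.1 * (B2 p.2 y0 * B2 y0 q.2 / c).
    rewrite /z (psd_suml pB1) mulr_suml; apply: eq_bigr => p _.
    rewrite (psd_sumr pB1) mulr_suml; apply: eq_bigr => q _.
    rewrite (psd_Zl pB1) (psd_Zr pB1) -(psd_herm pB2 q.2 y0); ring.
  rewrite /fsum_form (eq_bigr (fun p => \sum_(q <- p0 :: t) B1 p.1 q.1 * B2 (ph p).2 (ph q).2
     + \sum_(q <- p0 :: t) B1 p.1 q.1 * (B2 p.2 y0 * B2 y0 q.2 / c))); last first.
    by move=> p _; rewrite -big_split /=; apply: eq_bigr => q _; rewrite E mulrDr.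
  rewrite big_split /=; congr (_ + _).
  have ph0 : (ph p0).2 = 0 by rewrite /ph /= -/y0 -/c divff// scale1r subrr.
  have B0l y : B2 (ph p0).2 y = 0 by rewrite ph0 (psd_0l pB2).
  have B0r y : B2 y (ph p0).2 = 0 by rewrite ph0 (psd_0r pB2).
  rewrite big_cons big1 => [|q _]; last by rewrite B0l mulr0.
  rewrite add0r [in RHS]big_map; apply: eq_bigr => p _.
  by rewrite big_cons B0r mulr0 add0r big_map.
rewrite addr_ge0//; first by apply: IH; rewrite size_map.
rewrite divr_ge0//; [exact: (psd_ge0 pB1)|exact: (psd_ge0 pB2)].
Qed.

Lemma fsum_herm s t : fsum_form t s = conjc (fsum_form s t).
Proof.
have conjc_sum (I : Type) (r : seq I) (c : I -> R[i]) :
    conjc (\sum_(i <- r) c i) = \sum_(i <- r) conjc (c i).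
  by apply: big_morph; [exact: conjcD|exact: conjc0].
rewrite /fsum_form exchange_big /= conjc_sum; apply: eq_bigr => p _.
rewrite conjc_sum; apply: eq_bigr => q _.
by rewrite conjcM -(psd_herm pB1) -(psd_herm pB2).
Qed.

Definition fscale (a : R[i]) s := [seq (a *: p.1, p.2) | p <- s].

Lemma fsum_catl s s' t : fsum_form (s ++ s') t = fsum_form s t + fsum_form s' t.
Proof. by rewrite /fsum_form big_cat. Qed.

Lemma fsum_catr s t t' : fsum_form s (t ++ t') = fsum_form s t + fsum_form s t'.
Proof. by rewrite /fsum_form -big_split; apply: eq_bigr => p _; rewrite big_cat. Qed.

Lemma fsum_scalel a s t : fsum_form (fscale a s) t = a * fsum_form s t.
Proof.
rewrite /fsum_form big_map mulr_sumr; apply: eq_bigr => p _.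
by rewrite mulr_sumr; apply: eq_bigr => q _; rewrite (psd_Zl pB1) mulrA.
Qed.

Lemma fsum_scaler a s t : fsum_form s (fscale a t) = conjc a * fsum_form s t.
Proof.
rewrite /fsum_form mulr_sumr; apply: eq_bigr => p _.
by rewrite big_map mulr_sumr; apply: eq_bigr => q _; rewrite (psd_Zr pB1) mulrA.
Qed.

Lemma fsum_re_ge0 s : 0 <= complex.Re (fsum_form s s).
Proof. by have := schur_psd s; rewrite lecE => /andP[]. Qed.

Lemma fsum_cs s t : complex.Re (fsum_form s t) ^+ 2 <=
  complex.Re (fsum_form s s) * complex.Re (fsum_form t t).
Proof.
rewrite mulrC; apply: quad_disc; first exact: fsum_re_ge0.
move=> x; have := fsum_re_ge0 (s ++ fscale x%:C t).
rewrite !(fsum_catl, fsum_catr, fsum_scalel, fsum_scaler) (fsum_herm s t).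
rewrite conjc_real !ReD !ReM ?ReM !ReC !ImC !ReJ => /le_trans; apply.
rewrite !mul0r !subr0.
move: (complex.Re (fsum_form s s)) (complex.Re (fsum_form s t)) (complex.Re (fsum_form t t)) => a b k.
by lra.
Qed.

Lemma fsum_diag (I : eqType) (r : seq I) (a a' : I -> V) (c c' : I -> W) : uniq r ->
  (forall i j, i \in r -> j \in r -> i != j -> B2 (c i) (c' j) = 0) ->
  fsum_form [seq (a i, c i) | i <- r] [seq (a' i, c' i) | i <- r] =
  \sum_(i <- r) B1 (a i) (a' i) * B2 (c i) (c' i).
Proof.
move=> ur orth; rewrite /fsum_form big_map; apply: eq_big_seq => i ir.
rewrite big_map (bigD1_seq i)//= big1_seq ?addr0// => j /andP[ji jr].
by rewrite orth ?mulr0// eq_sym.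
Qed.

End schur_product.

Section formal_sums.
Context (R : realType) (G : topologicalGroupType) (h : haarMeasure R G).
Context (V : lmodType R[i]) (B : V -> V -> R[i]).
Hypothesis pB : psd B.
Implicit Types (s t : seq (V * L2 h)) (S T : VN h).

Lemma psd_L2_dot : psd (@L2_dot _ _ R h).
Proof.
split=> [a u v w|a u v w|u]; first exact: L2_dot_linl.
- by rewrite L2_dotDr L2_dotZr.
- exact: L2_dot_ge0.
Qed.

Definition fform := fsum_form B (@L2_dot _ _ R h).

Definition fmap_op S s := [seq (p.1, S p.2) | p <- s].

(** 1 (x) S has no larger norm than S: apply Schur positivity to the form [B'], whose positivity is
    exactly the bound on [S]. *)
Lemma fmap_op_bound (C : R) S s : op_le C S ->
  complex.Re (fform (fmap_op S s) (fmap_op S s)) <= C * complex.Re (fform s s).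
Proof.
move=> hS; pose B' u v := C%:C * L2_dot u v - L2_dot (S u) (S v).
have pB' : psd B'.
  split=> [a u v w|a u v w|u]; rewrite /B'.
  - by rewrite VN_linear !L2_dot_linl; ring.
  - by rewrite VN_linear !L2_dotDr !L2_dotZr; ring.
  - rewrite lecE ReD ImD ReN ImN ReM ImM ReC ImC (L2_dotxx u) (L2_dotxx (S u)) !ReC !ImC.
    rewrite mulr0 mul0r addr0 subr0 eqxx /= mul0r subr0 subr_ge0; exact: hS.
have := schur_psd pB pB' s; rewrite lecE => /andP[_].
have -> : fsum_form B B' s s = C%:C * fform s s - fform (fmap_op S s) (fmap_op S s).
  rewrite /fform /fsum_form mulr_sumr big_map -sumrB; apply: eq_bigr => p _.
  rewrite mulr_sumr big_map -sumrB; apply: eq_bigr => q _.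
  rewrite /B' /=; ring.
by rewrite ReD ReN ReM ReC ImC mul0r subr0 subr_ge0.
Qed.

Lemma fform_op_bound (C : R) S s t : op_le C S ->
  complex.Re (fform (fmap_op S s) t) ^+ 2 <=
  C * (complex.Re (fform s s) * complex.Re (fform t t)).
Proof.
move=> hS; apply: le_trans (fsum_cs pB psd_L2_dot _ _) _.
rewrite mulrA; apply: ler_wpM2r (fmap_op_bound _ hS).
exact: (fsum_re_ge0 pB psd_L2_dot).
Qed.

End formal_sums.

(** * Compactness and neighborhoods in a topological group *)

Lemma compact_subcover (X : topologicalType) (K : set X) (O : X -> set X) :
  compact K -> (forall t, K t -> nbhs t (O t)) ->
  exists s : seq X, forall t, K t -> exists2 y, y \in s & O y t.
Proof.
move=> /compact_near_coveringP cK hO.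
pose F : set_system (seq X) :=
  [set A : set (seq X) | exists r : seq X, forall s : seq X, {subset r <= s} -> A s].
have FF : Filter F.
  split; first by exists [::].
    move=> A B [r hr] [r' hr']; exists (r ++ r') => s rs.
    by split; [apply: hr|apply: hr'] => y yr; apply: rs; rewrite mem_cat yr ?orbT.
  by move=> A B AB [r hr]; exists r => s rs; apply/AB/hr.
have [t Kt|r hr] := cK (seq X) F (fun (s : seq X) t => exists2 y, y \in s & O y t) FF.
  exists (O t, [set s : seq X | t \in s]); first split; first exact: hO.
    by exists [:: t] => s ts; apply: ts; rewrite inE.
  by move=> [t' s] /= [Ot ts]; exists t.
by exists r => t Kt; apply: (hr r).
Qed.

Section topological_group.
Variable G : topologicalGroupType.
Implicit Types (x y z : G) (A U W K L : set G).

Lemma mulg_nbhs x y U : nbhs (x * y)%g U ->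
  exists V W, [/\ nbhs x V, nbhs y W & forall a b, V a -> W b -> U (a * b)%g].
Proof.
move=> /(mulg_continuous (x, y)) [[V W] [/= Vx Wy] hVW].
by exists V, W; split => // a b Va Wb; exact: (hVW (a, b)).
Qed.

Lemma lmul_nbhs a x U : nbhs (a * x)%g U -> nbhs x [set y | U (a * y)%g].
Proof.
move=> /mulg_nbhs[V [W [Va Wx hVW]]]; apply: filterS Wx => y Wy /=.
by apply: hVW => //; exact: nbhs_singleton Va.
Qed.

Lemma rmul_nbhs a x U : nbhs (x * a)%g U -> nbhs x [set y | U (y * a)%g].
Proof.
move=> /mulg_nbhs[V [W [Vx Wa hVW]]]; apply: filterS Vx => y Vy /=.
by apply: hVW => //; exact: nbhs_singleton Wa.
Qed.

Lemma inv_nbhs x U : nbhs (x^-1)%g U -> nbhs x [set y | U (y^-1)%g].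
Proof. exact: (@invg_continuous G x). Qed.

Lemma nbhs1_div U : nbhs (1 : G)%g U ->
  exists2 W, nbhs (1 : G)%g W & forall a b, W a -> W b -> U (a * b^-1)%g.
Proof.
rewrite -{1}(mulg1 (1 : G)%g) => /mulg_nbhs[V [W [V1 W1 hVW]]].
exists (V `&` [set y | W (y^-1)%g]).
  by apply: filterI => //; apply: inv_nbhs; rewrite invg1.
by move=> a b [Va _] [_ Wb]; exact: hVW.
Qed.

Lemma lset_preimage x A : lset x A = [set y | A (x^-1 * y)%g].
Proof.
by apply/seteqP; split => y; rewrite -[lset x A y]in_setE mem_lset inE.
Qed.

Lemma open_lset x U : open U -> open (lset x U : set G).
Proof.
move=> oU; rewrite lset_preimage openE => y /= Uy.
by apply: lmul_nbhs; exact: open_nbhs_nbhs.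
Qed.

Lemma compact_lset x K : compact K -> compact (lset x K : set G).
Proof.
move=> cK; apply: continuous_compact => //; apply: continuous_subspaceT => y.
by move=> U /lmul_nbhs.
Qed.

Lemma compact_tube L U : compact L -> (forall y, L y -> nbhs y U) ->
  nbhs (1 : G)%g [set x | forall y, L y -> U (x * y)%g].
Proof.
move=> /compact_near_coveringP cL LU.
apply: (cL G (nbhs (1 : G)%g) (fun x y => U (x * y)%g)) => y Ly.
have := LU y Ly; rewrite -{1}(mul1g y) => /mulg_nbhs[V [W [V1 Wy hVW]]].
by exists (W, V) => // -[b a] /= [Wb Va]; exact: hVW.
Qed.

Lemma compact_nbhs1 : locally_compact [set: G] ->
  exists2 K : set G, compact K & nbhs (1 : G)%g K.
Proof.
by move=> /(_ (1 : G)%g I)[K]; rewrite withinET => K1 [cK _]; exists K.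
Qed.

End topological_group.

(** * Haar measure and continuity of translations *)

Section haar_measure.
Context (R : realType) (G : topologicalGroupType) (h : haarMeasure R G).
Hypothesis HG : hausdorff_space G.
Implicit Types (x y z : G) (A U W K L : set G).

Lemma measurable_open U : open U -> measurable (U : set (borel G)).
Proof. by move=> oU; exact: sub_sigma_algebra. Qed.

Lemma measurable_compact K : compact K -> measurable (K : set (borel G)).
Proof.
move=> /(compact_closed HG) cK; rewrite -[K]setCK.
by apply: measurableC; apply: measurable_open; rewrite openC.
Qed.

Lemma haar_open_outer (A : set (borel G)) (e : R) : measurable A -> (h A < +oo)%E -> 0 < e ->
  exists U : set G, [/\ open U, A `<=` U & (h U < h A + e%:E)%E].
Proof.
move=> mA fA e0; have := haar_outer h mA => hA.
have fin : h A \is a fin_num by rewrite ge0_fin_numE.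
move: fin fA; rewrite hA => fin fA; have [_ [U [oU AU] <-] hU] := lb_ereal_inf_adherent e0 fin.
by exists U.
Qed.

Lemma haar_open_inner U (e : R) : open U -> (h U < +oo)%E -> 0 < e ->
  exists K : set G, [/\ compact K, K `<=` U & (h U < h K + e%:E)%E].
Proof.
move=> oU fU e0; have := haar_inner h oU => hU.
have fin : h U \is a fin_num by rewrite ge0_fin_numE.
move: fin fU; rewrite hU => fin fU.
have [_ [K [cK KU] <-] hK] := ub_ereal_sup_adherent e0 fin.
by exists K; split => //; rewrite -lteBlDr.
Qed.

(** If [U] were null, every compact set would be null, being covered by finitely many translates of
    [U]; inner regularity of the whole space would then make the measure zero. *)
Lemma haar_open_gt0 U x : open U -> U x -> (0 < h U)%E.
Proof.
move=> oU Ux; rewrite lt0e measure_ge0 andbT; apply/negP => /eqP hU0.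
have/negP := haar_neq0 h; apply; apply/eqP.
rewrite (haar_inner h (@openT G)); apply/eqP; rewrite eq_le; apply/andP; split; last first.
  by apply: ereal_sup_ubound; exists set0; [split=> //; exact: compact0|rewrite measure0].
apply: ub_ereal_sup => _ [K [cK _] <-].
pose O y := lset (y * x^-1)%g U : set (borel G).
have mO y : measurable (O y) by apply: measurable_lset; exact: measurable_open.
have [t Kt|s hs] := @compact_subcover G K O cK.
  apply: open_nbhs_nbhs; split; first exact: open_lset.
  by rewrite /O lset_preimage /= invgM invgK mulgVK.
have [mB B0] : measurable (\big[setU/set0]_(y <- s) O y) /\
    h (\big[setU/set0]_(y <- s) O y) = 0%E.
  elim: s {hs} => [|y s [mB B0]]; first by rewrite big_nil measure0.
  rewrite big_cons; split; first exact: measurableU.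
  have := @measureU0 _ _ _ h _ _ (mO y) mB B0 => ->.
  by rewrite /O haar_lset//; exact: measurable_open.
rewrite -B0; apply: le_measure; rewrite ?inE//; first exact: measurable_compact.
by move=> t /hs[y ys Oy]; rewrite -bigcup_seq; exists y.
Qed.

Lemma chi_sub_dot (A B : set (borel G)) : measurable A -> measurable B -> A `<=` B ->
  (h B < +oo)%E ->
  rdot (chi h B - chi h A) (chi h B - chi h A) = fine (h B) - fine (h A).
Proof.
move=> mA mB AB fB.
have fA : (h A < +oo)%E by apply: le_lt_trans fB; apply: le_measure; rewrite ?inE.
rewrite rdotBl !rdotBr (rdotC (chi h A)) /rdot !chi_dot// !ReC !setIid.
by rewrite (setIidr AB) subrr subr0.
Qed.

Lemma L2_dot_cs u v : sqmod (L2_dot u v) <= rdot u u * rdot (v : L2 h) v.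
Proof. exact: (psd_cs (psd_L2_dot h)). Qed.

Lemma dot_chi_limit u (B : set (borel G)) : (forall e : R, 0 < e -> exists A : set (borel G),
  L2_dot u (chi h A) = 0 /\ rdot (chi h B - chi h A) (chi h B - chi h A) <= e) ->
  L2_dot u (chi h B) = 0.
Proof.
move=> H; apply: sqmod_eq0; apply/eqP; rewrite eq_le sqmod_ge0 andbT.
apply/ler_addgt0Pr => e e0; rewrite add0r.
have k0 : 0 < rdot u u + 1 by rewrite ltr_wpDl// rdot_ge0.
have [|A [A0 hA]] := H (e / (rdot u u + 1)); first by rewrite divr_gt0.
have -> : L2_dot u (chi h B) = L2_dot u (chi h B - chi h A) by rewrite L2_dotBr A0 subr0.
apply: le_trans (L2_dot_cs _ _) _.
apply: le_trans (ler_wpM2l (rdot_ge0 _) hA) _.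
rewrite mulrCA; apply: ler_piMr; first exact: ltW.
by rewrite ler_pdivrMr// mul1r lerDl.
Qed.

(** Inner regularity is given on open sets only, so a set of finite measure is approximated by an
    open set from outside, and that one by a compact set from inside. *)
Lemma chi_compact_total u : (forall K, compact K -> L2_dot u (chi h K) = 0) -> u = 0.
Proof.
move=> Ku; apply: chi_total => B mB fB; apply: dot_chi_limit => e e0.
have [U [oU BU hU]] := haar_open_outer mB fB e0; have mU := measurable_open oU.
have finB : h B \is a fin_num by rewrite ge0_fin_numE.
have fU : (h U < +oo)%E by apply: lt_trans hU _; rewrite lte_add_pinfty ?ltry.
have finU : h U \is a fin_num by rewrite ge0_fin_numE.
exists U; split; last first.
  have -> : chi h B - chi h U = - (chi h U - chi h B) by rewrite opprB.
  rewrite rdotNl rdotNr opprK chi_sub_dot//; move: hU.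
  rewrite -(fineK finB) -(fineK finU) -EFinD lte_fin => hU.
  by rewrite lerBlDl ltW.
apply: dot_chi_limit => d d0; have [K [cK KU hK]] := haar_open_inner oU fU d0.
have mK := measurable_compact cK.
have finK : h K \is a fin_num by rewrite ge0_fin_numE// haar_compact.
exists K; split; first exact: Ku.
rewrite chi_sub_dot//; move: hK; rewrite -(fineK finK) -(fineK finU) -EFinD lte_fin => hK.
by rewrite lerBlDl ltW.
Qed.

Lemma L2_dense (P : L2 h -> Prop) : P 0 -> (forall u v, P u -> P v -> P (u + v)) ->
  (forall a u, P u -> P (a *: u)) ->
  (forall u, (forall v, P v -> L2_dot v u = 0) -> u = 0) ->
  forall u (e : R), 0 < e -> exists2 v, P v & rdot (u - v) (u - v) < e.
Proof.
move=> P0 PD PZ Ptot u e e0.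
pose V := {v | P v}.
pose add (v w : V) : V := exist _ (sval v + sval w) (PD _ _ (svalP v) (svalP w)).
pose scV (a : R) (v : V) : V := exist _ (a%:C *: sval v) (PZ a%:C _ (svalP v)).
have [||||||y [hy clo]] := riesz (@rdotC _ _ R h) (@rdotDl _ _ R h) (@rdotZl _ _ R h)
  (@rdot_ge0 _ _ R h) (@L2_complete _ _ R h) (add := add) (scV := scV) (exist _ 0 P0)
  (p := sval) (l := fun v => rdot (sval v) u) (C := rdot u u) => //.
- by move=> v w; rewrite rdotDl.
- by move=> a v; rewrite rdotZl.
- exact: rdot_ge0.
- by move=> v; rewrite mulrC; exact: rdot_cs.
have yu : u - y = 0.
  have re0 v : P v -> rdot v (u - y) = 0.
    by move=> Pv; rewrite rdotBr (hy (exist _ v Pv)) subrr.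
  apply: Ptot => v Pv; rewrite L2_dotE re0// -rdot_i scalerA.
  have -> : 'i * 'i = -1 :> R[i] by rewrite -expr2 sqr_i.
  by rewrite scaleN1r rdotNr re0 ?oppr0//; apply: (PZ).
have [[v Pv] /= hv] := clo e e0; exists v => //.
by have -> : u = y by apply/eqP; rewrite -subr_eq0 yu.
Qed.

Lemma restr_sub_le (B : set (borel G)) (u v : L2 h) : measurable B -> restr B v = v ->
  rdot (u - restr B u) (u - restr B u) <= rdot (u - v) (u - v).
Proof.
move=> mB Bv; set w := u - v.
have -> : u - restr B u = w - restr B w.
  by rewrite /w (lin_opB (@restr_linear _ _ R h B)) Bv opprB addrA subrK.
move: w => {u v Bv} w.
have E : rdot (restr B w) (restr B w) = rdot w (restr B w).
  by rewrite /rdot restr_dot restrI// setIid.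
rewrite rdotBl !rdotBr E (rdotC (restr B w) w).
have := rdot_ge0 (restr B w); rewrite E; move: (rdot w (restr B w)) (rdot w w) => a b; lra.
Qed.

Lemma restr_compact_approx (u : L2 h) (e : R) : 0 < e ->
  exists2 K : set G, compact K &
    rdot (u - restr (K : set (borel G)) u) (u - restr (K : set (borel G)) u) < e.
Proof.
move=> e0.
have [|v w [K cK Kv] [L cL Lw]|a v [K cK Kv]|v hv|v [K cK Kv] hv] :=
  @L2_dense (fun v : L2 h => exists2 K : set G, compact K & restr (K : set (borel G)) v = v) _ _ _ _ u e e0.
- by exists set0; [exact: compact0|rewrite (lin_op0 (@restr_linear _ _ R h _))].
- exists (K `|` L); first exact: compactU.
  have mK := measurable_compact cK; have mL := measurable_compact cL.
  have mKL : measurable (K `|` L : set (borel G)) by exact: measurableU.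
  rewrite (lin_opD (@restr_linear _ _ R h _)) -{1}Kv -{1}Lw !restrI//.
  by rewrite (setIidr (@subsetUl _ K L)) (setIidr (@subsetUr _ K L)) Kv Lw.
- by exists K => //; rewrite (lin_opZ (@restr_linear _ _ R h _)) Kv.
- apply: chi_compact_total => K cK; rewrite L2_dotC hv ?conjc0//; exists K => //.
  have mK := measurable_compact cK.
  by rewrite restr_chi// ?setIid// haar_compact.
exists K => //; apply: le_lt_trans hv; apply: restr_sub_le => //.
exact: measurable_compact.
Qed.

(** By the tube lemma [L] and its translate both lie in one open [U] of nearly the same measure, so
    both indicators are close to that of [U]. Two errors below e/4 give e after the factor 2 of
    [rdotD_le]. *)
Lemma lreg_chi_continuous L (e : R) : compact L -> 0 < e ->
  \forall x \near (1 : G)%g, rdot (lreg x (chi h L) - chi h L) (lreg x (chi h L) - chi h L) < e.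
Proof.
move=> cL e0; have mL := measurable_compact cL; have fL := haar_compact h cL.
have finL : h L \is a fin_num by rewrite ge0_fin_numE.
have [|U [oU LU hU]] := haar_open_outer (e := e / 4) mL fL; first by rewrite divr_gt0.
have mU := measurable_open oU.
have fU : (h U < +oo)%E by apply: lt_trans hU _; rewrite lte_add_pinfty ?ltry.
have finU : h U \is a fin_num by rewrite ge0_fin_numE.
have /(compact_tube cL) W1 y : L y -> nbhs y U.
  by move=> Ly; apply: open_nbhs_nbhs; split => //; exact: LU.
apply: filterS W1 => x hx; have mxL := measurable_lset x mL.
have fxL : (h (lset x L) < +oo)%E by rewrite haar_lset.
have xLU : lset x L `<=` U by move=> _ [y Ly <-]; exact: hx.
rewrite lreg_chi//.
have -> : chi h (lset x L) - chi h L = (chi h U - chi h L) - (chi h U - chi h (lset x L)).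
  by rewrite opprB [RHS]addrC addrA subrK.
apply: le_lt_trans (rdotD_le _ _) _; rewrite rdotNl rdotNr opprK !chi_sub_dot//.
rewrite haar_lset//; move: hU; rewrite -(fineK finL) -(fineK finU) -EFinD lte_fin /=.
by move: (fine (h L)) (fine (h U)) => a b; lra.
Qed.

Lemma lreg_continuous (u : L2 h) (e : R) : 0 < e ->
  \forall x \near (1 : G)%g, rdot (lreg x u - u) (lreg x u - u) < e.
Proof.
pose Q (v : L2 h) := forall e : R, 0 < e ->
  \forall x \near (1 : G)%g, rdot (lreg x v - v) (lreg x v - v) < e.
have lZ := lin_opZ (@lreg_linear R G h _); have lD := lin_opD (@lreg_linear R G h _).
suff : Q u by apply.
have QD v w : Q v -> Q w -> Q (v + w).
  move=> Qv Qw d d0; have d4 : 0 < d / 4 by rewrite divr_gt0.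
  apply: filterS2 (Qv _ d4) (Qw _ d4) => x vx wx.
  rewrite lD opprD addrACA; apply: le_lt_trans (rdotD_le _ _) _.
  by move: (rdot _ _) (rdot _ _) vx wx => a b; lra.
have QZ a v : Q v -> Q (a *: v).
  move=> Qv d d0; have s0 : 0 < sqmod a + 1 by rewrite ltr_wpDl// sqmod_ge0.
  apply: filterS (Qv (d / (sqmod a + 1)) (divr_gt0 d0 s0)) => x vx.
  rewrite lZ -scalerBr rdotZZ -/(sqmod a); move: vx; rewrite ltr_pdivlMr//.
  have := rdot_ge0 (lreg x v - v); move: (rdot _ _) (sqmod _) => k b; nra.
(* The approximation error enters with weight 8 and the translation error with weight 2, in total
   10/12 of [d]. *)
move=> d d0; have d12 : 0 < d / 12 by rewrite divr_gt0.
have [||v Qv hv] := L2_dense _ QD QZ _ u d12.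
- by move=> c c0; apply: nearW => x; rewrite (lin_op0 (@lreg_linear R G h x)) subrr rdot0l.
- move=> v hv; apply: chi_compact_total => L cL; rewrite L2_dotC hv ?conjc0// => c c0.
  exact: lreg_chi_continuous.
apply: filterS (Qv _ d12) => x vx.
have -> : lreg x u - u = (lreg x (u - v) - (u - v)) + (lreg x v - v).
  rewrite (lin_opB (@lreg_linear R G h x)) opprB; move: (lreg x u) (lreg x v) => a b.
  by rewrite [RHS]addrAC (addrA (a - b)) subrK addrA subrK.
apply: le_lt_trans (rdotD_le _ _) _.
have : rdot (lreg x (u - v) - (u - v)) (lreg x (u - v) - (u - v)) <=
   4 * rdot (u - v) (u - v).
  apply: le_trans (rdotD_le _ _) _; rewrite rdotNl rdotNr opprK lreg_rdot.
  by move: (rdot _ _) => a; lra.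
move: (rdot (u - v) (u - v)) (rdot (lreg x v - v) _) (rdot _ _) hv vx => a b k; lra.
Qed.

End haar_measure.

Lemma abs_Re_mul_le (R : realType) (c a : R[i]) (e p q : R) : 0 <= e -> 0 <= p -> 0 <= q ->
  sqmod c <= e ^+ 2 -> sqmod a <= p * q -> `|complex.Re (c * a)| <= e / 2 * (p + q).
Proof.
move=> e0 p0 q0 hc ha.
have h1 : complex.Re (c * a) ^+ 2 <= sqmod c * sqmod a.
  rewrite ReM /sqmod; case: c {hc} => c1 c2; case: a {ha} => a1 a2 /=.
  have := sqr_ge0 (c1 * a2 + c2 * a1); nra.
have h2 : complex.Re (c * a) ^+ 2 <= (e / 2 * (p + q)) ^+ 2.
  apply: le_trans h1 _; apply: le_trans (ler_pM (sqmod_ge0 _) (sqmod_ge0 _) hc ha) _.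
  rewrite exprMn; have := sqr_ge0 (e * (p - q)); nra.
rewrite -(@ler_pXn2r _ 2%N) ?nnegrE//; first by rewrite real_normK// num_real.
by apply: mulr_ge0; [apply: divr_ge0|apply: addr_ge0].
Qed.

(** * Multiplication of an operator by a normal state *)

Section partitions.
Context (R : realType) (G : topologicalGroupType) (h : haarMeasure R G).
Implicit Types (x y z t : G) (A U W K L : set G) (f g : L2 h).

(** The map sigma together with a list containing its values. Keeping sigma itself allows one to
    compare partitions pointwise, and cells are allowed to be empty. *)
Definition partition : Type := (G -> G) * seq G.
Implicit Type P : partition.

Definition cell P y : set (borel G) := [set t | P.1 t = y].

Definition valid P := [/\ uniq P.2, forall t, P.1 t \in P.2 &
  forall y, measurable (cell P y)].

Definition piece P f y : L2 h := restr (cell P y) f.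

Lemma piece_partial P f (s : seq G) : valid P -> uniq s ->
  measurable ([set t | P.1 t \in s] : set (borel G)) /\
  \sum_(y <- s) piece P f y = restr ([set t | P.1 t \in s] : set (borel G)) f.
Proof.
move=> [_ _ mP]; elim: s => [_|y s IH /= /andP[ys us]].
  have -> : [set t | P.1 t \in [::]] = set0 by apply/seteqP; split.
  by rewrite big_nil restr0; split => //; exact: measurable0.
have [ms Es] := IH us.
have -> : [set t | P.1 t \in y :: s] = cell P y `|` [set t | P.1 t \in s].
  apply/seteqP; split => t; rewrite /= inE.
    by case/orP => [/eqP|]; [left|right].
  by case=> [/= <-|/= ->]; rewrite ?eqxx ?orbT.
split; first exact: measurableU.
rewrite big_cons Es restrU//; apply/seteqP; split => // t [ty h1].
by have e1 : P.1 t = y := ty; move: ys; rewrite -e1 h1.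
Qed.

Lemma piece_sum P f : valid P -> \sum_(y <- P.2) piece P f y = f.
Proof.
move=> vP; have [uP sP _] := vP; have [_ ->] := piece_partial f vP uP.
have -> : [set t | P.1 t \in P.2] = setT by apply/seteqP; split => // t _; exact: sP.
exact: restrT.
Qed.

Lemma piece_orth P f g y y' : valid P -> y != y' ->
  L2_dot (piece P f y) (piece P g y') = 0.
Proof.
move=> [_ _ mP] yy'; rewrite /piece restr_dot restrI//.
have -> : cell P y `&` cell P y' = set0.
  apply/seteqP; split => // t [ty ty']; have e1 : P.1 t = y := ty.
  by have e2 : P.1 t = y' := ty'; move: yy'; rewrite -e1 e2 eqxx.
by rewrite restr0 L2_dot0r.
Qed.

Lemma piece_norm P f y : valid P ->
  L2_dot (piece P f y) (piece P f y) = L2_dot (piece P f y) f.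
Proof. by move=> [_ _ mP]; rewrite /piece [LHS]L2_dotC restr_dot restrI// setIid -L2_dotC. Qed.

Lemma piece_sum_norm P f : valid P ->
  \sum_(y <- P.2) L2_dot (piece P f y) (piece P f y) = L2_dot f f.
Proof.
move=> vP; rewrite (eq_bigr (fun y => L2_dot (piece P f y) f)) => [|y _]; last exact: piece_norm.
by rewrite -(psd_suml (psd_L2_dot h)) piece_sum.
Qed.

Lemma piece_linear P y : linear (piece P ^~ y).
Proof. exact: restr_linear. Qed.

Section joint.
Variables (P Q : partition).
Hypotheses (vP : valid P) (vQ : valid Q).

Lemma joint_norm f :
  \sum_(y <- P.2) \sum_(z <- Q.2) rdot (piece P (piece Q f z) y) (piece P (piece Q f z) y)
  = rdot f f.
Proof.
rewrite exchange_big /=.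
have E S g : valid S -> \sum_(y <- S.2) rdot (piece S g y) (piece S g y) = rdot g g.
  by move=> vS; rewrite /rdot -(piece_sum_norm g vS) raddf_sum.
by rewrite (eq_bigr (fun z => rdot (piece Q f z) (piece Q f z))) => [|z _]; rewrite E.
Qed.

(* The common refinement of P and Q turns the double sum into a sum over orthogonal pieces,
   so no factor depending on the number of cells appears. *)
Lemma joint_bound (K : set (borel G)) (c : G -> G -> R[i]) (e : R) f g : measurable K ->
  restr K f = f -> 0 <= e ->
  (forall t, K t -> sqmod (c (P.1 t) (Q.1 t)) <= e ^+ 2) ->
  `|complex.Re (\sum_(y <- P.2) \sum_(z <- Q.2) c y z * L2_dot (piece P f y) (piece Q g z))|
  <= e / 2 * (rdot f f + rdot g g).
Proof.
move=> mK Kf e0 hc; have [_ _ mP] := vP; have [_ _ mQ] := vQ.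
have comm u y z : piece P (piece Q u z) y = piece Q (piece P u y) z.
  by rewrite /piece !restrI// setIC.
have E y z : L2_dot (piece P f y) (piece Q g z) =
    L2_dot (piece P (piece Q f z) y) (piece P (piece Q g z) y).
  have mPQ := measurableI _ _ (mP y) (mQ z).
  rewrite /piece !restr_dot !restrI//; last exact: measurableI.
  by congr (L2_dot _ (restr _ _)); apply/seteqP; split => t; rewrite /setI /=; tauto.
rewrite raddf_sum; apply: le_trans (ler_norm_sum _ _ _) _.
rewrite -(joint_norm f) -(joint_norm g) -big_split mulr_sumr; apply: ler_sum => y _ /=.
rewrite raddf_sum; apply: le_trans (ler_norm_sum _ _ _) _.
rewrite -big_split mulr_sumr; apply: ler_sum => z _ /=.
rewrite E.
have [[t [Kt <- <-]]|nt] := pselect (exists t, [/\ K t, P.1 t = y & Q.1 t = z]).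
  by apply: abs_Re_mul_le; rewrite ?rdot_ge0 ?L2_dot_cs//; exact: hc.
have -> : piece P (piece Q f z) y = 0.
  rewrite -Kf /piece !restrI//; last exact: measurableI.
  rewrite (_ : _ `&` _ = set0) ?restr0//; apply/seteqP; split => // t ht.
  by case: nt; exists t; move: ht; rewrite /setI /cell /= => ht; split; tauto.
rewrite L2_dot0l mulr0 /= normr0; apply: mulr_ge0; first exact: divr_ge0.
by rewrite addr_ge0 ?rdot_ge0.
Qed.

End joint.
End partitions.

Section fine_partitions.
Context (R : realType) (G : topologicalGroupType).
Hypothesis HG : hausdorff_space G.
Implicit Types (x y z t : G) (A U W K L : set G) (P : partition G).

Definition subordinate K W : set (partition G) :=
  [set P | valid P /\ forall t, K t -> W (P.1 t * t^-1)%g].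

Lemma fine_exists K W : compact K -> nbhs (1 : G)%g W -> exists P, subordinate K W P.
Proof.
move=> cK; rewrite nbhsE => -[W0 [oW0 W01] W0W].
pose O y : set G := [set t | W0 (y * t^-1)%g].
have oO y : open (O y).
  rewrite openE => t /= Ot; have n0 : nbhs (y * t^-1)%g W0 by exact: open_nbhs_nbhs.
  by have := inv_nbhs (lmul_nbhs n0).
have [t Kt|s hs] := @compact_subcover G K O cK.
  by apply: open_nbhs_nbhs; split => //; rewrite /O /= mulgV.
(* Each point goes to the first center whose set contains it; points that are not covered go to the
   default 1, which is why 1 is added to the list of values. *)
pose sg (s : seq G) t := nth (1 : G)%g s (find (fun y => t \in O y) s).
pose r := undup (1%g :: s).
exists (sg s, r); split; last first.
  move=> t Kt; apply: W0W.
  have ht : has (fun y => t \in O y) s.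
    by have [y ys Oy] := hs t Kt; apply/hasP; exists y => //; rewrite inE.
  by have := nth_find (1 : G)%g ht; rewrite inE.
split; first exact: undup_uniq.
  move=> t; rewrite mem_undup inE /= /sg.
  have [lt|ge] := ltnP (find (fun y => t \in O y) s) (size s).
    by rewrite mem_nth ?orbT.
  by rewrite nth_default// eqxx.
move=> y; rewrite /cell /=; elim: s {hs r} => [|z s IH].
  have [->|y1] := eqVneq y 1%g.
    by have -> : [set t : borel G | sg [::] t = 1%g] = setT by apply/seteqP; split.
  have -> : [set t : borel G | sg [::] t = y] = set0.
    by apply/seteqP; split => // t /= /esym/eqP; rewrite (negbTE y1).
  exact: measurable0.
have mO : measurable (O z : set (borel G)) by exact: measurable_open.
have -> : [set t : borel G | sg (z :: s) t = y] =
    ((O z : set (borel G)) `&` [set _ : borel G | z = y]) `|` (~` (O z : set (borel G)) `&` [set t : borel G | sg s t = y]).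
  apply/seteqP; split => t; rewrite /setU /setI /setC /= /sg /=.
    case: (boolP (t \in O z)) => [|/negP]; rewrite inE => Ot /= E; [left|right]; split => //.
  case=> -[Ot E]; case: (boolP (t \in O z)) => [|/negP]; rewrite inE => Ot' //=.
apply: measurableU; last by apply: measurableI => //; exact: measurableC.
have [zy|zy] := eqVneq z y; first rewrite zy in mO *.
  have -> : [set _ : borel G | y = y] = setT by apply/seteqP; split => t.
  by rewrite setIT.
have -> : [set _ : borel G | z = y] = set0.
  by apply/seteqP; split => // t /= /eqP; rewrite (negbTE zy).
by rewrite setI0; exact: measurable0.
Qed.

Lemma fineS K L W U : K `<=` L -> W `<=` U -> subordinate L W `<=` subordinate K U.
Proof. by move=> KL WU P [vP hP]; split => // t Kt; apply/WU/hP/KL. Qed.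

Lemma fine_ultrafilter : exists2 F : set_system (partition G), UltraFilter F &
  forall K W, compact K -> nbhs (1 : G)%g W -> F (subordinate K W).
Proof.
pose F0 : set_system (partition G) := [set A | exists K W,
  [/\ compact K, nbhs (1 : G)%g W & subordinate K W `<=` A]].
have FF0 : ProperFilter F0.
  split.
    by move=> [K [W [cK W1 KW]]]; have [P /KW] := fine_exists cK W1.
  split.
  - by exists set0, setT; split=> //; [exact: compact0|exact: filterT].
  - move=> A B [K [W [cK W1 KW]]] [L [U [cL U1 LU]]].
    exists (K `|` L), (W `&` U); split; [exact: compactU|exact: filterI|].
    move=> P hP; split.
      by apply/KW; apply: fineS hP; [exact: subsetUl|exact: subIsetl].
    by apply/LU; apply: fineS hP; [exact: subsetUr|exact: subIsetr].
  - by move=> A B AB [K [W [cK W1 KW]]]; exists K, W; split => //; exact: subset_trans KW AB.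
have [F [FU F0F]] := ultraFilterLemma FF0.
by exists F => // K W cK W1; apply: F0F; exists K, W; split.
Qed.

End fine_partitions.

Section partition_forms.
Context (R : realType) (G : topologicalGroupType) (h : haarMeasure R G).
Variable u : VN h -> R[i].
Hypothesis pu : pnormal u.
Implicit Types (x y z t : G) (A U W K L : set G) (P : partition G) (f g : L2 h) (S T : VN h).

Let B S T := u (VN_mul (VN_adj T) S).
Let pB : psd B := pm_psd pu.1.

Definition phi x := u (VN_lreg h x).
Definition mass := complex.Re (u (VN_one h)).

Lemma mass_ge0 : 0 <= mass. Proof. exact: (pm1_ge0 pu.1). Qed.

Lemma phi1 : phi 1%g = mass%:C.
Proof.
rewrite /phi VN_lreg_one /mass; have := posf_ge0 pu.1 (@VN_ge0_1 R G h).
by rewrite lecE => /andP[/eqP E _]; apply/eqcP.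
Qed.

Lemma B_lreg y z : B (VN_lreg h y^-1%g) (VN_lreg h z^-1%g) = phi (z * y^-1)%g.
Proof. by rewrite /B VN_adj_lreg VN_mul_lreg invgK. Qed.

Definition slices P f : seq (VN h * L2 h) :=
  [seq (VN_lreg h y^-1%g, piece P f y) | y <- P.2].

(** On pairs of translations the form [B] is a value of [phi], so the compression of 1 (x) S becomes
    an explicit finite sum. *)
Definition qform P S f g : R[i] :=
  \sum_(y <- P.2) \sum_(z <- P.2) phi (z * y^-1)%g * L2_dot (S (piece P f y)) (piece P g z).

Lemma qformE P S f g : qform P S f g = fform B (fmap_op S (slices P f)) (slices P g).
Proof.
rewrite /qform /fform /fsum_form big_map big_map; apply: eq_bigr => y _.
by rewrite big_map; apply: eq_bigr => z _; rewrite B_lreg.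
Qed.

Lemma slices_dot P P' f g : fform B (slices P f) (slices P' g) =
  \sum_(y <- P.2) \sum_(z <- P'.2) phi (z * y^-1)%g * L2_dot (piece P f y) (piece P' g z).
Proof.
rewrite /fform /fsum_form big_map; apply: eq_bigr => y _.
by rewrite big_map; apply: eq_bigr => z _; rewrite B_lreg.
Qed.

(** Distinct pieces are orthogonal, so only the diagonal values [phi 1] contribute. The bounds on
    [qform] are therefore independent of the partition, as the passage to the limit requires. *)
Lemma slices_norm P f : valid P ->
  complex.Re (fform B (slices P f) (slices P f)) = mass * rdot f f.
Proof.
move=> vP; have [uP _ _] := vP.
rewrite /fform /slices (@fsum_diag _ _ _ _ _ G)//; last first.
  by move=> y z _ _; exact: piece_orth.
rewrite (eq_bigr (fun y => mass%:C * L2_dot (piece P f y) (piece P f y))); last first.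
  by move=> y _; rewrite B_lreg mulgV phi1.
by rewrite -mulr_sumr piece_sum_norm// ReM ReC ImC mul0r subr0.
Qed.

Lemma qform_good P C S : valid P -> op_le C S ->
  good_form (C * mass ^+ 2) (qform P S).
Proof.
move=> vP hS; split.
- move=> a f g k; rewrite /qform mulr_sumr -big_split; apply: eq_bigr => y _ /=.
  rewrite mulr_sumr -big_split; apply: eq_bigr => z _ /=.
  by rewrite piece_linear VN_linear L2_dot_linl; ring.
- move=> a f g k; rewrite /qform mulr_sumr -big_split; apply: eq_bigr => y _ /=.
  rewrite mulr_sumr -big_split; apply: eq_bigr => z _ /=.
  by rewrite piece_linear L2_dotDr L2_dotZr; ring.
move=> f g; rewrite qformE; apply: le_trans (fform_op_bound pB _ _ hS) _.
rewrite !slices_norm//; move: (rdot f f) (rdot g g) => a b.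
by rewrite le_eqVlt; apply/orP; left; apply/eqP; ring.
Qed.

Lemma qform_linS P a S T f g : qform P (a *: S + T) f g = a * qform P S f g + qform P T f g.
Proof.
rewrite /qform mulr_sumr -big_split; apply: eq_bigr => y _; cbv beta.
rewrite mulr_sumr -big_split; apply: eq_bigr => z _; cbv beta.
by rewrite VN_addE VN_scaleE L2_dot_linl mulrDr mulrCA.
Qed.

Lemma qform_ge0 P S f : VN_ge0 S -> 0 <= qform P S f f.
Proof.
move=> /ge0_psd pS; have := schur_psd pB pS (slices P f).
by rewrite qformE /fform /fsum_form [in X in _ -> _ <= X]big_map.
Qed.

(** Kadison's inequality in weak form. In the limit it becomes [U_sq], which supplies the domination
    demanded by [normal_unique]. *)
Lemma qform_sq P S f g : valid P -> complex.Re (qform P S f g) ^+ 2 <=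
  complex.Re (qform P (VN_mul (VN_adj S) S) f f) * (mass * rdot g g).
Proof.
move=> vP; rewrite qformE; apply: le_trans (fsum_cs pB (psd_L2_dot h) _ _) _.
rewrite -/(fform B (slices P g) (slices P g)) slices_norm//.
rewrite (_ : fsum_form _ _ _ _ = qform P (VN_mul (VN_adj S) S) f f)//.
rewrite /fsum_form big_map big_map; apply: eq_bigr => y _.
rewrite big_map big_map; apply: eq_bigr => z _.
by rewrite B_lreg VN_mulE VN_adjP'.
Qed.

Section comparison.
Variables (P P' : partition G) (K : set (borel G)) (e : R).
Hypotheses (vP : valid P) (vP' : valid P') (mK : measurable K) (e0 : 0 <= e).
Hypothesis close : forall t, K t ->
  sqmod (phi (P'.1 t * (P.1 t)^-1)%g - phi 1%g) <= e ^+ 2.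

Lemma slices_close f : restr K f = f ->
  `|complex.Re (fform B (slices P f) (slices P' f)) - mass * rdot f f| <= e * rdot f f.
Proof.
move=> Kf; have := joint_bound (c := fun y z => phi (z * y^-1)%g - phi 1%g) vP vP' f mK Kf e0 close.
rewrite (_ : complex.Re _ = complex.Re (fform B (slices P f) (slices P' f)) - mass * rdot f f).
  by move/le_trans; apply; move: (rdot f f) => a; lra.
rewrite slices_dot.
have E : L2_dot f f = \sum_(y <- P.2) \sum_(z <- P'.2) L2_dot (piece P f y) (piece P' f z).
  rewrite -{1}(piece_sum f vP) (psd_suml (psd_L2_dot h)); apply: eq_bigr => y _.
  by rewrite -{2}(piece_sum f vP') (psd_sumr (psd_L2_dot h)).
have -> : mass * rdot f f = complex.Re (phi 1%g * L2_dot f f).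
  by rewrite phi1 ReM ReC ImC mul0r subr0.
rewrite -ReN -ReD E mulr_sumr -sumrB; congr complex.Re; apply: eq_bigr => y _.
by rewrite mulr_sumr -sumrB; apply: eq_bigr => z _; rewrite mulrBl.
Qed.

(** Closeness of the two partitions makes the difference [d] of the slice vectors short, of squared
    norm at most 2e|f|^2, and the forms differ by two terms that each contain [d] once. The 8 is
    this 2 times the 4 from squaring a sum of two terms. *)
Lemma qform_close C S f : 0 <= C -> op_le C S -> restr K f = f ->
  (complex.Re (qform P S f f) - complex.Re (qform P' S f f)) ^+ 2 <=
  8 * C * mass * e * rdot f f ^+ 2.
Proof.
move=> C0 hS Kf; have := slices_close Kf; rewrite !qformE.
set s := slices P f; set s' := slices P' f.
pose d := s ++ fscale (-1) s'.
have mapd : fmap_op S d = fmap_op S s ++ fscale (-1) (fmap_op S s').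
  by rewrite /fmap_op /d map_cat /fscale -!map_comp.
have pL := psd_L2_dot h.
have nd : complex.Re (fform B d d) <= 2 * (mass * rdot f f - complex.Re (fform B s s')).
  rewrite /fform /d !(fsum_catl, fsum_catr, fsum_scalel _ pB, fsum_scaler _ pB).
  rewrite (fsum_herm pB pL s s') -/(fform B s s) -/(fform B s s') -/(fform B s' s').
  rewrite !rmorphN1 !mulN1r !(ReD, ReN) ReJ.
  have -> : complex.Re (fform B s s) = mass * rdot f f by exact: slices_norm.
  have -> : complex.Re (fform B s' s') = mass * rdot f f by exact: slices_norm.
  move: (mass * _) (complex.Re _) => a b; lra.
have -> : complex.Re (fform B (fmap_op S s) s) - complex.Re (fform B (fmap_op S s') s') =
    complex.Re (fform B (fmap_op S d) s) + complex.Re (fform B (fmap_op S s') d).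
  rewrite mapd /fform /d fsum_catl fsum_catr (fsum_scalel _ pB) (fsum_scaler _ pB).
  rewrite rmorphN1 !mulN1r !(ReD, ReN).
  by move: (complex.Re _) (complex.Re _) (complex.Re _) => a b k; ring.
move=> hss; have nd2 : complex.Re (fform B d d) <= 2 * (e * rdot f f).
  apply: le_trans nd _; rewrite ler_pM2l//; move: hss; rewrite ler_norml => /andP[+ _].
  by move: (mass * _) (complex.Re _) (e * _) => a b k; lra.
have M0 : 0 <= mass * rdot f f by rewrite mulr_ge0 ?mass_ge0 ?rdot_ge0.
have := fform_op_bound pB d s hS; have := fform_op_bound pB s' d hS.
have -> : complex.Re (fform B s s) = mass * rdot f f by exact: slices_norm.
have -> : complex.Re (fform B s' s') = mass * rdot f f by exact: slices_norm.
have h1 : C * (mass * rdot f f * complex.Re (fform B d d)) <=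
    C * (mass * rdot f f * (2 * (e * rdot f f))).
  by apply: ler_wpM2l => //; exact: ler_wpM2l.
move=> ha hb; have {}ha := le_trans ha h1; move: hb; rewrite (mulrC _ (mass * _)) => hb.
have {}hb := le_trans hb h1; apply: le_trans (_ : 4 * (C * (mass * rdot f f * (2 * (e * rdot f f)))) <= _).
  move: (complex.Re _) (complex.Re _) (C * (_ * _)) ha hb => a b k ha hb.
  have := sqr_ge0 (a - b); nra.
by move: (rdot f f) => a; rewrite le_eqVlt; apply/orP; left; apply/eqP; ring.
Qed.

End comparison.
End partition_forms.

(** * Stability of normality, and continuity of the coefficient function *)

Section normality.
Context (R : realType) (G : topologicalGroupType) (h : haarMeasure R G).
Implicit Types (f g : L2 h) (S T : VN h) (m n : VN h -> R[i]).

(** A directed set of positive operators with a supremum is norm bounded, so approximation that is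
    uniform on balls preserves normality. *)
Lemma pnormal_approx m : posf m ->
  (forall e C : R, 0 < e -> 0 <= C -> exists2 n, pnormal n & forall T, op_le C T ->
     `|complex.Re (m T) - complex.Re (n T)| <= e) -> pnormal m.
Proof.
move=> pm happ; split => // D S D0 dD sS z hz; apply/ler_addgt0Pr => e e0.
have [[S0 DS0] _] := dD.
have Sge0 : VN_ge0 S by apply: (VN_ge0_le (D0 _ DS0)); apply/VN_leE; exact: sS.1.
have [c c0 hc] := VN_le_scal Sge0.
have hC := VN_le_op (ltW c0) Sge0 hc.
have [||n [pn nn] hn] := happ (e / 2) (c ^+ 2); [by rewrite divr_gt0|exact: sqr_ge0|].
have hD S' : D S' -> op_le (c ^+ 2) S'.
  move=> DS'; apply: (VN_le_op (ltW c0) (D0 _ DS')); apply: VN_le_trans hc.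
  by apply/VN_leE; exact: sS.1.
have hnS : complex.Re (n S) <= z + e / 2.
  apply: (nn D S D0 dD sS) => S' DS'; have := hn _ (hD _ DS'); have := hz _ DS'.
  move: (complex.Re _) (complex.Re _) => a b hb; rewrite ler_norml => /andP[? ?]; lra.
have := hn _ hC; move: hnS; move: (complex.Re (n S)) (complex.Re _) => a b ha.
rewrite ler_norml => /andP[? ?]; lra.
Qed.

Lemma pnormal_le m n : posf m -> pnormal n ->
  (forall S, VN_ge0 S -> complex.Re (m S) <= complex.Re (n S)) -> pnormal m.
Proof.
move=> pm [pn nn] mn; split => // D S D0 dD sS z hz.
suff : complex.Re (n S) <= complex.Re (n S) - (complex.Re (m S) - z).
  by move: (complex.Re _) (complex.Re _) => a b; lra.
apply: (nn D S D0 dD sS) => S' DS'.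
have := mn _ (sS.1 _ DS'); rewrite (pmB pm) (pmB pn) !ReD !ReN; have := hz _ DS'.
move: (complex.Re (m S)) (complex.Re (m S')) (complex.Re (n S)) (complex.Re (n S')) => a b c d.
by lra.
Qed.

(** Positivity of the form at the difference of the head and the tail removes the cross terms at the
    cost of a factor 2; what is left is a finite sum of vector functionals. *)
Lemma fsum_dominated (B : VN h -> VN h -> R[i]) (pB : psd B) (s : seq (VN h * L2 h)) :
  exists2 n, pnormal n & forall S, VN_ge0 S ->
    complex.Re (fsum_form B (fun f g => L2_dot (S f) g) s s) <= complex.Re (n S).
Proof.
elim: s => [|p s [n pn hn]].
  by exists (fun=> 0); [exact: pnormal0|move=> S _; rewrite /fsum_form big_nil].
pose b := complex.Re (B p.1 p.1); have b0 : 0 <= b by exact: psd_re_ge0.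
pose w := (Num.sqrt (2 * b))%:C *: p.2.
exists (fun S => vecf w S + (n S + n S)).
  by apply: pnormalD; [exact: pnormal_vecf|exact: pnormalD].
move=> S S0; have pS := (ge0_psd S).1 S0; have := hn S S0.
set BS := fun f g => L2_dot (S f) g.
have := fsum_re_ge0 pB pS ([:: p] ++ fscale (-1) s).
rewrite -[p :: s]/([:: p] ++ s) !(fsum_catl, fsum_catr) !(fsum_scalel _ pB, fsum_scaler _ pB).
rewrite (fsum_herm pB pS [:: p] s) !rmorphN1 !mulN1r !(ReD, ReN) ReJ.
have -> : complex.Re (fsum_form B BS [:: p] [:: p]) = b * rdot (S p.2) p.2.
  rewrite /fsum_form !big_cons !big_nil !addr0 (psd_real pB) ReM ReC ImC mul0r subr0.
  by [].
have -> : complex.Re (vecf w S) = 2 * (b * rdot (S p.2) p.2).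
  rewrite /vecf -/(rdot _ _) /w (lin_opZ (@VN_linear _ _ _ S)) rdotZl rdotZr mulrA.
  by rewrite -expr2 sqr_sqrtr ?mulr_ge0// mulrA.
rewrite -/BS.
move: (b * _) (complex.Re (fsum_form _ _ s s)) (complex.Re (n S)) (complex.Re _) => a c d e.
by lra.
Qed.

End normality.

Lemma psd_sub (R : realType) (V : lmodType R[i]) (B : V -> V -> R[i]) (pB : psd B) a b :
  complex.Re (B (a - b) (a - b)) =
  complex.Re (B a a) + complex.Re (B b b) - 2 * complex.Re (B a b).
Proof.
rewrite (psd_Dl pB) (psd_Nl pB) !(psd_Dr pB) !(psd_Nr pB) (psd_herm pB a b).
by rewrite !(ReD, ReN) ReJ; move: (complex.Re _) (complex.Re _) (complex.Re _) => x y z; ring.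
Qed.

Lemma psd_sub_le (R : realType) (V : lmodType R[i]) (B : V -> V -> R[i]) (pB : psd B) a b :
  complex.Re (B (a - b) (a - b)) <= 2 * (complex.Re (B a a) + complex.Re (B b b)).
Proof.
have := psd_re_ge0 pB (a + b); rewrite psd_sub//.
rewrite (psd_Dl pB) !(psd_Dr pB) (psd_herm pB a b) !ReD ReJ.
by move: (complex.Re _) (complex.Re _) (complex.Re _) => x y z; lra.
Qed.

Section phi_continuity.
Context (R : realType) (G : topologicalGroupType) (h : haarMeasure R G).
Hypothesis HG : hausdorff_space G.
Variable u : VN h -> R[i].
Hypothesis pu : pnormal u.
Implicit Types (x y : G) (U W : set G).

Lemma VN_sq_lreg x y : VN_mul (VN_adj (VN_lreg h y)) (VN_lreg h x) = VN_lreg h (y^-1 * x)%g.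
Proof. by rewrite VN_adj_lreg VN_mul_lreg. Qed.

Lemma phi_le_mass x : complex.Re (phi u x) <= mass u.
Proof.
have := psd_re_ge0 (pm_psd pu.1) (VN_lreg h x - VN_lreg h 1%g).
rewrite (psd_sub (pm_psd pu.1)) !VN_sq_lreg !mulVg invg1 mul1g VN_lreg_one.
by rewrite -/(phi u x) -/(mass u); move: (mass u) (complex.Re _) => a b; lra.
Qed.

Lemma phi_lipschitz x y : sqmod (phi u y - phi u x) <=
  mass u * (2 * (mass u - complex.Re (phi u (x^-1 * y)%g))).
Proof.
rewrite /phi -(pmB pu.1); apply: le_trans (pm_cs pu.1 _) _.
rewrite -/(mass u); apply: ler_wpM2l; first exact: mass_ge0.
have := psd_sub (pm_psd pu.1) (VN_lreg h y) (VN_lreg h x) => ->.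
rewrite !VN_sq_lreg !mulVg -/(phi u 1%g) -/(phi u (x^-1 * y)%g) phi1// ReC.
by move: (mass u) (complex.Re _) => a b; lra.
Qed.

(** The tail of the series for [u] is controlled by its mass, uniformly in [x], and the finitely
    many other vectors by continuity of translations. A tail of mass below e/8 contributes at most
    e/2, by the factor 4 of [psd_sub_le]. *)
Lemma phi_cont1 (e : R) : 0 < e ->
  \forall x \near (1 : G)%g, mass u - complex.Re (phi u x) < e.
Proof.
move=> e0; have [z sz uz] := pnormal_series pu.
pose part n S : R[i] := \sum_(0 <= k < n) vecf (z k) S.
have [n hn] : exists n, mass u - complex.Re (part n (VN_one h)) < e / 8.
  have cv : (fun n => complex.Re (part n (VN_one h))) @ \oo --> mass u.
    have cz := @sumf_cvg_re _ _ _ z sz (VN_one h).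
    have -> : mass u = limn (series (fun k => rdot (VN_one h (z k)) (z k))) by rewrite /mass uz.
    have -> : (fun n => complex.Re (part n (VN_one h))) = series (fun k => rdot (VN_one h (z k)) (z k)).
      by apply/funext => n; rewrite /part partial_re.
    exact: cz.
  have e8 : 0 < e / 8 by rewrite divr_gt0.
  have lt8 : mass u - e / 8 < mass u by rewrite ltrBlDr ltrDl.
  have [n _ hn] := cvgr_gt (mass u) cv (mass u - e / 8) lt8.
  by exists n; have := hn n (leqnn n) => /=; rewrite ltrBlDr -ltrBlDl.
have pp : posf (fun S => u S - part n S).
  apply: posfB; [exact: pu.1|exact: (pnormal_partial z n).1|].
  move=> S; rewrite /part partial_re uz.
  by apply: sumf_partial_le => //; exact: VN_ge0_sq.
have near_part : \forall x \near (1 : G)%g,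
    \sum_(0 <= k < n) rdot (lreg x (z k) - z k) (lreg x (z k) - z k) < e / 2.
  have {}e0 : 0 < e / 2 by rewrite divr_gt0.
  elim: n (e / 2) e0 {hn pp} => [|n IH] d d0.
    by apply: nearW => x; rewrite big_geq.
  have d2 : 0 < d / 2 by rewrite divr_gt0.
  apply: filterS2 (IH _ d2) (lreg_continuous HG (z n) d2) => x h1 h2.
  rewrite big_nat_recr//=; move: (rdot _ _) (\sum_(_ <= _ < _) _) h1 h2 => a b.
  by lra.
apply: filterS near_part => x hx.
have [c cE] : exists c, c = VN_lreg h x - VN_lreg h 1%g by eexists.
have := psd_sub_le (pm_psd pp) (VN_lreg h x) (VN_lreg h 1%g); rewrite -cE.
have := psd_sub (pm_psd pu.1) (VN_lreg h x) (VN_lreg h 1%g); rewrite -cE.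
have e1 : VN_mul (VN_adj (VN_lreg h x)) (VN_lreg h x) = VN_one h.
  by rewrite VN_sq_lreg mulVg VN_lreg_one.
have e2 : VN_mul (VN_adj (VN_lreg h 1%g)) (VN_lreg h 1%g) = VN_one h.
  by rewrite VN_sq_lreg mulVg VN_lreg_one.
have e3 : VN_mul (VN_adj (VN_lreg h 1%g)) (VN_lreg h x) = VN_lreg h x.
  by rewrite VN_sq_lreg invg1 mul1g.
rewrite e1 e2 e3 => hc; rewrite !ReD !ReN hc {hc e1 e2 e3}.
have -> : complex.Re (part n (VN_mul (VN_adj c) c))
   = \sum_(0 <= k < n) rdot (lreg x (z k) - z k) (lreg x (z k) - z k).
  rewrite /part partial_re seriesEnat; apply: eq_bigr => k _.
  rewrite -[LHS]/(complex.Re (vecf (z k) (VN_mul (VN_adj c) c))) vecf_sq cE.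
  by rewrite VN_addE VN_oppE !VN_lregE lreg1.
rewrite /phi; move: hn hx; rewrite /mass; move: (\sum_(_ <= _ < _) _) (complex.Re (part n _)) (complex.Re (u (VN_one h))) (complex.Re _) => a b k d.
by lra.
Qed.

(** Perturbation on both sides of [x] is the form that occurs when sigma(t) and sigma(x^-1 t) are
    compared with t and x^-1 t. *)
Lemma phi_cont (x : G) (e : R) : 0 < e -> exists2 W, nbhs (1 : G)%g W &
  forall w w', W w -> W w' -> sqmod (phi u (w' * x * w^-1)%g - phi u x) < e.
Proof.
move=> e0; have m1 : 0 < 2 * mass u + 1 by rewrite ltr_wpDl// mulr_ge0// mass_ge0.
have /phi_cont1 /nbhs1_div[W W1 hW] : 0 < e / (2 * mass u + 1) by rewrite divr_gt0.
have W2 : nbhs (1 : G)%g [set w | W (x^-1 * w * x)%g].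
  have n1 : nbhs (x^-1 * 1 * x)%g W by rewrite mulg1 mulVg.
  exact: (lmul_nbhs (rmul_nbhs n1)).
exists (W `&` [set w | W (x^-1 * w * x)%g]); first exact: filterI.
move=> w w' [Ww _] [_ /= Ww']; apply: le_lt_trans (phi_lipschitz _ _) _.
have := hW _ _ Ww' Ww => /=; rewrite ltr_pdivlMr// !mulgA.
have := mass_ge0 pu; have := phi_le_mass (x^-1 * w' * x * w^-1)%g.
move: (mass u) (complex.Re _) => a b; nra.
Qed.

End phi_continuity.

Section multiplication_operator.
Context (R : realType) (G : topologicalGroupType) (h : haarMeasure R G).
Hypothesis HG : hausdorff_space G.
Variable u : VN h -> R[i].
Hypothesis pu : pnormal u.
Variable F : set_system (partition G).
Hypothesis FU : UltraFilter F.
Hypothesis hF : forall K W : set G, compact K -> nbhs (1 : G)%g W -> F (subordinate K W).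
Implicit Types (x y z t : G) (U W K L : set G) (P : partition G) (f g : L2 h) (S T : VN h).

Lemma F_valid : F [set P | valid P].
Proof.
have FF := @ultra_proper _ _ FU.
have := hF (@compact0 G) (@filterT _ _ (nbhs_filter (1 : G)%g)).
by move=> h0; apply: (@filterS _ F _ _ _ _ h0) => P [].
Qed.

Lemma qlim_exists S : exists A : L2 h -> L2 h, linear A /\
  ((forall C : R, 0 <= C -> op_le C S -> op_le (C * mass u ^+ 2) A) /\
   forall f g, (fun P => complex.Re (qform u P S f g)) @ F --> rdot (A f) g).
Proof.
have FF := @ultra_proper _ _ FU.
have step (C : R) : 0 <= C -> op_le C S -> exists A, [/\ linear A, op_le (C * mass u ^+ 2) A &
    forall f g, (fun P => complex.Re (qform u P S f g)) @ F --> rdot (A f) g].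
  move=> C0 hC; apply: (ultra_form FU).
    by rewrite mulr_ge0// sqr_ge0.
  by apply: (@filterS _ F _ _ _ _ F_valid) => P vP; exact: qform_good.
have [C C0 hC] := VN_op_le S; have [A [lA bA cA]] := step C C0 hC.
(* The operator produced from any other bound [D] is the same by uniqueness of limits, so a single
   [A] satisfies all the bounds. *)
exists A; split => //; split => // D D0 hD; have [A' [_ bA' cA']] := step D D0 hD.
move=> f; have -> : A f = A' f; last exact: bA'.
apply: rdot_ext => g; exact: (cvg_unique (@Rhausdorff R) (cA f g) (cA' f g)).
Qed.

Variable U : VN h -> L2 h -> L2 h.
Hypothesis lU : forall S, linear (U S).
Hypothesis bU : forall S (C : R), 0 <= C -> op_le C S -> op_le (C * mass u ^+ 2) (U S).
Hypothesis cU : forall S f g, (fun P => complex.Re (qform u P S f g)) @ F --> rdot (U S f) g.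

Lemma U_bounded S : bounded_operator (U S).
Proof.
apply/bounded_operatorP; split => //; have [C C0 hC] := VN_op_le S.
by exists (C * mass u ^+ 2); [rewrite mulr_ge0// sqr_ge0|exact: bU].
Qed.

Lemma U_linS a S T f : U (a *: S + T) f = a *: U S f + U T f.
Proof.
have FF := @ultra_proper _ _ FU.
apply: rdot_ext => g; rewrite rdotDl.
have -> : rdot (a *: U S f) g = rdot (U S f) (conjc a *: g).
  by rewrite /rdot L2_dotZl L2_dotZr conjcK.
apply: (@cvg_unique _ (@Rhausdorff R) _ _ _ _ (@cU (a *: S + T) f g)).
apply: cvg_trans (cvgD (@cU S f (conjc a *: g)) (@cU T f g)).
apply: near_eq_cvg.
have [C C0 hC] := VN_op_le S.
apply: (@filterS _ F _ _ _ _ F_valid) => P vP; rewrite fctE qform_linS ReD; congr (_ + _).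
by rewrite (gf_Zr _ _ _ (qform_good pu vP hC)) conjcK.
Qed.

Lemma U_ge0 S f : VN_ge0 S -> 0 <= L2_dot (U S f) f.
Proof.
have FF := @ultra_proper _ _ FU.
move=> S0; have q0 P := qform_ge0 pu P f S0.
have c0 : (fun _ : partition G => 0 : R) @ F --> (0 : R) by exact: cvg_cst.
rewrite L2_dotE lecE /=; apply/andP; split; last first.
  apply: (filter_le FU c0 (@cU S f f)).
  by apply: filterE => P; have := q0 P; rewrite lecE => /andP[].
apply/eqP; apply: (@cvg_unique _ (@Rhausdorff R) _ _ _ _ (@cU S f ('i *: f))).
apply: cvg_trans c0.
apply: near_eq_cvg; have [C C0 hC] := VN_op_le S.
apply: (@filterS _ F _ _ _ _ F_valid) => P vP.
rewrite (gf_Zr _ _ _ (qform_good pu vP hC)).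
have := q0 P; case: (qform _ _ _ _ _) => a b; rewrite lecE /= => /andP[/eqP -> _].
by rewrite mulr0 mul0r subr0.
Qed.

Lemma U_sq S f : rdot (U S f) (U S f) <= mass u * rdot (U (VN_mul (VN_adj S) S) f) f.
Proof.
have FF := @ultra_proper _ _ FU.
set g := U S f; have h1 : rdot g g ^+ 2 <= rdot (U (VN_mul (VN_adj S) S) f) f * (mass u * rdot g g).
  have c1 := @cU S f g; have c2 := @cU (VN_mul (VN_adj S) S) f f.
  apply: (filter_le FU (cvgM c1 c1) (cvgM c2 (cvg_cst (mass u * rdot g g)))).
  by apply: (@filterS _ F _ _ _ _ F_valid) => P vP; exact: (qform_sq pu S f g vP).
have := rdot_ge0 g; rewrite le_eqVlt => /orP[/eqP <-|g0].
  by rewrite mulr_ge0 ?mass_ge0//; have := U_ge0 f (VN_ge0_sq S); rewrite lecE => /andP[].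
rewrite -(ler_pM2r g0); apply: le_trans h1 _.
by rewrite mulrA (mulrC (rdot (U _ _) _)).
Qed.

Lemma U_close P' (K : set (borel G)) (e : R) : valid P' -> measurable K -> 0 <= e ->
  F [set P | forall t, K t -> sqmod (phi u (P'.1 t * (P.1 t)^-1)%g - phi u 1%g) <= e ^+ 2] ->
  forall C S f, 0 <= C -> op_le C S -> restr K f = f ->
  (rdot (U S f) f - complex.Re (qform u P' S f f)) ^+ 2 <= 8 * C * mass u * e * rdot f f ^+ 2.
Proof.
have FF := @ultra_proper _ _ FU.
move=> vP' mK e0 hP C S f C0 hC Kf.
set b := complex.Re (qform u P' S f f); set c := leRHS.
have cb : (fun _ : partition G => b) @ F --> b by exact: cvg_cst.
have cc : (fun _ : partition G => c) @ F --> c by exact: cvg_cst.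
have FF' : Filter F by exact: FF.
have c1 := cvgB (FF := FF') (@cU S f f) cb; rewrite expr2.
apply: (filter_le FU (cvgM c1 c1) cc).
have hFP := @filterI _ F FF' _ _ F_valid hP.
apply: (@filterS _ F _ _ _ _ hFP) => P [vP cl].
exact: (qform_close pu vP vP' mK e0 cl C0 hC Kf).
Qed.

Lemma posf_U f : posf (fun S => L2_dot (U S f) f).
Proof.
split=> [a S T|S S0]; last exact: U_ge0.
by rewrite U_linS L2_dot_linl.
Qed.

Lemma pnormal_qform P f : pnormal (fun S => qform u P S f f).
Proof.
have [n pn hn] := fsum_dominated (pm_psd pu.1) (slices P f).
apply: (pnormal_le _ pn).
  split=> [a S T|S S0]; first exact: qform_linS.
  exact: (qform_ge0 pu).
move=> S S0; apply: le_trans (hn S S0).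
by rewrite qformE /fform /fsum_form [in leLHS]big_map; exact: lexx.
Qed.

(** On vectors supported in [K] one fine partition [P'] approximates the limit uniformly on bounded
    sets of operators, and its form is normal, being dominated by finitely many vector
    functionals. *)
Lemma pnormal_U_compact K f : compact K -> restr (K : set (borel G)) f = f ->
  pnormal (fun S => L2_dot (U S f) f).
Proof.
have FF := @ultra_proper _ _ FU.
move=> cK Kf; apply: pnormal_approx; first exact: posf_U.
move=> e C e0 C0; have m0 := mass_ge0 pu.
pose k := 8 * C * mass u * rdot f f ^+ 2.
have k0 : 0 <= k by rewrite /k; apply: mulr_ge0; [apply: mulr_ge0 => //; exact: mulr_ge0|exact: sqr_ge0].
pose d := e ^+ 2 / (k + 1).
have k1 : 0 < k + 1 by rewrite ltr_wpDl.
have d0 : 0 < d by rewrite divr_gt0// exprn_gt0.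
have [W0 W01 hW0] := phi_cont HG pu 1%g (exprn_gt0 2 d0).
have [W W1 hW] := nbhs1_div W01.
have [P' hP'] := fine_exists cK W1; have [vP' fP'] := hP'.
exists (fun S => qform u P' S f f); first exact: pnormal_qform.
move=> T hT.
have hP : F [set P | forall t, K t ->
    sqmod (phi u (P'.1 t * (P.1 t)^-1)%g - phi u 1%g) <= d ^+ 2].
  apply: (@filterS _ F _ _ _ _ (hF cK W1)) => P [vP fP] t Kt.
  have := hW0 1%g (P'.1 t * (P.1 t)^-1)%g (nbhs_singleton W01); rewrite invg1 !mulg1.
  move=> H'; apply/ltW/H'.
  have -> : (P'.1 t * (P.1 t)^-1 = (P'.1 t * t^-1) * (P.1 t * t^-1)^-1)%g.
    by rewrite invgM invgK mulgA mulgVK.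
  by apply: hW; [exact: fP'|exact: fP].
have mK := measurable_compact HG cK.
have H := @U_close P' K d vP' mK (ltW d0) hP C T f C0 hT Kf.
rewrite -[X in `|X|]/(rdot (U T f) f - complex.Re (qform u P' T f f)).
rewrite -(@ler_pXn2r _ 2%N) ?nnegrE//; last exact: ltW.
rewrite real_normK; last exact: num_real.
apply: le_trans H _.
have -> : 8 * C * mass u * d * rdot f f ^+ 2 = k * d by rewrite /k; ring.
rewrite /d mulrA ler_pdivrMr// mulrC.
by apply: ler_wpM2l; [exact: sqr_ge0|rewrite lerDl].
Qed.

End multiplication_operator.

Section multiplication_operator_VN.
Context (R : realType) (G : topologicalGroupType) (h : haarMeasure R G).
Hypothesis HG : hausdorff_space G.
Variable u : VN h -> R[i].
Hypothesis pu : pnormal u.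
Variable F : set_system (partition G).
Hypothesis FU : UltraFilter F.
Hypothesis hF : forall K W : set G, compact K -> nbhs (1 : G)%g W -> F (subordinate K W).
Variable U : VN h -> L2 h -> L2 h.
Hypothesis lU : forall S, linear (U S).
Hypothesis bU : forall (S : VN h) (C : R), 0 <= C -> op_le C S -> op_le (C * mass u ^+ 2) (U S).
Hypothesis cU : forall (S : VN h) (f g : L2 h), (fun P => complex.Re (qform u P S f g)) @ F --> rdot (U S f) g.
Implicit Types (x y z t : G) (W K L : set G) (P : partition G) (f g : L2 h) (S T : VN h).

(** Cutting [f] down to a compact set changes the functional little, uniformly on bounded sets of
    operators. *)
Lemma pnormal_U f : pnormal (fun S => L2_dot (U S f) f).
Proof.
apply: pnormal_approx => [|e C e0 C0]; first exact: (posf_U pu FU hF cU f).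
pose D := C * mass u ^+ 2; have D0 : 0 <= D by rewrite mulr_ge0// sqr_ge0.
pose k := D * rdot f f; have k0 : 0 <= k by rewrite mulr_ge0// rdot_ge0.
have k1 : 0 < k + 1 by rewrite ltr_wpDl.
have d0 : 0 < (e / 2) ^+ 2 / (k + 1) by rewrite divr_gt0// exprn_gt0// divr_gt0.
have [K cK hK] := restr_compact_approx HG f d0.
have mK := measurable_compact HG cK.
move: hK; set v := restr (K : set (borel G)) f; set a := f - v => hK.
have vv : rdot v v <= rdot f f.
  have E : rdot v v = rdot f v by rewrite /rdot /v restr_dot restrI// setIid.
  have := rdot_ge0 (f - v); rewrite !(rdotBl, rdotBr) (rdotC v f) E.
  by move: (rdot f f) (rdot f v) => b c; lra.
exists (fun S => L2_dot (U S v) v).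
  by apply: (pnormal_U_compact HG pu FU hF cU cK); rewrite /v restrI// setIid.
move=> T hT; have hUT := bU C0 hT; rewrite -/D in hUT.
have small b c : rdot b b * rdot c c <= rdot f f * rdot a a -> `|rdot (U T b) c| <= e / 2.
  move=> hbc; have e2 : 0 < e / 2 by rewrite divr_gt0.
  rewrite -(@ler_pXn2r _ 2%N) ?nnegrE//; last exact: ltW.
  rewrite real_normK; last exact: num_real.
  apply: le_trans (op_le_rdot b c hUT) _; apply: le_trans (ler_wpM2l D0 hbc) _.
  rewrite mulrA -/k; move: hK; rewrite ltr_pdivlMr// => hK; apply: ltW; apply: le_lt_trans hK.
  by rewrite mulrC ler_wpM2l ?rdot_ge0// lerDl.
rewrite -[X in `|X|]/(rdot (U T f) f - rdot (U T v) v).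
have -> : rdot (U T f) f - rdot (U T v) v = rdot (U T f) a + rdot (U T a) v.
  rewrite /a (lin_opB (lU T)) rdotBl rdotBr.
  by move: (rdot _ f) (rdot _ v) (rdot _ v) => b c d; ring.
apply: le_trans (ler_normD _ _) _.
have := small f a (lexx _); have := small a v; rewrite mulrC => /(_ _) sv.
have {}sv : `|rdot (U T a) v| <= e / 2.
  by apply: sv; apply: ler_wpM2r => //; exact: rdot_ge0.
by move: (`|rdot (U T f) a|) (`|rdot (U T a) v|) sv => b c; lra.
Qed.

(** Translation by [x] maps the pieces of [P] to those of the translated partition [Q]. Where both
    are fine, sigma_P(t) sigma_Q(t)^-1 is close to [x], and [joint_bound] on the pair replaces every
    coefficient by [phi u x]. *)
Lemma U_lreg_compact x K f g : compact K -> restr (K : set (borel G)) f = f ->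
  rdot (U (VN_lreg h x) f) g = complex.Re (phi u x * L2_dot (lreg x f) g).
Proof.
have FF := @ultra_proper _ _ FU.
move=> cK Kf; have mK := measurable_compact HG cK.
set b := complex.Re (phi u x * _).
have cst (a : R) : (fun _ : partition G => a) @ F --> a by exact: cvg_cst.
apply/eqP; rewrite -subr_eq0 -normr_eq0 eq_le normr_ge0 andbT; apply/ler_addgt0Pr => e e0.
rewrite add0r; pose k := rdot f f + rdot g g.
have k0 : 0 <= k by rewrite addr_ge0// rdot_ge0.
have k1 : 0 < k + 1 by rewrite ltr_wpDl.
pose d := e / (k + 1); have d0 : 0 < d by rewrite divr_gt0.
have [W W1 hW] := phi_cont HG pu x (exprn_gt0 2 d0).
have cxK := @compact_lset G x K cK.
have hev : F [set P | `|complex.Re (qform u P (VN_lreg h x) f g) - b| <= e].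
  apply: (@filterS _ F _ _ _ _ (hF (compactU cK cxK) W1)) => P [vP fP].
  have [uP sP mP] := vP.
  pose Q : partition G := (fun t => P.1 (x^-1 * t)%g, P.2).
  have cellQ y : lset x (cell P y) = cell Q y by rewrite lset_preimage.
  have vQ : valid Q.
    by split => // [t|y]; [exact: sP|rewrite -cellQ; exact: measurable_lset].
  have pieceQ y : lreg x (piece P f y) = piece Q (lreg x f) y.
    by rewrite /piece lreg_restr// cellQ.
  have mxK := measurable_lset x mK.
  have xKf : restr (lset x K) (lreg x f) = lreg x f by rewrite -lreg_restr// Kf.
  have cond t : lset x K t -> sqmod (phi u (P.1 t * (Q.1 t)^-1)%g - phi u x) <= d ^+ 2.
    move=> xKt; apply/ltW; have Kt : K (x^-1 * t)%g by move: xKt; rewrite lset_preimage.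
    have -> : (P.1 t * (Q.1 t)^-1 = (P.1 t * t^-1) * x * (P.1 (x^-1 * t) * (x^-1 * t)^-1)^-1)%g.
      by rewrite /Q /= invgM invgK !mulgA mulgK mulgVK.
    by apply: hW; apply: fP; [left|right].
  have := joint_bound (c := fun y z => phi u (z * y^-1)%g - phi u x) vQ vP g mxK xKf (ltW d0) cond.
  rewrite (_ : complex.Re _ = complex.Re (qform u P (VN_lreg h x) f g) - b).
    move/le_trans; apply; rewrite lreg_rdot -/k /d.
    rewrite (_ : e / (k + 1) / 2 * k = e * (k / (2 * (k + 1)))); last first.
      by field; rewrite ?gt_eqF//.
    apply: ler_piMr; first exact: ltW.
    rewrite ler_pdivrMr ?mulr_gt0//; lra.
  have E : L2_dot (lreg x f) g = \sum_(y <- P.2) \sum_(z <- P.2) L2_dot (piece Q (lreg x f) y) (piece P g z).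
    rewrite -{1}(piece_sum (lreg x f) vQ) (psd_suml (psd_L2_dot h)); apply: eq_bigr => y _.
    by rewrite -{1}(piece_sum g vP) (psd_sumr (psd_L2_dot h)).
  rewrite /b E /qform -ReN -ReD mulr_sumr -sumrB; congr complex.Re; apply: eq_bigr => y _.
  by rewrite mulr_sumr -sumrB; apply: eq_bigr => z _; rewrite mulrBl VN_lregE pieceQ.
rewrite ler_norml lerBrDr lerBlDr; apply/andP; split.
  apply: (filter_le FU (cst (- e + b)) (@cU (VN_lreg h x) f g)).
  apply: (@filterS _ F _ _ _ _ hev) => P /=; rewrite ler_norml => /andP[+ _].
  by rewrite lerBrDr.
apply: (filter_le FU (@cU (VN_lreg h x) f g) (cst (e + b))).
apply: (@filterS _ F _ _ _ _ hev) => P /=; rewrite ler_norml => /andP[_].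
by rewrite lerBlDr.
Qed.

Lemma U_lreg x f : U (VN_lreg h x) f = phi u x *: lreg x f.
Proof.
pose A f := U (VN_lreg h x) f - phi u x *: lreg x f.
have bA : bounded_operator A.
  have b1 : bounded_operator (U (VN_lreg h x)).
    exact: (U_bounded lU bU).
  have := bounded_operator_comb (- phi u x) (@bounded_lreg R G h x) b1.
  rewrite (_ : _ + _ = A)//; apply/funext => g.
  by rewrite /A fctE addrC scaleNr.
have [lA [C C0 hC]] := (bounded_operatorP A).1 bA.
have A0 K g : compact K -> A (restr (K : set (borel G)) g) = 0.
  move=> cK; have mK := measurable_compact HG cK.
  apply: rdot_ext => k; rewrite rdot0l /A rdotBl.
  rewrite (@U_lreg_compact x K _ _ cK); last by rewrite restrI// setIid.
  by rewrite /rdot L2_dotZl subrr.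
apply/eqP; rewrite -subr_eq0; apply/eqP/rdot_eq0; rewrite -/(A f).
apply/eqP; rewrite eq_le rdot_ge0 andbT; apply/ler_addgt0Pr => e e0; rewrite add0r.
have C1 : 0 < C + 1 by rewrite ltr_wpDl.
have [K cK hK] := restr_compact_approx HG f (divr_gt0 e0 C1).
have -> : A f = A (f - restr (K : set (borel G)) f) by rewrite (lin_opB lA) A0// subr0.
apply: le_trans (hC _) _; move: hK; rewrite ltr_pdivlMr//.
have := rdot_ge0 (f - restr (K : set (borel G)) f).
move: (rdot _ _) => a; nra.
Qed.

(** The matrix coefficients of the commutator, as functionals of the operator, vanish on
    translations and are dominated by a normal functional, so [normal_unique] applies. This is what
    places the limit in VN(G). *)
Lemma U_com S (A : L2 h -> L2 h) f : com A -> U S (A f) = A (U S f).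
Proof.
move=> cA; have [bA _] := cA; have [B bB AB] := adjoint_exists bA.
have lA := bop_linear bA.
apply/eqP; rewrite -subr_eq0; apply/eqP; apply: rdot_eq0; set d := _ - _.
pose w T := L2_dot (U T (A f)) d - L2_dot (U T f) (B d).
suff w0 : forall T, w T = 0.
  by have := w0 S; rewrite /w -AB -L2_dotBl -/d /rdot => ->.
(* The vector [d] was defined from [S]; it has to be fixed before the argument of [w] varies. *)
move: d @w => d w.
have pm := pnormalD (pnormal_U (A f)) (pnormal_U f).
have wl a T1 T2 : w (a *: T1 + T2) = a * w T1 + w T2.
  by rewrite /w !(U_linS pu FU hF cU) !L2_dot_linl; ring.
pose K := rdot d d + rdot (B d) (B d).
have K0 : 0 <= K by rewrite addr_ge0 ?rdot_ge0.
have m0 := mass_ge0 pu.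
move=> T0; apply: (normal_unique (C := 2 * mass u * K) pm wl) => [|T|x].
- by rewrite !mulr_ge0.
- apply: le_trans (sqmodB _ _) _.
  have hb g k : sqmod (L2_dot (U T g) k) <= mass u *
      complex.Re (L2_dot (U (VN_mul (VN_adj T) T) g) g) * rdot k k.
    apply: le_trans (L2_dot_cs _ _) _; apply: ler_wpM2r; first exact: rdot_ge0.
    exact: (U_sq pu FU hF cU).
  have := hb (A f) d; have := hb f (B d).
  have p1 g : 0 <= complex.Re (L2_dot (U (VN_mul (VN_adj T) T) g) g).
    by have := U_ge0 pu FU hF cU g (VN_ge0_sq T); rewrite lecE => /andP[].
  have := p1 (A f); have := p1 f; have := rdot_ge0 d; have := rdot_ge0 (B d).
  rewrite ReD /K.
  move: (sqmod _) (sqmod _) (complex.Re _) (complex.Re _) (rdot d d) (rdot _ _) (mass u) m0.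
  move=> s1 s2 r1 r2 k1 k2 m m0 k20 k10 r20 r10 h2 h1.
  have : 0 <= m * r1 * k2 by apply: mulr_ge0 => //; exact: mulr_ge0.
  have : 0 <= m * r2 * k1 by apply: mulr_ge0 => //; exact: mulr_ge0.
  lra.
- by rewrite /w !U_lreg !L2_dotZl -AB (com_lreg x f cA) subrr.
Qed.

End multiplication_operator_VN.

Section fourier_action.
Context (R : realType) (G : topologicalGroupType) (h : haarMeasure R G).
Hypothesis HG : hausdorff_space G.
Implicit Types (x y z t : G) (W K L : set G) (f g : L2 h) (S T : VN h) (u v m : VN h -> R[i]).

(** The properties of T |-> uT used from here on. [mulop_supp] says that the compression of uT to a
    set depends only on that of T, which serves the upper bound; [mulop_close] says that near the
    identity uT acts as a multiple of T, which gives invariance of the limit means in the lower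
    bound. *)
Record is_mulop u (U : VN h -> VN h) : Prop := IsMulop {
  mulop_lin : forall a S T, U (a *: S + T) = a *: U S + U T;
  mulop_ge0 : forall S, VN_ge0 S -> VN_ge0 (U S);
  mulop_lreg : forall x, U (VN_lreg h x) = phi u x *: VN_lreg h x;
  mulop_vec : forall f, pnormal (fun S => vecf f (U S));
  mulop_supp : forall (K : set (borel G)) S f g, measurable K ->
    (forall a b : L2 h, restr K a = a -> restr K b = b -> L2_dot (S a) b = 0) ->
    restr K f = f -> restr K g = g -> L2_dot (U S f) g = 0;
  mulop_close : forall e : R, 0 < e -> exists2 V, nbhs (1 : G)%g V &
    forall (K : set G) (C : R) S f, compact K -> K `<=` V -> 0 <= C -> op_le C S ->
      restr (K : set (borel G)) f = f ->
      (rdot (U S f) f - mass u * rdot (S f) f) ^+ 2 <= 8 * C * mass u * e * rdot f f ^+ 2 }.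

Lemma mulop_exists u : pnormal u -> exists U, is_mulop u U.
Proof.
move=> pu; have [F FU hF] := fine_ultrafilter G.
have [A hA] := choice (qlim_exists pu FU hF).
pose U S f := A S f.
have lU S : linear (U S) by have [] := hA S.
have bU (S : VN h) (C : R) : 0 <= C -> op_le C S -> op_le (C * mass u ^+ 2) (U S).
  by have [_ [hb _]] := hA S; exact: hb.
have cU (S : VN h) f g : (fun P => complex.Re (qform u P S f g)) @ F --> rdot (U S f) g.
  by have [_ [_ hc]] := hA S; exact: hc.
have cVN S : commutant (@com R G h) (U S).
  split; first exact: (U_bounded lU bU).
  move=> B cB; apply/funext => f.
  exact: (U_com HG pu FU hF lU bU cU S f cB).
move: U lU bU cU cVN => U lU bU cU cVN {A hA}.
pose UV S := VN_mk (cVN S).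
have UVE S f : UV S f = U S f by [].
exists UV; split.
- move=> a S T; apply: VN_ext => f; rewrite VN_addE VN_scaleE !UVE.
  exact: (U_linS pu FU hF cU).
- by move=> S S0 f; rewrite UVE; exact: (U_ge0 pu FU hF cU f S0).
- move=> x; apply: VN_ext => f; rewrite UVE VN_scaleE VN_lregE.
  exact: (U_lreg HG pu FU hF lU bU cU).
- by move=> f; exact: (pnormal_U HG pu FU hF lU bU cU f).
- move=> K S f g mK SK Kf Kg.
  have FF := @ultra_proper _ _ FU.
  have c0 : (fun _ : partition G => 0 : R) @ F --> (0 : R) by exact: cvg_cst.
  have r0 k : restr K k = k -> rdot (UV S f) k = 0.
    move=> Kk; apply: (@cvg_unique _ (@Rhausdorff R) _ _ _ _ (@cU S f k)).
    apply: cvg_trans c0; apply: near_eq_cvg.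
    apply: (@filterS _ F _ _ _ _ (F_valid FU hF)) => P [_ _ mP].
    rewrite /qform big1 => [|y _]; first by [].
    rewrite big1 // => z _; rewrite SK ?mulr0//.
      by rewrite /piece -{2}Kf !restrI// setIC.
    by rewrite /piece -{2}Kk !restrI// setIC.
  rewrite L2_dotE r0// r0//.
  by rewrite (lin_opZ (@restr_linear _ _ R h K)) Kg.
move=> e e0; have [W0 W01 hW0] := phi_cont HG pu 1%g (exprn_gt0 2 e0).
have [W1 W11 hW1] := nbhs1_div W01.
exists [set t | W1 (t^-1)%g].
  by apply: inv_nbhs; rewrite invg1.
move=> K C S f cK KV C0 hC Kf; rewrite UVE.
(* The constant map 1 is compared with the limit: on a small set it is close to every fine
   partition, and its form is [mass u] times that of [S]. *)
have vP' : valid ((fun _ : G => 1%g : G, [:: 1%g : G]) : partition G).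
  split => // [t|y]; first by rewrite inE.
  rewrite /cell /=; have [<-|ny] := eqVneq (1%g : G) y.
    have -> : [set _ : borel G | (1%g : G) = 1%g] = setT by apply/seteqP; split => t.
    exact: measurableT.
  have -> : [set _ : borel G | (1%g : G) = y] = set0.
    by apply/seteqP; split => // t /= /eqP; rewrite (negbTE ny).
  exact: measurable0.
have mK := measurable_compact HG cK.
have FF := @ultra_proper _ _ FU.
have hP : F [set P : partition G | forall t, K t -> sqmod (phi u (1%g * (P.1 t)^-1)%g - phi u 1%g) <= e ^+ 2].
  apply: (@filterS _ F _ _ _ _ (hF K W1 cK W11)) => P [vP fP] t Kt.
  have := hW0 1%g (1%g * (P.1 t)^-1)%g (nbhs_singleton W01); rewrite invg1 !mulg1 => H.
  apply/ltW/H; have -> : (1%g * (P.1 t)^-1 = t^-1 * (P.1 t * t^-1)^-1)%g.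
    by rewrite mul1g invgM invgK mulKg.
  by apply: hW1; [exact: KV|exact: fP].
have := @U_close _ _ _ _ pu F FU hF U cU _ K e vP' mK (ltW e0) hP C S f C0 hC Kf.
have -> : complex.Re (qform u (fun _ : G => 1%g : G, [:: 1%g : G]) S f f) = mass u * rdot (S f) f.
  rewrite /qform !big_cons !big_nil !addr0 /= mulgV phi1// ReM ReC ImC mul0r subr0.
  rewrite /piece (_ : cell _ _ = setT) ?restrT//.
  by apply/seteqP; split => t.
by [].
Qed.

Definition mulop u : VN h -> VN h :=
  if pselect (exists U, is_mulop u U) is left e then sval (cid e) else idfun.

Lemma mulopP u : pnormal u -> is_mulop u (mulop u).
Proof.
move=> pu; rewrite /mulop; case: pselect => [e|]; first exact: (svalP (cid e)).
by move=> []; exact: mulop_exists.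
Qed.

Lemma pnormal_ext m1 m2 : pnormal m1 -> pnormal m2 ->
  (forall x, m1 (VN_lreg h x) = m2 (VN_lreg h x)) -> m1 = m2.
Proof.
move=> p1 p2 E; apply/funext => T; apply/eqP; rewrite -subr_eq0; apply/eqP.
pose K := complex.Re (m1 (VN_one h)) + complex.Re (m2 (VN_one h)).
have K0 : 0 <= K by rewrite addr_ge0 ?(pm1_ge0 p1.1) ?(pm1_ge0 p2.1).
apply: (normal_unique (w := fun T => m1 T - m2 T) (C := 2 * K) (pnormalD p1 p2)).
- by move=> a S S'; rewrite (posf_lin p1.1) (posf_lin p2.1); ring.
- exact: mulr_ge0.
- move=> S; apply: le_trans (sqmodB _ _) _; rewrite -mulrA ler_pM2l// ReD /K.
  have := pm_cs p1.1 S; have := pm_cs p2.1 S.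
  have := pm1_ge0 p1.1; have := pm1_ge0 p2.1.
  have := pm_re p1.1 (VN_ge0_sq S); have := pm_re p2.1 (VN_ge0_sq S).
  move: (sqmod _) (sqmod _) (complex.Re (m1 (VN_one h))) (complex.Re (m2 (VN_one h))).
  move=> s1 s2 k1 k2.
  move: (complex.Re _) (complex.Re _) => a b a0 b0 k20 k10 h2 h1.
  have : 0 <= k1 * a by exact: mulr_ge0.
  have : 0 <= k2 * b by exact: mulr_ge0.
  have : 0 <= k1 * b by exact: mulr_ge0.
  have : 0 <= k2 * a by exact: mulr_ge0.
  by lra.
- by move=> x; rewrite E subrr.
Qed.

(* uT increases with T, and its quadratic forms are normal in T, so T |-> uT preserves
   suprema of bounded directed sets. *)
Lemma pnormal_mulop u v : pnormal u -> pnormal v -> pnormal (v \o mulop u).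
Proof.
move=> pu pv; have mu := mulopP pu; split.
  split=> [a S T|S S0] /=; first by rewrite (mulop_lin mu) (posf_lin pv.1).
  by apply: (posf_ge0 pv.1); exact: (mulop_ge0 mu).
move=> D S D0 dD sS z hz /=.
have subU S1 S2 : mulop u (S1 - S2) = mulop u S1 - mulop u S2.
  by rewrite addrC -scaleN1r (mulop_lin mu) scaleN1r addrC.
have le S1 S2 : VN_ge0 (S1 - S2) -> VN_ge0 (mulop u S1 - mulop u S2).
  by move=> /(mulop_ge0 mu); rewrite subU.
apply: (pv.2 (mulop u @` D) (mulop u S)).
- by move=> _ [S' DS' <-]; exact: (mulop_ge0 mu) (D0 _ DS').
- have [[S0 DS0] dir] := dD; split; first by exists (mulop u S0), S0.
  move=> _ _ [S1 DS1 <-] [S2 DS2 <-]; have [S3 DS3 [h1 h2]] := dir _ _ DS1 DS2.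
  by exists (mulop u S3); [exists S3|split; exact: le].
- split=> [_ [S' DS' <-]|T hT]; first by apply: le; exact: sS.1.
  have herm S' : VN_ge0 S' -> forall f, L2_dot (mulop u S' f) f = (rdot (mulop u S' f) f)%:C.
    by move=> S'0 f; exact: (psd_real ((ge0_psd _).1 (mulop_ge0 mu S'0)) f).
  have S0 : VN_ge0 S by exact: (VN_sup_ge0 D0 dD sS).
  have [[S1 DS1] _] := dD.
  have T0 : VN_ge0 T.
    by rewrite -[T](subrK (mulop u S1)); apply: VN_ge0D; [apply: hT; exists S1|exact: (mulop_ge0 mu) (D0 _ DS1)].
  apply/ge0_rdot => f; rewrite VN_addE VN_oppE !rdotBl.
  have := (mulop_vec mu f).2 D S D0 dD sS (rdot (T f) f).
  have imT := (((ge0_rdot _).1 T0) f).2.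
  have imS := (((ge0_rdot _).1 (mulop_ge0 mu S0)) f).2.
  move=> H; rewrite imT imS subrr; split => //; rewrite subr_ge0; apply: H => S' DS'.
  have := (((ge0_rdot _).1 (hT _ (ex_intro2 _ _ S' DS' erefl))) f).1.
  by rewrite VN_addE VN_oppE rdotBl subr_ge0.
- by move=> _ [S' DS' <-]; exact: hz.
Qed.

(** Both sides are normal in [S] and agree on translations, where they multiply by commuting
    scalars. *)
Lemma mulop_comm u v S : pnormal u -> pnormal v -> v (mulop u S) = u (mulop v S).
Proof.
move=> pu pv; have := pnormal_ext (pnormal_mulop pu pv) (pnormal_mulop pv pu).
move=> /(_ _)/(congr1 (@^~ S)); apply => x /=.
rewrite (mulop_lreg (mulopP pu)) (mulop_lreg (mulopP pv)) (pmZ pu.1) (pmZ pv.1).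
by rewrite mulrC.
Qed.

(** The order on complex numbers compares equal imaginary parts only. As [m] is real on positive
    operators, complex upper bounds reduce to real ones. *)
Lemma P1P m : P1 h m <-> pnormal m /\ m (VN_one h) = 1.
Proof.
split=> [[[lm m0 m1] nm]|[[pm om] m1]].
  have pm : posf m by split=> // a S T; exact: lm.
  split => //; split => // D S D0 dD sS z hz.
  have [_ hS] := nm D S D0 dD sS.
  have /hS : forall S', D S' -> m S' <= z%:C.
    by move=> S' DS'; rewrite lecE ImC ReC (pm_im pm (D0 _ DS')) eqxx hz.
  by rewrite lecE ReC => /andP[].
split; first by split => //; [move=> a S T; exact: (posf_lin pm)|exact: (posf_ge0 pm)].
move=> D S D0 dD sS; have S0 : VN_ge0 S by exact: (VN_sup_ge0 D0 dD sS).
split=> [S' DS'|z hz].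
  rewrite lecE (pm_im pm S0) (pm_im pm (D0 _ DS')) eqxx /=.
  by apply: (pm_le pm); apply/VN_leE; exact: sS.1.
have [[S1 DS1] _] := dD.
have Im0 : complex.Im z = 0.
  by have := hz _ DS1; rewrite lecE (pm_im pm (D0 _ DS1)) => /andP[/eqP].
rewrite lecE (pm_im pm S0) Im0 eqxx /=; apply: (om D S D0 dD sS) => S' DS'.
by have := hz _ DS'; rewrite lecE => /andP[].
Qed.

End fourier_action.

(** * The Fourier algebra and invariant means *)

Section fourier_algebra_theory.
Context (R : realType) (G : topologicalGroupType) (h : haarMeasure R G).
Hypothesis HG : hausdorff_space G.
Implicit Types (x y z t : G) (f g : L2 h) (S T : VN h) (u v m w : VN h -> R[i]).

(** A class of functionals closed under linear combinations, hence containing A(G), whose members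
    are determined by their values on translations. *)
Definition dominated w := (forall a S T, w (a *: S + T) = a * w S + w T) /\
  exists m (C : R), [/\ pnormal m, 0 <= C &
    forall S, sqmod (w S) <= C * complex.Re (m (VN_mul (VN_adj S) S))].

Lemma dominated_comb a w v : dominated w -> dominated v -> dominated (fun S => a * w S + v S).
Proof.
move=> [lw [m [C [pm C0 hm]]]] [lv [n [D [pn D0 hn]]]]; split.
  by move=> b S T; rewrite lw lv; ring.
exists (fun S => m S + n S), (2 * (sqmod a * C + D)); split; first exact: pnormalD.
  by rewrite mulr_ge0// addr_ge0// mulr_ge0// sqmod_ge0.
move=> S; have := sqmodB (a * w S) (- v S); rewrite opprK.
have -> : sqmod (- v S) = sqmod (v S) by rewrite /sqmod ReN ImN !sqrrN.
have -> : sqmod (a * w S) = sqmod a * sqmod (w S).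
  by rewrite /sqmod ReM ImM; case: a => a1 a2; case: (w S) => b1 b2 /=; ring.
move/le_trans; apply; rewrite -mulrA ler_pM2l// ReD.
have := hm S; have := hn S; have := pm_re pm.1 (VN_ge0_sq S); have := pm_re pn.1 (VN_ge0_sq S).
have := sqmod_ge0 a.
move: (sqmod a) (sqmod (w S)) (sqmod (v S)) (complex.Re _) (complex.Re _) => k s1 s2 p q k0 q0 p0 h2 h1.
have : 0 <= k * C * q by rewrite !mulr_ge0.
have : 0 <= D * p by exact: mulr_ge0.
have : k * s1 <= k * (C * p) by exact: ler_wpM2l.
by lra.
Qed.

Lemma dominated_P1 m : P1 h m -> dominated m.
Proof.
move=> /P1P[pm m1]; split; first exact: (posf_lin pm.1).
exists m, 1; split => // S; have := pm_cs pm.1 S.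
by rewrite m1.
Qed.

Lemma dominated0 : dominated (fun=> 0).
Proof.
split; first by move=> a S T; rewrite mulr0 addr0.
exists (fun=> 0), 0; split => //; first exact: pnormal0.
by move=> S; rewrite mulr0 /sqmod /= expr0n addr0.
Qed.

Lemma dominated_fourier w : fourier_algebra h w -> dominated w.
Proof.
move=> [n [c [p [hp ->]]]]; elim: n c p hp => [|n IH] c p hp.
  rewrite big_ord0 (_ : 0 = fun=> 0); last by [].
  exact: dominated0.
rewrite big_ord_recl.
have -> : c ord0 *: p ord0 + \sum_(i < n) c (lift ord0 i) *: p (lift ord0 i) =
  (fun S => c ord0 * p ord0 S + (\sum_(i < n) c (lift ord0 i) *: p (lift ord0 i)) S) by [].
apply: dominated_comb; first exact: dominated_P1.
by apply: (IH (fun i => c (lift ord0 i)) (fun i => p (lift ord0 i))) => i; exact: hp.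
Qed.

Lemma fourier_ext w v : fourier_algebra h w -> fourier_algebra h v ->
  (forall x, w (VN_lreg h x) = v (VN_lreg h x)) -> w = v.
Proof.
move=> /dominated_fourier dw /dominated_fourier dv E.
have [l [m [C [pm C0 hm]]]] := dominated_comb (-1) dv dw.
apply/funext => T; apply/eqP; rewrite -subr_eq0 addrC -mulN1r; apply/eqP.
apply: (normal_unique pm l C0 hm) => x.
by rewrite E mulN1r addNr.
Qed.

Lemma fourier_P1 m : P1 h m -> fourier_algebra h m.
Proof.
move=> hm; exists 1%N, (fun=> 1), (fun=> m); split => //.
by rewrite big_ord1 scale1r.
Qed.

Lemma P1_mulop u v : P1 h u -> P1 h v -> P1 h (v \o mulop u).
Proof.
move=> /P1P[pu u1] /P1P[pv v1]; apply/P1P; split; first exact: pnormal_mulop.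
rewrite /= -VN_lreg_one (mulop_lreg (mulopP HG pu)) /phi VN_lreg_one u1 scale1r.
exact: v1.
Qed.

(** The composite lies in A(G), because composing with [mulop u] preserves normal states, and it has
    the right function on G; [fourier_ext] makes it the unique choice. *)
Lemma fourier_mulE u v : P1 h u -> fourier_algebra h v -> fourier_mul u v = v \o mulop u.
Proof.
move=> hu hv; have [pu u1] := (P1P u).1 hu.
have fa : fourier_algebra h (v \o mulop u).
  have [n [c [p [hp ->]]]] := hv.
  exists n, c, (fun i => p i \o mulop u); split => [i|]; first exact: P1_mulop.
  apply/funext => S /=; elim: n c p hp => [|n IH] c p hp; first by rewrite !big_ord0.
  rewrite !big_ord_recl.
  have E (a b : VN h -> R[i]) T : (a + b) T = a T + b T by [].
  by rewrite !E IH// => i; exact: hp.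
have ev x : (v \o mulop u) (VN_lreg h x) = u (VN_lreg h x) * v (VN_lreg h x).
  rewrite /= (mulop_lreg (mulopP HG pu)) -[u _]/(phi u x).
  have [lv _] := dominated_fourier hv.
  have v0 : v 0 = 0.
    by have := lv (-1) 0 0; rewrite scaler0 addr0 mulN1r addNr.
  by have := lv (phi u x) (VN_lreg h x) 0; rewrite !addr0 v0 addr0.
rewrite /fourier_mul; case: xgetP => [w -> [fw hw]|].
  by apply: fourier_ext => // x; rewrite ev; exact: hw.
by move=> /(_ (v \o mulop u)); case; split => // x; exact: ev.
Qed.

Lemma P1_vecf f : rdot f f = 1 -> P1 h (vecf f).
Proof.
move=> f1; apply/P1P; split; first exact: pnormal_vecf.
by rewrite /vecf VN_oneE L2_dotxx -/(rdot f f) f1.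
Qed.

(** Vector states are enough: an operator whose quadratic form vanishes is zero. *)
Lemma P1_separates S T : (forall v, P1 h v -> v S = v T) -> S = T.
Proof.
move=> E; apply/eqP; rewrite -subr_eq0; apply/eqP.
have z f : L2_dot ((S - T) f) f = 0.
  rewrite VN_addE VN_oppE L2_dotBl.
  have [f0|f0] := eqVneq (rdot f f) 0.
    by rewrite (rdot_eq0 f0) !L2_dot0r subrr.
  have fp : 0 < rdot f f by rewrite lt_def f0 rdot_ge0.
  pose k : R := (Num.sqrt (rdot f f))^-1; pose g := k%:C *: f.
  have kk : k ^+ 2 * rdot f f = 1 by rewrite /k exprVn sqr_sqrtr ?mulVf// ltW.
  have := E (vecf g); rewrite /vecf /g !(lin_opZ (@VN_linear _ _ _ _)) !L2_dotZl !L2_dotZr.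
  move=> /(_ _)/eqP; rewrite -subr_eq0 -!mulrBr mulf_eq0 mulf_eq0 conjc_real orbA orbb.
  move=> H; have := H _; case/(_ _)/orP => [|/eqP k0|/eqP//].
    apply: P1_vecf; rewrite rdotZl rdotZr mulrA -expr2; exact: kk.
  have k00 : k ^+ 2 = 0
      by rewrite expr2 (_ : k = 0) ?mul0r//; case: k0.
    by move/eqP: kk; rewrite k00 mul0r eq_sym oner_eq0.
by apply: VN_ge0_eq0 => [f|f]; rewrite ?/rdot z.
Qed.

Lemma fourier_actE u S : P1 h u -> fourier_act u S = mulop u S.
Proof.
move=> hu; rewrite /fourier_act; case: xgetP => [T -> hT|].
  apply: P1_separates => v hv.
  by rewrite (hT v (fourier_P1 hv)) fourier_mulE//; exact: fourier_P1.
by move=> /(_ (mulop u S)); case => v hv; rewrite fourier_mulE.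
Qed.

Lemma TIMP m : TIM h m <-> state m /\ forall u S, P1 h u -> m (mulop u S) = m S.
Proof.
by split=> -[sm hm]; split => // u S hu; have := hm u S hu; rewrite fourier_actE.
Qed.

End fourier_algebra_theory.

(** * Cardinalities *)

Section embeddings.

Definition emb (A B : Type) := exists f : A -> B, injective f.

Lemma emb_refl A : emb A A. Proof. by exists id. Qed.

Lemma emb_trans B A C : emb A B -> emb B C -> emb A C.
Proof. by move=> [f fi] [g gi]; exists (g \o f); exact: inj_comp. Qed.

Lemma emb_prod A B A' B' : emb A A' -> emb B B' -> emb (A * B) (A' * B').
Proof.
move=> [f fi] [g gi]; exists (fun p => (f p.1, g p.2)).
by move=> [a b] [a' b'] [/fi -> /gi ->].
Qed.

Lemma emb_seq A B : emb A B -> emb (seq A) (seq B).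
Proof. by move=> [f fi]; exists (map f); exact: inj_map. Qed.

Lemma emb_set A B : emb A B -> emb (set A) (set B).
Proof.
move=> [f fi]; exists (fun X => f @` X) => X Y E; apply/seteqP; split => a ha.
  have : (f @` X) (f a) by exists a.
  by rewrite E => -[b hb /fi <-].
have : (f @` Y) (f a) by exists a.
by rewrite -E => -[b hb /fi <-].
Qed.

Lemma sval_inj A (P : A -> Prop) : injective (@sval A P).
Proof. by case=> x hx [y hy] /= xy; subst y; congr exist; exact: Prop_irrelevance. Qed.

Lemma emb_sig A (P : A -> Prop) : emb {x | P x} A.
Proof. by exists sval; exact: sval_inj. Qed.

(** Comparability of cardinals: a maximal graph of a partial injection is total on one of the two
    sides. *)
Lemma emb_total A B : emb A B \/ emb B A.
Proof.
pose P : set (set (A * B)) := [set X | (forall a b b', X (a, b) -> X (a, b') -> b = b') /\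
  (forall a a' b, X (a, b) -> X (a', b) -> a = a')].
have [F FP tF|X [[X1 X2] maxX]] := @Zorn_bigcup _ P.
  have two s t : (\bigcup_(X in F) X) s -> (\bigcup_(X in F) X) t ->
      exists X, [/\ F X, X s & X t].
    move=> [X FX Xs] [Y FY Yt]; have [XY|YX] := tF X Y FX FY.
      by exists Y; split => //; exact: XY.
    by exists X; split => //; exact: YX.
  split=> [a b b'|a a' b] h1 h2; have [X [FX Xs Xt]] := two _ _ h1 h2; have [p1 p2] := FP X FX.
    exact: p1 Xs Xt.
  exact: p2 Xs Xt.
have [tot|/existsNP[a0 /forallNP na]] := pselect (forall a, exists b, X (a, b)).
  by left; have [f hf] := choice tot; exists f => a a' E; apply: (X2 _ _ (f a)) => //; rewrite E.
have [sur|/existsNP[b0 /forallNP nb]] := pselect (forall b, exists a, X (a, b)).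
  by right; have [f hf] := choice sur; exists f => b b' E; apply: (X1 (f b)) => //; rewrite E.
exfalso; apply: (maxX (X `|` [set (a0, b0)])).
  split; first by move=> t; left.
  by move=> /(_ (a0, b0)) H; apply: (na b0); apply: H; right.
split.
- move=> a b b' [h|E1] [h'|E2].
  + exact: X1 h h'.
  + by case: E2 => ea _; case: (na b); rewrite -ea.
  + by case: E1 => ea _; case: (na b'); rewrite -ea.
  + by case: E1 => _ ->; case: E2.
- move=> a a' b [h|E1] [h'|E2].
  + exact: X2 h h'.
  + by case: E2 => _ eb; case: (nb a); rewrite -eb.
  + by case: E1 => _ eb; case: (nb a'); rewrite -eb.
  + by case: E1 => ->; case: E2 => ->.
Qed.

Lemma emb_card A B : emb A B <-> [set: A] #<= [set: B].
Proof.
split=> [[f fi]|/card_leP[f]].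
  have := subset_card_le (subsetT (f @` [set: A])).
  by rewrite (card_le_eql (inj_card_eq (f := f) _))// => x y _ _; exact: fi.
have T A' (a : A') : a \in [set: A'] by rewrite inE.
exists (fun a => val (f (exist _ a (T A a)))) => a b /val_inj.
by move=> /(@inj _ _ _ f) /= H; have := H (in_setT _) (in_setT _) => -[].
Qed.

Lemma infinite_emb A : infinite_set [set: A] -> emb nat A.
Proof. by move=> /infiniteP /emb_card. Qed.

Section hessenberg.
Variable M : Type.
Hypothesis infM : emb nat M.

(* A subset of [M + M * M * M] codes a subset [dom A] of [M] with the graph of an
   injection from [dom A * dom A] to [dom A]. *)
Let dom (A : set (M + M * M * M)) : set M := [set x | A (inl x)].
Let gr (A : set (M + M * M * M)) (p : M * M) : set M := [set c | A (inr (p, c))].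

Let good (A : set (M + M * M * M)) :=
  [/\ forall a b, dom A a -> dom A b -> exists2 c, dom A c & gr A (a, b) c,
      forall p c, gr A p c -> [/\ dom A p.1, dom A p.2 & dom A c],
      forall p c d, gr A p c -> gr A p d -> c = d
    & forall p q c, gr A p c -> gr A q c -> p = q].

Variable nu : nat -> M.
Hypothesis nui : injective nu.

Let A0 : set (M + M * M * M) := [set t | match t with
  | inl x => range nu x
  | inr (p, c) => exists i j, [/\ p = (nu i, nu j) & c = nu (pickle (i, j))] end].

Let good0 : good A0.
Proof.
split.
- move=> a b [i _ <-] [j _ <-]; exists (nu (pickle (i, j))); first by exists (pickle (i, j)).
  by exists i, j.
- by move=> p c [i [j [-> ->]]]; split => /=; [exists i|exists j|exists (pickle (i, j))].
- by move=> p c d [i [j [-> ->]]] [i' [j' [[/nui -> /nui ->] ->]]].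
- move=> p q c [i [j [-> ->]]] [i' [j' [-> /nui E]]].
  by have [-> ->] : (i, j) = (i', j') by exact: (pcan_inj pickleK).
Qed.

Let maximal : exists A, [/\ good A, A0 `<=` A & forall B, good B -> A `<=` B -> B = A].
Proof.
pose P : set (set (M + M * M * M)) := [set A | good A /\ (A = set0 \/ A0 `<=` A)].
have [F FP tF|A [[gA hA] maxA]] := @Zorn_bigcup _ P.
  split; last first.
    have [[X FX X0]|nX] := pselect (exists2 X, F X & A0 `<=` X).
      by right => t /X0 Xt; exists X.
    left; apply/seteqP; split => // t [X FX Xt].
    by have [_ [X0|X0]] := FP X FX; [rewrite X0 in Xt|case: nX; exists X].
  have two s t : (\bigcup_(X in F) X) s -> (\bigcup_(X in F) X) t ->
      exists X, [/\ F X, X s & X t].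
    move=> [X FX Xs] [Y FY Yt]; have [XY|YX] := tF X Y FX FY.
      by exists Y; split => //; exact: XY.
    by exists X; split => //; exact: YX.
  split.
  - move=> a b ha hb; have [X [FX Xa Xb]] := two _ _ ha hb.
    have [[h1 _ _ _] _] := FP X FX; have [c hc gc] := h1 a b Xa Xb.
    by exists c; exists X.
  - move=> p c [X FX Xp]; have [[_ h1 _ _] _] := FP X FX.
    by have [? ? ?] := h1 p c Xp; split; exists X.
  - move=> p c d hc hd; have [X [FX Xc Xd]] := two _ _ hc hd.
    by have [[_ _ h1 _] _] := FP X FX; exact: h1 Xc Xd.
  - move=> p q c hc hd; have [X [FX Xc Xd]] := two _ _ hc hd.
    by have [[_ _ _ h1] _] := FP X FX; exact: h1 Xc Xd.
have A0A : A0 `<=` A.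
  case: hA => // AE; exfalso; apply: (maxA A0); last by split => //; right.
  rewrite AE; split; first by move=> t.
  by move=> h; apply: (h (inl (nu 0%N))); exists 0%N.
exists A; split => // B gB AB; apply: contrapT => BA; apply: (maxA B).
  by split => // BA'; apply: BA; apply/seteqP.
by split => //; right; exact: subset_trans AB.
Qed.

(** Let D be the domain of a maximal code. If the complement of D embeds into D, then [M] embeds
    into bool * D and so into D, where pairs can be coded. Otherwise the complement contains a copy
    of D, and the pairing extends to the union, against maximality. *)
Lemma hessenberg_nu : emb (M * M) M.
Proof.
have [A [gA A0A maxA]] := maximal; have [h1 h2 h3 h4] := gA.
pose D := {x | dom A x}.
have [g gP] : exists g : D -> D -> D, forall a b, gr A (sval a, sval b) (sval (g a b)).
  have /choice[g hg] (p : D * D) : exists c : D, gr A (sval p.1, sval p.2) (sval c).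
    case: p => -[a da] [b db] /=; have [c dc gc] := h1 a b da db.
    by exists (exist _ c dc).
  by exists (fun a b => g (a, b)) => a b; exact: (hg (a, b)).
have gi a b a' b' : g a b = g a' b' -> a = a' /\ b = b'.
  move=> E; have := gP a b; rewrite E => /h4/(_ (gP a' b'))[ea eb].
  by split; exact: sval_inj.
have DD : emb (D * D) D.
  by exists (fun p => g p.1 p.2) => -[a b] [a' b'] /= /gi[-> ->].
have d0 i : dom A (nu i) by apply: A0A; exists i.
pose e0 (b : bool) : D := exist _ (nu b) (d0 b).
have e0i : injective e0 by move=> b b' [] /nui; case: b; case: b'.
have bD : emb (bool * D) D.
  by apply: emb_trans DD; apply: emb_prod (emb_refl _); exists e0.
pose C := {x | ~ dom A x}.
have [[e ei]|[e ei]] := emb_total D C; last first.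
  have MD : emb M D.
    apply: emb_trans bD.
    exists (fun x => match pselect (dom A x) with
      | left h => (true, exist _ x h) | right h => (false, e (exist _ x h)) end).
    move=> x y; case: pselect => hx; case: pselect => hy // []; first by move=> ->.
    by move=> /ei[].
  apply: emb_trans (emb_prod MD MD) _; apply: emb_trans DD _; exact: emb_sig.
exfalso; have [k ki] : emb ((bool * D) * (bool * D)) D.
  exact: emb_trans (emb_prod bD bD) DD.
pose rep (p : bool * D) : M := if p.1 then sval (e p.2) else sval p.2.
have eD d : ~ dom A (sval (e d)) by exact: svalP (e d).
have Dd (d : D) : dom A (sval d) by exact: svalP d.
have repi : injective rep.
  move=> [b d] [b' d']; rewrite /rep; case: b; case: b' => /= E.
  - by have -> : d = d' by exact/ei/sval_inj.
  - by case: (eD d); rewrite E.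
  - by case: (eD d'); rewrite -E.
  - by have -> : d = d' by exact: sval_inj.
(* Pairs with at least one component in the copy receive codes in the copy, so the old and the new
   codes cannot collide. *)
pose new p c := exists q : (bool * D) * (bool * D), [/\ q.1.1 || q.2.1,
  p = (rep q.1, rep q.2) & c = sval (e (k q))].
pose B : set (M + M * M * M) := [set t | match t with
  | inl x => dom A x \/ exists d, x = sval (e d)
  | inr (p, c) => gr A p c \/ new p c end].
have domB p : dom B (rep p) by rewrite /rep; case: p.1; [right; exists p.2|left; exact: Dd].
have domBP x : dom B x -> exists p, x = rep p.
  by move=> [h|[d ->]]; [exists (false, exist _ x h)|exists (true, d)].
have new_dom p c : new p c -> ~ (dom A p.1 /\ dom A p.2).
  move=> [[[b d] [b' d']] [/= bb -> _]] [/=]; rewrite /rep /=.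
  by case: b bb => /= [_ /eD//|->] _ /eD.
have AB : A `<=` B by move=> [x|[p c]] h; left.
have gB : good B.
  split.
  - move=> a b /domBP[p ->] /domBP[q ->].
    have [pq|] := boolP (p.1 || q.1).
      exists (sval (e (k (p, q)))); first by right; exists (k (p, q)).
      by right; exists (p, q).
    rewrite negb_or /rep => /andP[/negbTE -> /negbTE ->].
    by exists (sval (g p.2 q.2)); left; [exact: Dd|exact: gP].
  - move=> p c [h|[q [_ -> ->]]]; first by have [? ? ?] := h2 _ _ h; split; left.
    by split; [exact: domB|exact: domB|right; exists (k q)].
  - move=> p c d [h|h] [h'|h'].
    + exact: h3 h h'.
    + by have [p1 p2 _] := h2 _ _ h; case: (new_dom _ _ h').
    + by have [p1 p2 _] := h2 _ _ h'; case: (new_dom _ _ h).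
    + case: h h' => [[q1 q2] [_ -> ->]] [[r1 r2] [_ [/repi <- /repi <-] ->]].
      by [].
  - move=> p q c [h|h] [h'|h'].
    + exact: h4 h h'.
    + have [_ _ pc] := h2 _ _ h; case: h' => r [_ _ ec].
      by case: (eD (k r)); rewrite -ec.
    + have [_ _ pc] := h2 _ _ h'; case: h => r [_ _ ec].
      by case: (eD (k r)); rewrite -ec.
    + by case: h h' => r [_ -> ->] [r' [_ -> /sval_inj/ei/ki ->]].
have BA := maxA B gB AB.
have : dom B (sval (e (e0 true))) by right; exists (e0 true).
by rewrite BA => /eD.
Qed.

End hessenberg.

Lemma hessenberg M : emb nat M -> emb (M * M) M.
Proof. by move=> [nu nui]; exact: hessenberg_nu nui. Qed.

Lemma emb_seq_infinite M : emb nat M -> emb (seq M) M.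
Proof.
move=> nM; have [g gi] := hessenberg nM; have [nu nui] := nM.
(* The end of a list is coded by an element that may also code a pair; recording the size makes
   decoding unambiguous. *)
pose code := foldr (fun x c => g (x, c)) (nu 0%N).
exists (fun s => g (nu (size s), code s)) => s t /gi[/nui].
elim: s t => [|x s IH] [|y t] //= [st] /gi[-> E].
by congr cons; exact: IH.
Qed.

Lemma emb_prod_infinite A B M : emb nat M -> emb A M -> emb B M -> emb (A * B) M.
Proof. by move=> nM AM BM; apply: emb_trans (emb_prod AM BM) (hessenberg nM). Qed.

Lemma emb_sum_infinite A B M : emb nat M -> emb A M -> emb B M -> emb (A + B) M.
Proof.
move=> nM [f fi] [g gi]; have [nu nui] := nM; apply: emb_trans (hessenberg nM).
exists (fun s => match s with inl a => (nu 0%N, f a) | inr b => (nu 1%N, g b) end).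
by move=> [a|b] [a'|b'] [] => [/fi ->|/nui|/nui|/gi ->].
Qed.

Lemma emb_seqW A M : emb nat M -> emb A M -> emb (seq A) M.
Proof. by move=> nM /emb_seq/emb_trans; apply; exact: emb_seq_infinite. Qed.

Lemma emb_countable (A : countType) M : emb nat M -> emb A M.
Proof. by move=> [nu nui]; exists (nu \o pickle); apply: inj_comp => //; exact: pcan_inj pickleK. Qed.

(** Dedekind cuts, with the rationals numbered by [pickle]. *)
Lemma emb_real (R : realType) : emb R (set nat).
Proof.
exists (fun r => [set n | exists q : rat, n = pickle q /\ ratr q < r]) => r s E.
have key (a b : R) : [set n | exists q : rat, n = pickle q /\ ratr q < a] =
    [set n | exists q : rat, n = pickle q /\ ratr q < b] -> a <= b.
  move=> E'; rewrite leNgt; apply/negP => /rat_in_itvoo[q].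
  rewrite in_itv /= => /andP[bq qa].
  have : [set n | exists q : rat, n = pickle q /\ ratr q < a] (pickle q) by exists q.
  rewrite E' => -[q' [/(pcan_inj pickleK) <- qb]].
  by have := lt_trans bq qb; rewrite ltxx.
by apply/eqP; rewrite eq_le !key.
Qed.

Lemma emb_complex (R : realType) : emb R[i] (set nat).
Proof.
have [f fi] := emb_real R.
exists (fun z => [set n | (exists k, n = k.*2 /\ f (complex.Re z) k) \/
   (exists k, n = k.*2.+1 /\ f (complex.Im z) k)]) => -[a b] [c d] E.
have key (X Y Z W : set nat) : [set n | (exists k, n = k.*2 /\ X k) \/
   (exists k, n = k.*2.+1 /\ Y k)] = [set n | (exists k, n = k.*2 /\ Z k) \/
   (exists k, n = k.*2.+1 /\ W k)] -> X `<=` Z /\ Y `<=` W.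
  move=> E'; split=> n hn.
    have : [set n | (exists k, n = k.*2 /\ X k) \/ (exists k, n = k.*2.+1 /\ Y k)] n.*2.
      by left; exists n.
    rewrite E' => -[[k [/double_inj -> //]]|[k [/(congr1 odd)]]].
    by rewrite /= !odd_double.
  have : [set n | (exists k, n = k.*2 /\ X k) \/ (exists k, n = k.*2.+1 /\ Y k)] n.*2.+1.
    by right; exists n.
  rewrite E' => -[[k [/(congr1 odd)]]|[k [[/double_inj -> //]]]].
  by rewrite /= !odd_double.
have [h1 h2] := key _ _ _ _ E; have [h3 h4] := key _ _ _ _ (esym E).
have -> : a = c by apply: fi; apply/seteqP.
by have -> : b = d by apply: fi; apply/seteqP.
Qed.

End embeddings.

(** * Normalized indicators *)

Section unit_indicators.
Context (R : realType) (G : topologicalGroupType) (h : haarMeasure R G).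

Definition uchi (V : set G) : L2 h := (Num.sqrt (fine (h V)))^-1%:C *: chi h V.

Variable V : set G.
Hypotheses (mV : measurable (V : set (borel G))) (V0 : (0 < h V)%E) (fV : (h V < +oo)%E).

Let fV0 : 0 < fine (h V).
Proof. by apply: fine_gt0; rewrite V0 fV. Qed.

Lemma uchi_norm : rdot (uchi V) (uchi V) = 1.
Proof.
rewrite /uchi rdotZl rdotZr mulrA -expr2 exprVn sqr_sqrtr; last exact: ltW.
by rewrite /rdot chi_dot// setIid ReC mulVf// gt_eqF.
Qed.

Lemma uchi_restr : restr (V : set (borel G)) (uchi V) = uchi V.
Proof. by rewrite /uchi (lin_opZ (@restr_linear _ _ R h V)) restr_chi// setIid. Qed.

End unit_indicators.

(** * Upper bound *)

Section upper_bound.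
Context (R : realType) (G : topologicalGroupType) (h : haarMeasure R G).
Hypothesis HG : hausdorff_space G.
Variable K : set G.
Hypotheses (cK : compact K) (K1 : nbhs (1 : G)%g K).
Context (M : Type) (U : M -> set G).
Hypotheses (U1 : forall m, nbhs (1 : G)%g (U m))
  (Ub : forall V, nbhs (1 : G)%g V -> exists m, U m `<=` V).
Implicit Types (f g : L2 h) (S T : VN h).

Let mK : measurable (K : set (borel G)). Proof. exact: measurable_compact. Qed.

Let K0 : (0 < h K)%E.
Proof.
have oK := @open_interior _ K.
apply: lt_le_trans (haar_open_gt0 h HG oK K1) _; apply: le_measure; rewrite ?inE//.
  exact: measurable_open.
exact: interior_subset.
Qed.

Let fK : (h K < +oo)%E. Proof. exact: haar_compact. Qed.

Lemma compact_tube_r L V : compact L -> (forall y, L y -> nbhs y V) ->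
  nbhs (1 : G)%g [set x | forall y, L y -> V (y * x)%g].
Proof.
move=> /compact_near_coveringP cL LU.
apply: (cL G (nbhs (1 : G)%g) (fun x y => V (y * x)%g)) => y Ly.
have := LU y Ly; rewrite -{1}(mulg1 y) => /mulg_nbhs[A [B [Ay B1 hAB]]].
by exists (A, B) => // -[b a] /= [Wb Va]; exact: hAB.
Qed.

Let W m := interior (U m).

Lemma cover_exists m : exists s : seq G, forall t, K t -> exists2 y, y \in s & lset y (W m) t.
Proof.
apply: compact_subcover cK _ => t Kt; apply: open_nbhs_nbhs; split.
  by apply: open_lset; exact: open_interior.
by rewrite lset_preimage /= mulVg; exact: U1.
Qed.

Variable xs : M -> seq G.
Hypothesis xsP : forall m t, K t -> exists2 y, y \in xs m & lset y (W m) t.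

(** A translate is named by its position in the finite list [xs p.1]. Finite unions of these sets
    thus form a family bounded by the cardinality of [M], whatever the cardinality of [G]. *)
Let tr (p : M * nat) : set (borel G) := lset (nth (1 : G)%g (xs p.1) p.2) (W p.1).

Let open_tr p : open (tr p : set G).
Proof. by apply: open_lset; exact: open_interior. Qed.

Let trs (s : seq (M * nat)) : set (borel G) := [set t | exists2 p, List.In p s & tr p t].

Let open_trs s : open (trs s : set G).
Proof.
elim: s => [|p s IH].
  have -> : trs [::] = set0 by apply/seteqP; split => // t [].
  exact: open0.
have -> : trs (p :: s) = tr p `|` trs s.
  apply/seteqP; split => [t [q [<-|qs] qt]|t [pt|[q qs qt]]].
  - by left.
  - by right; exists q.
  - by exists p => //; left.
  - by exists q => //; right.
exact: openU.
Qed.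

Let dvec s : L2 h := chi h (trs s).

(** A compact E inside [K] lies in an open set V of nearly the same measure. For [W m] small enough
    every translate that meets E stays in V, so a finite union of named translates fits between E
    and V, and its indicator approximates that of E. *)
Lemma dvec_total (c : L2 h) : (forall s, L2_dot c (dvec s) = 0) -> restr (K : set (borel G)) c = 0.
Proof.
move=> hc; apply: (chi_compact_total HG) => L cL.
have mL := measurable_compact HG cL; have fL := haar_compact h cL.
rewrite restr_dot restr_chi//; set E := K `&` L.
have cE : compact E by apply: compact_closedI => //; exact: compact_closed.
have mE := measurable_compact HG cE; have fE := haar_compact h cE.
apply: dot_chi_limit => e e0; have [V [oV EV hV]] := haar_open_outer mE fE e0.
have mV := measurable_open oV.
have N1 : nbhs (1 : G)%g [set x | forall y, E y -> V (y * x)%g].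
  by apply: compact_tube_r => // y Ey; apply: open_nbhs_nbhs; split => //; exact: EV.
have [W0 W01 hW0] := nbhs1_div N1.
have [|m Um] := @Ub [set t | W0 (t^-1)%g]; first by apply: inv_nbhs; rewrite invg1.
have WW a b t : W m a -> W m b -> E t -> V (t * (a^-1 * b))%g.
  move=> /interior_subset/Um Wa /interior_subset/Um Wb Et.
  by have := hW0 _ _ Wa Wb t Et; rewrite invgK.
(* The positions of exactly those translates that meet E. *)
pose s := [seq (m, i) | i <- [seq i <- iota 0 (size (xs m)) | `[< (tr (m, i) `&` E) !=set0 >]]].
have EO : E `<=` trs s.
  move=> t Et; have [y ys yt] := xsP m (proj1 Et).
  have trt : tr (m, index y (xs m)) t by rewrite /tr /= nth_index.
  exists (m, index y (xs m)) => //; rewrite /s; apply: List.in_map.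
  apply/List.filter_In; split; last by apply/asboolP; exists t.
  have : index y (xs m) \in iota 0 (size (xs m)) by rewrite mem_iota /= index_mem.
  elim: (iota _ _) => // k l IH; rewrite inE => /orP[/eqP ->|/IH]; first by left.
  by right.
have OV : trs s `<=` V.
  move=> t [p ps pt]; have [i [/esym ip]] := (List.in_map_iff _ _ _).1 ps.
  move=> /List.filter_In[_ /asboolP[t' [t't Et']]]; move: pt t't; rewrite ip /tr /=.
  move=> [b Wb <-] [a Wa t'E]; have := WW a b t' Wa Wb Et'.
  by rewrite -t'E mulgA mulgK.
have mO := measurable_open (open_trs s).
have fV : (h V < +oo)%E by apply: lt_trans hV _; rewrite lte_add_pinfty ?ltry.
have hOV : (h (trs s) <= h V)%E by apply: le_measure; rewrite ?inE.
have fO : (h (trs s) < +oo)%E by exact: le_lt_trans hOV fV.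
exists (trs s); split; first exact: hc.
have -> : chi h E - chi h (trs s) = - (chi h (trs s) - chi h E) by rewrite opprB.
rewrite rdotNl rdotNr opprK chi_sub_dot//.
have finE : h E \is a fin_num by rewrite ge0_fin_numE.
have finO : h (trs s) \is a fin_num by rewrite ge0_fin_numE.
have := le_lt_trans hOV hV; rewrite -(fineK finE) -(fineK finO) -EFinD lte_fin => /ltW.
by rewrite lerBlDl.
Qed.

Lemma dvec_separates S : (forall s t, L2_dot (S (dvec s)) (dvec t) = 0) ->
  forall a b : L2 h, restr (K : set (borel G)) a = a -> restr (K : set (borel G)) b = b ->
  L2_dot (S a) b = 0.
Proof.
move=> hS a b Ka Kb.
have h1 s : L2_dot (S (dvec s)) b = 0.
  by rewrite -Kb -restr_dot (dvec_total (hS s)) L2_dot0l.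
have h2 : restr (K : set (borel G)) (VN_adj S b) = 0.
  by apply: dvec_total => s; rewrite VN_adjP' L2_dotC h1 conjc0.
by rewrite VN_adjP -Ka restr_dot h2 L2_dot0r.
Qed.

Let f0 := uchi h K.

(** Invariance replaces [S] by u0 S, where u0 is the vector state of [f0]. A state [v] tests this
    operator as v (u0 S) = u0 (v S), which involves only the compression of v S to [K], and this
    depends on that of [S] alone. *)
Lemma TIM_determined m S T : TIM h m ->
  (forall s t, L2_dot (S (dvec s)) (dvec t) = L2_dot (T (dvec s)) (dvec t)) -> m S = m T.
Proof.
move=> /(TIMP HG)[sm im] ST.
have P0 : P1 h (vecf f0) by apply: P1_vecf; exact: uchi_norm.
have p0 := ((P1P _).1 P0).1.
rewrite -(im _ S P0) -(im _ T P0); congr m; apply: (P1_separates) => v hv.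
have pv := ((P1P _).1 hv).1; rewrite !(mulop_comm HG _ p0 pv) /vecf.
have mv := mulopP HG pv.
apply/eqP; rewrite -subr_eq0 -L2_dotBl; apply/eqP.
have -> : mulop v S f0 - mulop v T f0 = mulop v (-1 *: T + S) f0.
  by rewrite (mulop_lin mv) VN_addE VN_scaleE scaleN1r addrC.
have Kf0 : restr (K : set (borel G)) f0 = f0 by exact: uchi_restr.
apply: (mulop_supp mv mK _ Kf0 Kf0); apply: dvec_separates => s t.
by rewrite VN_addE VN_scaleE scaleN1r L2_dotDl L2_dotNl ST addNr.
Qed.

(** By [TIM_determined] the value m S is a function of the numbers [kap S]. The mean is coded by the
    graph of that function, a set of pairs ([kap S], n) with n in the code of m S; a pair is written
    as a subset of [J + nat]. *)
Lemma TIM_emb_aux : emb nat M -> emb {m | TIM h m} (set (set M)).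
Proof.
move=> nM; have [rho rhoi] := emb_complex R.
pose I := seq (M * nat); pose J := ((I * I) * nat)%type.
have IM : emb I M.
  by apply: emb_seqW => //; apply: emb_prod_infinite => //; exact: emb_refl.
have JM : emb (J + nat) M.
  apply: emb_sum_infinite => //; apply: emb_prod_infinite => //.
  exact: emb_prod_infinite.
apply: emb_trans (emb_set (emb_set JM)).
pose kap S : set J := [set t | rho (L2_dot (S (dvec t.1.1)) (dvec t.1.2)) t.2].
pose cd S n : set (J + nat) := [set t | match t with inl j => kap S j | inr k => k = n end].
have cdi S n S' n' : cd S n = cd S' n' -> kap S = kap S' /\ n = n'.
  move=> E; split; last by have : cd S n (inr n) by []; rewrite E.
  apply/seteqP; split=> t ht.
    by have : cd S n (inl t) by []; rewrite E.
  by have : cd S' n' (inl t) by []; rewrite -E.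
have kapi S S' m : TIM h m -> kap S = kap S' -> m S = m S'.
  move=> hm E; apply: TIM_determined => // s t; apply: rhoi; apply/seteqP; split => n hn.
    by have : kap S ((s, t), n) by []; rewrite E.
  by have : kap S' ((s, t), n) by []; rewrite -E.
exists (fun m => [set c | exists S n, c = cd S n /\ rho (sval m S) n]).
move=> [m hm] [m' hm'] /= E; apply: sval_inj => /=.
have key m1 m2 S : TIM h m1 -> TIM h m2 -> [set c | exists S n, c = cd S n /\ rho (m1 S) n] =
    [set c | exists S n, c = cd S n /\ rho (m2 S) n] -> rho (m1 S) `<=` rho (m2 S).
  move=> h1 h2 E' n hn.
  have : [set c | exists S n, c = cd S n /\ rho (m1 S) n] (cd S n) by exists S, n.
  rewrite E' => -[S' [n' [/cdi[kE ->]]]].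
  by rewrite -(kapi S S' m2 h2 kE).
apply/funext => S; apply: rhoi; apply/seteqP; split; apply: key => //.
Qed.

End upper_bound.

Lemma TIM_upper (R : realType) (G : topologicalGroupType) (h : haarMeasure R G)
    (M : Type) (U : M -> set G) : hausdorff_space G -> locally_compact [set: G] ->
  (forall m, nbhs (1 : G)%g (U m)) ->
  (forall V, nbhs (1 : G)%g V -> exists m, U m `<=` V) ->
  emb nat M -> emb {m | TIM h m} (set (set M)).
Proof.
move=> HG LG U1 Ub nM; have [K cK K1] := compact_nbhs1 LG.
have [xs hxs] := choice (cover_exists cK U1).
exact: (TIM_emb_aux h HG cK K1 Ub hxs nM).
Qed.

(** * Lower bound *)

Section separating_operators.
Context (R : realType) (G : topologicalGroupType) (h : haarMeasure R G).
Context (I : Type) (f : I -> L2 h) (c : I -> VN h) (e : I -> R).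
Hypotheses (f1 : forall i, rdot (f i) (f i) = 1) (c1 : forall i, op_le 1 (c i))
  (cf : forall i, rdot (c i (f i)) (c i (f i)) <= 1 / 4)
  (e0 : forall i, 0 <= e i) (e1 : forall i, e i <= 1 / 100).
Variable X : set I.

Definition chi_op i : VN h := if pselect (X i) then VN_one h - VN_mul (VN_adj (c i)) (c i) else 0.

(** On vectors the head [i] acts first, see [sep_form]. As the largest index of a chain it shrinks
    its own vector [f i] and hardly moves the vectors of the tail. *)
Fixpoint sep s : VN h := if s is i :: s' then
  VN_mul (VN_adj (c i)) (VN_mul (sep s') (c i)) + chi_op i else 0.

Lemma sep_form i s v : rdot (sep (i :: s) v) v = rdot (sep s (c i v)) (c i v) +
  (if pselect (X i) then rdot v v - rdot (c i v) (c i v) else 0).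
Proof.
rewrite [sep _]/= VN_addE rdotDl VN_mulE VN_mulE; congr (_ + _).
  by rewrite /rdot VN_adjP'.
rewrite /chi_op; case: pselect => ?; last by rewrite VN_zeroE rdot0l.
by rewrite VN_addE VN_oppE VN_oneE VN_mulE rdotBl /rdot VN_adjP'.
Qed.

Lemma sep_ge0 s : VN_ge0 (sep s).
Proof.
elim: s => [|i s IH]; first exact: VN_ge0_0.
rewrite [sep _]/=; apply: VN_ge0D; first exact: VN_ge0_conj.
rewrite /chi_op; case: pselect => ?; last exact: VN_ge0_0.
apply/ge0_rdot => v; rewrite VN_addE VN_oppE VN_oneE VN_mulE !rdotBl.
have E k : rdot (VN_adj (c i) (c i v)) k = rdot (c i v) (c i k) by rewrite /rdot VN_adjP'.
rewrite !E (lin_opZ (@VN_linear _ _ _ (c i))) !rdot_iself subrr subr_ge0; split => //.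
by have := c1 i v; rewrite mul1r.
Qed.

Lemma sep_le1 s v : rdot (sep s v) v <= rdot v v.
Proof.
elim: s v => [|i s IH] v; first by rewrite VN_zeroE rdot0l rdot_ge0.
rewrite sep_form; have := IH (c i v); have := c1 i v; rewrite mul1r.
case: pselect => ?; move: (rdot (sep s _) _) (rdot (c i v) _) (rdot v v) => x y z /=; lra.
Qed.

Lemma sep_op_le s : op_le 1 (sep s).
Proof.
have := @VN_le_op _ _ h 1 (sep s) ler01 (sep_ge0 s); rewrite expr1n; apply.
apply/VN_leE/ge0_rdot => v; rewrite VN_addE VN_oppE VN_scaleE VN_oneE !rdotBl.
have -> : (1 : R)%:C *: v = v by rewrite scale1r.
rewrite rdot_iself (((ge0_rdot _).1 (sep_ge0 s)) v).2 subrr subr_ge0; split => //.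
exact: sep_le1.
Qed.

Lemma form_perturb (A : L2 h -> L2 h) (v w : L2 h) (d : R) : linear A -> op_le 1 A -> 0 <= d ->
  rdot v v <= 1 -> rdot w w <= 1 -> rdot (w - v) (w - v) <= d ^+ 2 ->
  `|rdot (A w) w - rdot (A v) v| <= 2 * d.
Proof.
move=> lA hA d0 v1 w1 wv.
have small a b : rdot a a * rdot b b <= d ^+ 2 -> `|rdot (A a) b| <= d.
  move=> ab; rewrite -(@ler_pXn2r _ 2%N) ?nnegrE// real_normK; last exact: num_real.
  by apply: le_trans (op_le_rdot a b hA) _; rewrite mul1r.
have -> : rdot (A w) w - rdot (A v) v = rdot (A (w - v)) w + rdot (A v) (w - v).
  rewrite (lin_opB lA) rdotBl rdotBr.
  by move: (rdot (A w) w) (rdot (A v) v) (rdot (A v) w) => x y z; ring.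
apply: le_trans (ler_normD _ _) _.
have h1 : `|rdot (A (w - v)) w| <= d.
  apply: small; apply: le_trans wv; rewrite ler_piMr// rdot_ge0//.
have h2 : `|rdot (A v) (w - v)| <= d.
  by apply: small; apply: le_trans wv; rewrite ler_piMl// rdot_ge0.
by rewrite mulr_natl mulr2n lerD.
Qed.

Definition below_rel j i := rdot (c i (f j) - f j) (c i (f j) - f j) <= e i ^+ 2 /\ 2 * e i <= e j.

Fixpoint chain s : Prop := if s is i :: s' then
  (forall j, List.In j s' -> below_rel j i) /\ chain s' else True.

(** The tail contributes at most the squared norm of [c i (f i)], which is at most 1/4, and the
    added term misses its ideal value 1 or 0 by no more than that same quantity; the two errors have
    opposite signs. *)
Lemma sep_head i s : `|rdot (sep (i :: s) (f i)) (f i) - (if pselect (X i) then 1 else 0)| <= 1 / 4.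
Proof.
rewrite sep_form f1; have := cf i; have := sep_le1 s (c i (f i)).
have := VN_ge0_re (c i (f i)) (sep_ge0 s).
case: pselect => ?; move: (rdot (sep s _) _) (rdot (c i _) _) => x y x0 xy y4 /=;
  rewrite ler_norml; apply/andP; split; lra.
Qed.

(* The factor 8 is chosen so that the bound telescopes: each step costs at most 4 e i,
   and 2 e i <= e k gives 4 e i <= 8 (e k - e i). *)
Lemma sep_err i s : chain (i :: s) -> forall j, List.In j (i :: s) ->
  `|rdot (sep (i :: s) (f j)) (f j) - (if pselect (X j) then 1 else 0)| <= 1 / 4 + 8 * (e j - e i).
Proof.
elim: s i => [|k s IH] i.
  move=> _ j [<-|//]; rewrite subrr mulr0 addr0; exact: sep_head.
move=> [hb ch] j [<-|js]; first by rewrite subrr mulr0 addr0; exact: sep_head.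
have [hj _] := hb j js; have [_ ik] := hb k (or_introl erefl).
have := IH k ch j js; rewrite (sep_form i (k :: s)); move: (if pselect (X j) then 1 else 0) => chij.
have h1 := form_perturb (@VN_linear _ _ _ (sep (k :: s))) (sep_op_le (k :: s)) (e0 i).
have cj1 : rdot (c i (f j)) (c i (f j)) <= 1 by have := c1 i (f j); rewrite f1 mul1r.
have fj1 : rdot (f j) (f j) <= 1 by rewrite f1.
have {}h1 := h1 _ _ fj1 cj1 hj.
(* [form_perturb] for the identity bounds the change of the squared norm under [c i]. This and the
   change of the tail form cost 2 e i each. *)
have lid : linear (@idfun (L2 h)) by move=> a u v.
have bid : op_le 1 (@idfun (L2 h)) by move=> u; rewrite mul1r.
have h2 := form_perturb lid bid (e0 i) fj1 cj1 hj.
rewrite f1 in h2; have := e0 i.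
move: h1 h2 ik; rewrite !ler_norml -[idfun _]/(c i (f j)) ?f1.
move: (rdot (sep (k :: s) (c i (f j))) _) (rdot (sep (k :: s) (f j)) _) (rdot (c i (f j)) _) (e i) (e j) (e k).
move=> x y z p q r /andP[a1 a2] /andP[b1 b2] pr p0 /andP[d1 d2].
case: pselect => ? /=; apply/andP; split; lra.
Qed.

End separating_operators.

Section separation.
Context (R : realType) (G : topologicalGroupType) (h : haarMeasure R G).
Context (I : Type) (f : I -> L2 h) (c : I -> VN h) (e : I -> R).
Hypotheses (f1 : forall i, rdot (f i) (f i) = 1) (c1 : forall i, op_le 1 (c i))
  (cf : forall i, rdot (c i (f i)) (c i (f i)) <= 1 / 4)
  (e0 : forall i, 0 <= e i) (e1 : forall i, e i <= 1 / 100).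
Hypothesis chains : forall r : seq I, exists2 s, chain f c e s &
  forall j, List.In j r -> List.In j s.

Lemma separation (X : set I) : exists T : VN h, forall i,
  (X i -> 2 / 3 <= rdot (T (f i)) (f i)) /\ (~ X i -> rdot (T (f i)) (f i) <= 1 / 3).
Proof.
pose F0 : set_system (seq I) := [set A : set (seq I) | exists r, forall s,
  chain f c e s -> (forall j, List.In j r -> List.In j s) -> A s].
have FF0 : ProperFilter F0.
  split; first by move=> [r hr]; have [s cs rs] := chains r; exact: hr cs rs.
  split; first by exists [::].
    move=> A B [r hr] [r' hr']; exists (r ++ r') => s cs rs; split.
      by apply: hr => // j jr; apply: rs; apply: List.in_or_app; left.
    by apply: hr' => // j jr; apply: rs; apply: List.in_or_app; right.
  by move=> A B AB [r hr]; exists r => s cs rs; apply: AB; exact: hr.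
have [F [FU F0F]] := ultraFilterLemma FF0.
have hT : F [set s | op_le 1 (sep c X s)].
  by apply: F0F; exists [::] => s _ _; exact: (sep_op_le c1).
have [T _ cT] := VN_wlim FU ler01 hT; exists T => i.
have FF := @ultra_proper _ _ FU.
have cst (a : R) : (fun _ : seq I => a) @ F --> a by exact: cvg_cst.
have ev : F [set s | `|rdot (sep c X s (f i)) (f i) - (if pselect (X i) then 1 else 0)| <= 1 / 3].
  apply: F0F; exists [:: i] => s cs /(_ i (or_introl erefl)).
  case: s cs => // k s cs js.
  (* Here the bound 1/100 on the errors matters: 1/4 + 8/100 is below 1/3. *)
  have H := sep_err f1 c1 cf e0 X cs js; rewrite /mkset; apply: (le_trans H).
  by have := e0 k; have := e1 i; move: (e i) (e k) => p q; lra.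
split=> Xi.
  apply: (filter_le FU (cst (2 / 3)) (@cT (f i) (f i))).
  apply: (@filterS _ F _ _ _ _ ev) => s /=; case: pselect => // ?.
  by move: (rdot _ _) => a /=; rewrite ler_norml => /andP[? ?]; lra.
apply: (filter_le FU (@cT (f i) (f i)) (cst (1 / 3))).
apply: (@filterS _ F _ _ _ _ ev) => s /=; case: pselect => // ?.
by move: (rdot _ _) => a /=; rewrite ler_norml subr0 => /andP[].
Qed.

End separation.

Section averaging.
Context (R : realType) (G : topologicalGroupType) (h : haarMeasure R G).
Implicit Types (a b v w f : L2 h).

Definition half a b : L2 h := (1 / 2 : R)%:C *: (a + b).

Lemma half_le a b w (d : R) : rdot (a - w) (a - w) <= d -> rdot (b - w) (b - w) <= d ->
  rdot (half a b - w) (half a b - w) <= d.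
Proof.
have -> : half a b - w = half (a - w) (b - w).
  rewrite /half addrACA -opprD scalerBr; congr (_ - _).
  rewrite scalerDr -scalerDl -rmorphD /= (_ : 1 / 2 + 1 / 2 = 1 :> R); last by lra.
  by rewrite scale1r.
rewrite /half rdotZl rdotZr => ha hb; have := rdotD_le (a - w) (b - w).
move: ha hb; move: (rdot (a - w + _) _) (rdot (a - w) _) (rdot (b - w) _) => x y z; lra.
Qed.

Lemma half_orth a b : rdot a b = 0 ->
  rdot (half a b) (half a b) = (rdot a a + rdot b b) / 4.
Proof.
by move=> ab; rewrite /half rdotZl rdotZr rdotDl !rdotDr (rdotC b a) ab; field.
Qed.

Lemma half_rdot a b v : rdot (half a b) v = (rdot a v + rdot b v) / 2.
Proof. by rewrite /half rdotZl rdotDl; field. Qed.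

Definition VN_half (S T : VN h) : VN h := (1 / 2 : R)%:C *: (S + T).

Lemma VN_halfE S T v : VN_half S T v = half (S v) (T v). Proof. by []. Qed.

(** Four translates make the squared norm 1/4, small enough for the values near 0 and near 1 to stay
    apart. Nesting two-term averages reduces all estimates to those for [half]. *)
Definition average (x : nat -> G) : VN h :=
  VN_half (VN_half (VN_lreg h (x 0%N)) (VN_lreg h (x 1%N)))
          (VN_half (VN_lreg h (x 2%N)) (VN_lreg h (x 3%N))).

Lemma averageE x v : average x v =
  half (half (lreg (x 0%N) v) (lreg (x 1%N) v)) (half (lreg (x 2%N) v) (lreg (x 3%N) v)).
Proof. by rewrite /average !VN_halfE. Qed.

Lemma average_close x v w (d : R) :
  (forall i, (i < 4)%N -> rdot (lreg (x i) v - w) (lreg (x i) v - w) <= d) ->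
  rdot (average x v - w) (average x v - w) <= d.
Proof. by move=> hx; rewrite averageE; apply: half_le; apply: half_le; exact: hx. Qed.

Lemma average_op_le x : op_le 1 (average x).
Proof.
move=> v; rewrite mul1r -[average x v]subr0; apply: average_close => i _.
by rewrite subr0 lreg_rdot.
Qed.

Lemma average_orth x f : rdot f f = 1 ->
  (forall i j, (i < 4)%N -> (j < 4)%N -> i != j -> rdot (lreg (x i) f) (lreg (x j) f) = 0) ->
  rdot (average x f) (average x f) <= 1 / 4.
Proof.
move=> f1 o; rewrite averageE half_orth ?half_orth ?lreg_rdot ?f1 ?o//; first by lra.
by rewrite half_rdot ![rdot _ (half _ _)]rdotC !half_rdot !o//; lra.
Qed.

Lemma lreg_orth x y (V : set (borel G)) f : measurable V -> restr V f = f ->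
  lset x V `&` lset y V = set0 -> rdot (lreg x f) (lreg y f) = 0.
Proof.
move=> mV Vf xy; rewrite -Vf !lreg_restr// /rdot restr_dot restrI ?xy ?restr0 ?L2_dot0r//;
  exact: measurable_lset.
Qed.

End averaging.

(** * Small neighborhoods of the identity and their intersections *)

Section small_neighborhoods.
Variable G : topologicalGroupType.
Hypotheses (HG : hausdorff_space G) (LG : locally_compact [set: G]).
Implicit Types (U V W : set G).

Lemma nbhs_neq (x z : G) : x != z -> nbhs x [set y | y != z].
Proof.
move=> xz; have : closed [set z].
  exact: (compact_closed HG (@compact_set1 G z)).
rewrite -openC => oz; have := open_nbhs_nbhs (conj oz (_ : (~` [set z]) x)).
move=> H; apply: filterS (H _) => [y yz|]; first by apply/eqP.
by move=> E; move: xz; rewrite E eqxx.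
Qed.

Lemma small_compact_nbhs U : nbhs (1 : G)%g U ->
  exists V, [/\ compact V, nbhs (1 : G)%g V & V `<=` U].
Proof.
move=> /nbhs1_div[W W1 hW]; have [K cK K1] := compact_nbhs1 LG.
exists (K `&` closure W); split.
- by apply: compact_closedI => //; exact: closed_closure.
- by apply: filterI => //; apply: filterS W1; exact: subset_closure.
- move=> t [_ Wt]; have n : nbhs t [set s | W (t^-1 * s)%g].
    by apply: lmul_nbhs; rewrite mulVg.
  have [s [Ws /= Wts]] := Wt _ n.
  by have := hW _ _ Ws Wts; rewrite invgM invgK mulVKg.
Qed.

Lemma disjoint_translates (x : nat -> G) (n : nat) U : injective x -> nbhs (1 : G)%g U ->
  exists V, [/\ compact V, nbhs (1 : G)%g V, V `<=` U &
    forall i j, (i < n)%N -> (j < n)%N -> i != j -> lset (x i) V `&` lset (x j) V = set0].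
Proof.
move=> xi U1.
have sep (i j : nat) : exists W, nbhs (1 : G)%g W /\
    (i != j -> forall a b, W a -> W b -> (x i * a)%g <> (x j * b)%g).
  have [->|ij] := eqVneq i j; first by exists setT; split => //; exact: filterT.
  have z1 : (1 : G)%g != ((x i)^-1 * x j)%g.
    apply/eqP => E; move/eqP: ij; apply; apply: xi.
    by rewrite -[x i]mulg1 E mulVKg.
  have [W W1 hW] := nbhs1_div (nbhs_neq z1); exists W; split => // _ a b Wa Wb E.
  have /eqP := hW a b Wa Wb; apply.
  by rewrite -[a](mulKg (x i)) E mulgA mulgK.
have /choice[W hW] (p : nat * nat) : exists W, nbhs (1 : G)%g W /\
    (p.1 != p.2 -> forall a b, W a -> W b -> (x p.1 * a)%g <> (x p.2 * b)%g).
  exact: sep.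
have : nbhs (1 : G)%g (U `&` [set t | forall p : 'I_n * 'I_n, W (val p.1, val p.2) t]).
  by apply: filterI => //; apply: filter_forall => p; exact: (hW _).1.
move=> /small_compact_nbhs[V [cV V1 VU]]; exists V; split => //.
  by move=> t /VU[].
move=> i j ilt jlt ij; apply/seteqP; split => // t [[a Va <-] [b Vb E]].
have [_ Wa] := VU _ Va; have [_ Wb] := VU _ Vb.
have := (hW (i, j)).2 ij a b (Wa (Ordinal ilt, Ordinal jlt)) (Wb (Ordinal ilt, Ordinal jlt)).
by apply; rewrite E.
Qed.

Lemma nbhs1_avoid (s : seq G) :
  nbhs (1 : G)%g [set y | forall z, z \in s -> z != 1%g -> y != z].
Proof.
elim: s => [|z s IH]; first by apply: filterE.
have [z1|z1] := eqVneq z 1%g.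
  apply: filterS IH => y h1 k; rewrite inE => /orP[/eqP ->|ks]; last exact: h1.
  by rewrite z1 eqxx.
have nz : nbhs (1 : G)%g [set y | y != z] by apply: nbhs_neq; rewrite eq_sym.
apply: filterS2 IH nz => y h1 h2 k; rewrite inE => /orP[/eqP -> //|ks]; exact: h1.
Qed.

Lemma nbhs1_infinite U : ~ discrete_space G -> nbhs (1 : G)%g U -> infinite_set U.
Proof.
move=> nd U1 /finite_seqP[s Us]; apply: nd.
have n1 : nbhs (1 : G)%g [set (1 : G)%g].
  have hs := nbhs1_avoid s; apply: filterS2 hs U1 => y hy Uy; apply/eqP/negPn/negP => y1.
  by have := hy y _ y1; rewrite eqxx => /(_ _)/negP; apply => //; rewrite Us in Uy.
apply/funext => x; rewrite /principal_filter.
apply/seteqP; split => A; first by move=> /nbhs_singleton Ax y /= ->.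
move=> Ax; have : nbhs x [set x].
  have : nbhs (x^-1 * x)%g [set (1 : G)%g] by rewrite mulVg.
  move=> /lmul_nbhs; apply: filterS => y /= E.
  by rewrite -[y](mulVKg x) E mulg1.
by apply: filterS => y ->; exact: Ax.
Qed.

(* Otherwise the finite intersections of compact shrinkings of the [A i] with a fixed
   compact neighborhood would form a basis at 1 that is too small. *)
Lemma infinite_bigcap (M I : Type) (A : I -> set G) :
  (forall (J : Type) (V : J -> set G), (forall j, nbhs (1 : G)%g (V j)) ->
    (forall U, nbhs (1 : G)%g U -> exists j, V j `<=` U) -> emb M J) ->
  emb nat I -> ~ emb M I -> (forall i, nbhs (1 : G)%g (A i)) ->
  infinite_set [set t | forall i, A i t].
Proof.
move=> minM nI MI A1 /finite_seqP[s As].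
have /choice[C hC] i := small_compact_nbhs (A1 i).
(* If the intersection is the finite set [s], a compact [W] that avoids its other points meets it in
   the identity alone. *)
have := nbhs1_avoid s; move=> /small_compact_nbhs[W [cW W1 hW]].
have only1 t : W t -> (forall i, A i t) -> t = 1%g.
  move=> Wt At; apply/eqP/negPn/negP => t1.
  have ts : t \in s by have : [set t | forall i, A i t] t by []; rewrite As.
  by have := hW t Wt t ts t1; rewrite eqxx.
have [nu nui] := nI.
apply: MI; apply: emb_trans (emb_seq_infinite nI).
apply: (minM (seq I) (fun r => [set t | W t /\ forall i, List.In i r -> C i t])).
  move=> r; elim: r => [|i r IH].
    by apply: filterS W1 => t Wt; split.
  have [_ Ci _] := hC i; apply: filterS2 IH Ci => t [Wt Ct] Cit; split => // j [<-//|].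
  exact: Ct.
move=> U; rewrite nbhsE => -[Q [oO O1] OU].
have cWO : compact (W `&` ~` Q) by apply: compact_closedI => //; rewrite closedC.
(* Every point of [W] outside the open [Q] escapes some [C i]; by compactness finitely many indices
   expel all of them. *)
have /choice[io hio] (y : G) : exists i, (W `&` ~` Q) y -> ~ C i y.
  have [Wy|nWy] := pselect ((W `&` ~` Q) y); last by exists (nu 0%N).
  have : ~ forall i, A i y.
    by move=> Ay; apply: (proj2 Wy); rewrite (only1 y (proj1 Wy) Ay).
  by move=> /existsNP[i Ai]; exists i => _ Cy; have [_ _ CA] := hC i; exact/Ai/CA.
have [t ht|r hr] := @compact_subcover G (W `&` ~` Q) (fun y => ~` (C (io y))) cWO.
  have [cC _ _] := hC (io t); apply: open_nbhs_nbhs; split; last exact: hio.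
  by rewrite openC; exact: compact_closed.
exists (map io r) => t [Wt Ct]; apply: OU; apply: contrapT => nOt.
have [y yr] := hr t (conj Wt nOt); apply; apply: Ct; apply: List.in_map.
elim: r yr {hr} => // z r IH; rewrite inE => /orP[/eqP ->|/IH]; first by left.
by right.
Qed.

End small_neighborhoods.

Lemma infinite_emb_set (T : Type) (A : set T) : infinite_set A -> emb nat {x | A x}.
Proof.
move=> /infiniteP /card_leP[f].
have H (n : nat) : n \in [set: nat] by rewrite inE.
pose g n := f (exist _ n (H n)).
exists (fun n => exist _ (val (g n)) (set_mem (valP (g n)))) => m n [] /val_inj.
by move=> /(@inj _ _ _ f) /= E; have := E (in_setT _) (in_setT _) => -[].
Qed.

(** Well-founded recursion with a choice at each step that is only possible if the earlier choices
    were good. The function is therefore defined unconditionally, and goodness is proved afterwards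
    by induction. *)
Lemma wf_choice (I D : Type) (lt : I -> I -> Prop) (good : I -> (I -> D) -> D -> Prop) (d0 : D) :
  well_founded lt ->
  (forall i f g d, (forall j, lt j i -> f j = g j) -> good i f d -> good i g d) ->
  (forall i f, (forall j, lt j i -> good j f (f j)) -> exists d, good i f d) ->
  exists f, forall i, good i f (f i).
Proof.
move=> wf ext ex.
(* The default [d0] is taken when no good value exists; the induction shows that this never
   happens. *)
pose pick (P : D -> Prop) : D := if pselect (exists d, P d) is left e then sval (cid e) else d0.
have pickP P : (exists d, P d) -> P (pick P).
  by move=> e; rewrite /pick; case: pselect => // e'; exact: svalP (cid e').
pose tot i (rec : forall j, lt j i -> D) j : D := if pselect (lt j i) is left H then rec j H else d0.
pose f := Fix wf (fun _ => D) (fun i rec => pick (good i (tot i rec))).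
have fE i : f i = pick (good i (tot i (fun j _ => f j))).
  rewrite /f Fix_eq// => k r r' rr'; congr (pick (good k _)); apply/funext => j.
  by rewrite /tot; case: pselect => // H; exact: rr'.
exists f => i; elim: (wf i) => {}i _ IH; have [d hd] := ex i f IH.
have tE j : lt j i -> tot i (fun j _ => f j) j = f j by rewrite /tot; case: pselect.
rewrite fE; apply: (ext _ (tot i (fun j _ => f j))) => //.
apply: pickP; exists d; apply: (ext _ f) => // j ji; by rewrite tE.
Qed.

(* If some initial segment embeds M, cut the well-order at the least such point. *)
Lemma small_well_order (M : Type) : exists (I : choiceType) (lt : I -> I -> Prop),
  [/\ well_founded lt, forall i j k, lt i j -> lt j k -> lt i k,
    forall i j, [\/ lt i j, i = j | lt j i], emb M I & emb I M] /\
  forall i, ~ emb M {j | lt j i}.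
Proof.
have [Q wQ] := wochoice.well_ordering_principle {classic M}.
pose lt (i j : M) := Q i j /\ i <> j.
have minP (P : M -> Prop) : (exists i, P i) -> exists i, P i /\ forall j, P j -> Q i j.
  move=> [i Pi]; have [|z [[zP zm] _]] := wQ [pred i | `[< P i >]].
    by exists i; apply/asboolP.
  exists z; split; first exact/asboolP.
  by move=> j Pj; apply: zm; apply/asboolP.
have Qrefl i : Q i i.
  by have [j [-> h]] := minP (fun j => j = i) (ex_intro _ i erefl); exact: h.
have Qtot i j : Q i j \/ Q j i.
  have [k [[->|->] h]] := minP (fun k => k = i \/ k = j) (ex_intro _ i (or_introl erefl)).
    by left; apply: h; right.
  by right; apply: h; left.
have Qanti i j : Q i j -> Q j i -> i = j.
  move=> ij ji; have [|z [_ zu]] := wQ [pred k : {classic M} | `[< k = i \/ k = j >]].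
    by exists i; apply/asboolP; left.
  have mi : wochoice.minimum_of Q [pred k : {classic M} | `[< k = i \/ k = j >]] i.
    split; first by apply/asboolP; left.
    by move=> k /asboolP[->|->].
  have mj : wochoice.minimum_of Q [pred k : {classic M} | `[< k = i \/ k = j >]] j.
    split; first by apply/asboolP; right.
    by move=> k /asboolP[->|->].
  by rewrite -(zu i mi) (zu j mj).
have tot i j : [\/ lt i j, i = j | lt j i].
  have [->|ij] := pselect (i = j); first by constructor 2.
  by have [h|h] := Qtot i j; [constructor 1|constructor 3; split => // ji; apply: ij].
have lt_min (P : M -> Prop) : (exists i, P i) -> exists i, P i /\ forall j, lt j i -> ~ P j.
  move=> /minP[i [Pi h]]; exists i; split => // j [ji nji] Pj; apply: nji.
  by apply: Qanti => //; exact: h.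
have wf : well_founded lt.
  move=> i; apply: contrapT => ni.
  have [k [nk hk]] := lt_min (fun i => ~ Acc lt i) (ex_intro _ i ni).
  by apply: nk; constructor => j /hk /contrapT.
have tr i j k : lt i j -> lt j k -> lt i k.
  move=> ij jk.
  have [z [zP h]] := lt_min (fun z => [\/ z = i, z = j | z = k]) (ex_intro _ i (Or31 _ _ erefl)).
  have zi : z = i.
    case: zP => // E; first by case: (h i); [rewrite E|constructor 1].
    by case: (h j); [rewrite E|constructor 2].
  have [//|E|ki] := tot i k; last by case: (h k); [rewrite zi|constructor 3].
  by case: (h j); [rewrite zi E|constructor 2].
have [small|] := pselect (forall i, ~ emb M {j | lt j i}).
  exists {classic M}, lt; split => //; split => //; exact: emb_refl.
move=> /existsNP[i /contrapT big].
have [m [bm hm]] := lt_min (fun i => emb M {j | lt j i}) (ex_intro _ i big).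
exists {classic {j | lt j m}}, (fun a b => lt (sval a) (sval b)); split.
  split.
  - move=> [a ha]; elim: (wf a) ha => {}a _ IH ha; constructor => -[b hb] /= ba.
    exact: IH.
  - by move=> a b c; exact: tr.
  - move=> a b; have [h|h|h] := tot (sval a) (sval b); [by constructor 1| |by constructor 3].
    by constructor 2; exact: sval_inj.
  - exact: bm.
  - exact: emb_sig.
move=> [a ha] ea; apply: (hm a ha); apply: emb_trans ea _.
exists (fun b : {b : {j | lt j m} | lt (sval b) a} =>
  exist (fun j => lt j a) (sval (sval b)) (svalP b)) => b c [] E.
by apply: sval_inj; apply: sval_inj.
Qed.

(** * The transfinite choice of neighborhoods and translations *)

Section separated_vectors.
Context (R : realType) (G : topologicalGroupType) (h : haarMeasure R G).
Hypotheses (HG : hausdorff_space G) (LG : locally_compact [set: G]) (nd : ~ discrete_space G).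
Variable M : Type.
Hypothesis minM : forall (J : Type) (V : J -> set G), (forall j, nbhs (1 : G)%g (V j)) ->
  (forall U, nbhs (1 : G)%g U -> exists j, V j `<=` U) -> emb M J.
Variables (I : choiceType) (lt : I -> I -> Prop) (N : I -> set G).
Hypotheses (wf : well_founded lt) (tr : forall i j k, lt i j -> lt j k -> lt i k)
  (tot : forall i j, [\/ lt i j, i = j | lt j i]) (small : forall i, ~ emb M {j | lt j i})
  (N1 : forall i, nbhs (1 : G)%g (N i)).

Lemma compact_nbhs_haar (V : set G) : compact V -> nbhs (1 : G)%g V ->
  [/\ measurable (V : set (borel G)), (0 < h V)%E & (h V < +oo)%E].
Proof.
move=> cV V1; have mV := measurable_compact HG cV; split => //; last exact: haar_compact.
have oV := @open_interior _ V.
apply: lt_le_trans (haar_open_gt0 h HG oV V1) _; apply: le_measure; rewrite ?inE//.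
  exact: measurable_open.
exact: interior_subset.
Qed.

Let D : Type := (set G * (nat -> G) * R)%type.
Let seg i : set I := [set j | lt j i].

(** A value consists of a neighborhood, a sequence whose first four terms are the translations, and
    an error. Halving forces error 0 once [i] has infinitely many predecessors; positivity on finite
    segments leaves room for the next steps. *)
Let good i (F : I -> D) (d : D) :=
  [/\ [/\ compact d.1.1, nbhs (1 : G)%g d.1.1 & d.1.1 `<=` N i],
   forall k l, (k < 4)%N -> (l < 4)%N -> k != l ->
     lset (d.1.2 k) d.1.1 `&` lset (d.1.2 l) d.1.1 = set0,
   0 <= d.2 <= 1 / 100,
   forall j, lt j i -> 2 * d.2 <= (F j).2 /\ forall k, (k < 4)%N ->
     rdot (lreg (d.1.2 k) (uchi h (F j).1.1) - uchi h (F j).1.1)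
          (lreg (d.1.2 k) (uchi h (F j).1.1) - uchi h (F j).1.1) <= d.2 ^+ 2
   & finite_set (seg i) -> 0 < d.2].

Let close_set i (F : I -> D) (e : R) : set G := [set x | forall j, lt j i ->
  rdot (lreg x (uchi h (F j).1.1) - uchi h (F j).1.1)
       (lreg x (uchi h (F j).1.1) - uchi h (F j).1.1) <= e ^+ 2].

Let good_of_infinite i F e : 0 <= e <= 1 / 100 -> (forall j, lt j i -> 2 * e <= (F j).2) ->
  (finite_set (seg i) -> 0 < e) -> infinite_set (close_set i F e) -> exists d, good i F d.
Proof.
move=> he h2 h3 /infinite_emb_set[x xi].
have xi' : injective (fun n => sval (x n)) by move=> a b /sval_inj/xi.
have [V [cV V1 VN dV]] := disjoint_translates HG LG 4 xi' (N1 i).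
exists (V, (fun n => sval (x n)), e); split => //= j ji; split; first exact: h2.
by move=> k _; exact: (svalP (x k)).
Qed.

Let good_ext i F F' d : (forall j, lt j i -> F j = F' j) -> good i F d -> good i F' d.
Proof. by move=> FF' [a1 a2 a3 a4 a5]; split => // j ji; rewrite -FF'//; exact: a4. Qed.

Let good_exists i F : (forall j, lt j i -> good j F (F j)) -> exists d, good i F d.
Proof.
move=> hF; have [/finite_seqP[r rE]|inf] := pselect (finite_set (seg i)).
  have pos j : lt j i -> 0 < (F j).2.
    move=> ji; have [_ _ _ _ H] := hF j ji; apply: H.
    apply: (@sub_finite_set _ _ (seg i)); last by apply/finite_seqP; exists r.
    by move=> k kj; exact: tr kj ji.
  have [e [e0 e1 he]] : exists e : R, [/\ 0 < e, e <= 1 / 100 &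
      forall j, j \in r -> lt j i -> 2 * e <= (F j).2].
    elim: r {rE} => [|k r [e [e0 e1 he]]]; first by exists (1 / 100); split => //; rewrite divr_gt0.
    have [ki|nki] := pselect (lt k i); last first.
      by exists e; split => // j; rewrite inE => /orP[/eqP -> //|]; exact: he.
    exists (Num.min e ((F k).2 / 2)); split.
    - by rewrite lt_min e0 divr_gt0// pos.
    - by rewrite ge_min e1.
    - move=> j; rewrite inE => /orP[/eqP -> _|jr ji].
        by rewrite mulrC -ler_pdivlMr// ge_min lexx orbT.
      by apply: le_trans (he j jr ji); rewrite ler_pM2l// ge_min lexx.
  apply: (good_of_infinite (e := e)) => //; first by rewrite ltW.
    by move=> j ji; apply: he => //; have : seg i j by []; rewrite rE.
  (* With finitely many predecessors and a positive error the admissible translations form a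
     neighborhood of the identity. *)
  apply: (nbhs1_infinite HG nd).
  have : \forall x \near (1 : G)%g, forall j, j \in r ->
    rdot (lreg x (uchi h (F j).1.1) - uchi h (F j).1.1)
         (lreg x (uchi h (F j).1.1) - uchi h (F j).1.1) <= e ^+ 2.
    elim: r {rE he} => [|k r IH]; first exact: nearW.
    apply: filterS2 IH (lreg_continuous HG (uchi h (F k).1.1) (exprn_gt0 2 e0)) => x h1 h2 j.
    by rewrite inE => /orP[/eqP ->|]; [exact: ltW|exact: h1].
  by apply: filterS => x hx j ji; apply: hx; have : seg i j by []; rewrite rE.
apply: (good_of_infinite (e := 0)) => //.
- by rewrite lexx divr_ge0.
- by move=> j ji; rewrite mulr0; have [_ _ /andP[]] := hF j ji.
have nS := infinite_emb_set inf.
pose f (p : {j | lt j i} * nat) := uchi h (F (sval p.1)).1.1.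
(* Fixing each earlier vector exactly is the intersection of the conditions with error below
   1/(n+1). They are indexed by predecessors and natural numbers, a set into which [M] still does
   not embed. *)
pose A p : set G := [set x | rdot (lreg x (f p) - f p) (lreg x (f p) - f p) < p.2.+1%:R^-1].
have PS : emb ({j | lt j i} * nat) {j | lt j i}.
  by apply: emb_prod_infinite => //; exact: emb_refl.
have iA := infinite_bigcap (A := A) HG LG minM (emb_trans nS _).
have {iA} : infinite_set [set t | forall p, A p t].
  apply: iA.
  - by have [nu nui] := nS; exists (fun s => (s, 0%N)) => a b [].
  - by move=> MP; apply: (small (i := i)); exact: emb_trans MP PS.
  - by move=> p; apply: (lreg_continuous HG); rewrite invr_gt0.
apply: contra_not => fin; apply: sub_finite_set fin => t ht j ji.
rewrite expr0n; apply/ler_addgt0Pr => e e0; rewrite add0r.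
have [n hn] := small_invn e0.
by apply: ltW; apply: lt_trans (ht (exist _ j ji, n)) hn.
Qed.

Let chain_exists (f : I -> L2 h) (c : I -> VN h) (e : I -> R) :
  (forall j i, lt j i -> below_rel f c e j i) ->
  forall r : seq I, exists2 s, chain f c e s & forall j, List.In j r -> List.In j s.
Proof.
move=> lt_rel r.
(* A chain lists its largest index first; a finite set of indices is put into this order by
   insertion sort. *)
pose desc := fix desc (s : seq I) : Prop :=
  if s is i :: s' then (forall j, List.In j s' -> lt j i) /\ desc s' else True.
have insert s i : desc s -> exists2 s', desc s' & forall j, List.In j s' <-> i = j \/ List.In j s.
  elim: s i => [|k s IH] i; first by exists [:: i] => //; split.
  move=> [ks ds]; have [ik|ik|ki] := tot i k.
  - have [s' ds' hs'] := IH i ds; exists (k :: s').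
      by split => // j /hs'[<-//|]; exact: ks.
    by move=> j /=; rewrite hs'; tauto.
  - by exists (k :: s); [split|move=> j /=; rewrite ik; tauto].
  - exists (i :: k :: s); last by move=> j.
    by split => // j [<-//|js]; exact: tr (ks j js) ki.
have [s ds rs] : exists2 s, desc s & forall j, List.In j r -> List.In j s.
  elim: r => [|i r [s ds rs]]; first by exists [::].
  have [s' ds' hs'] := insert s i ds; exists s' => // j [<-|jr]; apply/hs'; [by left|right].
  exact: rs.
exists s => //; elim: s ds {rs} => // i s IH [h1 /IH ch]; split => // j js.
by apply: lt_rel; exact: h1.
Qed.

Lemma separated_vectors : exists V : I -> set G,
  (forall i, [/\ compact (V i), nbhs (1 : G)%g (V i) & V i `<=` N i]) /\
  forall X : set I, exists T : VN h, forall i,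
    (X i -> 2 / 3 <= rdot (T (uchi h (V i))) (uchi h (V i))) /\
    (~ X i -> rdot (T (uchi h (V i))) (uchi h (V i)) <= 1 / 3).
Proof.
have [F hF] := wf_choice (setT, (fun=> 1%g), 0) wf good_ext good_exists.
exists (fun i => (F i).1.1); split; first by move=> i; have [] := hF i.
pose f i := uchi h (F i).1.1; pose c i := average h (F i).1.2; pose e i := (F i).2.
have mV i : [/\ measurable ((F i).1.1 : set (borel G)), (0 < h (F i).1.1)%E & (h (F i).1.1 < +oo)%E].
  by have [[? ? _] _ _ _ _] := hF i; exact: compact_nbhs_haar.
have f1 i : rdot (f i) (f i) = 1 by have [? ? ?] := mV i; exact: uchi_norm.
have Vf i : restr ((F i).1.1 : set (borel G)) (f i) = f i.
  by have [? ? ?] := mV i; exact: uchi_restr.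
apply: (@separation _ _ _ I f c e f1).
- by move=> i; exact: average_op_le.
- move=> i; apply: average_orth => // k l k4 l4 kl; have [m _ _] := mV i.
  have [_ dis _ _ _] := hF i; exact: (lreg_orth m (Vf i) (dis k l k4 l4 kl)).
- by move=> i; have [_ _ /andP[]] := hF i.
- by move=> i; have [_ _ /andP[]] := hF i.
apply: chain_exists => j i ji; have [_ _ _ H _] := hF i; have [h1 h2] := H j ji.
split; last exact: h1.
by apply: average_close => k k4; exact: h2.
Qed.

End separated_vectors.

(** * Limit means and the independent family *)

Section lower_bound.
Context (R : realType) (G : topologicalGroupType) (h : haarMeasure R G).
Hypotheses (HG : hausdorff_space G) (LG : locally_compact [set: G]) (nd : ~ discrete_space G).
Context (M : Type) (U : M -> set G).
Hypotheses (U1 : forall m, nbhs (1 : G)%g (U m))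
  (Ub : forall V, nbhs (1 : G)%g V -> exists m, U m `<=` V).
Hypothesis minM : forall (J : Type) (V : J -> set G), (forall j, nbhs (1 : G)%g (V j)) ->
  (forall U, nbhs (1 : G)%g U -> exists j, V j `<=` U) -> emb M J.
Hypothesis nM : emb nat M.

Section limit_means.
Variables (I : Type) (V : I -> set G) (F : set_system I).
Hypothesis FU : UltraFilter F.
Hypothesis V0 : forall i, compact (V i) /\ nbhs (1 : G)%g (V i).
Hypothesis FV : forall W, nbhs (1 : G)%g W -> F [set i | V i `<=` W].
Let f i := uchi h (V i).

Let mV i : measurable (V i : set (borel G)).
Proof. by have [c n] := V0 i; have [] := compact_nbhs_haar h HG c n. Qed.

Let f1 i : rdot (f i) (f i) = 1.
Proof. by have [c n] := V0 i; have [? ? ?] := compact_nbhs_haar h HG c n; exact: uchi_norm. Qed.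

Let Vf i : restr (V i : set (borel G)) (f i) = f i.
Proof. by have [c n] := V0 i; have [? ? ?] := compact_nbhs_haar h HG c n; exact: uchi_restr. Qed.

Lemma limit_mean : exists2 m : VN h -> R[i], TIM h m &
  forall S : VN h, (fun i => rdot (S (f i)) (f i)) @ F --> complex.Re (m S).
Proof.
have FF := @ultra_proper _ _ FU; have FF' : Filter F by exact: FF.
have cv (S : VN h) (g : I -> L2 h) : (forall i, rdot (g i) (g i) = 1) ->
    cvg ((fun i => rdot (S (f i)) (g i)) @ F).
  move=> g1; have [C C0 hC] := VN_op_le S.
  apply: (ultra_cvg FU (C := (C + 1) * 2)); apply: filterE => i /=.
  by apply: le_trans (rdot_le_half _ _ C0 hC) _; rewrite f1 g1.
have if1 i : rdot ('i *: f i) ('i *: f i) = 1 by rewrite rdot_i f1.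
pose m (S : VN h) : R[i] := lim ((fun i => rdot (S (f i)) (f i)) @ F) +i*
  lim ((fun i => rdot (S (f i)) ('i *: f i)) @ F).
have cR (S : VN h) : (fun i => rdot (S (f i)) (f i)) @ F --> complex.Re (m S) := cv S f f1.
have cI (S : VN h) : (fun i => rdot (S (f i)) ('i *: f i)) @ F --> complex.Im (m S) :=
  cv S (fun i => 'i *: f i) if1.
move: m cR cI => m cR cI {cv}.
have cst (a : R) : (fun _ : I => a) @ F --> a by exact: cvg_cst.
have uniq (p : I -> R) (a b : R) : p @ F --> a -> p @ F --> b -> a = b.
  by move=> pa pb; exact: (@cvg_unique _ (@Rhausdorff R) _ _ _ _ pa pb).
have Im (S : VN h) i : rdot (S (f i)) ('i *: f i) = complex.Im (L2_dot (S (f i)) (f i)).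
  by rewrite L2_dotE.
have lin a S T : m (a *: S + T) = a * m S + m T.
  have E i : L2_dot ((a *: S + T) (f i)) (f i) = a * L2_dot (S (f i)) (f i) + L2_dot (T (f i)) (f i).
    by rewrite VN_addE VN_scaleE L2_dotDl L2_dotZl.
  apply/eqcP; rewrite ?ReD ?ImD ?ReM ?ImM.
  - apply: (uniq _ _ _ (@cR (a *: S + T))).
    have c1 := cvgB (FF := FF') (cvgM (FF := FF') (cst (complex.Re a)) (@cR S))
      (cvgM (FF := FF') (cst (complex.Im a)) (@cI S)).
    apply: cvg_trans (cvgD (FF := FF') c1 (@cR T)); apply: near_eq_cvg; apply: filterE => i.
    by rewrite [RHS]/rdot E ReD ReM -Im.
  - apply: (uniq _ _ _ (@cI (a *: S + T))).
    have c1 := cvgD (FF := FF') (cvgM (FF := FF') (cst (complex.Re a)) (@cI S))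
      (cvgM (FF := FF') (cst (complex.Im a)) (@cR S)).
    apply: cvg_trans (cvgD (FF := FF') c1 (@cI T)); apply: near_eq_cvg; apply: filterE => i.
    by rewrite [RHS](Im (a *: S + T) i) E ImD ImM -!Im.
have m0 : m 0 = 0.
  by have := lin (-1) 0 0; rewrite scaler0 addr0 mulN1r addNr.
have mZ a S : m (a *: S) = a * m S by have := lin a S 0; rewrite !addr0 m0 addr0.
exists m; last exact: cR.
apply/(TIMP HG); split; first split => //.
- move=> S S0; rewrite lecE; apply/andP; split.
    apply/eqP/esym; apply: (uniq _ _ _ (cst 0)); apply: cvg_trans (@cI S).
    apply: near_eq_cvg; apply: filterE => i.
    exact: (((ge0_rdot _).1 S0) (f i)).2.
  apply: (filter_le FU (cst 0) (@cR S)); apply: filterE => i /=.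
  exact: VN_ge0_re.
- apply/eqcP.
    apply: (uniq _ _ _ (@cR (VN_one h))); apply: cvg_trans (cst 1).
    by apply: near_eq_cvg; apply: filterE => i; rewrite VN_oneE f1.
  apply: (uniq _ _ _ (@cI (VN_one h))); apply: cvg_trans (cst 0).
  by apply: near_eq_cvg; apply: filterE => i; rewrite VN_oneE rdot_iself.
move=> u S hu; have [pu u1] := (P1P u).1 hu; have mu := mulopP HG pu.
have mass1 : mass u = 1 by rewrite /mass u1.
have re T : complex.Re (m (mulop u T)) = complex.Re (m T).
  have [C C0 hC] := VN_op_le T.
  have c1 := cvgB (FF := FF') (@cR (mulop u T)) (@cR T).
  have c2 := cvgM (FF := FF') c1 c1.
  apply/eqP; rewrite -subr_eq0 -sqrf_eq0 eq_le sqr_ge0 andbT expr2.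
  apply/ler_addgt0Pr => e e0; rewrite add0r.
  have k0 : 0 < 8 * C + 1 by rewrite ltr_wpDl// mulr_ge0.
  have d0 : 0 < e / (8 * C + 1) by rewrite divr_gt0.
  have [W W1 hW] := mulop_close mu d0.
  apply: (filter_le FU c2 (cst e)); apply: (@filterS _ F FF' _ _ _ (FV W1)) => i VW.
  have := hW (V i) C T (f i) (proj1 (V0 i)) VW C0 hC (Vf i).
  rewrite mass1 f1 expr1n !mulr1 mul1r expr2 => /le_trans; apply.
  by rewrite mulrA ler_pdivrMr// mulrC ler_pM2l// lerDl.
apply/eqcP; first exact: re.
(* The estimate compares real parts only; imaginary parts follow by applying it to [-i T], since
   [mulop u] is linear. *)
have H T : complex.Im (m T) = complex.Re (m ((- 'i) *: T)).
  by rewrite mZ; case: (m T) => a b /=; ring.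
rewrite !H -[RHS]re; congr (complex.Re (m _)).
have U0 : mulop u 0 = 0.
  by have := mulop_lin mu (-1) 0 0; rewrite scaler0 addr0 scaleN1r addNr.
by have := mulop_lin mu (- 'i) S 0; rewrite !addr0 U0 addr0.
Qed.

End limit_means.

Lemma separating_list (s : seq (set M)) : exists F : seq M, forall X Y,
  List.In X s -> List.In Y s -> [seq `[< X x >] | x <- F] = [seq `[< Y x >] | x <- F] -> X = Y.
Proof.
have key (l : seq (set M * set M)) : exists F : seq M, forall p, List.In p l ->
    [seq `[< p.1 x >] | x <- F] = [seq `[< p.2 x >] | x <- F] -> p.1 = p.2.
  elim: l => [|[X Y] l [F hF]]; first by exists [::].
  have [XY|XY] := pselect (X = Y).
    by exists F => p [<-//|]; exact: hF.
  have [x hx] : exists x, `[< X x >] <> `[< Y x >].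
    apply: contrapT => /forallNP H; apply: XY; apply/funext => x.
    by have /contrapT E := H x; rewrite -(asboolE (X x)) E asboolE.
  exists (x :: F) => p [<- [] //|pl [_]]; exact: hF.
have [F hF] := key (List.list_prod s s); exists F => X Y Xs Ys.
by apply: (hF (X, Y)); exact: List.in_prod.
Qed.

(** The Fichtenholz-Kantorovich-Hausdorff construction of an independent family. A label consists of
    a basic neighborhood, a finite list F of points of [M] and a finite family of traces on F, and
    [A X] collects the labels whose family contains the trace of X. The first component lets the
    ultrafilters converge to the identity as well. *)
Lemma TIM_lower : emb (set (set M)) {m | TIM h m}.
Proof.
have [I [lt [[wf tr tot MI IM] small]]] := small_well_order M.
pose L : Type := (M * seq M * seq (seq bool))%type.
have [lab labi] : emb L I.
  apply: emb_trans MI; apply: emb_prod_infinite => //; last exact: emb_countable.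
  by apply: emb_prod_infinite => //; [exact: emb_refl|exact: emb_seq_infinite].
(* Labels only embed into [I]; an index that is no label gets no condition. *)
pose N i : set G := if pselect (exists l, lab l = i) is left e then U (sval (cid e)).1.1 else setT.
have N1 i : nbhs (1 : G)%g (N i).
  by rewrite /N; case: pselect => // _; exact: filterT.
have NE l : N (lab l) = U l.1.1.
  rewrite /N; case: pselect => [e|[]]; last by exists l.
  by rewrite (labi _ _ (svalP (cid e))).
have [V [hV sepV]] := separated_vectors h HG LG nd minM wf tr tot small N1.
have V0 i : compact (V i) /\ nbhs (1 : G)%g (V i) by have [] := hV i.
pose A (X : set M) : set I := [set i | exists l, i = lab l /\ [seq `[< X x >] | x <- l.1.2] \in l.2].
have AE X l : A X (lab l) <-> [seq `[< X x >] | x <- l.1.2] \in l.2.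
  by split=> [[l' [/labi <-]]|hl] //; exists l.
have mean (Q : set (set M)) : exists m : {m | TIM h m}, forall X (T : VN h),
    (forall i, (A X i -> 2 / 3 <= rdot (T (uchi h (V i))) (uchi h (V i))) /\
      (~ A X i -> rdot (T (uchi h (V i))) (uchi h (V i)) <= 1 / 3)) ->
    (Q X -> 2 / 3 <= complex.Re (sval m T)) /\ (~ Q X -> complex.Re (sval m T) <= 1 / 3).
  (* The filter prescribes, for each X, whether i lies in [A X], according to Q; its properness is
     the independence of the family. *)
  pose F0 : set_system I := [set B | exists (W : set G) (s : seq (set M)), nbhs (1 : G)%g W /\
    forall l, U l.1.1 `<=` W -> (forall X, List.In X s -> (A X (lab l) <-> Q X)) -> B (lab l)].
  have FF0 : ProperFilter F0.
    split.
      move=> [W [s [W1 hW]]]; have [b bW] := Ub W1; have [F hF] := separating_list s.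
      (* The required label carries the traces of those members of [s] that lie in Q; as F separates
         [s], no other member has such a trace. *)
      have [a ha] : exists a : seq (seq bool), forall t, t \in a <->
          exists X, [/\ List.In X s, Q X & t = [seq `[< X x >] | x <- F]].
        elim: s {hW hF} => [|X s [a ha]]; first by exists [::] => t; split => // -[? []].
        have [QX|nQX] := pselect (Q X).
          exists ([seq `[< X x >] | x <- F] :: a) => t; rewrite inE; split.
            case/orP => [/eqP ->|/ha[Y [Ys QY tE]]]; first by exists X; split => //; left.
            by exists Y; split => //; right.
          move=> [Y [[<-|Ys] QY tE]]; first by rewrite tE eqxx.
          by apply/orP; right; apply/ha; exists Y.
        exists a => t; split=> [/ha[Y [Ys QY tE]]|[Y [[XY|Ys] QY tE]]].
        - by exists Y; split => //; right.
        - by rewrite -XY in QY.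
        - by apply/ha; exists Y.
      apply: (hW (b, F, a)) => // X Xs; split.
        by move=> /AE /ha [Y [Ys QY /(hF X Y Xs Ys) ->]].
      by move=> QX; apply/AE/ha; exists X.
    split.
    - by exists setT, [::]; split => //; exact: filterT.
    - move=> B B' [W [s [W1 hW]]] [W' [s' [W1' hW']]].
      exists (W `&` W'), (s ++ s'); split; first exact: filterI.
      move=> l lW ls; split.
        apply: hW; first by move=> t /lW[].
        by move=> X Xs; apply: ls; apply: List.in_or_app; left.
      apply: hW'; first by move=> t /lW[].
      by move=> X Xs; apply: ls; apply: List.in_or_app; right.
    - move=> B B' BB' [W [s [W1 hW]]]; exists W, s; split => // l lW ls.
      by apply: BB'; exact: hW.
  have [F [FU F0F]] := ultraFilterLemma FF0.
  have FF := @ultra_proper _ _ FU.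
  have FV W : nbhs (1 : G)%g W -> F [set i | V i `<=` W].
    move=> W1; apply: F0F; exists W, [::]; split => // l lW _ t.
    by have [_ _ VN] := hV (lab l) => /VN; rewrite NE => /lW.
  have [m Tm cm] := limit_mean FU V0 FV.
  exists (exist _ m Tm) => X T hT.
  have ev : F [set i | A X i <-> Q X].
    apply: F0F; exists setT, [:: X]; split => [|l _ H]; first exact: filterT.
    by apply: H; left.
  have cst (a : R) : (fun _ : I => a) @ F --> a by exact: cvg_cst.
  split=> QX /=.
    apply: (filter_le FU (cst (2 / 3)) (@cm T)).
    by apply: (@filterS _ F _ _ _ _ ev) => i /= AQ; apply: (hT i).1; apply/AQ.
  apply: (filter_le FU (@cm T) (cst (1 / 3))).
  by apply: (@filterS _ F _ _ _ _ ev) => i /= AQ; apply: (hT i).2 => /AQ.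
have [mm hmm] := choice mean.
exists mm => Q Q' E; apply/seteqP.
have sub (P P' : set (set M)) : mm P = mm P' -> P `<=` P'.
  move=> E' X PX; apply: contrapT => nPX; have [T hT] := sepV (A X).
  have := (hmm P X T hT).1 PX; have := (hmm P' X T hT).2 nPX; rewrite E'.
  by move: (complex.Re _) => a; lra.
by split; apply: sub.
Qed.

End lower_bound.

Theorem theorem7p15 (R : realType) (G : topologicalGroupType)
    (h : haarMeasure R G) (M : Type) :
  hausdorff_space G -> locally_compact [set: G] -> ~ discrete_space G ->
  is_character (1%g : G) M ->
  infinite_set [set: M] /\ TIM h #= [set: set (set M)].
Proof.
move=> HG LG nd [[B [B1 Bb] BM] minB].
have [U [U1 Ub]] : exists U : M -> set G, (forall m, nbhs (1 : G)%g (U m)) /\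
    forall V, nbhs (1 : G)%g V -> exists m, U m `<=` V.
  have /card_bijP[f [g fK gK]] := BM.
  have memM (m : M) : m \in [set: M] by rewrite inE.
  exists (fun m => val (g (exist _ m (memM m)))); split.
    by move=> m; apply: B1; exact: (set_mem (valP (g _))).
  move=> V /Bb[W BW WV]; pose w := f (exist _ W (mem_set BW)).
  exists (val w); have -> : exist _ (val w) (memM (val w)) = w by exact: val_inj.
  by rewrite /w fK.
have minM (J : Type) (V : J -> set G) : (forall j, nbhs (1 : G)%g (V j)) ->
    (forall W, nbhs (1 : G)%g W -> exists j, V j `<=` W) -> emb M J.
  move=> V1 Vb; apply/emb_card.
  have /card_le_trans : [set: M] #<= range V.
    apply: minB; split; first by move=> _ [j _ <-].
    by move=> W /Vb[j VW]; exists (V j) => //; exists j.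
  by apply; exact: card_image_le.
(* A finite basis would intersect in a neighborhood containing only the identity, whereas
   neighborhoods are infinite. *)
have infM : infinite_set [set: M].
  move=> /(@finite_seqP {classic M})[s sE].
  have : nbhs (1 : G)%g [set t | forall m : {classic M}, m \in s -> U m t].
    elim: s {sE} => [|m s IH]; first by apply: filterE.
    apply: filterS2 IH (U1 m) => t h1 h2 k; rewrite inE => /orP[/eqP -> //|].
    exact: h1.
  move=> /(nbhs1_infinite HG nd); apply; apply: (sub_finite_set _ (finite_set1 (1 : G)%g)).
  move=> t ht; apply: contrapT => t1; have z1 : (1 : G)%g != t by apply/eqP => /esym.
  have [m Um] := Ub _ (nbhs_neq HG z1).
  have ms : (m : {classic M}) \in s by have : [set: {classic M}] m by []; rewrite sE.
  by have := Um _ (ht m ms); rewrite /= eqxx.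
split=> //; have nM := infinite_emb infM.
have [p pi] := TIM_upper h HG LG U1 Ub nM.
have [q qi] := TIM_lower h HG LG nd U1 Ub minM nM.
rewrite card_eq_le; apply/andP; split.
  pose P m : set (set M) := if pselect (TIM h m) is left e then p (exist _ m e) else set0.
  have Pi : {in TIM h &, injective P}.
    move=> m m' /set_mem hm /set_mem hm'; rewrite /P; case: pselect => // e; case: pselect => // e'.
    by move=> /pi[].
  have := subset_card_le (subsetT (P @` TIM h)).
  by rewrite (card_le_eql (inj_card_eq Pi)).
have qi' : {in [set: set (set M)] &, injective (fun Q => sval (q Q))}.
  by move=> Q Q' _ _ /sval_inj/qi.
rewrite -(card_le_eql (inj_card_eq qi')); apply: subset_card_le => _ [Q _ <-].
exact: (svalP (q Q)).
Qed.
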